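(* Let $A\subset\mathbb R^n$ be inner $\alpha$-thin at infinity, let $(U_k)_{k\in\mathbb N}$ be an increasing sequence of universally measurable subsets of $\mathbb R^n$ with $\bigcup_k U_k=\mathbb R^n$, and set $A_k:=A\cap U_k$. Then $\gamma_{A_k}\to\gamma_A$ vaguely and $\kappa_\alpha\gamma_{A_k}\uparrow\kappa_\alpha\gamma_A$ pointwise on $\mathbb R^n$. If moreover $c_\alpha(A)<\infty$, then $\lim_{k\to\infty}\|\gamma_{A_k}-\gamma_A\|_\alpha=0$, and hence $\lim_{k\to\infty}c_\alpha(A_k)=c_\alpha(A)$.
   Context: Standing assumptions: $n\ge3$, $\alpha\in(0,2]$, and $\kappa_\alpha(x,y)=|x-y|^{\alpha-n}$ is the Riesz kernel on $\mathbb R^n$. $\mathfrak M^+$ denotes the cone of positive Radon measures $\mu$ on $\mathbb R^n$ whose potential $\kappa_\alpha\mu(x)=\int|x-z|^{\alpha-n}d\mu(z)$ is not identically $+\infty$. The vague topology is that of pointwise convergence on continuous compactly supported functions. $\mathcal E_\alpha$ is the pre-Hilbert space of signed Radon measures of finite energy with inner product $\kappa_\alpha(\mu,\nu)=\iint\kappa_\alpha\,d\mu\,d\nu$ and norm $\|\mu\|_\alpha$; $\mathcal E^+_\alpha(A)$ is the set of positive measures of finite energy concentrated on $A$. The inner capacity of $A\subset\mathbb R^n$ is defined by $1/c_\alpha(A)=\inf\{\|\mu\|_\alpha^2:\ \mu\in\mathcal E^+_\alpha(A),\ \mu(\mathbb R^n)=1\}$. ''n.e. on $A$'' means: for all points of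 $A$ except a subset of inner capacity zero. Inner equilibrium measure: $\gamma_A$, if it exists, is the unique measure in $\mathfrak M^+$ with $\kappa_\alpha\gamma_A=\inf\{\kappa_\alpha\nu:\ \nu\in\mathfrak M^+,\ \kappa_\alpha\nu\ge1\text{ n.e. on }A\}$ pointwise on $\mathbb R^n$. $A$ is called inner $\alpha$-thin at infinity if $\gamma_A$ exists (then $\gamma_{E}$ exists for every $E\subset A$). *)

(* Defs.v *)
From HB Require Import structures.
From mathcomp Require Import all_boot all_order all_algebra.
From mathcomp Require Import all_classical all_reals all_analysis.
Set Implicit Arguments. Unset Strict Implicit. Unset Printing Implicit Defensive.
Import Order.TTheory GRing.Theory Num.Theory.
Import numFieldNormedType.Exports.
Local Open Scope classical_set_scope.
Local Open Scope ring_scope.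

(* R^n is modelled as row vectors 'rV[R]_n (product topology = Euclidean
   topology), equipped with its Borel sigma-algebra (generated by the open
   sets). *)
Definition Rn (R : realType) (n : nat) : measurableType _ :=
  g_sigma_algebraType (@open 'rV[R]_n).

Definition edist (R : realType) (n : nat) (x y : 'rV[R]_n) : R :=
  Num.sqrt (\sum_(i < n) (x ord0 i - y ord0 i) ^+ 2).

(* Riesz kernel |x-y|^(alpha-n), equal to +oo on the diagonal
   (alpha - n < 0 in the standing assumptions). *)
Definition riesz (R : realType) (n : nat) (alpha : R) (x y : 'rV[R]_n)
  : \bar R :=
  if x == y then +oo%E else ((edist x y) `^ (alpha - n%:R))%:E.

Notation bmeasure R n := {measure set (Rn R n) -> \bar R}.

(* positive Radon measure on R^n: locally finite Borel measure
   (on R^n these are automatically regular) *)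
Definition radon (R : realType) (n : nat) (mu : bmeasure R n) : Prop :=
  forall K : set 'rV[R]_n, compact K -> (mu K < +oo)%E.

Definition potential (R : realType) (n : nat) (alpha : R) (mu : bmeasure R n)
  (x : 'rV[R]_n) : \bar R :=
  (\int[mu]_z riesz alpha x z)%E.

Definition Mplus (R : realType) (n : nat) (alpha : R) (mu : bmeasure R n)
  : Prop :=
  radon mu /\ exists x, potential alpha mu x != +oo%E.

(* mutual energy kappa_alpha(mu, nu) = iint kappa d mu d nu
   (iterated form; equal to the double integral by Tonelli) *)
Definition mutual (R : realType) (n : nat) (alpha : R) (mu nu : bmeasure R n)
  : \bar R :=
  (\int[mu]_x potential alpha nu x)%E.

Definition energy (R : realType) (n : nat) (alpha : R) (mu : bmeasure R n)
  : \bar R := mutual alpha mu mu.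

(* ||mu - nu||_alpha^2 for positive measures mu, nu *)
Definition dist_energy (R : realType) (n : nat) (alpha : R)
  (mu nu : bmeasure R n) : \bar R :=
  (energy alpha mu + energy alpha nu - 2%:E * mutual alpha mu nu)%E.

Definition concentrated (R : realType) (n : nat) (mu : bmeasure R n)
  (A : set 'rV[R]_n) : Prop :=
  exists B : set (Rn R n), [/\ measurable B, B `<=` A & mu (~` B) = 0%E].

Definition cap_inf (R : realType) (n : nat) (alpha : R) (A : set 'rV[R]_n)
  : \bar R :=
  ereal_inf [set energy alpha mu | mu in
    [set mu : bmeasure R n | [/\ radon mu, concentrated mu A,
        mu setT = 1%E & (energy alpha mu < +oo)%E]]].

Definition cap (R : realType) (n : nat) (alpha : R) (A : set 'rV[R]_n)
  : \bar R :=
  let I := cap_inf alpha A in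
  if I == +oo%E then 0%E else if I == 0%E then +oo%E else ((fine I)^-1)%:E.

Definition nearly_everywhere (R : realType) (n : nat) (alpha : R)
  (P : 'rV[R]_n -> Prop) (A : set 'rV[R]_n) : Prop :=
  cap alpha [set x | A x /\ ~ P x] = 0%E.

Definition equilibrium (R : realType) (n : nat) (alpha : R)
  (A : set 'rV[R]_n) (g : bmeasure R n) : Prop :=
  Mplus alpha g /\
  forall x, potential alpha g x =
    ereal_inf [set potential alpha nu x | nu in
      [set nu : bmeasure R n | Mplus alpha nu /\
         nearly_everywhere alpha (fun y => (1 <= potential alpha nu y)%E) A]].

Definition inner_thin (R : realType) (n : nat) (alpha : R)
  (A : set 'rV[R]_n) : Prop :=
  exists g : bmeasure R n, equilibrium alpha A g.

(* U is universally measurable: measurable for the completion of every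
   positive Radon measure *)
Definition universally_measurable (R : realType) (n : nat)
  (U : set 'rV[R]_n) : Prop :=
  forall mu : bmeasure R n, radon mu ->
    exists B1 B2 : set (Rn R n),
      [/\ measurable B1, measurable B2, B1 `<=` U, U `<=` B2
        & mu (B2 `\` B1) = 0%E].

Definition vague_cvg (R : realType) (n : nat) (g : nat -> bmeasure R n)
  (mu : bmeasure R n) : Prop :=
  forall f : 'rV[R]_n -> R, continuous f ->
    compact (closure [set x | f x != 0]) ->
    ((fun k => \int[g k]_x (f x)%:E) @ \oo --> \int[mu]_x (f x)%:E)%E.

(* Main.v *)
(* Write G_s for the Gaussian kernel exp(-|x-y|^2/s)/(pi s)^(n/2), H_s for the
   corresponding heat operator and a = alpha/2 in (0,1]. The Riesz kernel is
   kappa = c int_0^oo s^(a-1) G_s ds, and potentials are handled through the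
   averages P_t f = int w(r) H_(tr) f dr for a probability density w such that
   kappa mu = P_t (kappa mu) + t^a c int_0^oo S(s) H_(ts) mu ds with S >= 0
   integrable.

   The domination principle (kappa mu <= v mu-almost everywhere implies
   kappa mu <= v, for v excessive) is proved by testing the truncation
   g = min((kappa mu - v - eps)^+, 1): t^(-a) (<g,g> - <g,P_t g>) tends to 0
   with t and does not increase when t is doubled, so it vanishes, and g = 0.
   A minimizer of the energy over the unit measures on a compact set, obtained
   as a vague limit along an ultrafilter, then gives the equilibrium measure of
   that set, with potential at most 1.

   If potentials kappa gamma_k increase to h <= kappa sigma, every vague cluster
   point gamma of (gamma_k) satisfies kappa gamma = h: the parts
   H_r P_t (kappa gamma_k) <= H_r P_t (kappa sigma) tend to 0 as t -> oo, while
   the remaining kernels H_r (kappa - P_t kappa) are bounded, continuous and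
   small compared with kappa at infinity. Since a measure is determined by its
   potential, the whole sequence converges vaguely.

   Applied to gamma_(A_k), the limit h is at least 1 nearly everywhere on A,
   since a measure charging the exceptional set charges a Borel kernel of some
   U_k; minimality of gamma_A then gives h = kappa gamma_A. Finally
   c(A) = ||gamma_A||^2, approximating A from inside by compact sets, and the
   energies converge because
   2 kappa(gamma_(A_k),gamma_A) - ||gamma_A||^2 <= ||gamma_(A_k)||^2
     <= kappa(gamma_(A_k),gamma_A). *)
Require Import Defs.
From HB Require Import structures.
From mathcomp Require Import all_boot all_order all_algebra.
From mathcomp Require Import all_classical all_reals all_analysis.
From mathcomp Require Import measurable_realfun.
From mathcomp Require Import ring lra.
Import Order.TTheory GRing.Theory Num.Theory.
Import numFieldNormedType.Exports.
Local Open Scope classical_set_scope.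
Local Open Scope ring_scope.
Set Implicit Arguments.
Unset Strict Implicit.
Unset Printing Implicit Defensive.

(** * Tonelli's theorem and the Borel sets of R^n *)

(** The averages P_t stand in for the semigroup of the Riesz kernel, whose densities for alpha < 2
    are not elementary. They do not form a semigroup; what is used is that P_t is symmetric,
    preserves constants, does not increase potentials, and has an explicit loss on them. As w lives
    on (1, oo), S(s) = s^(a-1) on (0, 1]: the loss keeps all times up to t in full, which is why P_t
    (kappa mu) can be made to vanish for large t. As P_t P_s is not P_(t+s), the usual monotonicity
    of approximating Dirichlet forms is replaced by an inequality along t, 2t, 4t, ..., drawn from
    the heat semigroup under the average.

    Two obstacles shape the rest. Vague convergence gives only one inequality for the kernel kappa;
    the other needs bounded, continuous, tight kernels, hence the extra smoothing H_r. And gamma_A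
    is a pointwise infimum over an uncountable family, so neither kappa gamma_A >= 1 nearly
    everywhere nor kappa gamma_A <= 1 is immediate. Both come from compact subsets of A, the second
    through a sequence of them maximizing one number, the heat average of the equilibrium potential
    at the origin. *)

Section sigma_finite_copy.
Context d (T : measurableType d) (R : realType) (m : {measure set T -> \bar R}).
(** The proof [sm] is an argument of the alias so that the sigma-finite structure can be attached to
    it; Tonelli's theorem then applies to measures known to be sigma-finite only by hypothesis. *)
Definition sigma_finite_copy (sm : sigma_finite setT m) : set T -> \bar R := m.
Variable sm : sigma_finite setT m.
HB.instance Definition _ := Measure.on (sigma_finite_copy sm).
HB.instance Definition _ := Measure_isSigmaFinite.Build _ _ _ (sigma_finite_copy sm) sm.
End sigma_finite_copy.

Section tonelli.
Context d1 d2 (T1 : measurableType d1) (T2 : measurableType d2) (R : realType).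
Variables (m1 : {measure set T1 -> \bar R}) (m2 : {measure set T2 -> \bar R}).

Lemma tonelli (f : T1 -> T2 -> \bar R) :
  sigma_finite setT m1 -> sigma_finite setT m2 ->
  measurable_fun setT (fun p : T1 * T2 => f p.1 p.2) ->
  (forall x y, 0 <= f x y)%E ->
  (\int[m1]_x \int[m2]_y f x y = \int[m2]_y \int[m1]_x f x y)%E.
Proof.
move=> s1 s2 mf f0.
exact: (@fubini_tonelli _ _ _ _ _ (sigma_finite_copy s1) (sigma_finite_copy s2)
  (fun p => f p.1 p.2)).
Qed.

Lemma measurable_tonelli (f : T1 -> T2 -> \bar R) :
  sigma_finite setT m2 ->
  measurable_fun setT (fun p : T1 * T2 => f p.1 p.2) ->
  (forall x y, 0 <= f x y)%E ->
  measurable_fun setT (fun x => \int[m2]_y f x y)%E.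
Proof.
move=> s2 mf f0.
exact: (@measurable_fun_fubini_tonelli_F _ _ _ _ _ (sigma_finite_copy s2)
  (fun p => f p.1 p.2)).
Qed.
End tonelli.

Section Borel_row_vectors.
Context (R : realType) (n : nat).
Implicit Types O : set 'rV[R]_n.

Lemma measurable_open O : open O -> measurable (O : set (Rn R n)).
Proof. by move=> oO; exact: sub_sigma_algebra. Qed.

Lemma measurable_closed O : closed O -> measurable (O : set (Rn R n)).
Proof.
by move=> cO; rewrite -(setCK O); apply: measurableC; apply: measurable_open; rewrite openC.
Qed.

Lemma measurable_compact O : compact O -> measurable (O : set (Rn R n)).
Proof.
move=> cO; apply: measurable_closed; exact: compact_closed.
Qed.

Lemma lsc_measurable (h : 'rV[R]_n -> \bar R) :
  lower_semicontinuous h -> measurable_fun setT (h : Rn R n -> \bar R).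
Proof.
move/lower_semicontinuousP => oh.
apply: (measurability _ (ErealGenOInfty.measurableE R)).
by move=> _ [_ [a ->] <-]; rewrite setTI preimage_itvoy; exact: (measurable_open (oh a)).
Qed.

Lemma continuous_measurable_rV (f : 'rV[R]_n -> R) :
  continuous f -> measurable_fun setT (f : Rn R n -> R).
Proof.
move=> cf; apply/measurable_EFinP; apply: lsc_measurable.
apply/lower_semicontinuousP => a.
rewrite (_ : [set _ | _] = f @^-1` [set y | a < y]).
  by apply: open_comp; [move=> x _; exact: cf|exact: open_gt].
by apply/seteqP; split => x /=; rewrite lte_fin.
Qed.

Lemma measurable_coord i : measurable_fun setT (fun x : Rn R n => (x : 'rV[R]_n) ord0 i).
Proof. apply: continuous_measurable_rV; exact: coord_continuous. Qed.

(** [Rn] carries the Borel sigma-algebra, not the product one. Countably many rational cubes cover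
    an open set from inside, which reduces measurability of maps into [Rn] to their coordinates. *)
Lemma open_rV_countable O : open O ->
  O = \bigcup_(p in [set p : 'rV[rat]_n * rat | 0 < p.2 /\
     [set x : 'rV[R]_n | forall i, `|ratr (p.1 ord0 i) - x ord0 i| < ratr p.2] `<=` O])
     [set x : 'rV[R]_n | forall i, `|ratr (p.1 ord0 i) - x ord0 i| < ratr p.2].
Proof.
move=> oO; apply/seteqP; split; last by move=> x [p [_ pO] px]; exact: pO.
move=> x Ox; have /nbhs_ballP[e /= e0 eO] : nbhs x O by exact: open_nbhs_nbhs.
have /rat_in_itvoo[q] := divr_gt0 e0 (ltr0Sn R 1).
rewrite in_itv/= => /andP[q0 qe].
have H i : exists p : rat, `|ratr p - x ord0 i| < ratr q.
  have /rat_in_itvoo[p] : x ord0 i - ratr q < x ord0 i + ratr q.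
    by rewrite ltrD2l gtrN.
  by rewrite in_itv/= => pq; exists p; rewrite ltr_distl.
exists (\row_i projT1 (cid (H i)), q) => /=; last first.
  by move=> i; rewrite mxE; exact: projT2 (cid (H i)).
split; first by rewrite -(@ltr0q R).
move=> y /= yq; apply: eO; split => // i j; rewrite ord1 /ball/=.
have := yq j; have := projT2 (cid (H j)); rewrite mxE => h1 h2.
rewrite (_ : _ - _ = (x ord0 j - ratr (projT1 (cid (H j)))) +
  (ratr (projT1 (cid (H j))) - y ord0 j)); last by ring.
rewrite (le_lt_trans (ler_normD _ _))// [e]splitr ltrD//.
- by rewrite distrC (lt_trans h1).
- by rewrite (lt_trans h2).
Qed.

Lemma measurable_into_rV d (T : measurableType d) (phi : T -> Rn R n) :
  (forall i, measurable_fun setT (fun t => (phi t : 'rV[R]_n) ord0 i)) ->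
  measurable_fun setT phi.
Proof.
move=> mphi; apply: (@measurability _ _ T (Rn R n) setT phi (@open 'rV[R]_n) (erefl _)).
move=> _ [V oV <-]; rewrite setTI (open_rV_countable oV) preimage_bigcup bigcup_mkcond.
apply: countable_bigcupT_measurable => // p; case: ifP => // _.
rewrite (_ : _ @^-1` _ = \bigcap_(i in [set: 'I_n])
   (fun t => (phi t : 'rV[R]_n) ord0 i) @^-1` [set y | `|ratr (p.1 ord0 i) - y| < ratr p.2]).
  apply: fin_bigcap_measurable => // i _; rewrite -[X in measurable X]setTI.
  apply: mphi => //.
  rewrite (_ : [set y | _] = ball (ratr (p.1 ord0 i) : R) (ratr p.2)) //.
  exact: measurable_ball.
by apply/seteqP; split => t /= h i; [move=> _; exact: h|exact: (h i I)].
Qed.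

End Borel_row_vectors.

(** * Gaussian kernels *)

Lemma measurable_inv (R : realType) : measurable_fun setT (@GRing.inv R).
Proof.
have -> : @GRing.inv R = fun x => if 0 < x then x `^ (-1) else
    if x < 0 then - ((- x) `^ (-1)) else 0.
  apply/funext => x; case: ltgtP => [x0|x0|<-]; last by rewrite invr0.
    by rewrite powR_inv1 ?ltW.
  by rewrite powR_inv1 ?oppr_ge0 ?ltW// invrN opprK.
apply: measurable_fun_ifT.
- by apply: measurable_fun_ltr; [exact: measurable_cst|exact: measurable_id].
- exact: measurable_powR.
- apply: measurable_fun_ifT => //; first by apply: measurable_fun_ltr; [exact: measurable_id|exact: measurable_cst].
  apply: (measurable_funN); apply: (measurableT_comp (measurable_powR _)).
  exact: measurable_funN.
Qed.

Section gauss1.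
Context (R : realType).
Implicit Types s t x y z : R.

(** The normal density of variance s/2; the times s add under convolution. *)
Definition gauss1 s x : R := (pi * s) `^ (- 2^-1) * expR (- (x ^+ 2 / s)).

Lemma gauss1_ge0 s x : 0 <= gauss1 s x.
Proof. by rewrite mulr_ge0 ?expR_ge0// powR_ge0. Qed.

Lemma gauss1N s x : gauss1 s (- x) = gauss1 s x.
Proof. by rewrite /gauss1 sqrrN. Qed.

Lemma gauss1E s x m : 0 < s -> gauss1 s (x - m) = normal_pdf m (Num.sqrt (s / 2)) x.
Proof.
move=> s0; have s2 : 0 < s / 2 by rewrite divr_gt0.
rewrite normal_pdfE; last by rewrite gt_eqF// sqrtr_gt0.
have ps0 : 0 <= pi * s by rewrite mulr_ge0 ?pi_ge0 ?ltW.
rewrite /gauss1 /normal_peak /normal_fun sqr_sqrtr ?(ltW s2)// powRN powR12_sqrt//.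
congr (_^-1 * expR _); last by field; rewrite gt_eqF.
by congr Num.sqrt; field.
Qed.

Lemma integral_gauss1 s m : 0 < s ->
  (\int[lebesgue_measure]_y (gauss1 s (m - y))%:E = 1)%E.
Proof.
move=> s0; under eq_integral do rewrite -gauss1N opprB gauss1E//.
exact: integral_normal_pdf.
Qed.

Lemma measurable_gauss1 d (T : measurableType d) (s x : T -> R) :
  measurable_fun setT s -> measurable_fun setT x ->
  measurable_fun setT (fun p => gauss1 (s p) (x p)).
Proof.
move=> ms mx; apply: measurable_funM.
  by apply: (measurableT_comp (measurable_powR _)); exact: measurable_funM.
apply: (measurableT_comp (@measurable_expR R)).
apply: measurableT_comp => //; apply: measurable_funM; first exact: measurable_funX.
exact: measurableT_comp (@measurable_inv R) _.
Qed.

(* Completing the square: the product of two Gaussians in y is, up to a factor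
   independent of y, a Gaussian of variance st/(s+t). *)
Lemma gauss1M s t x y z : 0 < s -> 0 < t ->
  gauss1 s (x - y) * gauss1 t (y - z) =
  gauss1 (s + t) (x - z) * gauss1 (s * t / (s + t)) ((t * x + s * z) / (s + t) - y).
Proof.
move=> s0 t0; have st0 : 0 < s + t by rewrite addr_gt0.
rewrite /gauss1 mulrACA [RHS]mulrACA -!expRD.
have p0 := pi_gt0 R.
have pst0 : 0 <= pi * (s * t / (s + t)).
  by rewrite mulr_ge0 ?ltW// divr_gt0// mulr_gt0.
rewrite -!powRM ?mulr_ge0 ?ltW// ?invr_gt0//.
congr (_ `^ _ * expR _); first by field; rewrite gt_eqF.
by field; rewrite ?gt_eqF// ?mulf_neq0 ?gt_eqF.
Qed.

Lemma gauss1_semigroup s t x z : 0 < s -> 0 < t ->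
  (\int[lebesgue_measure]_y (gauss1 s (x - y) * gauss1 t (y - z))%:E =
   (gauss1 (s + t) (x - z))%:E)%E.
Proof.
move=> s0 t0; under eq_integral do rewrite gauss1M// EFinM.
rewrite ge0_integralZl_EFin ?gauss1_ge0//.
- by rewrite integral_gauss1 ?mule1// divr_gt0 ?mulr_gt0 ?addr_gt0.
- by move=> y _; rewrite lee_fin gauss1_ge0.
- by apply/measurable_EFinP; apply: measurable_gauss1 => //; exact: measurable_funB.
Qed.
End gauss1.

Definition heat (R : realType) (n : nat) (s : R) (x y : 'rV[R]_n) : R :=
  \prod_(i < n) gauss1 s (x ord0 i - y ord0 i).

Definition sqdist (R : realType) (n : nat) (x y : 'rV[R]_n) : R :=
  \sum_(i < n) (x ord0 i - y ord0 i) ^+ 2.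

Section heat_basics.
Context (R : realType) (n : nat).
Implicit Types (s t : R) (x y z : 'rV[R]_n).

Lemma heat_ge0 s x y : 0 <= heat s x y.
Proof. by apply: prodr_ge0 => i _; exact: gauss1_ge0. Qed.

Lemma heatC s x y : heat s x y = heat s y x.
Proof. by apply: eq_bigr => i _; rewrite -gauss1N opprB. Qed.

Lemma measurable_heat d (T : measurableType d) (s : T -> R) (x y : T -> Rn R n) :
  measurable_fun setT s -> measurable_fun setT x -> measurable_fun setT y ->
  measurable_fun setT (fun p => heat (s p) (x p) (y p)).
Proof.
move=> ms mx my; apply: measurable_prod => i _; apply: measurable_gauss1 => //.
by apply: measurable_funB; exact: measurableT_comp (measurable_coord i) _.
Qed.

Lemma sqdist_ge0 x y : 0 <= sqdist x y.
Proof. by apply: sumr_ge0 => i _; exact: sqr_ge0. Qed.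

Lemma sqdistC x y : sqdist x y = sqdist y x.
Proof. by apply: eq_bigr => i _; rewrite -sqrrN opprB. Qed.

Lemma sqdist_eq0 x y : (sqdist x y == 0) = (x == y).
Proof.
rewrite psumr_eq0; last by move=> i _; exact: sqr_ge0.
apply/allP/eqP => [h|-> i _]; last by rewrite subrr expr0n /= eqxx.
apply/rowP => i; have := h i; rewrite mem_index_enum => /(_ isT).
by rewrite sqrf_eq0 subr_eq0 => /eqP.
Qed.

Lemma heatE s x y : 0 < s ->
  heat s x y = (pi * s) `^ (- (n%:R / 2)) * expR (- (sqdist x y / s)).
Proof.
move=> s0; rewrite /heat big_split/= prodr_const card_ord; congr (_ * _).
  by rewrite -powR_mulrn ?powR_ge0// -powRrM; congr (_ `^ _); field.
by rewrite /sqdist mulr_suml -sumrN expR_sum.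
Qed.

End heat_basics.

(** * A reference measure for the heat semigroup *)

Section reference_measure.
Context (R : realType).

Definition rVcons n (p : R * Rn R n) : Rn R n.+1 :=
  \row_i (if unlift ord0 i is Some j then (p.2 : 'rV[R]_n) ord0 j else p.1).
Definition rVbehead n (x : Rn R n.+1) : Rn R n :=
  \row_j (x : 'rV[R]_n.+1) ord0 (lift ord0 j).

Lemma measurable_rVcons n : measurable_fun setT (@rVcons n).
Proof.
apply: measurable_into_rV => i; rewrite /rVcons.
case: (unliftP ord0 i) => [j ->|->].
  under eq_fun do rewrite mxE liftK.
  by apply: (measurableT_comp (measurable_coord j)); exact: measurable_snd.
by under eq_fun do rewrite mxE unlift_none; exact: measurable_fst.
Qed.

Lemma heat_cons n s (x : 'rV[R]_n.+1) (p : R * Rn R n) :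
  heat s x (rVcons p) = gauss1 s (x ord0 ord0 - p.1) * heat s (rVbehead x) p.2.
Proof.
rewrite /heat big_ord_recl mxE unlift_none; congr (_ * _).
by apply: eq_bigr => i _; rewrite !mxE liftK.
Qed.

Lemma heat_behead n s (x y : 'rV[R]_n.+1) :
  heat s x y = gauss1 s (x ord0 ord0 - y ord0 ord0) * heat s (rVbehead x) (rVbehead y).
Proof.
rewrite /heat big_ord_recl; congr (_ * _).
by apply: eq_bigr => i _; rewrite !mxE.
Qed.

(* Any measure with these properties can play the role of Lebesgue measure: only
   the semigroup structure of the heat kernel matters. *)
Definition heat_reference n (m : bmeasure R n) :=
  [/\ sigma_finite setT m,
    forall (s : R) x, 0 < s -> (\int[m]_y (heat s x y)%:E = 1)%E &
    forall (s t : R) x z, 0 < s -> 0 < t ->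
      (\int[m]_y (heat s x y * heat t y z)%:E = (heat (s + t) x z)%:E)%E].

(** The heat kernel is positive with mass 1, so its superlevel sets exhaust the space and have
    finite measure by Markov's inequality. *)
Lemma sigma_finite_heat n (m : bmeasure R n) :
  (\int[m]_y (heat 1 0 y)%:E = 1)%E -> sigma_finite setT m.
Proof.
move=> m1; exists (fun k => [set y | k.+1%:R^-1 <= heat 1 0 (y : 'rV[R]_n)]).
  apply/esym; rewrite -subTset => y _.
  have h0 : 0 < heat 1 0 (y : 'rV[R]_n).
    by rewrite heatE// mulr_gt0 ?expR_gt0// powR_gt0// mulr_gt0// pi_gt0.
  exists (Num.truncn (heat 1 0 (y : 'rV[R]_n))^-1) => //=.
  rewrite -[leRHS]invrK lef_pV2 ?posrE ?invr_gt0//.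
  by rewrite ltW// truncnS_gt.
move=> k.
have mh : measurable_fun setT (fun y : Rn R n => heat 1 0 y).
  by apply: measurable_heat.
have mS : measurable [set y : Rn R n | k.+1%:R^-1 <= heat 1 0 (y : 'rV[R]_n)].
  rewrite -[X in measurable X]setTI.
  have := @measurable_fun_ler _ _ R setT (cst k.+1%:R^-1) _ (measurable_cst _) mh.
  by move=> /(_ measurableT [set true] I).
split=> //; apply: (@le_lt_trans _ _ (k.+1%:R%:E)); last by rewrite ltry.
set S := [set y | _] in mS *.
rewrite -[leRHS]mule1 -m1 -ge0_integralZl_EFin//; last 2 first.
- by move=> y _; rewrite lee_fin heat_ge0.
- exact/measurable_EFinP.
rewrite -[leLHS]mul1e -integral_cst//.
apply: (@le_trans _ _ (\int[m]_(y in S) (k.+1%:R%:E * (heat 1 0 y)%:E))%E).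
  apply: ge0_le_integral => //.
  - by apply: measurable_funTS; apply: measurable_funeM; exact/measurable_EFinP.
  - by move=> y hy; rewrite -EFinM lee_fin -ler_pdivrMl// mulr1.
apply: ge0_subset_integral => //.
- by apply: measurable_funeM; exact/measurable_EFinP.
- by move=> y _; rewrite -EFinM lee_fin mulr_ge0// heat_ge0.
Qed.

(** Induction on the dimension: a Dirac mass in dimension 0, then the image under [rVcons] of the
    product with Lebesgue measure on the line. The heat kernel factors along the first coordinate,
    so both identities reduce to those of [gauss1]. *)
Lemma exists_heat_reference n : exists m : bmeasure R n, heat_reference m.
Proof.
elim: n => [|n [m [sm m1 mCK]]].
  have h0 s (x y : 'rV[R]_0) : heat s x y = 1 by rewrite /heat big_ord0.
  pose m : bmeasure R 0 := \d_(0 : Rn R 0).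
  exists m; have m1 s (x : 'rV[R]_0) : 0 < s -> (\int[m]_y (heat s x y)%:E = 1)%E.
    move=> s0; rewrite integral_dirac//; last exact/measurable_EFinP/measurable_heat.
    by rewrite h0 diracT mule1.
  split => //; first exact/sigma_finite_heat/m1.
  move=> s t x z _ _; rewrite integral_dirac//.
    by rewrite !h0 diracT mul1e mul1r.
  by apply/measurable_EFinP; apply: measurable_funM; exact: measurable_heat.
pose M := (lebesgue_measure \x sigma_finite_copy sm)%E.
pose m' : bmeasure R n.+1 :=
  measure_function_pushforward__canonical__measure_function_Measure M (@measurable_rVcons n).
have intE (f : Rn R n.+1 -> \bar R) (g : R -> \bar R) (h : Rn R n -> \bar R) :
    measurable_fun setT f -> measurable_fun setT h ->
    (forall y, 0 <= f y)%E -> (forall v, 0 <= g v)%E -> (forall v, 0 <= h v)%E ->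
    (forall p, f (rVcons p) = g p.1 * h p.2)%E ->
    (\int[m']_y f y = \int[lebesgue_measure]_u (g u * \int[m]_v h v))%E.
  move=> mf mh f0 g0 h0 fgh.
  rewrite /m' ge0_integral_pushforward//; last exact: measurable_rVcons.
  rewrite preimage_setT.
  rewrite fubini_tonelli1//=; last exact: measurableT_comp mf (@measurable_rVcons n).
  apply: eq_integral => u _; rewrite /fubini_F/=.
  under eq_integral do rewrite fgh/=.
  by rewrite ge0_integralZl.
have m'1 s (x : 'rV[R]_n.+1) : 0 < s -> (\int[m']_y (heat s x y)%:E = 1)%E.
  move=> s0; rewrite (intE _ (fun u => (gauss1 s (x ord0 ord0 - u))%:E)
    (fun v => (heat s (rVbehead x) v)%:E))//.
  - rewrite -[RHS](integral_gauss1 (x ord0 ord0) s0); apply: eq_integral => u _.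
    by rewrite -[RHS]mule1; congr (_ * _)%E; exact: m1.
  - exact/measurable_EFinP/measurable_heat.
  - exact/measurable_EFinP/measurable_heat.
  - by move=> y; rewrite lee_fin heat_ge0.
  - by move=> y; rewrite lee_fin gauss1_ge0.
  - by move=> y; rewrite lee_fin heat_ge0.
  - by move=> p; rewrite heat_cons EFinM.
exists m'; split => //; first exact/sigma_finite_heat/m'1.
move=> s t x z s0 t0.
rewrite (intE _ (fun u => (gauss1 s (x ord0 ord0 - u) * gauss1 t (u - z ord0 ord0))%:E)
    (fun v => (heat s (rVbehead x) v * heat t v (rVbehead z))%:E))//.
- transitivity (\int[lebesgue_measure]_u
    ((gauss1 s (x ord0 ord0 - u) * gauss1 t (u - z ord0 ord0))%:E *
    (heat (s + t) (rVbehead x) (rVbehead z))%:E))%E.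
    by apply: eq_integral => u _; congr (_ * _)%E; exact: mCK.
  rewrite ge0_integralZr//.
  + by rewrite gauss1_semigroup// -EFinM -heat_behead.
  + by apply/measurable_EFinP; apply: measurable_funM; apply: measurable_gauss1 => //; exact: measurable_funB.
  + by move=> u _; rewrite lee_fin mulr_ge0 ?gauss1_ge0.
  + by rewrite lee_fin heat_ge0.
- by apply/measurable_EFinP; apply: measurable_funM; exact: measurable_heat.
- by apply/measurable_EFinP; apply: measurable_funM; exact: measurable_heat.
- by move=> y; rewrite lee_fin mulr_ge0 ?heat_ge0.
- by move=> y; rewrite lee_fin mulr_ge0 ?gauss1_ge0.
- by move=> y; rewrite lee_fin mulr_ge0 ?heat_ge0.
- move=> p; rewrite heat_cons (heatC t) heat_cons -EFinM mulrACA; congr (_ * _)%:E.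
    by rewrite -(gauss1N t) opprB.
  by rewrite (heatC t).
Qed.

End reference_measure.

(** * Changes of variable and the fundamental theorem of calculus on open intervals *)

Section lebesgue_affine.
Context (R : realType).
Notation leb := (@lebesgue_measure R).

Lemma ge0_integral_translation (h : R -> \bar R) (c : R) :
  measurable_fun setT h -> (forall x, 0 <= h x)%E ->
  (\int[leb]_x h (x + c)%R = \int[leb]_x h x)%E.
Proof.
move=> mh h0.
have mphi : measurable_fun setT (fun x : measurableTypeR R => (x + c)%R : measurableTypeR R).
  by apply: measurable_funD.
pose m' : {measure set (measurableTypeR R) -> \bar R} :=
  measure_function_pushforward__canonical__measure_function_Measure leb mphi.
have E A : measurable A -> leb A = m' A.
  apply: lebesgue_measure_unique => _ [[a b] _ <-].
  rewrite /m' /= /pushforward.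
  rewrite (_ : _ @^-1` _ = `]a - c, b - c]%classic); last first.
    by apply/seteqP; split => x /=; rewrite !in_itv/= ltrBlDr lerBrDr.
  by rewrite !lebesgue_measure_itv/= !lte_fin ltrD2r -!EFinB opprB addrA subrK.
rewrite [RHS](eq_measure_integral m'); last by move=> A mA _; exact: E.
by rewrite /m' ge0_integral_pushforward.
Qed.

Lemma ge0_integral_scaling (h : R -> \bar R) (t : R) : 0 < t ->
  measurable_fun setT h -> (forall x, 0 <= h x)%E ->
  (t%:E * \int[leb]_x h (t * x)%R = \int[leb]_x h x)%E.
Proof.
move=> t0 mh h0.
have mphi : measurable_fun setT (fun x : measurableTypeR R => (t * x)%R : measurableTypeR R).
  by apply: measurable_funM.
pose m1 : {measure set (measurableTypeR R) -> \bar R} :=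
  measure_function_pushforward__canonical__measure_function_Measure leb mphi.
pose m' : {measure set (measurableTypeR R) -> \bar R} := mscale (NngNum (ltW t0)) m1.
have E A : measurable A -> leb A = m' A.
  apply: lebesgue_measure_unique => _ [[a b] _ <-].
  have -> : m' `]a, b]%classic = (t%:E * leb (`](a / t)%R, (b / t)%R]%classic))%E.
    congr (_ * leb _)%E; apply/seteqP; split => x /=;
    by rewrite !in_itv/= ltr_pdivrMr// ler_pdivlMr// (mulrC x).
  rewrite !lebesgue_measure_itv/= !lte_fin ltr_pM2r ?invr_gt0//.
  case: ifPn => _; last by rewrite mule0.
  by rewrite -!EFinB -EFinM; congr (_%:E); field; rewrite gt_eqF.
rewrite [RHS](eq_measure_integral m'); last by move=> A mA _; exact: E.
by rewrite /m' ge0_integral_mscale// /m1 ge0_integral_pushforward.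
Qed.

(** The integrand may be unbounded at both ends, as (s - r)^(a-1) is at r = s; monotone convergence
    over closed subintervals replaces continuity there. *)
Lemma ge0_integral_oo_FTC (F f : R -> R) (a b la lb : R) : a < b ->
  (forall x, a < x < b -> is_derive x 1 F (f x)) ->
  (forall x, a < x < b -> {for x, continuous f}) ->
  (forall x, a < x < b -> 0 <= f x) ->
  F x @[x --> a^'+] --> la -> F x @[x --> b^'-] --> lb ->
  (\int[leb]_(x in `]a, b[) (f x)%:E = (lb - la)%:E)%E.
Proof.
move=> ab dF cf f0 Fa Fb.
(* The shift [k.+3] keeps d k below half the length, so that the closed subintervals are
   nondegenerate from k = 0 on. *)
pose d k : R := (b - a) / k.+3%:R.
have ba0 : 0 < b - a by rewrite subr_gt0.
have d0 k : 0 < d k by rewrite divr_gt0.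
have dlt k : d k < (b - a) / 2.
  by rewrite /d ltr_pM2l// ltf_pV2 ?posrE// ltr_nat.
have ddec k l : (k <= l)%N -> d l <= d k.
  by move=> kl; rewrite /d ler_pM2l// lef_pV2 ?posrE// ler_nat.
have dcvg : d k @[k --> \oo] --> (0 : R).
  rewrite -[X in _ --> X](mulr0 (b - a)); apply: cvgMr.
  have := @cvg_harmonic R; rewrite -(cvg_shiftn 2)/=.
  by apply: cvg_trans; apply: near_eq_cvg; near=> k; rewrite /= addn2.
pose I k : set R := `[a + d k, b - d k]%classic.
have Isub k x : I k x -> a < x < b.
  rewrite /I/= in_itv/= => /andP[h1 h2]; apply/andP; split.
    by rewrite (lt_le_trans _ h1)// ltrDl.
  by rewrite (le_lt_trans h2)// ltrBlDr ltrDl.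
have IU : `]a, b[%classic = \bigcup_k I k.
  apply/seteqP; split => x /=; last by move=> [k _ /Isub]; rewrite in_itv.
  rewrite in_itv/= => /andP[ax xb].
  have e0 : 0 < Num.min (x - a) (b - x) by rewrite lt_min !subr_gt0 ax.
  have := dcvg; move=> /cvgrPdist_lt/(_ _ e0)[k _ /(_ k (leqnn k))].
  rewrite sub0r normrN gtr0_norm// lt_min => /andP[h1 h2].
  by exists k => //; rewrite /I/= in_itv/=; apply/andP; split; lra.
have Fk k : (\int[leb]_(x in I k) (f x)%:E = (F (b - d k) - F (a + d k))%:E)%E.
  have abk : a + d k < b - d k by have := dlt k; lra.
  rewrite (@continuous_FTC2 _ f F)//.
  - apply: continuous_in_subspaceT => x; rewrite inE => /Isub; exact: cf.
  - split.
    + move=> x; rewrite in_itv/= => /andP[h1 h2].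
      by have /dF[] : a < x < b by apply: (Isub k); rewrite /I/= in_itv/= !ltW.
    + apply: cvg_at_right_filter.
      have /dF[/derivable1_diffP/differentiable_continuous//] : a < a + d k < b.
      by apply: (Isub k); rewrite /I/= in_itv/= lexx ltW.
    + apply: cvg_at_left_filter.
      have /dF[/derivable1_diffP/differentiable_continuous//] : a < b - d k < b.
      by apply: (Isub k); rewrite /I/= in_itv/= lexx ltW.
  - move=> x; rewrite in_itv/= => /andP[h1 h2].
    have /dF H : a < x < b by apply: (Isub k); rewrite /I/= in_itv/= !ltW.
    by rewrite derive1E (@derive_val _ _ _ _ _ _ _ H).
have mfI k : measurable_fun (I k) (EFin \o f).
  have cI : {within I k, continuous f}.
    by apply: continuous_in_subspaceT => x; rewrite inE => /Isub; exact: cf.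
  apply/measurable_EFinP; apply: subspace_continuous_measurable_fun => //.
  exact: measurable_itv.
have h1 : (\int[leb]_(x in I k) (f x)%:E @[k --> \oo] --> \int[leb]_(x in `]a, b[) (f x)%:E)%E.
  rewrite IU; apply: ge0_nondecreasing_set_cvg_integral => //.
  - move=> k l kl; rewrite subsetEset => x; rewrite /I/= !in_itv/= => /andP[h1 h2].
    by have := ddec _ _ kl => h; apply/andP; split; lra.
  - by move=> k; exact: measurable_itv.
  - by move=> k x /Isub /f0; rewrite lee_fin.
have h2 : (\int[leb]_(x in I k) (f x)%:E @[k --> \oo] --> (lb - la)%:E)%E.
  under eq_fun do rewrite Fk.
  apply: cvg_EFin; first by near=> k.
  apply: cvgB.
  - move/cvg_at_leftP : Fb; apply; split; first by move=> k; rewrite ltrBlDr ltrDl.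
    by rewrite -[X in _ --> X]subr0; apply: cvgB => //; exact: cvg_cst.
  - move/cvg_at_rightP : Fa; apply; split; first by move=> k; rewrite ltrDl.
    by rewrite -[X in _ --> X]addr0; apply: cvgD => //; exact: cvg_cst.
exact: cvg_unique h1 h2.
Unshelve. all: by end_near. Qed.
End lebesgue_affine.

(** * Weights on the time axis *)

Lemma muleVK (R : realType) (k : R) (x : \bar R) : k != 0 -> (k^-1%:E * (k%:E * x) = x)%E.
Proof. by move=> k0; rewrite muleA -EFinM mulVf// mul1e. Qed.

Lemma ge0_integralTZl d (T : measurableType d) (R : realType)
    (mu : {measure set T -> \bar R}) (f : T -> \bar R) (k : R) :
  measurable_fun setT f -> (forall x, 0 <= f x)%E -> 0 <= k ->
  (\int[mu]_x (k%:E * f x) = k%:E * \int[mu]_x f x)%E.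
Proof. by move=> mf f0 k0; rewrite ge0_integralZl_EFin. Qed.

Section time_weights.
Context (R : realType).
Notation leb := (@lebesgue_measure R).

(** Extended by 0 to s <= 0, so that convolutions and translations in time are integrals over the
    whole line. *)
Definition tpow (a s : R) : R := if 0 < s then s `^ (a - 1) else 0.

Lemma tpow_ge0 a s : 0 <= tpow a s.
Proof. by rewrite /tpow; case: ifP => // _; exact: powR_ge0. Qed.

Lemma measurable_tpow a : measurable_fun setT (tpow a).
Proof.
apply: measurable_fun_ifT; last 2 first.
- exact: measurable_powR.
- exact: measurable_cst.
by apply: measurable_fun_ltr; [exact: measurable_cst|exact: measurable_id].
Qed.

(* [tw_conv] is the convolution identity w * s^(a-1) = s^(a-1) - S, so that
   smearing the Riesz kernel by heat kernels weighted by [w] loses only an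
   integrable rest [S].
   [tw_doubling]: if psi(2r) <= 2 psi(r), then t^(-a) times the [w]-average of
   psi at scale t does not increase when t is doubled. *)
Record time_weights (a : R) (w S : R -> R) : Prop := TimeWeights {
  tw_mw : measurable_fun setT w;
  tw_mS : measurable_fun setT S;
  tw_w_ge0 : forall r, 0 <= w r;
  tw_S_ge0 : forall s, 0 <= S s;
  tw_w_le1 : forall r, r <= 1 -> w r = 0;
  tw_w_mass : (\int[leb]_r (w r)%:E = 1)%E;
  tw_S_fin : (\int[leb]_s (S s)%:E < +oo)%E;
  tw_conv : forall s, (\int[leb]_r (w r * tpow a (s - r))%:E + (S s)%:E = (tpow a s)%:E)%E;
  tw_tail : exists2 c : R, 0 < c & forall s : R, 2 <= s ->
    ((c * tpow a s)%:E <= \int[leb]_r (w r * tpow a (s - r))%:E)%E;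
  tw_doubling : forall psi : R -> \bar R, measurable_fun setT psi ->
    (forall r, 0 <= psi r)%E ->
    (forall r : R, 0 < r -> (psi (2 * r)%R <= 2%:E * psi r)%E) ->
    forall t : R, 0 < t ->
      (\int[leb]_r ((w r)%:E * psi (2 * t * r)%R) <=
        (2 `^ a)%:E * \int[leb]_r ((w r)%:E * psi (t * r)%R))%E }.

Lemma integral_if_itv (f : R -> R) (i : interval R) :
  (\int[leb]_r (if r \in i then f r else 0)%:E = \int[leb]_(r in [set` i]) (f r)%:E)%E.
Proof.
rewrite [RHS]integral_mkcond; apply: eq_integral => r _; rewrite patchE.
rewrite (_ : (r \in [set` i]) = (r \in i)); first by case: ifP.
by apply/idP/idP => [/set_mem|] //= ?; exact/mem_set.
Qed.

Lemma integral_ind_itv (i : interval R) :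
  (\int[leb]_r (if r \in i then 1 else 0 : R)%:E = leb [set` i])%E.
Proof.
rewrite (integral_if_itv (cst 1)) -[RHS]mul1e -integral_cst//.
Qed.

Lemma measurable_if_itv (f : R -> R) (i : interval R) : measurable_fun setT f ->
  measurable_fun setT (fun r => if r \in i then f r else 0).
Proof.
move=> mf; apply: measurable_fun_ifT => //.
apply: (@measurable_fun_bool _ _ setT _ true); rewrite setTI.
rewrite (_ : _ @^-1` _ = [set` i]); first exact: measurable_itv.
by apply/seteqP; split => r /=.
Qed.

(** For a = 1 the weight is uniform on (1, 2): its convolution with the indicator of s > 0 reaches 1
    at s = 2, so S has bounded support. The power weight taken for a < 1 would leave the rest 1/s
    here, which is not integrable. Doubling is the pointwise bound on psi. *)
Lemma time_weights1 : exists w S, time_weights 1 w S.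
Proof.
pose w (r : R) : R := if r \in `]1, 2[ then 1 else 0.
pose C (s : R) : R := if s <= 1 then 0 else if s <= 2 then s - 1 else 1.
pose S (s : R) : R := if 0 < s then 1 - C s else 0.
have t1 s : tpow 1 s = if 0 < s then 1 else 0 by rewrite /tpow subrr powRr0.
have mC : measurable_fun setT C.
  apply: measurable_fun_ifT => //; first exact: measurable_fun_ler.
  by apply: measurable_fun_ifT => //; [exact: measurable_fun_ler|exact: measurable_funB].
have conv (s : R) : (\int[leb]_r (w r * tpow 1 (s - r))%:E = (C s)%:E)%E.
  transitivity (\int[leb]_r (if r \in `]1, (Num.min 2 s)[ then 1 else 0 : R)%:E)%E.
    apply: eq_integral => r _; rewrite /w t1 subr_gt0 !in_itv/= lt_min.
    by case: (1 < r); case: (r < 2); case: (r < s); rewrite ?mulr0 ?mulr1 ?mul0r.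
  rewrite integral_ind_itv lebesgue_measure_itv/= lte_fin.
  rewrite /C; case: (leP s 1) => s1; first by rewrite lt_min [1 < s]ltNge s1 andbF.
  case: (leP s 2) => s2; first by rewrite s1 -EFinB.
  by rewrite ltrDl ltr01 -EFinB; congr (_%:E); lra.
exists w, S; split => //.
- exact: measurable_if_itv.
- apply: measurable_fun_ifT => //; first exact: measurable_fun_ltr.
  exact: measurable_funB.
- by move=> r; rewrite /w; case: ifP.
- move=> s; rewrite /S /C; case: ltP => // s0; case: (leP s 1) => h1; [|case: (leP s 2) => h2]; lra.
- by move=> r r1; rewrite /w in_itv/= ltNge r1.
- rewrite integral_ind_itv lebesgue_measure_itv/= lte_fin.
  by rewrite ltrDl ltr01 -EFinB; congr (_%:E); lra.
- apply: (@le_lt_trans _ _ (\int[leb]_r (if r \in `]0, 2[ then 1 else 0 : R)%:E)%E); last first.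
    rewrite integral_ind_itv lebesgue_measure_itv/= lte_fin.
    by rewrite ltr0n -EFinB ltry.
  apply: ge0_le_integral => //.
  + by move=> s _; rewrite lee_fin /S /C; case: ltP => // s0; case: (leP s 1) => h1; [|case: (leP s 2) => h2]; lra.
  + apply/measurable_EFinP; apply: measurable_fun_ifT => //; first exact: measurable_fun_ltr.
    exact: measurable_funB.
  + by apply/measurable_EFinP; exact: measurable_if_itv.
  + move=> s _; rewrite lee_fin /S /C in_itv/=; case: (ltP 0 s) => //= s0.
    case: (leP s 1) => s1; first by rewrite (le_lt_trans s1) ?ltr1n//; lra.
    by case: (leP s 2) => s2; case: ltP => //= h; lra.
- move=> s; rewrite conv -EFinD; congr (_%:E); rewrite /S t1.
  case: (ltP 0 s) => // s0; first by rewrite addrC subrK.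
  by rewrite /C (le_trans s0 ler01) addr0.
- exists 1 => // s s2; rewrite conv lee_fin t1 /C mul1r.
  rewrite ifT; last by lra.
  by case: (leP s 1) => h1; [|case: (leP s 2) => h2]; lra.
- move=> psi mpsi psi0 psi2 t t0.
  rewrite powRr1// -ge0_integralZl//; last 2 first.
  + apply: emeasurable_funM; first by apply/measurable_EFinP; exact: measurable_if_itv.
    by apply: measurableT_comp => //; exact: measurable_funM.
  + by move=> r _; rewrite mule_ge0// lee_fin /w; case: ifP.
  apply: ge0_le_integral => //.
  + by move=> r _; rewrite mule_ge0// lee_fin /w; case: ifP.
  + apply: emeasurable_funM; first by apply/measurable_EFinP; exact: measurable_if_itv.
    by apply: measurableT_comp => //; exact: measurable_funM.
  + apply: measurable_funeM.
    apply: emeasurable_funM; first by apply/measurable_EFinP; exact: measurable_if_itv.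
    by apply: measurableT_comp => //; exact: measurable_funM.
  + move=> r _; rewrite /w in_itv/=; case: (ltP 1 r) => /= r1; last by rewrite !mul0e mule0.
    case: ltP => _; last by rewrite !mul0e mule0.
    by rewrite !mul1e -mulrA psi2// mulr_gt0// (lt_trans ltr01).
Qed.
End time_weights.

Section time_weights_lt1.
Context (R : realType).
Notation leb := (@lebesgue_measure R).

Lemma powR_cvgy (p : R) : 0 < p -> r `^ (- p) @[r --> +oo] --> 0.
Proof.
move=> p0; apply/cvgrPdist_lt => e e0; near=> r.
have r0 : 0 < r by near: r; exact: nbhs_pinfty_gt.
rewrite sub0r normrN ger0_norm ?powR_ge0// powRN.
rewrite -[ltRHS]invrK ltf_pV2 ?posrE ?invr_gt0 ?powR_gt0//.
have -> : e^-1 = (e^-1 `^ p^-1) `^ p.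
  by rewrite -powRrM mulVf ?gt_eqF// powRr1// invr_ge0 ltW.
apply: gt0_ltr_powR; rewrite ?nnegrE ?powR_ge0 ?(ltW r0)//.
Unshelve. all: by end_near. Qed.

Lemma is_derive_powR_comp (p : R) (f : R -> R) (x df : R) : 0 < f x ->
  is_derive x 1 f df ->
  is_derive x 1 (fun y => f y `^ p) (p * f x `^ (p - 1) * df).
Proof.
move=> fx0 dfx; have dp := is_derive1_powR p fx0.
have := is_derive1_comp dp dfx.
by rewrite mulrC [X in is_derive _ _ _ X]mulrC.
Qed.

Lemma continuous_powR (p x : R) : 0 < x -> {for x, continuous (fun y : R => y `^ p)}.
Proof.
move=> x0; apply: differentiable_continuous; apply/derivable1_diffP.
by have [] := is_derive1_powR p x0.
Qed.

Lemma integral_powR_01 (p : R) : 0 < p ->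
  (\int[leb]_(x in `]0%R, 1%R[) (x `^ (p - 1))%:E = p^-1%:E)%E.
Proof.
move=> p0; rewrite -[in RHS](subr0 p^-1).
apply: (@ge0_integral_oo_FTC _ (fun x => p^-1 * x `^ p)) => //.
- move=> x /andP[x0 _].
  have := is_deriveZ p^-1 (is_derive1_powR p x0).
  by rewrite /GRing.scale/= mulrA mulVf ?gt_eqF// mul1r.
- by move=> x /andP[x0 _]; exact: continuous_powR.
- by move=> x _; exact: powR_ge0.
- rewrite -[X in _ --> X](mulr0 p^-1); apply: cvgM; first exact: cvg_cst.
  exact: powR_cvg0.
- apply: cvg_at_left_filter; rewrite -[X in _ --> X]mulr1; apply: cvgM; first exact: cvg_cst.
  suff : y `^ p @[y --> (1:R)] --> (1:R) `^ p by rewrite powR1.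
  exact: continuous_powR.
Qed.

Lemma integral_powR_1y (p : R) : 0 < p ->
  (\int[leb]_(x in `[1%R, +oo[) (x `^ (- p - 1))%:E = p^-1%:E)%E.
Proof.
move=> p0; rewrite (@ge0_continuous_FTC2y _ _ (fun x => - p^-1 * x `^ (- p)) 1 0)//.
- by rewrite powR1 mulr1 -EFinB sub0r opprK.
- by move=> x _; exact: powR_ge0.
- apply: continuous_in_subspaceT => x; rewrite inE/= in_itv/= andbT => x1.
  by apply: continuous_powR; rewrite (lt_le_trans ltr01).
- by rewrite -[X in _ --> X](mulr0 (- p^-1)); apply: cvgM; [exact: cvg_cst|exact: powR_cvgy].
- move=> x x1; have x0 : 0 < x by rewrite (lt_trans ltr01).
  by have [] := is_deriveZ (- p^-1) (is_derive1_powR (- p) x0).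
- apply: cvg_at_right_filter; apply: cvgM; first exact: cvg_cst.
  by exact: continuous_powR.
- move=> x; rewrite in_itv/= andbT => x1; have x0 : 0 < x by rewrite (lt_trans ltr01).
  have H := is_deriveZ (- p^-1) (is_derive1_powR (- p) x0).
  rewrite derive1E (@derive_val _ _ _ _ _ _ _ H).
  by rewrite /GRing.scale/= mulrA mulrNN mulVf ?gt_eqF// mul1r.
Qed.

(* The integrand is the derivative of [- ((s / r - 1) `^ a) / s]. *)
Lemma integral_pareto_conv (a s : R) : 0 < a -> 1 < s ->
  (\int[leb]_(r in `]1%R, s[) (a * r `^ (- a - 1) * (s - r) `^ (a - 1))%:E =
   ((s - 1) `^ a / s)%:E)%E.
Proof.
move=> a0 s1; have s0 : 0 < s by rewrite (lt_trans ltr01).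
have dF r : 0 < r < s -> is_derive r 1 (fun r => - s^-1 * (s / r - 1) `^ a)
   (a * r `^ (- a - 1) * (s - r) `^ (a - 1)).
  move=> /andP[r0 rs].
  have sr0 : 0 < s / r - 1 by rewrite subr_gt0 ltr_pdivlMr// mul1r.
  have d1 : is_derive r (1:R) (fun r => s / r - 1) (- s / r ^+ 2).
    have dV : is_derive r (1:R) (fun r : R => r^-1) (- r ^- 2).
      have := is_deriveV (f := id) (v := 1:R) (x := r).
      rewrite /GRing.scale/= => /(_ _ (lt0r_neq0 r0) (is_derive_id _ _)).
      by rewrite mulr1.
    have := is_deriveB (is_deriveZ s dV) (is_derive_cst (1:R) r (1:R)).
    by rewrite subr0 /GRing.scale/= mulrN mulNr.
  have := is_deriveZ (- s^-1) (@is_derive_powR_comp a (fun r => s / r - 1) r _ sr0 d1).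
  congr is_derive; rewrite /GRing.scale/=.
  have -> : s / r - 1 = (s - r) / r by field; rewrite gt_eqF.
  have -> : ((s - r) / r) `^ (a - 1) = (s - r) `^ (a - 1) * r `^ (- (a - 1)).
    by rewrite powRM ?invr_ge0 ?subr_ge0 ?ltW// -powR_inv1 ?ltW// -powRrM mulN1r.
  have -> : r `^ (- a - 1) = r `^ (- (a - 1)) * r ^- 2.
    rewrite -powR_invn ?(ltW r0)// -powRD; last by apply/implyP => _; rewrite gt_eqF.
    by congr powR; ring.
  by field; rewrite !gt_eqF.
have -> : (s - 1) `^ a / s = 0 - (- s^-1 * (s - 1) `^ a).
  by rewrite sub0r mulNr opprK mulrC.
apply: (@ge0_integral_oo_FTC _ (fun r => - s^-1 * (s / r - 1) `^ a)) => //.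
- by move=> r /andP[r1 rs]; apply: dF; rewrite (lt_trans ltr01).
- move=> r /andP[r1 rs]; have r0 : 0 < r by rewrite (lt_trans ltr01).
  apply: cvgM; last first.
    apply: (@continuous_comp R R R (fun r => s - r) (fun y => y `^ (a - 1))).
      by apply: (@cvgB _ R^o); [exact: cvg_cst|exact: cvg_id].
    by apply: continuous_powR; rewrite subr_gt0.
  by apply: cvgM; [exact: cvg_cst|exact: continuous_powR].
- move=> r _; apply: mulr_ge0; last exact: powR_ge0.
  by apply: mulr_ge0; [exact: ltW|exact: powR_ge0].
- apply: cvg_at_right_filter.
  have /dF[/derivable1_diffP/differentiable_continuous h _] : 0 < (1:R) < s by rewrite ltr01.
  have -> : - s^-1 * (s - 1) `^ a = (fun r => - s^-1 * (s / r - 1) `^ a) 1.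
    by rewrite /= divr1.
  exact: h.
- rewrite -[X in _ --> X](mulr0 (- s^-1)); apply: cvgM; first exact: cvg_cst.
  (* As r tends to s from below, s / r - 1 tends to 0 through positive values, where [powR_cvg0]
     applies. *)
  apply: (cvg_trans _ (powR_cvg0 a0)).
  move=> V /= [e /= e0 eV].
  have h : s / r - 1 @[r --> s] --> (0:R).
    have -> : (0:R) = s / s - 1 by rewrite divff ?subrr// gt_eqF.
    apply: cvgB; last exact: cvg_cst.
    by apply: cvgM; [exact: cvg_cst|apply: cvgV; rewrite ?gt_eqF//; exact: cvg_id].
  have {}h := cvg_at_left_filter h.
  move/cvgrPdist_lt : h => /(_ _ e0) h.
  have : \forall r \near s^'-, V ((s / r - 1) `^ a).
    near=> r; apply: eV => /=; first by near: r.
    by rewrite subr_gt0 ltr_pdivlMr ?mul1r.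
  by [].
Unshelve. all: by end_near. Qed.
End time_weights_lt1.

Lemma half_le_sub1 (R : realFieldType) (s : R) : 2 <= s -> 2^-1 * s <= s - 1.
Proof. by move=> s2; lra. Qed.

Section time_weights_pareto.
Context (R : realType) (a : R).
Hypotheses (a0 : 0 < a) (a1 : a < 1).
Notation leb := (@lebesgue_measure R).

(** The Pareto density: its convolution with s^(a-1) is elementary, namely [C], and its homogeneity
    turns doubling into a change of variable. *)
Let w (r : R) : R := if r \in `]1, +oo[ then a * r `^ (- a - 1) else 0.
Let C (s : R) : R := if 1 < s then (s - 1) `^ a / s else 0.
Let S (s : R) : R := tpow a s - C s.

Let mw : measurable_fun setT w.
Proof. by apply: measurable_if_itv; apply: measurable_funM => //; exact: measurable_powR. Qed.

Let mC : measurable_fun setT C.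
Proof.
apply: measurable_fun_ifT => //; first exact: measurable_fun_ltr.
apply: measurable_funM; last exact: measurable_inv.
by apply: (measurableT_comp (measurable_powR _)); exact: measurable_funB.
Qed.

Let w_ge0 r : 0 <= w r.
Proof. by rewrite /w; case: ifP => // _; rewrite mulr_ge0 ?powR_ge0 ?ltW. Qed.

Let conv s : (\int[leb]_r (w r * tpow a (s - r))%:E = (C s)%:E)%E.
Proof.
transitivity (\int[leb]_r (if r \in `]1%R, s[
    then a * r `^ (- a - 1) * (s - r) `^ (a - 1) else 0)%:E)%E.
  apply: eq_integral => r _; rewrite /w /tpow subr_gt0 !in_itv/= andbT.
  by case: (1 < r); case: (r < s); rewrite ?mulr0 ?mul0r.
rewrite integral_if_itv /C; case: ltP => s1; first exact: integral_pareto_conv.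
rewrite (_ : [set` _] = set0) ?integral_set0//.
by apply/seteqP; split => r //=; rewrite in_itv/= => /andP[]; lra.
Qed.

Let S_ge0 s : 0 <= S s.
Proof.
rewrite /S /C subr_ge0; case: ltP => s1; last exact: tpow_ge0.
have s0 : 0 < s by rewrite (lt_trans ltr01).
rewrite /tpow s0 ler_pdivrMr// mulrC mulr_powRB1 ?(ltW s0)//.
by apply: ge0_ler_powR; rewrite ?nnegrE ?(ltW a0) ?subr_ge0 ?(ltW s1) ?(ltW s0) ?gerBl.
Qed.

(** Dividing by s^a / s, this is 1 <= (1 - 1/s)^a + 1/s, true because (1 - 1/s)^a >= 1 - 1/s for a
    <= 1. The resulting exponent a - 2 is integrable at infinity exactly when a < 1. *)
Let S_le s : 1 < s -> S s <= s `^ (- (1 - a) - 1).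
Proof.
move=> s1; have s0 : 0 < s by rewrite (lt_trans ltr01).
rewrite /S /C s1 /tpow s0 lerBlDr.
have -> : s `^ (a - 1) = s `^ a / s.
  by rewrite -(mulr_powRB1 (ltW s0) a0) mulrAC divff ?gt_eqF// mul1r.
have -> : s `^ (- (1 - a) - 1) = s `^ a / s / s.
  have -> : - (1 - a) - 1 = a - 2%:R by ring.
  rewrite powRB; last by apply/implyP => _; rewrite gt_eqF.
  by rewrite powR_mulrn ?(ltW s0)// expr2 invfM mulrA.
have -> : s - 1 = s * (1 - s^-1) by rewrite mulrBr mulr1 divff ?gt_eqF.
have h : 0 < 1 - s^-1 by rewrite subr_gt0 invf_lt1.
rewrite powRM ?(ltW s0) ?(ltW h)// -mulrDl ler_pM2r ?invr_gt0//.
rewrite -mulrDr -[leLHS]mulr1 ler_pM2l ?powR_gt0//.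
rewrite -lerBlDl ger1_powR ?(ltW a1)// h/=.
by rewrite gerBl invr_ge0 ltW.
Qed.

Lemma time_weights_lt1 : exists w S, time_weights a w S.
Proof.
exists w, S; split => //.
- by apply: measurable_funB => //; exact: measurable_tpow.
- by move=> r r1; rewrite /w in_itv/= ltNge r1.
- rewrite integral_if_itv integral_itv_obnd_cbnd; last first.
    by apply/measurable_EFinP/measurable_funTS; apply: measurable_funM => //; exact: measurable_powR.
  under eq_integral do rewrite EFinM.
  rewrite ge0_integralZl_EFin ?(ltW a0)//.
  + by rewrite integral_powR_1y// -EFinM divff// gt_eqF.
  + by move=> r _; rewrite lee_fin powR_ge0.
  + by apply/measurable_EFinP/measurable_funTS; exact: measurable_powR.
- have mtp p : measurable_fun setT (fun s : R => if s \in `]0, 1[ then s `^ p else 0).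
    by apply: measurable_if_itv; exact: measurable_powR.
  have mtq p : measurable_fun setT (fun s : R => if s \in `[1, +oo[ then s `^ p else 0).
    by apply: measurable_if_itv; exact: measurable_powR.
  apply: (@le_lt_trans _ _ (\int[leb]_s ((if s \in `]0%R, 1%R[ then s `^ (a - 1) else 0)%:E +
     (if s \in `[1%R, +oo[ then s `^ (- (1 - a) - 1) else 0)%:E))%E).
    apply: ge0_le_integral => //.
    + by move=> s _; rewrite lee_fin.
    + by apply/measurable_EFinP; apply: measurable_funB => //; exact: measurable_tpow.
    + by apply: emeasurable_funD; [(apply/measurable_EFinP; exact: mtp)|(apply/measurable_EFinP; exact: mtq)].
    + move=> s _; rewrite -EFinD lee_fin !in_itv/= andbT.
      case: (ltgtP s 1) => [s1|s1|->].
      * by rewrite andbT addr0 /S /C /tpow [1 < s]ltNge (ltW s1)/= subr0.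
      * by rewrite andbF add0r S_le.
      * by rewrite andbF add0r /S /C ltxx /tpow ltr01 !powR1 subr0.
  rewrite ge0_integralD//.
  + rewrite !integral_if_itv integral_powR_01// integral_powR_1y ?subr_gt0//.
    by rewrite -EFinD ltry.
  + by move=> s _; rewrite lee_fin; case: ifP => // _; exact: powR_ge0.
  + (apply/measurable_EFinP; exact: mtp).
  + by move=> s _; rewrite lee_fin; case: ifP => // _; exact: powR_ge0.
  + (apply/measurable_EFinP; exact: mtq).
- by move=> s; rewrite conv -EFinD /S addrC subrK.
- exists (2^-1 `^ a); first by rewrite powR_gt0.
  move=> s s2; have s0 : 0 < s by rewrite (lt_le_trans _ s2).
  have s1 : 1 < s by rewrite (lt_le_trans _ s2)// ltr1n.
  rewrite conv lee_fin /C s1 /tpow s0.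
  have -> : s `^ (a - 1) = s `^ a / s.
    by rewrite -(mulr_powRB1 (ltW s0) a0) mulrAC divff ?gt_eqF// mul1r.
  rewrite mulrA -powRM ?(ltW s0)// ler_pM2r ?invr_gt0//.
  have h1 : 0 <= s - 1 by rewrite subr_ge0 ltW.
  have h2 : 0 <= 2^-1 * s by rewrite mulr_ge0// ltW.
  have h3 : 2^-1 * s <= s - 1 by exact: half_le_sub1.
  by apply: ge0_ler_powR; rewrite ?nnegrE ?(ltW a0).
- move=> psi mpsi psi0 psi2 t t0.
  have mwpsi c (u : R -> R) : measurable_fun setT u ->
      measurable_fun setT (fun r => (w (u r))%:E * psi (c * r)%R)%E.
    move=> mu; apply: emeasurable_funM; first by apply/measurable_EFinP; exact: measurableT_comp mw mu.
    by apply: measurableT_comp => //; exact: measurable_funM.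
  (* Substituting r / 2 for r turns the weight into w(r/2)/2, which is 2^a w(r) for r > 2 and 0
     otherwise. *)
  have := @ge0_integral_scaling R (fun r => (w (2^-1 * r))%:E * psi (t * r)%R)%E 2 (ltr0Sn _ _).
  move=> /(_ _ _)/wrap[||sc].
  + by apply: (mwpsi t (fun r => 2^-1 * r)); exact: measurable_funM.
  + by move=> r; rewrite mule_ge0// lee_fin.
  have -> : (\int[leb]_r ((w r)%:E * psi (2 * t * r)%R) =
      2^-1%:E * \int[leb]_r ((w (2^-1 * r))%:E * psi (t * r)%R))%E.
    transitivity (2^-1%:E * (2%:E * \int[leb]_r ((w (2^-1 * (2 * r)))%:E * psi (t * (2 * r))%R)))%E; last first.
      by apply: (congr1 (fun z => 2^-1%:E * z)%E); exact: sc.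
    rewrite (@muleVK R 2 _ (lt0r_neq0 (ltr0Sn _ 1))).
    by apply: eq_integral => r _; rewrite mulKf// mulrA (mulrC t).
  have m1 : measurable_fun setT (fun r => (w r)%:E * psi (t * r)%R)%E.
    by apply: (mwpsi t id); exact: measurable_id.
  have m2 : measurable_fun setT (fun r : R => (w (2^-1 * r)%R)%:E * psi (t * r)%R)%E.
    by apply: (mwpsi t (fun r => 2^-1 * r)); exact: measurable_funM.
  have p1 (r : R) : (0 <= (w r)%:E * psi (t * r)%R)%E by rewrite mule_ge0// lee_fin.
  have p2 (r : R) : (0 <= (w (2^-1 * r)%R)%:E * psi (t * r)%R)%E by rewrite mule_ge0// lee_fin.
  have p3 : (0 <= (2 `^ a)%:E :> \bar R)%E by rewrite lee_fin powR_ge0.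
  have h2 : 0 <= 2^-1 :> R by rewrite invr_ge0.
  rewrite -(ge0_integralTZl leb m2 p2 h2) -(ge0_integralTZl leb m1 p1 (powR_ge0 2 a)).
  apply: ge0_le_integral.
  + exact: measurableT.
  + by move=> r _; rewrite mule_ge0.
  + exact: measurable_funeM.
  + exact: measurable_funeM.
  + move=> r _; rewrite !muleA lee_wpmul2r// -!EFinM lee_fin /w !in_itv/= !andbT.
    case: ltP => r1; last by rewrite mulr0; case: ifP => _; rewrite ?mulr0// !mulr_ge0 ?powR_ge0 ?ltW.
    have r2 : 2 < r by rewrite -(ltr_pM2l (_ : 0 < 2^-1 :> R))// mulVf.
    have r0 : 0 < r by rewrite (lt_trans _ r2).
    rewrite ifT; last by rewrite (lt_trans _ r2)// ltr1n.
    rewrite powRM ?(ltW r0)//.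
    have -> : 2^-1 `^ (- a - 1) = 2 `^ a * 2 :> R.
      rewrite -powR_inv1// -powRrM (_ : -1 * (- a - 1) = a + 1); last by ring.
      by rewrite powRD ?powRr1//; apply/implyP.
    by rewrite le_eqVlt; apply/orP; left; apply/eqP; field.
Qed.
End time_weights_pareto.

Lemma exists_time_weights (R : realType) (a : R) : 0 < a -> a <= 1 ->
  exists w S, time_weights a w S.
Proof.
by move=> a0; rewrite le_eqVlt => /predU1P[->|]; [exact: time_weights1|exact: time_weights_lt1].
Qed.

(** * The Riesz kernel as a mixture of heat kernels *)

Section riesz_heat.
Context (R : realType) (n : nat) (a : R).
Hypotheses (a0 : 0 < a) (a1 : a <= 1) (n2 : (2 < n)%N).
Notation leb := (@lebesgue_measure R).

(** The time integrand depends on the two points only through their squared distance D; the diagonal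
    is D = 0, and the substitution s = D u reduces every D > 0 to D = 1. *)
Definition heat_profile (D s : R) : R :=
  tpow a s * ((pi * s) `^ (- (n%:R / 2)) * expR (- (D / s))).

Lemma heat_profileE s (x y : 'rV[R]_n) : tpow a s * heat s x y = heat_profile (sqdist x y) s.
Proof.
rewrite /heat_profile /tpow; case: (ltP 0 s) => s0; last by rewrite !mul0r.
by rewrite heatE.
Qed.

Lemma heat_profile_ge0 D s : 0 <= heat_profile D s.
Proof. by rewrite !mulr_ge0 ?tpow_ge0 ?powR_ge0 ?expR_ge0. Qed.

Lemma measurable_heat_profile D : measurable_fun setT (heat_profile D).
Proof.
apply: measurable_funM; first exact: measurable_tpow.
apply: measurable_funM.
  by apply: (measurableT_comp (measurable_powR _)); exact: measurable_funM.
apply: (measurableT_comp (@measurable_expR R)).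
apply: measurableT_comp => //; apply: measurable_funM => //.
exact: measurable_inv.
Qed.

(** The inequality y / n <= exp(y / n), raised to the power n. With y = 1/s it tames the heat kernel
    at small times. *)
Lemma powR_expRN_le (y : R) : 0 < y -> y ^+ n * expR (- y) <= n%:R ^+ n.
Proof.
move=> y0; rewrite expRN ler_pdivrMr ?expR_gt0//.
have n0 : 0 < n%:R :> R by rewrite ltr0n (leq_trans _ n2).
have -> : expR y = expR (y / n%:R) ^+ n.
  by rewrite -expRM_natl; congr expR; rewrite mulrCA divff ?mulr1// gt_eqF.
rewrite -exprMn; apply: lerXn2r; rewrite ?nnegrE ?mulr_ge0 ?expR_ge0 ?(ltW y0) ?(ltW n0)//.
rewrite -ler_pdivrMl// mulrC (le_trans _ (expR_ge1Dx _))//.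
by rewrite lerDr.
Qed.

Lemma n2a_gt0 : 0 < n%:R / 2 - a :> R.
Proof.
have : 3 <= n%:R :> R by rewrite ler_nat.
by move: a1 => ? ?; lra.
Qed.

Lemma pi_ge1 : 1 <= pi :> R.
Proof. by rewrite (le_trans _ (pi_ge2 R))// ler1n. Qed.

Let pe s : 0 < s -> (pi * s) `^ (- (n%:R / 2)) <= s `^ (- (n%:R / 2)) :> R.
Proof.
move=> s0; rewrite powRM ?pi_ge0 ?(ltW s0)// ler_piMl ?powR_ge0//.
rewrite powRN invf_le1 ?powR_gt0 ?pi_gt0//.
have := @ler_powR R pi pi_ge1 0 (n%:R / 2); rewrite powRr0; apply.
by rewrite divr_ge0.
Qed.

(** Near 0 the exponential absorbs s^(-n/2) and leaves s^(a-1); near infinity the exponent a - 1 -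
    n/2 is below -1, since a <= 1 and n >= 3. *)
Lemma heat_profile1_lty : (\int[leb]_s (heat_profile 1 s)%:E < +oo)%E.
Proof.
pose f1 (s : R) : R := if s \in `]0, 1[ then n%:R ^+ n * s `^ (a - 1) else 0.
pose f2 (s : R) : R := if s \in `[1, +oo[ then s `^ (- (n%:R / 2 - a) - 1) else 0.
have m1 : measurable_fun setT f1.
  by apply: measurable_if_itv; apply: measurable_funM => //; exact: measurable_powR.
have m2 : measurable_fun setT f2 by apply: measurable_if_itv; exact: measurable_powR.
have f10 s : 0 <= f1 s by rewrite /f1; case: ifP => // _; rewrite mulr_ge0 ?powR_ge0 ?exprn_ge0.
have f20 s : 0 <= f2 s by rewrite /f2; case: ifP => // _; rewrite powR_ge0.
apply: (@le_lt_trans _ _ (\int[leb]_s ((f1 s)%:E + (f2 s)%:E))%E).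
  apply: ge0_le_integral => //.
  - by move=> s _; rewrite lee_fin heat_profile_ge0.
  - by apply/measurable_EFinP; exact: measurable_heat_profile.
  - by apply: emeasurable_funD; apply/measurable_EFinP.
  move=> s _; rewrite -EFinD lee_fin /f1 /f2 /heat_profile /tpow !in_itv/= andbT.
  case: (ltP 0 s) => s0; last first.
    by rewrite mul0r addr_ge0//; case: ifP => // _; rewrite powR_ge0.
  case: (ltP s 1) => s1 /=.
    rewrite addr0 mulrC ler_wpM2r ?powR_ge0//.
    rewrite (le_trans _ (@powR_expRN_le s^-1 _)) ?invr_gt0//.
    rewrite div1r ler_wpM2r ?expR_ge0// (le_trans (pe s0))//.
    rewrite -powR_mulrn ?invr_ge0 ?(ltW s0)// -(powR_inv1 (ltW s0)) -powRrM mulN1r.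
    apply: ger_powR; first by rewrite s0/= ltW.
    by rewrite lerN2 ler_pdivrMr// ler_peMr// ler1n.
  rewrite add0r.
  have -> : s `^ (- (n%:R / 2 - a) - 1) = s `^ (a - 1) * s `^ (- (n%:R / 2)).
    rewrite -powRD; last by apply/implyP => _; rewrite gt_eqF.
    by congr powR; ring.
  rewrite ler_wpM2l ?powR_ge0// -[leRHS]mulr1 ler_pM ?powR_ge0 ?expR_ge0//; first exact: pe.
  by rewrite expR_le1 oppr_le0 divr_ge0 // ltW.
rewrite ge0_integralD//.
- rewrite !integral_if_itv integral_powR_1y ?n2a_gt0//.
  under eq_integral do rewrite EFinM.
  rewrite ge0_integralZl_EFin ?exprn_ge0//.
  + by rewrite integral_powR_01// -EFinM -EFinD ltry.
  + by move=> x _; rewrite lee_fin powR_ge0.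
  + by apply/measurable_EFinP/measurable_funTS; exact: measurable_powR.
- by move=> s _; rewrite lee_fin.
- exact/measurable_EFinP.
- by move=> s _; rewrite lee_fin.
- exact/measurable_EFinP.
Qed.

Lemma heat_profile1_gt0 : (0 < \int[leb]_s (heat_profile 1 s)%:E)%E.
Proof.
rewrite lt_neqAle; apply/andP; split; last first.
  by apply: integral_ge0 => s _; rewrite lee_fin heat_profile_ge0.
apply/eqP => /esym I0.
have : ae_eq leb setT (EFin \o heat_profile 1) (cst 0%E).
  apply/ae_eq_integral_abs => //; first by apply/measurable_EFinP; exact: measurable_heat_profile.
  rewrite -[RHS]I0; apply: eq_integral => s _.
  by rewrite /= ger0_norm ?heat_profile_ge0.
move=> [N [mN N0 sN]].
have : (leb `]0%R, 1%R[%classic <= leb N)%E.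
  apply: le_measure; rewrite ?inE//.
  apply: (subset_trans _ sN) => s; rewrite /= in_itv/= => /andP[s0 s1].
  move=> /(_ I) [] /eqP; rewrite gt_eqF// !mulr_gt0 ?expR_gt0 ?powR_gt0 ?mulr_gt0 ?pi_gt0//.
  by rewrite /tpow s0 powR_gt0.
rewrite [X in (_ <= X)%E -> _]N0 lebesgue_measure_itv/= lte_fin ltr01 oppr0 adde0.
by rewrite lee_fin ler10.
Qed.

Lemma heat_profile_scaling D : 0 < D ->
  (\int[leb]_s (heat_profile D s)%:E =
   (D `^ (a - n%:R / 2))%:E * \int[leb]_s (heat_profile 1 s)%:E)%E.
Proof.
move=> D0.
have mp d : measurable_fun setT (fun s : measurableTypeR R => (heat_profile d s)%:E).
  by apply/measurable_EFinP; exact: measurable_heat_profile.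
have p0 d s : (0 <= (heat_profile d s)%:E)%E by rewrite lee_fin heat_profile_ge0.
have mpD : measurable_fun setT (fun s : measurableTypeR R => (heat_profile D (D * s))%:E).
  by apply: (measurableT_comp (mp D)); exact: measurable_funM.
rewrite -(ge0_integral_scaling D0 (mp D) (p0 D)).
rewrite -(ge0_integralTZl leb mpD (fun s => p0 D (D * s)) (ltW D0)).
rewrite -(ge0_integralTZl leb (mp 1) (p0 1) (powR_ge0 _ _)).
apply: eq_integral => s _; rewrite -!EFinM; congr (_%:E).
rewrite /heat_profile /tpow pmulr_rgt0//; case: ltP => s0; last by rewrite !mul0r !mulr0.
have -> : (D * s) `^ (a - 1) = D `^ (a - 1) * s `^ (a - 1) by rewrite powRM ?ltW.
have -> : (pi * (D * s)) `^ (- (n%:R / 2)) =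
    D `^ (- (n%:R / 2)) * (pi * s) `^ (- (n%:R / 2)).
  by rewrite (mulrCA pi) [LHS]powRM ?mulr_ge0 ?pi_ge0 ?(ltW s0) ?(ltW D0).
have -> : D / (D * s) = 1 / s by field; rewrite !gt_eqF.
have -> : D `^ (a - n%:R / 2) = D * (D `^ (a - 1) * D `^ (- (n%:R / 2))).
  rewrite -powRD; last by apply/implyP => _; rewrite gt_eqF.
  rewrite -{2}(powRr1 (ltW D0)) -powRD; last by apply/implyP => _; rewrite gt_eqF.
  by congr powR; ring.
by ring.
Qed.

(* On the diagonal the time integral dominates its values at every positive
   squared distance, which are unbounded. *)
Lemma heat_profile0 : (\int[leb]_s (heat_profile 0 s)%:E = +oo)%E.
Proof.
have I0 := heat_profile1_gt0; have Ioo := heat_profile1_lty.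
set I := (\int[leb]_s (heat_profile 1 s)%:E)%E in I0 Ioo.
have Ifin : I \is a fin_num by rewrite ge0_fin_numE// ltW.
have le D : 0 < D -> ((D `^ (a - n%:R / 2))%:E * I <= \int[leb]_s (heat_profile 0 s)%:E)%E.
  move=> D0; rewrite -heat_profile_scaling//; apply: ge0_le_integral.
  - exact: measurableT.
  - by move=> s _; rewrite lee_fin heat_profile_ge0.
  - by apply/measurable_EFinP; exact: measurable_heat_profile.
  - by apply/measurable_EFinP; exact: measurable_heat_profile.
  - move=> s _; rewrite lee_fin /heat_profile /tpow; case: ltP => s0; last by rewrite !mul0r.
    rewrite !ler_wpM2l ?powR_ge0// ler_expR mul0r oppr0 oppr_le0.
    by rewrite divr_ge0 ?ltW.
apply: eq_infty => M; have [M0|M0] := leP M 0.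
  apply: (@le_trans _ _ 0%E); first by rewrite lee_fin.
  by apply: integral_ge0 => s _; rewrite lee_fin heat_profile_ge0.
have fI0 : 0 < fine I by rewrite fine_gt0// I0.
have n2a := n2a_gt0.
have MI0 : 0 < M / fine I by rewrite divr_gt0.
(* This squared distance D solves D^(a - n/2) * I = M. *)
have D0 : 0 < (M / fine I) `^ (- (n%:R / 2 - a)^-1) by rewrite powR_gt0.
apply: (le_trans _ (le _ D0)); rewrite -(fineK Ifin) -powRrM.
have -> : - (n%:R / 2 - a)^-1 * (a - n%:R / 2) = 1.
  by rewrite mulNr -mulrN opprB mulVf// gt_eqF.
by rewrite /= powRr1 ?(ltW MI0)// -EFinM divfK// gt_eqF.
Qed.

(** By scaling, the time integral is its value at D = 1 times D^(a - n/2), the power 2a - n of the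
    distance; c is the inverse of that value. *)
Lemma riesz_time_integral : exists2 c : R, 0 < c & forall x z : 'rV[R]_n,
  (riesz (2 * a) x z = \int[leb]_s (c * tpow a s * heat s x z)%:E)%E.
Proof.
have I0 := heat_profile1_gt0; have Ioo := heat_profile1_lty.
set I := (\int[leb]_s (heat_profile 1 s)%:E)%E in I0 Ioo.
have Ifin : I \is a fin_num by rewrite ge0_fin_numE// ltW.
have fI0 : 0 < fine I by rewrite fine_gt0// I0.
exists (fine I)^-1; first by rewrite invr_gt0.
move=> x z; under eq_integral do rewrite -mulrA heat_profileE EFinM.
rewrite ge0_integralZl_EFin ?invr_ge0 ?(ltW fI0)//; last 2 first.
- by move=> s _; rewrite lee_fin heat_profile_ge0.
- by apply/measurable_EFinP; exact: measurable_heat_profile.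
rewrite /riesz; case: eqVneq => [->|xz].
  have -> : sqdist z z = 0 by apply/eqP; rewrite sqdist_eq0.
  by rewrite heat_profile0 gt0_muley// lte_fin invr_gt0.
have D0 : 0 < sqdist x z by rewrite lt_neqAle sqdist_ge0 andbT eq_sym sqdist_eq0.
rewrite heat_profile_scaling// -/I -(fineK Ifin) -!EFinM; congr (_%:E).
rewrite /= /Defs.edist -/(sqdist x z) -powR12_sqrt ?(ltW D0)// -powRrM.
have -> : 2^-1 * (2 * a - n%:R) = a - n%:R / 2 by field.
by rewrite mulrCA mulVf ?mulr1// gt_eqF.
Qed.

End riesz_heat.

(** * Heat operators and potentials *)

Lemma measurable_on_fst d1 d2 d3 (T1 : measurableType d1) (T2 : measurableType d2)
    (T3 : measurableType d3) (f : T1 -> T3) :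
  measurable_fun setT f -> measurable_fun setT (fun p : T1 * T2 => f p.1).
Proof. by move=> mf; exact: measurableT_comp mf measurable_fst. Qed.

Lemma measurable_on_snd d1 d2 d3 (T1 : measurableType d1) (T2 : measurableType d2)
    (T3 : measurableType d3) (f : T2 -> T3) :
  measurable_fun setT f -> measurable_fun setT (fun p : T1 * T2 => f p.2).
Proof. by move=> mf; exact: measurableT_comp mf measurable_snd. Qed.

Section heat_operators.
Context (R : realType) (n : nat) (m : bmeasure R n).
Hypothesis hm : heat_reference m.
Implicit Types (mu nu : bmeasure R n) (f g : Rn R n -> \bar R) (x : 'rV[R]_n).

Definition heatf (s : R) f x : \bar R := (\int[m]_y ((heat s x y)%:E * f y))%E.
Definition heatm (s : R) mu x : \bar R := (\int[mu]_z (heat s x z)%:E)%E.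

Lemma sigma_finite_ref : sigma_finite setT m. Proof. by have [] := hm. Qed.

Lemma heatf_ge0 s f x : (forall y, 0 <= f y)%E -> (0 <= heatf s f x)%E.
Proof. by move=> f0; apply: integral_ge0 => y _; rewrite mule_ge0// lee_fin heat_ge0. Qed.

Lemma heatm_ge0 s mu x : (0 <= heatm s mu x)%E.
Proof. by apply: integral_ge0 => y _; rewrite lee_fin heat_ge0. Qed.

Lemma measurable_heatE d (T : measurableType d) (s : T -> R) (x y : T -> Rn R n) :
  measurable_fun setT s -> measurable_fun setT x -> measurable_fun setT y ->
  measurable_fun setT (fun p => (heat (s p) (x p) (y p))%:E).
Proof. by move=> *; apply/measurable_EFinP; exact: measurable_heat. Qed.

Lemma measurable_heatf d (T : measurableType d) (s : T -> R) (x : T -> Rn R n) f :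
  measurable_fun setT s -> measurable_fun setT x -> measurable_fun setT f ->
  (forall y, 0 <= f y)%E ->
  measurable_fun setT (fun t => heatf (s t) f (x t)).
Proof.
move=> ms mx mf f0.
apply: (@measurable_tonelli _ _ T (Rn R n) R m (fun t y => (heat (s t) (x t) y)%:E * f y)%E).
- exact: sigma_finite_ref.
- apply: emeasurable_funM.
    apply: measurable_heatE => //.
    + exact: measurable_on_fst ms.
    + exact: measurable_on_fst mx.
  exact: measurable_on_snd mf.
- by move=> t y; rewrite mule_ge0// lee_fin heat_ge0.
Qed.

Lemma measurable_heatm d (T : measurableType d) (s : T -> R) (x : T -> Rn R n) mu :
  sigma_finite setT mu -> measurable_fun setT s -> measurable_fun setT x ->
  measurable_fun setT (fun t => heatm (s t) mu (x t)).
Proof.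
move=> smu ms mx.
apply: (@measurable_tonelli _ _ T (Rn R n) R mu (fun t y => (heat (s t) (x t) y)%:E)%E) => //.
- apply: measurable_heatE => //.
  + exact: measurable_on_fst ms.
  + exact: measurable_on_fst mx.
- by move=> t y; rewrite lee_fin heat_ge0.
Qed.

Lemma heat_mass s x : 0 < s -> (\int[m]_y (heat s x y)%:E = 1)%E.
Proof. by have [_ h _] := hm; exact: h. Qed.

Lemma heat_semigroup s t x z : 0 < s -> 0 < t ->
  (\int[m]_y ((heat s x y)%:E * (heat t y z)%:E) = (heat (s + t) x z)%:E)%E.
Proof. by have [_ _ h] := hm; exact: h. Qed.

Lemma heatf_cst s x (k : \bar R) : 0 < s -> (0 <= k)%E -> heatf s (cst k) x = k.
Proof.
move=> s0 k0; rewrite /heatf ge0_integralZr ?heat_mass ?mul1e//.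
- exact: measurable_heatE.
- by move=> y _; rewrite lee_fin heat_ge0.
Qed.

Lemma le_heatf s f g x : measurable_fun setT f -> measurable_fun setT g ->
  (forall y, 0 <= f y)%E -> (forall y, f y <= g y)%E ->
  (heatf s f x <= heatf s g x)%E.
Proof.
move=> mf mg f0 fg; apply: ge0_le_integral => //.
- by move=> y _; rewrite mule_ge0// lee_fin heat_ge0.
- by apply: emeasurable_funM => //; exact: measurable_heatE.
- by apply: emeasurable_funM => //; exact: measurable_heatE.
- by move=> y _; rewrite lee_wpmul2l// lee_fin heat_ge0.
Qed.

Lemma heatfD s f g x : measurable_fun setT f -> measurable_fun setT g ->
  (forall y, 0 <= f y)%E -> (forall y, 0 <= g y)%E ->
  heatf s (fun y => f y + g y)%E x = (heatf s f x + heatf s g x)%E.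
Proof.
move=> mf mg f0 g0; rewrite -ge0_integralD//.
- by apply: eq_integral => y _; rewrite ge0_muleDr.
- by move=> y _; rewrite mule_ge0// lee_fin heat_ge0.
- by apply: emeasurable_funM => //; exact: measurable_heatE.
- by move=> y _; rewrite mule_ge0// lee_fin heat_ge0.
- by apply: emeasurable_funM => //; exact: measurable_heatE.
Qed.

Lemma heatf_heatf s t f x : 0 < s -> 0 < t ->
  measurable_fun setT f -> (forall y, 0 <= f y)%E ->
  heatf s (heatf t f) x = heatf (s + t) f x.
Proof.
move=> s0 t0 mf f0; rewrite /heatf.
transitivity (\int[m]_y \int[m]_z ((heat s x y)%:E * ((heat t y z)%:E * f z)))%E.
  apply: eq_integral => y _; rewrite ge0_integralZl_EFin ?heat_ge0//.
  - by move=> z _; rewrite mule_ge0// lee_fin heat_ge0.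
  - by apply: emeasurable_funM => //; exact: measurable_heatE.
rewrite tonelli; first last.
- by move=> y z; rewrite !mule_ge0// lee_fin heat_ge0.
- apply: emeasurable_funM; first by apply: measurable_heatE => //; exact: measurable_fst.
  apply: emeasurable_funM; last exact: measurable_on_snd mf.
  by apply: measurable_heatE.
- exact: sigma_finite_ref.
- exact: sigma_finite_ref.
apply: eq_integral => z _; under eq_integral do rewrite muleA.
rewrite ge0_integralZr//; first by rewrite heat_semigroup.
- by apply: emeasurable_funM; exact: measurable_heatE.
- by move=> y _; rewrite mule_ge0// lee_fin heat_ge0.
Qed.

Lemma heatf_heatm s t mu x : 0 < s -> 0 < t -> sigma_finite setT mu ->
  heatf s (heatm t mu) x = heatm (s + t) mu x.
Proof.
move=> s0 t0 smu; rewrite /heatf /heatm.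
transitivity (\int[m]_y \int[mu]_z ((heat s x y)%:E * (heat t y z)%:E))%E.
  apply: eq_integral => y _; rewrite ge0_integralZl_EFin ?heat_ge0//.
  - by move=> z _; rewrite lee_fin heat_ge0.
  - exact: measurable_heatE.
rewrite tonelli//; first last.
- by move=> y z; rewrite !mule_ge0// lee_fin heat_ge0.
- apply: emeasurable_funM; first by apply: measurable_heatE => //; exact: measurable_fst.
  by apply: measurable_heatE.
- exact: sigma_finite_ref.
by apply: eq_integral => z _; rewrite heat_semigroup.
Qed.

Lemma integral_heatfC s f g : measurable_fun setT f -> measurable_fun setT g ->
  (forall y, 0 <= f y)%E -> (forall y, 0 <= g y)%E ->
  (\int[m]_x (f x * heatf s g x) = \int[m]_x (heatf s f x * g x))%E.
Proof.
move=> mf mg f0 g0; rewrite /heatf.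
transitivity (\int[m]_x \int[m]_y (f x * ((heat s x y)%:E * g y)))%E.
  apply: eq_integral => x _; rewrite ge0_integralZl//.
  - by apply: emeasurable_funM => //; exact: measurable_heatE.
  - by move=> y _; rewrite mule_ge0// lee_fin heat_ge0.
rewrite tonelli; first last.
- by move=> y z; rewrite !mule_ge0// lee_fin heat_ge0.
- apply: emeasurable_funM; first exact: measurable_on_fst mf.
  apply: emeasurable_funM; last exact: measurable_on_snd mg.
  by apply: measurable_heatE.
- exact: sigma_finite_ref.
- exact: sigma_finite_ref.
apply: eq_integral => y _; rewrite -ge0_integralZr//.
- by apply: eq_integral => x _; rewrite muleCA muleA heatC.
- by apply: emeasurable_funM => //; exact: measurable_heatE.
- by move=> x _; rewrite mule_ge0// lee_fin heat_ge0.
Qed.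

Lemma integral_heatf_heatm s f mu : measurable_fun setT f -> (forall y, 0 <= f y)%E ->
  sigma_finite setT mu ->
  (\int[m]_x (f x * heatm s mu x) = \int[mu]_x heatf s f x)%E.
Proof.
move=> mf f0 smu; rewrite /heatf /heatm.
transitivity (\int[m]_x \int[mu]_y (f x * (heat s x y)%:E))%E.
  apply: eq_integral => x _; rewrite ge0_integralZl//.
  - exact: measurable_heatE.
  - by move=> y _; rewrite lee_fin heat_ge0.
rewrite tonelli; first last.
- by move=> y z; rewrite mule_ge0// lee_fin heat_ge0.
- apply: emeasurable_funM; first exact: measurable_on_fst mf.
  by apply: measurable_heatE.
- exact: smu.
- exact: sigma_finite_ref.
by apply: eq_integral => y _; apply: eq_integral => x _; rewrite muleC heatC.
Qed.

Lemma integral_heatm_heatm s t mu nu : 0 < s -> 0 < t ->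
  sigma_finite setT mu -> sigma_finite setT nu ->
  (\int[m]_x (heatm s mu x * heatm t nu x) = \int[nu]_x heatm (s + t) mu x)%E.
Proof.
move=> s0 t0 smu snu; rewrite integral_heatf_heatm//.
- by apply: eq_integral => x _; rewrite heatf_heatm// addrC.
- exact: measurable_heatm.
- by move=> y; exact: heatm_ge0.
Qed.

(* 2ab <= a^2 + b^2 and symmetry: the heat operators contract L^2. *)
Lemma integral_heatf_sqr_le s f : 0 < s -> measurable_fun setT f ->
  (forall y, 0 <= f y)%E ->
  (\int[m]_x (f x * heatf s f x) <= \int[m]_x (f x * f x))%E.
Proof.
move=> s0 mf f0.
have mff : measurable_fun setT (fun x : Rn R n => f x * f x)%E by exact: emeasurable_funM.
have ff0 (x : Rn R n) : (0 <= f x * f x)%E by rewrite mule_ge0.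
have AMGM (u v : \bar R) : (0 <= u -> 0 <= v -> 2%:E * (u * v) <= u * u + v * v)%E.
  move: u v => [u| |] [v| |]//= u0 v0.
  - rewrite -!EFinM -EFinD lee_fin -subr_ge0.
    by rewrite (_ : _ - _ = (u - v) ^+ 2) ?sqr_ge0//; ring.
  - by rewrite mulyy addey ?leey// gt_eqF// (lt_le_trans _ (mule_ge0 u0 u0))// ltNy0.
  - by rewrite mulyy addye ?leey// gt_eqF// (lt_le_trans _ (mule_ge0 v0 v0))// ltNy0.
  - by rewrite mulyy addye ?leey.
have hE (x : Rn R n) : heatf s (fun y => f x * f x + f y * f y)%E x =
    (f x * f x + heatf s (fun y => f y * f y)%E x)%E.
  transitivity (heatf s (cst (f x * f x)%E) x + heatf s (fun y => f y * f y)%E x)%E.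
    by rewrite -heatfD// => y; exact: ff0.
  by rewrite heatf_cst.
rewrite -(@lee_pmul2l _ 2%:E)//.
have -> : (2%:E * \int[m]_x (f x * f x) =
   \int[m]_x (heatf s (fun y => f x * f x + f y * f y) x))%E.
  transitivity (\int[m]_x (f x * f x + heatf s (fun y => f y * f y) x))%E; last first.
    by apply: eq_integral => x _; rewrite hE.
  rewrite ge0_integralD//; last 2 first.
  - by move=> x _; exact: heatf_ge0.
  - exact: measurable_heatf.
  have -> : (\int[m]_x heatf s (fun y => f y * f y) x =
     \int[m]_x (cst 1 x * heatf s (fun y => f y * f y) x))%E.
    by apply: eq_integral => x _; rewrite mul1e.
  rewrite integral_heatfC//.
  have -> : (\int[m]_x (heatf s (cst 1) x * (f x * f x)) = \int[m]_x (f x * f x))%E.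
    by apply: eq_integral => x _; rewrite heatf_cst// mul1e.
  by rewrite (_ : 2%:E = 1 + 1)%E// ge0_muleDl// mul1e.
rewrite -ge0_integralZl//; last 2 first.
- by apply: emeasurable_funM => //; exact: measurable_heatf.
- by move=> x _; rewrite mule_ge0// heatf_ge0.
have mM : measurable_fun setT (fun x : Rn R n => heatf s (fun y => f x * f x + f y * f y)%E x).
  rewrite (_ : (fun x => _) = fun x : Rn R n => (f x * f x + heatf s (fun y => f y * f y) x)%E).
    by apply: emeasurable_funD => //; exact: measurable_heatf.
  by apply/funext => x; rewrite hE.
apply: ge0_le_integral => //.
- by move=> x _; rewrite !mule_ge0// heatf_ge0.
- by apply: measurable_funeM; apply: emeasurable_funM => //; exact: measurable_heatf.
move=> x _; rewrite muleA -ge0_integralZl//; last 3 first.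
- by apply: emeasurable_funM => //; exact: measurable_heatE.
- by move=> y _; rewrite mule_ge0// lee_fin heat_ge0.
- by rewrite mule_ge0.
apply: ge0_le_integral => //.
- by move=> y _; rewrite !mule_ge0// lee_fin heat_ge0.
- by apply: measurable_funeM; apply: emeasurable_funM => //; exact: measurable_heatE.
- apply: emeasurable_funM; first exact: measurable_heatE.
  by apply: emeasurable_funD => //; exact: measurable_cst.
- by move=> y _; rewrite muleCA lee_wpmul2l ?lee_fin ?heat_ge0// -muleA AMGM.
Qed.

End heat_operators.

Record riesz_setting (R : realType) (n : nat) (m : bmeasure R n) (a c : R)
    (w S : R -> R) : Prop := RieszSetting {
  rs_ref : heat_reference m;
  rs_a_gt0 : 0 < a;
  rs_a_le1 : a <= 1;
  rs_n : (2 < n)%N;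
  rs_c_gt0 : 0 < c;
  rs_riesz : forall x z : 'rV[R]_n,
    (riesz (2 * a) x z = \int[lebesgue_measure]_s (c * tpow a s * heat s x z)%:E)%E;
  rs_weights : time_weights a w S }.

Lemma radon_sigma_finite (R : realType) n (mu : bmeasure R n) :
  radon mu -> sigma_finite setT mu.
Proof.
move=> rmu; exists (fun k => [set x : 'rV[R]_n | `|x| <= k%:R]).
  apply/esym; rewrite -subTset => x _; exists (Num.truncn `|x|).+1 => //=.
  by rewrite ltW// truncnS_gt.
move=> k.
have cK : compact [set x : 'rV[R]_n | `|x| <= k%:R].
  apply: bounded_closed_compact.
    exists k%:R; split; first exact: num_real.
    by move=> M kM x /= xk; rewrite (le_trans xk)// ltW.
  rewrite (_ : [set _ | _] = (fun x : 'rV[R]_n => `|x|) @^-1` [set y | y <= k%:R])//.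
  by apply: closed_comp => [x _|]; [exact: norm_continuous|exact: closed_le].
by split; [exact: measurable_compact|exact: rmu].
Qed.

Section potentials.
Context (R : realType) (n : nat) (m : bmeasure R n) (a c : R) (w S : R -> R).
Hypothesis H : riesz_setting m a c w S.
Notation leb := (@lebesgue_measure R).
Notation kap := (@riesz R n (2 * a)).
Notation pot := (@potential R n (2 * a)).
Implicit Types (mu nu : bmeasure R n) (f g : Rn R n -> \bar R) (x z : 'rV[R]_n).

Let hm := rs_ref H.
Let tw := rs_weights H.
Let c0 : 0 <= c. Proof. exact: ltW (rs_c_gt0 H). Qed.

Lemma sigma_finite_leb : sigma_finite setT leb.
Proof. exact: sigma_finiteT. Qed.

Let ctw s : 0 <= c * tpow a s. Proof. by rewrite mulr_ge0// tpow_ge0. Qed.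

Let mctw : measurable_fun setT (fun s => c * tpow a s).
Proof. by apply: measurable_funM => //; exact: measurable_tpow. Qed.

Lemma riesz_ge0 x z : (0 <= kap x z)%E.
Proof.
rewrite (rs_riesz H); apply: integral_ge0 => s _.
by rewrite lee_fin mulr_ge0 ?heat_ge0.
Qed.

Lemma rieszC x z : kap x z = kap z x.
Proof. by rewrite !(rs_riesz H); apply: eq_integral => s _; rewrite heatC. Qed.

Lemma measurable_riesz d (T : measurableType d) (x z : T -> Rn R n) :
  measurable_fun setT x -> measurable_fun setT z ->
  measurable_fun setT (fun p => kap (x p) (z p)).
Proof.
move=> mx mz.
have -> : (fun p => kap (x p) (z p)) =
    (fun p => \int[leb]_s (c * tpow a s * heat s (x p) (z p))%:E)%E.
  by apply/funext => p; rewrite (rs_riesz H).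
apply: (@measurable_tonelli _ _ T _ R leb
  (fun p s => (c * tpow a s * heat s (x p) (z p))%:E)).
- exact: sigma_finite_leb.
- apply/measurable_EFinP; apply: measurable_funM.
    exact: measurable_on_snd mctw.
  apply: measurable_heat.
  + exact: measurable_snd.
  + exact: measurable_on_fst mx.
  + exact: measurable_on_fst mz.
- by move=> p s; rewrite lee_fin mulr_ge0 ?heat_ge0.
Qed.

Lemma pot_ge0 mu x : (0 <= pot mu x)%E.
Proof. by apply: integral_ge0 => z _; exact: riesz_ge0. Qed.

Lemma measurable_pot mu : sigma_finite setT mu -> measurable_fun setT (pot mu : Rn R n -> \bar R).
Proof.
move=> smu; apply: (@measurable_tonelli _ _ (Rn R n) (Rn R n) R mu kap) => //.
- by apply: measurable_riesz; [exact: measurable_fst|exact: measurable_snd].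
- by move=> x z; exact: riesz_ge0.
Qed.

Lemma mutualC mu nu : sigma_finite setT mu -> sigma_finite setT nu ->
  mutual (2 * a) mu nu = mutual (2 * a) nu mu.
Proof.
move=> smu snu; rewrite /mutual /potential.
rewrite (@tonelli _ _ (Rn R n) (Rn R n) R mu nu kap smu snu).
- by apply: eq_integral => y _; apply: eq_integral => x _; rewrite rieszC.
- by apply: measurable_riesz; [exact: measurable_fst|exact: measurable_snd].
- by move=> x y; exact: riesz_ge0.
Qed.

Lemma pot_time mu x : sigma_finite setT mu ->
  pot mu x = (\int[leb]_s ((c * tpow a s)%:E * heatm s mu x))%E.
Proof.
move=> smu; rewrite /potential.
under eq_integral do rewrite (rs_riesz H).
rewrite tonelli//; first last.
- by move=> z s; rewrite lee_fin mulr_ge0 ?heat_ge0.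
- apply/measurable_EFinP; apply: measurable_funM; first exact: measurable_on_snd mctw.
  by apply: measurable_heat; [exact: measurable_snd|exact: measurable_cst|exact: measurable_fst].
- exact: sigma_finite_leb.
apply: eq_integral => s _; rewrite /heatm -ge0_integralZl_EFin//.
- by move=> z _; rewrite lee_fin heat_ge0.
- by apply: measurable_heatE.
Qed.

Lemma heatf_pot_time r mu x : 0 < r -> sigma_finite setT mu ->
  heatf m r (pot mu) x = (\int[leb]_s ((c * tpow a s)%:E * heatm (r + s) mu x))%E.
Proof.
move=> r0 smu; rewrite /heatf.
transitivity (\int[m]_y \int[leb]_s
    ((heat r x y)%:E * ((c * tpow a s)%:E * heatm s mu y)))%E.
  apply: eq_integral => y _; rewrite pot_time// ge0_integralZl_EFin ?heat_ge0//.
  - by move=> s _; rewrite mule_ge0 ?heatm_ge0// lee_fin.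
  - apply: emeasurable_funM; first exact/measurable_EFinP.
    by apply: measurable_heatm.
rewrite tonelli; first last.
- by move=> y s; rewrite !mule_ge0 ?heatm_ge0// lee_fin ?heat_ge0.
- apply: emeasurable_funM.
    by apply: measurable_heatE.
  apply: emeasurable_funM.
    by apply/measurable_EFinP; exact: measurable_on_snd mctw.
  by apply: measurable_heatm.
- exact: sigma_finite_leb.
- exact: sigma_finite_ref hm.
apply: eq_integral => s _.
have [s0|s0] := leP s 0.
  rewrite /tpow ltNge s0/= mulr0 mul0e.
  by rewrite integral0_eq// => y _; rewrite mul0e mule0.
rewrite -(heatf_heatm hm x r0 s0 smu) /heatf.
have mhm : measurable_fun setT (fun y : Rn R n => (heat r x y)%:E * heatm s mu y)%E.
  apply: emeasurable_funM; first exact: measurable_heatE.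
  by apply: measurable_heatm.
rewrite -(ge0_integralTZl m mhm _ (ctw s)).
  by apply: eq_integral => y _; rewrite muleCA.
by move=> y; rewrite mule_ge0 ?heatm_ge0// lee_fin heat_ge0.
Qed.

(** Substitutes s = t (u - r0); the homogeneity of s^(a-1) produces the factor t^a. *)
Lemma time_scaling t r0 mu x : 0 < t -> sigma_finite setT mu ->
  (\int[leb]_s ((c * tpow a s)%:E * heatm (t * r0 + s)%R mu x) =
   (c * t `^ a)%:E * \int[leb]_s ((tpow a (s - r0))%:E * heatm (t * s)%R mu x))%E.
Proof.
move=> t0 smu.
have mtp : measurable_fun setT (fun s : R => (tpow a (s - r0))%:E).
  by apply/measurable_EFinP; apply: (measurableT_comp (measurable_tpow a)); exact: measurable_funB.
have mh : measurable_fun setT (fun s : R => heatm (t * s)%R mu x).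
  by apply: measurable_heatm => //; exact: measurable_funM.
pose h1 s := ((c * tpow a s)%:E * heatm (t * r0 + s)%R mu x)%E.
pose h2 s := ((tpow a (s - r0))%:E * heatm (t * s)%R mu x)%E.
have mh1 : measurable_fun setT h1.
  apply: emeasurable_funM; first exact/measurable_EFinP.
  by apply: measurable_heatm => //; exact: measurable_funD.
have h10 s : (0 <= h1 s)%E by rewrite mule_ge0 ?heatm_ge0// lee_fin.
have mh2 : measurable_fun setT h2 by exact: emeasurable_funM.
have h20 s : (0 <= h2 s)%E by rewrite mule_ge0 ?heatm_ge0// lee_fin tpow_ge0.
transitivity (\int[leb]_s h1 s)%E; first by [].
transitivity ((c * t `^ a)%:E * \int[leb]_s h2 s)%E; last by [].
rewrite -(ge0_integral_scaling t0 mh1 h10) -(ge0_integral_translation r0 mh2 h20).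
have ms1 : measurable_fun setT (fun s => h1 (t * s)).
  by apply: (measurableT_comp mh1); exact: measurable_funM.
have ms2 : measurable_fun setT (fun s : R => h2 (s + r0)).
  by apply: (measurableT_comp mh2); exact: measurable_funD.
rewrite -(ge0_integralTZl leb ms1 (fun s => h10 _) (ltW t0)).
have ct0 : 0 <= c * t `^ a by rewrite mulr_ge0 ?powR_ge0.
rewrite -(ge0_integralTZl leb ms2 (fun s => h20 _) ct0).
rewrite /h1 /h2.
apply: eq_integral => s _; rewrite addrK -mulrDr [r0 + s]addrC !muleA -!EFinM.
congr (_%:E * _)%E; rewrite /tpow pmulr_rgt0//; case: ltP => s0; last by rewrite !mulr0.
rewrite powRM ?(ltW t0) ?(ltW s0)//.
have -> : t `^ a = t * t `^ (a - 1) by rewrite mulr_powRB1 ?(ltW t0) ?(rs_a_gt0 H).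
ring.
Qed.

(** [smear t] is the operator P_t; [smear_rest] below is what a potential loses under it. *)
Definition smear t f x : \bar R := (\int[leb]_r ((w r)%:E * heatf m (t * r)%R f x))%E.

Definition smear_rest t mu x : \bar R :=
  ((c * t `^ a)%:E * \int[leb]_s ((S s)%:E * heatm (t * s)%R mu x))%E.

Definition wconv s : \bar R := (\int[leb]_r (w r * tpow a (s - r))%:E)%E.

Lemma wconv_ge0 s : (0 <= wconv s)%E.
Proof. by apply: integral_ge0 => r _; rewrite lee_fin mulr_ge0 ?tpow_ge0// (tw_w_ge0 tw). Qed.

Lemma wconvD s : (wconv s + (S s)%:E = (tpow a s)%:E)%E. Proof. exact: tw_conv tw s. Qed.

Let mtp2 : measurable_fun setT (fun p : measurableTypeR R * measurableTypeR R =>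
  (w p.1 * tpow a (p.2 - p.1))%:E).
Proof.
apply/measurable_EFinP; apply: measurable_funM.
  exact: measurable_on_fst (tw_mw tw).
apply: (measurableT_comp (measurable_tpow a)).
by apply: measurable_funB; [exact: measurable_snd|exact: measurable_fst].
Qed.

Lemma measurable_wconv : measurable_fun setT wconv.
Proof.
apply: (@measurable_tonelli _ _ (measurableTypeR R) (measurableTypeR R) R leb
  (fun s r => (w r * tpow a (s - r))%:E)).
- exact: sigma_finite_leb.
- exact: (measurableT_comp mtp2 (@measurable_swap _ _ _ _)).
- by move=> s r; rewrite lee_fin mulr_ge0 ?tpow_ge0// (tw_w_ge0 tw).
Qed.

Lemma measurable_heatm_scale t mu x : sigma_finite setT mu ->
  measurable_fun setT (fun s : measurableTypeR R => heatm (t * s)%R mu x).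
Proof. by move=> smu; apply: measurable_heatm => //; exact: measurable_funM. Qed.

Lemma smear_pot t mu x : 0 < t -> sigma_finite setT mu ->
  smear t (pot mu) x = ((c * t `^ a)%:E * \int[leb]_s (wconv s * heatm (t * s)%R mu x))%E.
Proof.
move=> t0 smu; rewrite /smear.
have mh := @measurable_heatm_scale t mu x smu.
transitivity (\int[leb]_r ((c * t `^ a)%:E *
   \int[leb]_s ((w r * tpow a (s - r))%:E * heatm (t * s)%R mu x)))%E.
  apply: eq_integral => r _; have [r1|r1] := leP r 1.
    rewrite (tw_w_le1 tw r1) mul0e integral0_eq ?mule0// => s _.
    by rewrite mul0r mul0e.
  have r0 : 0 < r by rewrite (lt_trans _ r1).
  rewrite (heatf_pot_time x (mulr_gt0 t0 r0) smu) (time_scaling r x t0 smu) [LHS]muleCA.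
  congr (_ * _)%E.
  rewrite -ge0_integralZl_EFin ?(tw_w_ge0 tw)//.
  - by apply: eq_integral => s _; rewrite muleA -EFinM.
  - by move=> s _; rewrite mule_ge0 ?heatm_ge0// lee_fin tpow_ge0.
  - apply: emeasurable_funM => //; apply/measurable_EFinP.
    by apply: (measurableT_comp (measurable_tpow a)); exact: measurable_funB.
have mF : measurable_fun setT (fun p : measurableTypeR R * measurableTypeR R =>
    (w p.1 * tpow a (p.2 - p.1))%:E * heatm (t * p.2)%R mu x)%E.
  by apply: emeasurable_funM => //; exact: measurable_on_snd mh.
have F0 r s : (0 <= (w r * tpow a (s - r))%:E * heatm (t * s)%R mu x)%E.
  by rewrite mule_ge0 ?heatm_ge0// lee_fin mulr_ge0 ?tpow_ge0// (tw_w_ge0 tw).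
rewrite ge0_integralZl_EFin ?mulr_ge0 ?powR_ge0//; last 2 first.
- by move=> r _; apply: integral_ge0.
- apply: (@measurable_tonelli _ _ (measurableTypeR R) (measurableTypeR R) R leb
    (fun r s => (w r * tpow a (s - r))%:E * heatm (t * s)%R mu x)%E) => //.
  exact: sigma_finite_leb.
congr (_ * _)%E; rewrite tonelli//; try exact: sigma_finite_leb.
apply: eq_integral => s _; rewrite ge0_integralZr ?heatm_ge0//.
- exact: (measurable_fun_pair1 s mtp2).
- by move=> r _; rewrite lee_fin mulr_ge0 ?tpow_ge0// (tw_w_ge0 tw).
Qed.

(** In the time representation of the potential, P_t replaces the density s^(a-1) at scale t by its
    convolution with w; [tw_conv] identifies the difference as S. *)
Lemma pot_split t mu x : 0 < t -> sigma_finite setT mu ->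
  (pot mu x = smear t (pot mu) x + smear_rest t mu x)%E.
Proof.
move=> t0 smu; rewrite smear_pot// /smear_rest -ge0_muleDr; last 2 first.
- by apply: integral_ge0 => s _; rewrite mule_ge0 ?heatm_ge0 ?wconv_ge0.
- by apply: integral_ge0 => s _; rewrite mule_ge0 ?heatm_ge0// lee_fin (tw_S_ge0 tw).
rewrite -ge0_integralD//; last 4 first.
- by move=> s _; rewrite mule_ge0 ?heatm_ge0 ?wconv_ge0.
- by apply: emeasurable_funM; [exact: measurable_wconv|exact: measurable_heatm_scale].
- by move=> s _; rewrite mule_ge0 ?heatm_ge0// lee_fin (tw_S_ge0 tw).
- apply: emeasurable_funM; last exact: measurable_heatm_scale.
  by apply/measurable_EFinP; exact: tw_mS tw.
rewrite pot_time//.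
transitivity (\int[leb]_s ((c * tpow a s)%:E * heatm (t * 0 + s)%R mu x))%E.
  by apply: eq_integral => s _; rewrite mulr0 add0r.
rewrite time_scaling//; congr (_ * _)%E; apply: eq_integral => s _.
by rewrite subr0 -ge0_muleDl ?wconv_ge0 ?lee_fin ?(tw_S_ge0 tw)// wconvD.
Qed.

End potentials.

(** * Excessive functions *)

Section fatou_bounds.
Context (R : realType).

Lemma limn_einf_ge (u : nat -> \bar R) (l : \bar R) :
  (\forall k \near \oo, (l <= u k)%E) -> (l <= limn_einf u)%E.
Proof.
move=> [N _ lu]; rewrite limn_einf_lim; apply: lime_ge; first exact: is_cvg_einfs.
exists N => // k /= Nk; apply/ereal_infP => _ [j /= kj <-].
by apply: lu; rewrite /= (leq_trans Nk).
Qed.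

Lemma limn_einf_le (u : nat -> \bar R) (l : \bar R) :
  (forall k, (u k <= l)%E) -> (limn_einf u <= l)%E.
Proof.
move=> ul; rewrite limn_einf_lim; apply: lime_le; first exact: is_cvg_einfs.
apply: nearW => k; apply: (le_trans _ (ul k)).
by apply: ereal_inf_lbound; exists k => /=.
Qed.

Lemma le_limn_einf (u v : nat -> \bar R) :
  (forall k, (u k <= v k)%E) -> (limn_einf u <= limn_einf v)%E.
Proof.
move=> uv; rewrite !limn_einf_lim; apply: lee_lim; [exact: is_cvg_einfs|exact: is_cvg_einfs|].
apply: nearW => k; apply/ereal_infP => _ [j /= kj <-].
by apply: (le_trans _ (uv j)); apply: ereal_inf_lbound; exists j.
Qed.

Lemma limn_einf_pMl (u : nat -> \bar R) (c : R) : 0 <= c ->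
  (c%:E * limn_einf u <= limn_einf (fun k => c%:E * u k))%E.
Proof.
move=> c0; rewrite !limn_einf_lim.
have h : (c%:E * einfs u k)%E @[k --> \oo] --> (c%:E * limn (einfs u))%E.
  by apply: cvgeMl => //; exact: is_cvg_einfs.
rewrite -(cvg_lim _ h)//; apply: lee_lim; [by apply: cvgP h|exact: is_cvg_einfs|].
apply: nearW => k; apply/ereal_infP => _ [j /= kj <-].
rewrite lee_wpmul2l//; apply: ereal_inf_lbound; exists j => //.
Qed.

Lemma lee_real_below (x y : \bar R) : (0 <= y)%E ->
  (forall b : R, 0 <= b -> (b%:E < x)%E -> (b%:E <= y)%E) -> (x <= y)%E.
Proof.
move=> y0 xy; rewrite leNgt; apply/negP => yx.
case: y y0 xy yx => [r| |]//=; last by move=> _ _; rewrite ltNge leey.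
rewrite lee_fin => r0 xy; case: x xy => [q| |]// xy.
  rewrite lte_fin => rq; have := xy ((r + q) / 2); rewrite !lte_fin !lee_fin; lra.
by move=> _; have := xy (r + 1); rewrite ltry lee_fin; lra.
Qed.

Lemma measurable_limn_einf d (T : measurableType d) (f : nat -> T -> \bar R) :
  (forall k, measurable_fun setT (f k)) ->
  measurable_fun setT (fun x => limn_einf (f^~ x)).
Proof.
move=> mf; have -> : (fun x => limn_einf (f^~ x)) =
    (fun x => - limn_esup (fun k => - f k x))%E.
  apply/funext => x; rewrite -[LHS]oppeK -limn_esupN.
  by congr (- limn_esup _)%E.
apply: measurableT_comp => //; apply: measurable_fun_limn_esup => k.
by apply: measurableT_comp => //; exact: mf.
Qed.

Lemma le_integral_limn_einf d (T : measurableType d) (mu : {measure set T -> \bar R})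
    (f : T -> \bar R) (g : nat -> T -> \bar R) :
  measurable_fun setT f -> (forall k, measurable_fun setT (g k)) ->
  (forall x, 0 <= f x)%E -> (forall k x, 0 <= g k x)%E ->
  (forall x, f x <= limn_einf (g^~ x))%E ->
  (\int[mu]_x f x <= limn_einf (fun k => \int[mu]_x g k x))%E.
Proof.
move=> mf mg f0 g0 fg; apply: (@le_trans _ _ (\int[mu]_x limn_einf (g^~ x))%E).
  by apply: ge0_le_integral => //; exact: measurable_limn_einf.
by apply: fatou => // k; exact: mg.
Qed.

End fatou_bounds.

Section excessive.
Context (R : realType) (n : nat) (m : bmeasure R n) (a c : R) (w S : R -> R).
Hypothesis H : riesz_setting m a c w S.
Notation leb := (@lebesgue_measure R).
Notation kap := (@riesz R n (2 * a)).
Notation pot := (@potential R n (2 * a)).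
Notation smear := (smear m w).
Implicit Types (mu nu : bmeasure R n) (f g : Rn R n -> \bar R) (x y z : 'rV[R]_n).

Let hm := rs_ref H.
Let tw := rs_weights H.

(** Half of the Gaussian exponent is spent through exp(-y) <= 1/y with y = sqdist / (2s); the other
    half is the kernel at time 2s, whose normalization costs 2^(n/2). *)
Lemma heat_tail_le s x y (r : R) : 0 < s -> 0 < r -> r <= sqdist x y ->
  heat s x y <= (2 `^ (n%:R / 2) * (2 / r) * s) * heat (2 * s) x y.
Proof.
move=> s0 r0 rD; rewrite !heatE ?mulr_gt0//.
have D0 : 0 < sqdist x y by rewrite (lt_le_trans r0).
have -> : pi * (2 * s) = 2 * (pi * s) by ring.
rewrite [in leRHS]powRM ?mulr_ge0 ?pi_ge0 ?(ltW s0)//.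
have p2 : (2:R) `^ (n%:R / 2) * 2 `^ (- (n%:R / 2)) = 1.
  by rewrite -powRD ?subrr ?powRr0//; apply/implyP.
rewrite (_ : _ * _ * s * _ = (2 `^ (n%:R / 2) * 2 `^ (- (n%:R / 2))) * (pi * s) `^ (- (n%:R / 2)) *
   (2 / r * s * expR (- (sqdist x y / (2 * s))))); last by ring.
rewrite p2 mul1r ler_wpM2l ?powR_ge0//.
have -> : - (sqdist x y / s) = - (sqdist x y / (2 * s)) - (sqdist x y / (2 * s)).
  by field; rewrite gt_eqF.
rewrite expRD ler_wpM2r ?expR_ge0//.
have y0 : 0 < sqdist x y / (2 * s) by rewrite divr_gt0 ?mulr_gt0.
rewrite expRN; apply: (@le_trans _ _ (sqdist x y / (2 * s))^-1).
  rewrite lef_pV2 ?posrE ?expR_gt0// (le_trans _ (expR_ge1Dx _))//.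
  by rewrite lerDr.
rewrite invf_div mulrAC ler_pM2r// ler_pM2l//.
by rewrite lef_pV2 ?posrE.
Qed.

Lemma sqdist_ball x y (r : R) : 0 < r -> ~ ball x r y -> r ^+ 2 <= sqdist x y.
Proof.
move=> r0 /not_andP[//|/existsNP[i /existsNP[j]]]; rewrite !ord1 => nb.
rewrite /sqdist (bigD1 j)//= -[leLHS]addr0 lerD//; last first.
  by apply: sumr_ge0 => k _; exact: sqr_ge0.
rewrite -[leRHS]real_normK ?num_real// lerXn2r ?nnegrE ?(ltW r0)//.
by rewrite leNgt; apply/negP.
Qed.

Lemma heat_outside_ball x (r : R) : 0 < r -> exists2 K : R, 0 < K & forall s, 0 < s ->
  (\int[m]_(y in ~` ball x r) (heat s x y)%:E <= (K * s)%:E)%E.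
Proof.
move=> r0; set K := (2 `^ (n%:R / 2) * (2 / r ^+ 2)).
have K0 : 0 < K by rewrite mulr_gt0 ?powR_gt0 ?divr_gt0 ?exprn_gt0.
have mB : measurable (~` ball x r : set (Rn R n)).
  by apply: measurableC; apply: measurable_open; exact: ball_open.
exists K => // s s0.
have Ks0 : 0 <= K * s by rewrite mulr_ge0 ?ltW.
apply: (@le_trans _ _ (\int[m]_(y in ~` ball x r) ((K * s)%:E * (heat (2 * s) x y)%:E))%E).
  apply: ge0_le_integral => //.
  - by move=> y _; rewrite lee_fin heat_ge0.
  - by apply: measurable_funTS; apply: measurable_heatE.
  - by apply: measurable_funTS; apply: measurable_funeM; apply: measurable_heatE.
  - move=> y xy; rewrite -EFinM lee_fin.
    by apply: heat_tail_le; rewrite ?exprn_gt0//; exact: sqdist_ball.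
apply: (@le_trans _ _ (\int[m]_y ((K * s)%:E * (heat (2 * s) x y)%:E))%E).
  apply: ge0_subset_integral => //.
  - by apply: measurable_funeM; apply: measurable_heatE.
  - by move=> y _; rewrite -EFinM lee_fin mulr_ge0 ?heat_ge0.
rewrite ge0_integralTZl//.
- by rewrite (heat_mass hm)// ?mule1// mulr_gt0.
- exact: measurable_heatE.
- by move=> y; rewrite lee_fin heat_ge0.
Qed.

(** Near x the function exceeds b, and the heat mass leaving a ball around x in time t is at most a
    multiple of t. *)
Lemma heatf_lsc (t : nat -> R) f x : (forall k, 0 < t k) -> t @ \oo --> 0 ->
  measurable_fun setT f -> (forall y, 0 <= f y)%E ->
  lower_semicontinuous (f : 'rV[R]_n -> \bar R) ->
  (f x <= limn_einf (fun k => heatf m (t k) f x))%E.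
Proof.
move=> t0 tcvg mf f0 lf; apply: lee_real_below.
  by apply: limn_einf_ge; apply: nearW => k; exact: heatf_ge0.
move=> b b0 /lf[V xV fV]; have /nbhs_ballP[r /= r0 rV] := xV.
have [K K0 HK] := heat_outside_ball x r0.
have mB : measurable (ball x r : set (Rn R n)) by apply: measurable_open; exact: ball_open.
apply/lee_subgt0Pr => e e0; apply: limn_einf_ge.
have e1 : 0 < e / (b + 1) / K by rewrite !divr_gt0// ltr_wpDl.
move/cvgrPdist_lt : tcvg => /(_ _ e1); apply: filterS => k.
rewrite sub0r normrN gtr0_norm// => tk.
have mh : measurable_fun setT (fun y : Rn R n => (heat (t k) x y)%:E).
  exact: measurable_heatE.
have h0 y : (0 <= (heat (t k) x y)%:E)%E by rewrite lee_fin heat_ge0.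
have massB : ((1 - K * t k)%:E <= \int[m]_(y in ball x r) (heat (t k) x y)%:E)%E.
  rewrite EFinB leeBlDr// -(heat_mass hm x (t0 k)).
  rewrite -(setUv (ball x r)) ge0_integral_setU//; last 3 first.
  - by apply: measurableC.
  - by rewrite setUv.
  - by apply/disj_setPCl.
  by rewrite leeD2l// HK.
apply: (@le_trans _ _ (b%:E * (1 - K * t k)%:E)%E).
  rewrite -EFinM -EFinB lee_fin mulrBr mulr1 lerD2l lerN2.
  move: tk; rewrite ltr_pdivlMr// ltr_pdivlMr ?ltr_wpDl// => tk.
  by have := mulr_ge0 (ltW (t0 k)) (ltW K0); nra.
apply: (@le_trans _ _ (b%:E * \int[m]_(y in ball x r) (heat (t k) x y)%:E)%E).
  by rewrite lee_wpmul2l.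
rewrite -ge0_integralZl_EFin//; last by exact: measurable_funTS.
apply: (@le_trans _ _ (\int[m]_(y in ball x r) ((heat (t k) x y)%:E * f y))%E).
  apply: ge0_le_integral => //.
  - by move=> y _; rewrite mule_ge0.
  - by apply: measurable_funTS; exact: measurable_funeM.
  - by apply: measurable_funTS; exact: emeasurable_funM.
  - by move=> y /rV /fV /ltW fy; rewrite muleC lee_wpmul2l.
apply: ge0_subset_integral => //; first exact: emeasurable_funM.
by move=> y _; rewrite mule_ge0.
Qed.

Lemma smear_ge0 t f x : (forall y, 0 <= f y)%E -> (0 <= smear t f x)%E.
Proof.
move=> f0; apply: integral_ge0 => r _.
by rewrite mule_ge0 ?heatf_ge0// lee_fin (tw_w_ge0 tw).
Qed.

Lemma measurable_smear_integrand t f x : measurable_fun setT f -> (forall y, 0 <= f y)%E ->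
  measurable_fun setT (fun r : measurableTypeR R => (w r)%:E * heatf m (t * r)%R f x)%E.
Proof.
move=> mf f0; apply: emeasurable_funM.
  by apply/measurable_EFinP; exact: tw_mw tw.
by apply: (measurable_heatf hm) => //; exact: measurable_funM.
Qed.

Lemma measurable_smear t f : measurable_fun setT f -> (forall y, 0 <= f y)%E ->
  measurable_fun setT (smear t f : Rn R n -> \bar R).
Proof.
move=> mf f0; apply: (@measurable_tonelli _ _ (Rn R n) (measurableTypeR R) R leb
  (fun x r => (w r)%:E * heatf m (t * r)%R f x)%E).
- exact: sigma_finite_leb.
- apply: emeasurable_funM.
    by apply/measurable_EFinP; exact: measurable_on_snd (tw_mw tw).
  apply: (measurable_heatf hm) => //.
  by apply: measurable_funM => //; exact: measurable_snd.
- by move=> x r; rewrite mule_ge0 ?heatf_ge0// lee_fin (tw_w_ge0 tw).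
Qed.

Lemma le_smear t f g x : measurable_fun setT f -> measurable_fun setT g ->
  (forall y, 0 <= f y)%E -> (forall y, f y <= g y)%E -> (smear t f x <= smear t g x)%E.
Proof.
move=> mf mg f0 fg; have g0 y : (0 <= g y)%E := le_trans (f0 y) (fg y).
apply: ge0_le_integral => //.
- by move=> r _; rewrite mule_ge0 ?heatf_ge0// lee_fin (tw_w_ge0 tw).
- exact: measurable_smear_integrand.
- exact: measurable_smear_integrand.
- by move=> r _; rewrite lee_wpmul2l ?lee_fin ?(tw_w_ge0 tw)//; exact: le_heatf.
Qed.

Lemma smear_cst t k x : 0 < t -> (0 <= k)%E -> smear t (cst k) x = k.
Proof.
move=> t0 k0; transitivity (\int[leb]_r ((w r)%:E * k))%E.
  apply: eq_integral => r _; have [r1|r1] := leP r 1.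
    by rewrite (tw_w_le1 tw r1) !mul0e.
  by rewrite (heatf_cst hm)// mulr_gt0// (lt_trans _ r1).
rewrite ge0_integralZr//; first by rewrite (tw_w_mass tw) mul1e.
- by apply/measurable_EFinP; exact: tw_mw tw.
- by move=> r _; rewrite lee_fin (tw_w_ge0 tw).
Qed.

Lemma smearD t f g x : measurable_fun setT f -> measurable_fun setT g ->
  (forall y, 0 <= f y)%E -> (forall y, 0 <= g y)%E ->
  smear t (fun y => f y + g y)%E x = (smear t f x + smear t g x)%E.
Proof.
move=> mf mg f0 g0; rewrite -ge0_integralD//.
- apply: eq_integral => r _; rewrite heatfD// ge0_muleDr ?heatf_ge0//.
- by move=> r _; rewrite mule_ge0 ?heatf_ge0// lee_fin (tw_w_ge0 tw).
- exact: measurable_smear_integrand.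
- by move=> r _; rewrite mule_ge0 ?heatf_ge0// lee_fin (tw_w_ge0 tw).
- exact: measurable_smear_integrand.
Qed.

Lemma smear_lsc (t : nat -> R) f x : (forall k, 0 < t k) -> t @ \oo --> 0 ->
  measurable_fun setT f -> (forall y, 0 <= f y)%E ->
  lower_semicontinuous (f : 'rV[R]_n -> \bar R) ->
  (f x <= limn_einf (fun k => smear (t k) f x))%E.
Proof.
move=> t0 tcvg mf f0 lf; rewrite -[leLHS](@smear_cst 1 (f x) x)//.
apply: le_integral_limn_einf.
- by apply: measurable_smear_integrand => // y; exact: f0.
- by move=> k; exact: measurable_smear_integrand.
- move=> r; apply: mule_ge0; first by rewrite lee_fin (tw_w_ge0 tw).
  by apply: heatf_ge0 => y; exact: f0.
- by move=> k r; rewrite mule_ge0 ?heatf_ge0// lee_fin (tw_w_ge0 tw).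
move=> r; have [r1|r1] := leP r 1.
  rewrite (tw_w_le1 tw r1) [leLHS]mul0e; apply: limn_einf_ge; apply: nearW => k.
  by rewrite mule_ge0// heatf_ge0.
have r0 : 0 < r by rewrite (lt_trans _ r1).
have wr0 : (0 <= (w r)%:E)%E by rewrite lee_fin (tw_w_ge0 tw).
rewrite (heatf_cst hm) ?mul1r//.
apply: (le_trans _ (@limn_einf_pMl R (fun k => heatf m (t k * r) f x) (w r) (tw_w_ge0 tw r))).
rewrite lee_wpmul2l//; apply: (@heatf_lsc (fun k => t k * r)) => //.
- by move=> k; rewrite mulr_gt0.
- by rewrite -(mul0r r); apply: cvgMl.
Qed.

Lemma cvg_coord (T : Type) (F : set_system T) {FF : Filter F} (u : T -> 'rV[R]_n) x i :
  u @ F --> x -> u t ord0 i @[t --> F] --> x ord0 i.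
Proof.
move=> ux.
apply: (@cvg_comp _ _ _ u (fun y : 'rV[R]_n => y ord0 i) F (nbhs x) _ ux).
exact: (@coord_continuous R 1 n ord0 i x).
Qed.

Lemma cvg_sqdist (T : Type) (F : set_system T) {FF : Filter F} (u : T -> 'rV[R]_n) x z :
  u @ F --> x -> sqdist (u t) z @[t --> F] --> sqdist x z.
Proof.
move=> ux; rewrite /sqdist; elim: (index_enum 'I_n) => [|i r IH].
  by under eq_fun do rewrite big_nil; rewrite big_nil; exact: cvg_cst.
under eq_fun do rewrite big_cons; rewrite big_cons; apply: cvgD; last exact: IH.
have h : (u t ord0 i - z ord0 i) @[t --> F] --> x ord0 i - z ord0 i.
  by apply: cvgB; [exact: cvg_coord|exact: cvg_cst].
exact: (cvgM h h).
Qed.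

Lemma cvg_heat (T : Type) (F : set_system T) {FF : Filter F} (u : T -> 'rV[R]_n) s x z :
  0 < s -> u @ F --> x -> heat s (u t) z @[t --> F] --> heat s x z.
Proof.
move=> s0 ux; rewrite heatE//; under eq_fun do rewrite heatE//.
apply: cvgMr; apply: (cvg_comp _ expR); last exact: continuous_expR.
by apply: cvgN; apply: cvgMl; exact: cvg_sqdist.
Qed.

(** Sequences suffice in a metric space, and they are the form in which Fatou's lemma yields lower
    semicontinuity of potentials. *)
Lemma lsc_seq (f : 'rV[R]_n -> \bar R) :
  (forall x (u : nat -> 'rV[R]_n), u @ \oo --> x ->
     (f x <= limn_einf (fun k => f (u k)))%E) -> lower_semicontinuous f.
Proof.
move=> fu x b bf; apply: contrapT => nV.
have /choice[u uP] (k : nat) : exists y, ball x k.+1%:R^-1 y /\ (f y <= b%:E)%E.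
  apply: contrapT => nE; apply: nV; exists (ball x k.+1%:R^-1).
    exact: nbhsx_ballx.
  move=> y xy; rewrite ltNge; apply/negP => fy; apply: nE; by exists y.
have ux : u @ \oo --> x.
  apply/cvg_ballP => e e0.
  have /cvgrPdist_lt/(_ _ e0) := @cvg_harmonic R.
  apply: filterS => k /=; rewrite sub0r normrN gtr0_norm// => ke.
  by apply: (le_ball (ltW ke)); have [] := uP k.
have := fu _ _ ux; rewrite leNgt => /negP; apply.
apply: le_lt_trans bf; apply: limn_einf_le => k.
by have [] := uP k.
Qed.

Lemma riesz_le_limn_einf x z (u : nat -> 'rV[R]_n) : u @ \oo --> x ->
  (kap x z <= limn_einf (fun k => kap (u k) z))%E.
Proof.
move=> ux; rewrite (rs_riesz H).
have -> : (fun k => kap (u k) z) =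
    fun k => (\int[leb]_s (c * tpow a s * heat s (u k) z)%:E)%E.
  by apply/funext => k; rewrite (rs_riesz H).
have mF y : measurable_fun setT (fun s : measurableTypeR R => (c * tpow a s * heat s y z)%:E).
  apply/measurable_EFinP; apply: measurable_funM.
    by apply: measurable_funM => //; exact: measurable_tpow.
  exact: measurable_heat.
have F0 y s : (0 <= (c * tpow a s * heat s y z)%:E)%E.
  by rewrite lee_fin !mulr_ge0 ?tpow_ge0 ?heat_ge0 ?ltW// (rs_c_gt0 H).
apply: le_integral_limn_einf => // s.
have [s0|s0] := leP s 0.
  by apply: limn_einf_ge; apply: nearW => k; rewrite /tpow ltNge s0/= mulr0 !mul0r.
have h : (c * tpow a s * heat s (u k) z)%:E @[k --> \oo] --> (c * tpow a s * heat s x z)%:E.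
  apply: cvg_EFin; first exact: nearW.
  apply: cvgM; first exact: cvg_cst.
  exact: cvg_heat.
by rewrite (cvg_limn_einf_sup h).1.
Qed.

Lemma pot_lsc mu : sigma_finite setT mu -> lower_semicontinuous (pot mu).
Proof.
move=> smu; apply: lsc_seq => x u ux; apply: le_integral_limn_einf.
- by apply: (measurable_riesz H).
- by move=> k; apply: (measurable_riesz H).
- by move=> z; exact: riesz_ge0 H _ _.
- by move=> k z; exact: riesz_ge0 H _ _.
- by move=> z; exact: riesz_le_limn_einf.
Qed.

(** Excessive for the whole family P_t. Lower semicontinuity stands for the return of P_t f to f as
    t tends to 0, by [smear_lsc]. *)
Record excessive f : Prop := Excessive {
  exc_meas : measurable_fun setT f;
  exc_ge0 : forall y, (0 <= f y)%E;
  exc_lsc : lower_semicontinuous (f : 'rV[R]_n -> \bar R);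
  exc_smear : forall t x, 0 < t -> (smear t f x <= f x)%E }.

Lemma pot_excessive mu : sigma_finite setT mu -> excessive (pot mu).
Proof.
move=> smu; split.
- exact: measurable_pot H _ smu.
- by move=> y; exact: pot_ge0 H _ _.
- exact: pot_lsc.
- move=> t x t0; rewrite [leRHS](pot_split H x t0 smu) leeDl//.
  apply: mule_ge0; first by rewrite lee_fin mulr_ge0 ?powR_ge0// ltW// (rs_c_gt0 H).
  by apply: integral_ge0 => s _; rewrite mule_ge0 ?heatm_ge0// lee_fin (tw_S_ge0 tw).
Qed.

Lemma cst_excessive (k : \bar R) : (0 <= k)%E -> excessive (cst k).
Proof.
move=> k0; split => //.
- by move=> x b bk; exists setT => //; exact: filterT.
- by move=> t x t0; rewrite smear_cst.
Qed.

Lemma mine_excessive f g : excessive f -> excessive g ->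
  excessive (fun x => mine (f x) (g x)).
Proof.
move=> [mf f0 lf sf] [mg g0 lg sg].
have mm : measurable_fun setT (fun x : Rn R n => mine (f x) (g x)) by exact: measurable_mine.
have m0 y : (0 <= mine (f y) (g y))%E by rewrite le_min f0 g0.
split => //.
- move=> x b; rewrite lt_min => /andP[/lf[V xV fV] /lg[W xW gW]].
  exists (V `&` W); first exact: filterI.
  by move=> y [Vy Wy]; rewrite lt_min fV ?gW.
- move=> t x t0; rewrite le_min; apply/andP; split.
    apply: (le_trans _ (sf t x t0)); apply: le_smear => // y.
    by rewrite ge_min lexx.
  apply: (le_trans _ (sg t x t0)); apply: le_smear => // y.
  by rewrite ge_min lexx orbT.
Qed.

Lemma addcst_excessive f (e : R) : 0 <= e -> excessive f ->
  excessive (fun x => f x + e%:E)%E.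
Proof.
move=> e0 [mf f0 lf sf]; split.
- by apply: emeasurable_funD.
- by move=> y; rewrite adde_ge0// lee_fin.
- move=> x b; rewrite -lteBlDr// -EFinB => /lf[V xV fV].
  by exists V => // y /fV; rewrite EFinB lteBlDr.
- move=> t x t0; rewrite (@smearD t f (cst e%:E))//.
  by rewrite smear_cst ?lee_fin// leeD2r// sf.
Qed.

Lemma heatf_ae_le s f g x : measurable_fun setT f -> measurable_fun setT g ->
  (forall y, 0 <= f y)%E -> (forall y, 0 <= g y)%E ->
  {ae m, forall y, (f y <= g y)%E} -> (heatf m s f x <= heatf m s g x)%E.
Proof.
move=> mf mg f0 g0 fg; apply: ae_ge0_le_integral => //.
- by move=> y _; rewrite mule_ge0// lee_fin heat_ge0.
- by apply: emeasurable_funM => //; exact: measurable_heatE.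
- by move=> y _; rewrite mule_ge0// lee_fin heat_ge0.
- by apply: emeasurable_funM => //; exact: measurable_heatE.
- case: fg => N [mN N0 sN]; exists N; split => // y /= ny; apply: sN => fgy.
  by apply: ny => _; rewrite lee_wpmul2l// lee_fin heat_ge0.
Qed.

Lemma smear_ae_le t f g x : measurable_fun setT f -> measurable_fun setT g ->
  (forall y, 0 <= f y)%E -> (forall y, 0 <= g y)%E ->
  {ae m, forall y, (f y <= g y)%E} -> (smear t f x <= smear t g x)%E.
Proof.
move=> mf mg f0 g0 fg.
apply: ge0_le_integral => //.
- by move=> r _; rewrite mule_ge0 ?heatf_ge0// lee_fin (tw_w_ge0 tw).
- exact: measurable_smear_integrand.
- exact: measurable_smear_integrand.
- by move=> r _; rewrite lee_wpmul2l ?lee_fin ?(tw_w_ge0 tw)//; exact: heatf_ae_le.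
Qed.

(** P_t does not see null sets of [m], and f is recovered from below by P_t f as t tends to 0, while
    P_t g stays below g. *)
Lemma excessive_ae_le f g : excessive f -> excessive g ->
  {ae m, forall y, (f y <= g y)%E} -> forall x, (f x <= g x)%E.
Proof.
move=> [mf f0 lf sf] [mg g0 lg sg] fg x.
apply: (@le_trans _ _ (limn_einf (fun k => smear (k.+1%:R^-1) f x))).
  by apply: smear_lsc => //; exact: cvg_harmonic.
apply: limn_einf_le => k; apply: (le_trans _ (sg k.+1%:R^-1 x _)) => //.
exact: smear_ae_le.
Qed.

Lemma excessive_limn_einf (f : nat -> Rn R n -> \bar R) g :
  (forall k, excessive (f k)) -> (forall x, f ^~ x @ \oo --> g x) ->
  (forall k x, (f k x <= g x)%E) -> excessive g.
Proof.
move=> ef fg fleg; have gE : g = fun x => limn_einf (f^~ x).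
  by apply/funext => x; rewrite (cvg_limn_einf_sup (fg x)).1.
have mg : measurable_fun setT g.
  by rewrite gE; apply: measurable_limn_einf => k; exact: exc_meas (ef k).
have g0 y : (0 <= g y)%E by apply: (le_trans _ (fleg 0%N y)); exact: exc_ge0 (ef 0%N) y.
split => //.
- move=> x b bg; have [k bk] : exists k, (b%:E < f k x)%E.
    apply: contrapT => nk; move: bg; rewrite ltNge => /negP; apply.
    rewrite gE; apply: limn_einf_le => k; rewrite leNgt; apply/negP => bk.
    by apply: nk; exists k.
  have [V xV fV] := exc_lsc (ef k) bk.
  by exists V => // y /fV /lt_le_trans; apply.
- move=> t x t0; have -> : g x = limn_einf (f^~ x) by rewrite gE.
  apply: (@le_trans _ _ (limn_einf (fun k => smear t (f k) x))); last first.
    by apply: le_limn_einf => k; exact: exc_smear (ef k) _ _ t0.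
  have f0 k y : (0 <= f k y)%E by exact: exc_ge0 (ef k) y.
  have mf k : measurable_fun setT (f k) by exact: exc_meas (ef k).
  apply: le_integral_limn_einf.
  + exact: measurable_smear_integrand.
  + by move=> k; exact: measurable_smear_integrand.
  + by move=> r; rewrite mule_ge0 ?heatf_ge0// lee_fin (tw_w_ge0 tw).
  + by move=> k r; rewrite mule_ge0 ?heatf_ge0// lee_fin (tw_w_ge0 tw).
  move=> r; apply: (le_trans _ (@limn_einf_pMl R (fun k => heatf m (t * r) (f k) x) (w r) (tw_w_ge0 tw r))).
  rewrite lee_wpmul2l ?lee_fin ?(tw_w_ge0 tw)//.
  apply: le_integral_limn_einf.
  + by apply: emeasurable_funM => //; exact: measurable_heatE.
  + by move=> k; apply: emeasurable_funM => //; exact: measurable_heatE.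
  + by move=> y; rewrite mule_ge0// lee_fin heat_ge0.
  + by move=> k y; rewrite mule_ge0// lee_fin heat_ge0.
  move=> y; apply: (le_trans _ (@limn_einf_pMl R (fun k => f k y) (heat (t * r) x y) (heat_ge0 _ _ _))).
  by rewrite lee_wpmul2l ?lee_fin ?heat_ge0// gE.
Qed.

End excessive.

(** * Energy *)

Lemma mule_amgm (R : realType) (x y : \bar R) : (0 <= x)%E -> (0 <= y)%E ->
  (2%:E * (x * y) <= x * x + y * y)%E.
Proof.
case: x => [x| |]//; case: y => [y| |]// x0 y0; last 3 first.
- by rewrite [X in (_ <= _ + X)%E](_ : (+oo * +oo = +oo)%E)// addey ?leey.
- by rewrite [X in (_ <= X + _)%E](_ : (+oo * +oo = +oo)%E)// addye ?leey.
- by rewrite [X in (_ <= X + _)%E](_ : (+oo * +oo = +oo)%E)// addye ?leey.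
by rewrite -!EFinM -EFinD lee_fin; have := sqr_ge0 (x - y); nra.
Qed.

Lemma lee_wpmul2l_neq0 (R : realType) (k x y : \bar R) : (0 <= k)%E ->
  (k != 0 -> (x <= y)%E) -> (k * x <= k * y)%E.
Proof.
by move=> k0; have [->|kn0 xy] := eqVneq k 0%E; [rewrite !mul0e|rewrite lee_wpmul2l// xy].
Qed.

Lemma lte_pmul_fin (R : realType) (d : R) (x : \bar R) : 0 < d -> (0 <= x)%E ->
  (d%:E * x < +oo)%E -> (x < +oo)%E.
Proof.
by move=> d0; case: x => [r _ _|_|]//; [rewrite ltry|rewrite gt0_muley ?lte_fin].
Qed.

Lemma heat_gt0 (R : realType) n (s : R) (x y : 'rV[R]_n) : 0 < s -> 0 < heat s x y.
Proof. by move=> s0; rewrite heatE// mulr_gt0 ?powR_gt0 ?expR_gt0// mulr_gt0 ?pi_gt0. Qed.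

Lemma heat_le_inv (R : realType) n (s : R) (x y : 'rV[R]_n) : (2 < n)%N -> 1 <= s ->
  heat s x y <= s^-1.
Proof.
move=> n2 s1; have s0 : 0 < s by rewrite (lt_le_trans _ s1).
have ps1 : 1 <= pi * s :> R by rewrite mulr_ege1 ?pi_ge1.
rewrite heatE//; apply: (@le_trans _ _ ((pi * s) `^ (- (n%:R / 2)))).
  rewrite ler_piMr ?powR_ge0// -expR0 ler_expR oppr_le0 divr_ge0 ?sqdist_ge0 ?(ltW s0)//.
apply: (@le_trans _ _ ((pi * s) `^ (- 1))).
  rewrite ler_powR// lerN2 ler_pdivlMr// mul1r.
  by rewrite ler_nat ltnW.
rewrite powR_inv1 ?(le_trans _ ps1)// lef_pV2 ?posrE ?(lt_le_trans _ ps1)//.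
by rewrite ler_peMl ?pi_ge1// ltW.
Qed.

Lemma sqdist_le_ball (R : realType) n (x : 'rV[R]_n) (r : R) : exists D : R,
  forall y : 'rV[R]_n, ball 0 r y -> sqdist x y <= D.
Proof.
exists (\sum_(i < n) (`|x ord0 i| + r) ^+ 2) => y [r0 yr].
apply: ler_sum => i _; rewrite -[leLHS]real_normK ?num_real//.
rewrite lerXn2r ?nnegrE ?addr_ge0 ?(ltW r0)//.
apply: (le_trans (ler_normB _ _)); rewrite lerD2l ltW//.
by have := yr ord0 i; rewrite /ball/= mxE sub0r normrN.
Qed.

Section energy.
Context (R : realType) (n : nat) (m : bmeasure R n) (a c : R) (w S : R -> R).
Hypothesis H : riesz_setting m a c w S.
Notation leb := (@lebesgue_measure R).
Notation kap := (@riesz R n (2 * a)).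
Notation pot := (@potential R n (2 * a)).
Notation smear := (smear m w).
Notation excessive := (excessive m w).
Implicit Types (mu nu : bmeasure R n) (f g : Rn R n -> \bar R) (x y z : 'rV[R]_n).

Let hm := rs_ref H.
Let tw := rs_weights H.

(** Splitting the time u into two halves writes each term as an integral over [m] of a product of
    two heat extensions, where 2ab <= a^2 + b^2 applies. *)
Lemma cross_heatm_amgm u mu nu : 0 < u -> sigma_finite setT mu -> sigma_finite setT nu ->
  (2%:E * \int[nu]_x heatm u mu x <= \int[mu]_x heatm u mu x + \int[nu]_x heatm u nu x)%E.
Proof.
move=> u0 smu snu; have h0 : 0 < u / 2 by rewrite divr_gt0.
have uE : u = u / 2 + u / 2 by rewrite -splitr.
have mh (l : bmeasure R n) : sigma_finite setT l -> measurable_fun setT (fun x : Rn R n => heatm (u / 2) l x).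
  by move=> sl; apply: measurable_heatm.
have p0 (k l : bmeasure R n) x : (0 <= heatm (u / 2) k x * heatm (u / 2) l x)%E by rewrite mule_ge0 ?heatm_ge0.
rewrite uE -!(integral_heatm_heatm hm)// -ge0_integralTZl//; last first.
  by apply: emeasurable_funM; exact: mh.
rewrite -ge0_integralD//; last 2 first.
- by apply: emeasurable_funM; exact: mh.
- by apply: emeasurable_funM; exact: mh.
apply: ge0_le_integral => //.
- by move=> x _; rewrite mule_ge0.
- by apply: measurable_funeM; apply: emeasurable_funM; exact: mh.
- by apply: emeasurable_funD; apply: emeasurable_funM; exact: mh.
- by move=> x _; rewrite mule_amgm ?heatm_ge0.
Qed.

(** With h the heat extension of mu at time u/2, the two sides are <h, H_r h> and <h, h>; H_r is a
    contraction of L^2. *)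
Lemma self_heatm_le r u mu : 0 < r -> 0 < u -> sigma_finite setT mu ->
  (\int[mu]_x heatm (r + u) mu x <= \int[mu]_x heatm u mu x)%E.
Proof.
move=> r0 u0 smu; have h0 : 0 < u / 2 by rewrite divr_gt0.
have mh : measurable_fun setT (heatm (u / 2) mu : Rn R n -> \bar R) by apply: measurable_heatm.
have E1 := integral_heatm_heatm hm h0 (addr_gt0 r0 h0) smu smu.
have E2 := integral_heatm_heatm hm h0 h0 smu smu.
rewrite -splitr in E2; rewrite (_ : u / 2 + (r + u / 2) = r + u) in E1; last by lra.
rewrite -E1 -E2.
apply: le_trans (integral_heatf_sqr_le hm r0 mh _); last by move=> y; exact: heatm_ge0.
rewrite le_eqVlt; apply/orP; left; apply/eqP; apply: eq_integral => x _.
by rewrite (heatf_heatm hm _ r0 h0 smu).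
Qed.

Let tint mu nu r s := ((c * tpow a s)%:E * \int[nu]_x heatm (r + s) mu x)%E.

Let ctp0 s : 0 <= c * tpow a s.
Proof. by rewrite mulr_ge0 ?tpow_ge0 ?ltW ?(rs_c_gt0 H). Qed.

Let ctp s : s <= 0 -> c * tpow a s = 0.
Proof. by move=> s0; rewrite /tpow ltNge s0 mulr0. Qed.

Let mctp : measurable_fun setT (fun s : measurableTypeR R => (c * tpow a s)%:E).
Proof.
by apply/measurable_EFinP; apply: measurable_funM => //; exact: measurable_tpow.
Qed.

Let mheat mu r : sigma_finite setT mu ->
  measurable_fun setT (fun p : Rn R n * measurableTypeR R => heatm (r + p.2) mu p.1).
Proof.
by move=> smu; apply: measurable_heatm => //; apply: measurable_funD => //; exact: measurable_snd.
Qed.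

Let mtint mu nu r : sigma_finite setT mu -> sigma_finite setT nu ->
  measurable_fun setT (tint mu nu r : measurableTypeR R -> \bar R).
Proof.
move=> smu snu; apply: emeasurable_funM => //.
apply: (@measurable_tonelli _ _ (measurableTypeR R) (Rn R n) R nu (fun s x => heatm (r + s) mu x)) => //.
  by apply: measurable_heatm => //; apply: measurable_funD => //; exact: measurable_fst.
by move=> s x; exact: heatm_ge0.
Qed.

Let tint0 mu nu r s : (0 <= tint mu nu r s)%E.
Proof. by rewrite mule_ge0 ?lee_fin// integral_ge0// => x _; exact: heatm_ge0. Qed.

Let integral_time mu nu r : sigma_finite setT mu -> sigma_finite setT nu ->
  (\int[nu]_x \int[leb]_s ((c * tpow a s)%:E * heatm (r + s) mu x) =
   \int[leb]_s tint mu nu r s)%E.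
Proof.
move=> smu snu; rewrite (@tonelli _ _ (Rn R n) (measurableTypeR R) R nu leb
  (fun x s => (c * tpow a s)%:E * heatm (r + s) mu x)%E).
- apply: eq_integral => s _; rewrite ge0_integralTZl// => [|x]; last exact: heatm_ge0.
  by apply: measurable_heatm.
- by [].
- exact: sigma_finite_leb.
- apply: emeasurable_funM; last exact: mheat.
  exact: measurable_on_snd mctp.
- by move=> x s; rewrite mule_ge0 ?heatm_ge0 ?lee_fin.
Qed.

Lemma mutual_time mu nu : sigma_finite setT mu -> sigma_finite setT nu ->
  (\int[nu]_x pot mu x = \int[leb]_s tint mu nu 0 s)%E.
Proof.
move=> smu snu; rewrite -integral_time//; apply: eq_integral => x _.
by rewrite (pot_time H _ smu); apply: eq_integral => s _; rewrite add0r.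
Qed.

Lemma mutual_heat_time mu nu r : 0 < r -> sigma_finite setT mu -> sigma_finite setT nu ->
  (\int[nu]_x heatf m r (pot mu) x = \int[leb]_s tint mu nu r s)%E.
Proof.
move=> r0 smu snu; rewrite -integral_time//; apply: eq_integral => x _.
by rewrite (heatf_pot_time H _ r0 smu).
Qed.

Let tint_amgm mu nu r : 0 <= r -> sigma_finite setT mu -> sigma_finite setT nu ->
  (2%:E * \int[leb]_s tint mu nu r s <=
   \int[leb]_s tint mu mu r s + \int[leb]_s tint nu nu r s)%E.
Proof.
move=> r0 smu snu; rewrite -ge0_integralTZl//; last exact: mtint.
rewrite -ge0_integralD//; last 2 first.
- exact: mtint.
- exact: mtint.
apply: ge0_le_integral => //.
- by move=> s _; rewrite mule_ge0.
- by apply: measurable_funeM; exact: mtint.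
- by apply: emeasurable_funD; exact: mtint.
move=> s _; rewrite /tint; have [s0|s0] := leP s 0.
  by rewrite ctp// !mul0e mule0 adde0.
rewrite muleCA -ge0_muleDr; last 2 first.
- by apply: integral_ge0 => x _; exact: heatm_ge0.
- by apply: integral_ge0 => x _; exact: heatm_ge0.
by rewrite lee_wpmul2l ?lee_fin// cross_heatm_amgm// ltr_wpDl.
Qed.

(* Positive definiteness of the Riesz kernel, a mixture of the kernels
   heat (s / 2) * heat (s / 2). *)
Lemma mutual_amgm mu nu : sigma_finite setT mu -> sigma_finite setT nu ->
  (2%:E * mutual (2 * a) nu mu <= energy (2 * a) mu + energy (2 * a) nu)%E.
Proof. by move=> smu snu; rewrite /energy/mutual !mutual_time// tint_amgm. Qed.

Lemma energy_heat_le r mu : 0 < r -> sigma_finite setT mu ->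
  (\int[mu]_x heatf m r (pot mu) x <= energy (2 * a) mu)%E.
Proof.
move=> r0 smu; rewrite /energy/mutual (mutual_time smu smu) (mutual_heat_time r0 smu smu).
apply: ge0_le_integral; first exact: measurableT.
- by move=> s _; exact: tint0.
- exact: mtint.
- exact: mtint.
move=> s _; apply: lee_wpmul2l_neq0; first by rewrite lee_fin.
move=> cs; rewrite add0r; apply: self_heatm_le => //.
by rewrite ltNge; apply: contraNN cs => s0; rewrite (ctp s0).
Qed.

(** If H_s f were infinite at x for all s > 0, so would be P_1 f, since w has mass 1 on positive
    times. *)
Lemma excessive_heatf_fin f x : excessive f -> (f x < +oo)%E ->
  exists2 s, 0 < s & (heatf m s f x < +oo)%E.
Proof.
move=> [mf f0 lf sf] fx; apply: contrapT => nE.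
have : (smear 1 f x = +oo)%E.
  apply: (eq_trans _ (smear_cst H x ltr01 (leey 0%E))).
  apply: eq_integral => r _; have [r1|r1] := leP r 1.
    by rewrite (tw_w_le1 tw r1) !mul0e.
  have r0 : 0 < 1 * r by rewrite mul1r (lt_trans _ r1).
  rewrite (heatf_cst hm)//; congr (_ * _)%E.
  apply/eqP; rewrite -leye_eq leNgt; apply/negP => h.
  by apply: nE; exists (1 * r).
by have := sf 1 x ltr01 => /[swap] ->; rewrite leye_eq => /eqP fE; rewrite fE in fx.
Qed.

Lemma excessive_ae_fin f x : excessive f -> (f x < +oo)%E -> {ae m, forall y, (f y < +oo)%E}.
Proof.
move=> ef fx; have [s s0 fs] := excessive_heatf_fin ef fx; case: ef => [mf f0 _ _].
have : m.-integrable setT (fun y => (heat s x y)%:E * f y)%E.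
  apply/integrableP; split.
    by apply: emeasurable_funM => //; exact: measurable_heatE.
  rewrite (eq_integral (fun y : Rn R n => (heat s x y)%:E * f y)%E)// => y _.
  by rewrite gee0_abs// mule_ge0// lee_fin heat_ge0.
move=> /(integrable_ae measurableT) [N [mN N0 sN]]; exists N; split => // y ny.
apply: sN => /= /(_ Logic.I) h; apply: ny; move: h.
have h0 : 0 < heat s x y by exact: heat_gt0.
by rewrite fin_numElt => /andP[_]; exact: lte_pmul_fin.
Qed.

(** At a fixed time the heat kernel is bounded below on a ball, so H_s f finite at one point
    controls the integral there. *)
Lemma excessive_locint f x (r : R) : excessive f -> (f x < +oo)%E ->
  (\int[m]_(y in ball (0%R : 'rV[R]_n) r) f y < +oo)%E.
Proof.
move=> ef fx; have [s s0 fs] := excessive_heatf_fin ef fx; case: ef => [mf f0 _ _].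
have [D yD] := sqdist_le_ball x r.
pose d := (pi * s) `^ (- (n%:R / 2)) * expR (- (D / s)).
have d0 : 0 < d by rewrite mulr_gt0 ?powR_gt0 ?expR_gt0// mulr_gt0 ?pi_gt0.
have mB : measurable (ball (0 : 'rV[R]_n) r : set (Rn R n)).
  by apply: measurable_open; exact: ball_open.
have mhf : measurable_fun setT (fun y : Rn R n => (heat s x y)%:E * f y)%E.
  by apply: emeasurable_funM => //; exact: measurable_heatE.
have hf0 y : (0 <= (heat s x y)%:E * f y)%E by rewrite mule_ge0// lee_fin heat_ge0.
have : (d%:E * \int[m]_(y in ball (0%R : 'rV[R]_n) r) f y < +oo)%E.
  rewrite -ge0_integralZl_EFin//; last 2 first.
  - exact: measurable_funTS.
  - exact: ltW.
  apply: le_lt_trans fs; apply: (@le_trans _ _ (\int[m]_(y in ball (0%R : 'rV[R]_n) r)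
      ((heat s x y)%:E * f y))%E).
    apply: ge0_le_integral => //.
    - by move=> y _; rewrite mule_ge0// lee_fin ltW.
    - by apply: measurable_funTS; exact: measurable_funeM.
    - exact: measurable_funTS.
    move=> y /yD xy; rewrite lee_wpmul2r// lee_fin heatE// ler_wpM2l ?powR_ge0//.
    by rewrite ler_expR lerN2 ler_pM2r ?invr_gt0.
  by apply: ge0_subset_integral => //.
by apply: lte_pmul_fin => //; apply: integral_ge0.
Qed.

Lemma riesz_far (rho D : R) x z : 1 <= D -> ball (0 : 'rV[R]_n) rho z ->
  ~ ball (0 : 'rV[R]_n) (rho + D) x -> (kap x z <= (D^-1)%:E)%E.
Proof.
move=> D1 [rho0 zr] nx; have D0 : 0 < D by rewrite (lt_le_trans _ D1).
have xz : D <= Defs.edist x z.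
  case/not_andP : nx => [|/existsNP[i /existsNP[j]]]; first by rewrite addr_gt0.
  rewrite !ord1 /ball/= mxE sub0r normrN => /negP; rewrite -leNgt => xj.
  have zj : `|z ord0 j| < rho by have := zr ord0 j; rewrite /ball/= mxE sub0r normrN.
  rewrite -[leLHS]ger0_norm ?(ltW D0)// -sqrtr_sqr ler_wsqrtr//.
  rewrite (bigD1 j)//= -[leLHS]addr0 lerD//; last first.
    by apply: sumr_ge0 => k _; exact: sqr_ge0.
  rewrite -[leRHS]real_normK ?num_real// lerXn2r ?nnegrE ?(ltW D0)//.
  by have := ler_distD 0 (x ord0 j) (z ord0 j); have := lerB_dist (x ord0 j) (z ord0 j); lra.
have e1 : 1 <= Defs.edist x z := le_trans D1 xz.
rewrite /riesz; case: eqP => [xzE|_].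
  move: xz; rewrite xzE /Defs.edist big1 ?sqrtr0; first by rewrite leNgt D0.
  by move=> i _; rewrite subrr expr0n.
(* The exponent 2a - n is at most -1, and the distance is at least 1. *)
rewrite lee_fin; apply: (@le_trans _ _ (Defs.edist x z `^ (-1))).
  have n3 : 3%:R <= n%:R :> R by rewrite ler_nat; exact: rs_n H.
  by rewrite ler_powR//; have := rs_a_le1 H; lra.
by rewrite powR_inv1 ?(le_trans ler01)// lef_pV2 ?posrE// (lt_le_trans D0).
Qed.

Lemma pot_vanish mu (rho e : R) : 0 < e -> 0 < rho ->
  mu (~` ball (0%R : 'rV[R]_n) rho) = 0%E -> (mu setT < +oo)%E ->
  exists2 r, 0 < r & forall x, ~ ball (0 : 'rV[R]_n) r x -> (pot mu x < e%:E)%E.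
Proof.
move=> e0 rho0 mu0 mufin.
have mB : measurable (ball (0 : 'rV[R]_n) rho : set (Rn R n)).
  by apply: measurable_open; exact: ball_open.
have [M M0 muM] : exists2 M : R, 0 <= M & (mu setT = M%:E)%E.
  exists (fine (mu setT)); first by rewrite fine_ge0.
  by rewrite fineK// ge0_fin_numE.
(* With M the total mass, the choice gives M / D < e, and D >= 1 as [riesz_far] requires. *)
pose D := 1 + M / e; have Me : 0 <= M / e by rewrite divr_ge0// ltW.
have D1 : 1 <= D by rewrite /D; lra.
have D0 : 0 < D by lra.
exists (rho + D) => [|x nx]; first by rewrite addr_gt0.
have mk : measurable_fun setT (fun z : Rn R n => kap x z * (\1_(ball (0%R : 'rV[R]_n) rho) z)%:E)%E.
  apply: emeasurable_funM; first exact: (measurable_riesz H).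
  by apply/measurable_EFinP; exact: measurable_indic.
have -> : pot mu x = (\int[mu]_z (kap x z * (\1_(ball (0%R : 'rV[R]_n) rho) z)%:E))%E.
  apply: ae_eq_integral => //; first exact: (measurable_riesz H).
  exists (~` ball (0 : 'rV[R]_n) rho); split => //; first exact: measurableC.
  by move=> z /= nz zr; apply: nz => _; rewrite indicE mem_set// mule1.
apply: (@le_lt_trans _ _ (\int[mu]_z (cst (D^-1)%:E z))%E).
  apply: ge0_le_integral => //.
  - by move=> z _; rewrite mule_ge0 ?(riesz_ge0 H) ?lee_fin.
  move=> z _; rewrite indicE; have [zr|zr] := boolP (z \in _).
    by rewrite mule1 (@riesz_far rho)//; rewrite inE in zr.
  by rewrite mule0 lee_fin invr_ge0 ltW.
rewrite integral_cst// muM -EFinM lte_fin mulrC ltr_pdivrMr// /D mulrDr mulr1.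
by rewrite mulrCA divff ?gt_eqF// mulr1 ltrDr.
Qed.

End energy.

(** * The domination principle *)

Section ae_lemmas.
Context d (T : measurableType d) (R : realType) (mu : {measure set T -> \bar R}).

Lemma ae_imp (P Q : T -> Prop) : (forall x, P x -> Q x) ->
  {ae mu, forall x, P x} -> {ae mu, forall x, Q x}.
Proof.
move=> PQ [N [mN N0 PN]]; exists N; split => //.
by move=> x /= nQ; apply: PN => /= Px; apply: nQ; exact: PQ.
Qed.

Lemma ae_imp2 (P Q S : T -> Prop) : (forall x, P x -> Q x -> S x) ->
  {ae mu, forall x, P x} -> {ae mu, forall x, Q x} -> {ae mu, forall x, S x}.
Proof.
move=> PQ [N [mN N0 PN]] [M [mM M0 QM]]; exists (N `|` M); split.
- exact: measurableU.
- by rewrite measureU0.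
move=> x /= nS; apply: contrapT => /not_orP[nN nM]; apply: nS; apply: PQ.
  by apply: contrapT => nP; apply: nN; exact: PN.
by apply: contrapT => nQ; apply: nM; exact: QM.
Qed.

Lemma ae_le_integral (f g : T -> \bar R) : measurable_fun setT f ->
  measurable_fun setT g -> (forall x, 0 <= f x)%E -> (forall x, 0 <= g x)%E ->
  {ae mu, forall x, (f x <= g x)%E} -> (\int[mu]_x f x <= \int[mu]_x g x)%E.
Proof.
move=> mf mg f0 g0 fg; apply: ae_ge0_le_integral => //.
by apply: ae_imp fg => x fgx _.
Qed.

Lemma integral0_ae (f : T -> \bar R) : measurable_fun setT f -> (forall x, 0 <= f x)%E ->
  (\int[mu]_x f x = 0)%E -> {ae mu, forall x, f x = 0%E}.
Proof.
move=> mf f0 If; have : (\int[mu]_x `|f x| = 0)%E.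
  by rewrite -[RHS]If; apply: eq_integral => x _; rewrite gee0_abs.
by move=> /(ae_eq_integral_abs mu measurableT mf); apply: ae_imp => x /(_ Logic.I).
Qed.

Lemma finite_sigma_finite : (mu setT < +oo)%E -> sigma_finite setT mu.
Proof.
move=> mufin; exists (fun=> setT); first by rewrite bigcup_const.
by move=> i; split => //; exact: measurableT.
Qed.

End ae_lemmas.

Lemma limn_einf_gt_near (R : realType) (u : nat -> \bar R) (l : \bar R) :
  (l < limn_einf u)%E -> \forall k \near \oo, (l < u k)%E.
Proof.
rewrite limn_einf_lim => lu; have [N lN] : exists N, (l < einfs u N)%E.
  apply: contrapT => nN; move: lu; rewrite ltNge => /negP; apply.
  apply: lime_le; first exact: is_cvg_einfs.
  by apply: nearW => k; rewrite leNgt; apply/negP => lk; apply: nN; exists k.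
exists N => // k /= Nk; apply: (lt_le_trans lN).
by apply: ereal_inf_lbound; exists k.
Qed.

(** If y alone exhausts the finite budget E in the lower limit, nothing is left for x. Fatou's lemma
    supplies such lower limits, so no convergence has to be known beforehand. *)
Lemma cvg0_complement (R : realType) (x y : nat -> \bar R) (E : \bar R) :
  (E < +oo)%E -> (forall k, 0 <= x k)%E -> (forall k, 0 <= y k)%E ->
  (forall k, x k + y k <= E)%E -> (E <= limn_einf y)%E -> x @ \oo --> 0%E.
Proof.
move=> Ef x0 y0 xyE Ey.
have [r rE] : exists r, E = r%:E.
  exists (fine E); rewrite fineK// ge0_fin_numE//.
  by apply: le_trans (xyE 0%N); rewrite adde_ge0.
rewrite {E}rE in xyE Ey Ef.
have xf k : x k \is a fin_num.
  rewrite ge0_fin_numE// (le_lt_trans _ Ef)// (le_trans _ (xyE k))// leeDl//.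
have yf k : y k \is a fin_num.
  rewrite ge0_fin_numE// (le_lt_trans _ Ef)// (le_trans _ (xyE k))// leeDr//.
apply/fine_cvgP; split; first exact: nearW.
apply/cvgrPdist_le => e e0; have : ((r - e)%:E < limn_einf y)%E.
  by apply: lt_le_trans Ey; rewrite lte_fin ltrBlDr ltrDl.
move=> /limn_einf_gt_near; apply: filterS => k rk.
have := xyE k; rewrite -(fineK (xf k)) -(fineK (yf k)) -EFinD lee_fin => xy.
move: rk; rewrite -(fineK (yf k)) lte_fin => ry.
rewrite /= sub0r normrN ger0_norm; last by rewrite fine_ge0.
by lra.
Qed.

(** The case p = q = +oo is no exception: the convention +oo - +oo = -oo makes the positive part
    0. *)
Lemma maxe_mine_split (R : realType) (p q : \bar R) : (0 <= p)%E -> (0 <= q)%E ->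
  p = (maxe (p - q) 0 + mine p q)%E.
Proof.
case: p => [p| |]//; case: q => [q| |]//= p0 q0; rewrite ?addeNy ?addey//=.
- rewrite -EFinB /maxe /mine lte_fin lte_fin; case: (ltP p q) => pq.
    by rewrite subr_lt0 pq add0e.
  by rewrite ltNge subr_ge0 pq/= -EFinD subrK.
- by rewrite /maxe ltNy0 add0e /mine ltry.
by rewrite maxNye.
Qed.

Lemma trunc_real (R : realType) (q r : R) : 0 <= q -> q <= 1 -> 1 < r ->
  1 + r * q <= q + r.
Proof. by move=> q0 q1 r1; nra. Qed.

Lemma lee_cancel_split (R : realType) (f W A B F : \bar R) : W \is a fin_num ->
  (f + W = A + B)%E -> (A <= F + W)%E -> (f <= F + B)%E.
Proof. by move=> Wf fW AF; rewrite -(leeD2rE _ _ Wf) fW addeAC leeD2r. Qed.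

Lemma lee_double_gap (R : realType) (N p q : \bar R) : N \is a fin_num ->
  p \is a fin_num -> q \is a fin_num -> (2%:E * p <= N + q)%E ->
  (N - q <= 2%:E * (N - p))%E.
Proof.
case: N => [N| |]//; case: p => [p| |]//; case: q => [q| |]// _ _ _.
by rewrite -!EFinB -!EFinM -EFinD !lee_fin; lra.
Qed.

Lemma powR_dyadic (R : realType) (a t : R) k : 0 < t ->
  (2 `^ a) ^+ k * (t / 2 ^+ k) `^ a = t `^ a.
Proof.
move=> t0; rewrite -[X in X * _](_ : (2 ^+ k) `^ a = _); last first.
  by rewrite -(powR_mulrn k (powR_ge0 2 a)) -(powR_mulrn k (ler0n R 2)) -!powRrM mulrC.
rewrite -powRM ?exprn_ge0// ?divr_ge0 ?exprn_ge0 ?(ltW t0)//.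
by rewrite mulrC divfK// expf_neq0.
Qed.

Lemma sube_le0_of_le (R : realType) (p q : \bar R) : (p <= q)%E -> (p - q <= 0)%E.
Proof.
case: p => [p| |]//; case: q => [q| |]//=; rewrite ?addNye ?addeNy//.
by rewrite -EFinB !lee_fin subr_le0.
Qed.

Section domination.
Context (R : realType) (n : nat) (m : bmeasure R n) (a c : R) (w S : R -> R).
Hypothesis H : riesz_setting m a c w S.
Notation leb := (@lebesgue_measure R).
Notation kap := (@riesz R n (2 * a)).
Notation pot := (@potential R n (2 * a)).
Notation smear := (smear m w).
Notation smear_rest := (smear_rest a c S).
Notation excessive := (excessive m w).
Implicit Types (mu nu : bmeasure R n) (f g : Rn R n -> \bar R) (x y z : 'rV[R]_n).

Let hm := rs_ref H.
Let tw := rs_weights H.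

Let w0 r : (0 <= (w r)%:E)%E. Proof. by rewrite lee_fin (tw_w_ge0 tw). Qed.
Let mw : measurable_fun setT (fun r : measurableTypeR R => (w r)%:E).
Proof. by apply/measurable_EFinP; exact: tw_mw tw. Qed.
Let S0 r : (0 <= (S r)%:E)%E. Proof. by rewrite lee_fin (tw_S_ge0 tw). Qed.
Let mS : measurable_fun setT (fun r : measurableTypeR R => (S r)%:E).
Proof. by apply/measurable_EFinP; exact: tw_mS tw. Qed.

Lemma S_le0 s : s <= 0 -> S s = 0.
Proof.
move=> s0; have := tw_conv tw s; rewrite /tpow [in RHS]ltNge s0/= => Se.
apply/eqP; rewrite eq_le (tw_S_ge0 tw) andbT -lee_fin -Se leeDr//.
by apply: integral_ge0 => r _; rewrite lee_fin mulr_ge0 ?tpow_ge0// (tw_w_ge0 tw).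
Qed.

Lemma measurable_form_heatf f g t : measurable_fun setT f -> measurable_fun setT g ->
  (forall y, 0 <= f y)%E -> (forall y, 0 <= g y)%E ->
  measurable_fun setT (fun r : measurableTypeR R => \int[m]_x (f x * heatf m (t * r)%R g x))%E.
Proof.
move=> mf mg f0 g0; apply: (@measurable_tonelli _ _ (measurableTypeR R) (Rn R n) R m
  (fun r x => f x * heatf m (t * r)%R g x)%E).
- exact: sigma_finite_ref hm.
- apply: emeasurable_funM; first exact: measurable_on_snd mf.
  apply: (measurable_heatf hm) => //.
  by apply: measurable_funM => //; exact: measurable_fst.
- by move=> r x; rewrite mule_ge0// heatf_ge0.
Qed.

Lemma integral_smear f g t : measurable_fun setT f -> measurable_fun setT g ->
  (forall y, 0 <= f y)%E -> (forall y, 0 <= g y)%E ->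
  (\int[m]_x (f x * smear t g x) =
   \int[leb]_r ((w r)%:E * \int[m]_x (f x * heatf m (t * r)%R g x)))%E.
Proof.
move=> mf mg f0 g0.
have mfh r : measurable_fun setT (fun x : Rn R n => f x * heatf m (t * r)%R g x)%E.
  apply: emeasurable_funM => //; apply: (measurable_heatf hm) => //.
transitivity (\int[m]_x \int[leb]_r ((w r)%:E * (f x * heatf m (t * r)%R g x)))%E.
  apply: eq_integral => x _; change (smear t g x) with (\int[leb]_r ((w r)%:E * heatf m (t * r)%R g x))%E.
  rewrite -ge0_integralZl//; first last.
  - by move=> r _; rewrite mule_ge0// heatf_ge0.
  - exact: (measurable_smear_integrand H).
  by apply: eq_integral => r _; rewrite muleCA.
rewrite (@tonelli _ _ (Rn R n) (measurableTypeR R) R m leb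
  (fun x r => (w r)%:E * (f x * heatf m (t * r)%R g x))%E).
- apply: eq_integral => r _; rewrite ge0_integralTZl//.
    by move=> x; rewrite mule_ge0// heatf_ge0.
  by have := w0 r; rewrite lee_fin.
- exact: sigma_finite_ref hm.
- exact: sigma_finite_leb.
- apply: emeasurable_funM; first exact: measurable_on_snd mw.
  apply: emeasurable_funM; first exact: measurable_on_fst mf.
  apply: (measurable_heatf hm) => //.
  by apply: measurable_funM => //; exact: measurable_snd.
- by move=> x r; rewrite !mule_ge0// heatf_ge0.
Qed.

Lemma integral_smearC f g t : measurable_fun setT f -> measurable_fun setT g ->
  (forall y, 0 <= f y)%E -> (forall y, 0 <= g y)%E ->
  (\int[m]_x (f x * smear t g x) = \int[m]_x (g x * smear t f x))%E.
Proof.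
move=> mf mg f0 g0; rewrite (integral_smear t mf mg f0 g0) (integral_smear t mg mf g0 f0).
apply: eq_integral => r _; congr (_ * _)%E.
by rewrite (integral_heatfC hm)//; apply: eq_integral => x _; rewrite muleC.
Qed.

Lemma integral_smear_rest f t mu : measurable_fun setT f -> (forall y, 0 <= f y)%E ->
  sigma_finite setT mu ->
  (\int[m]_x (f x * smear_rest t mu x) =
   (c * t `^ a)%:E * \int[leb]_s ((S s)%:E * \int[mu]_y heatf m (t * s)%R f y))%E.
Proof.
move=> mf f0 smu.
have ct0 : 0 <= c * t `^ a by rewrite mulr_ge0 ?powR_ge0// ltW// (rs_c_gt0 H).
transitivity (\int[m]_x ((c * t `^ a)%:E * \int[leb]_s ((S s)%:E * (f x * heatm (t * s)%R mu x))))%E.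
  apply: eq_integral => x _; rewrite muleCA; congr (_ * _)%E.
  rewrite -ge0_integralZl//; first last.
  - by move=> s _; rewrite mule_ge0// heatm_ge0.
  - apply: emeasurable_funM => //; exact: measurable_heatm_scale.
  by apply: eq_integral => s _; rewrite muleCA.
have mSfh : measurable_fun setT (fun p : Rn R n * measurableTypeR R =>
    (S p.2)%:E * (f p.1 * heatm (t * p.2)%R mu p.1))%E.
  apply: emeasurable_funM; first exact: measurable_on_snd mS.
  apply: emeasurable_funM; first exact: measurable_on_fst mf.
  apply: measurable_heatm => //.
  by apply: measurable_funM => //; exact: measurable_snd.
have Sfh0 x s : (0 <= (S s)%:E * (f x * heatm (t * s)%R mu x))%E.
  by rewrite mule_ge0// mule_ge0// heatm_ge0.
rewrite ge0_integralTZl//; first last.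
- by move=> x; apply: integral_ge0.
- by apply: (@measurable_tonelli _ _ (Rn R n) (measurableTypeR R) R leb
    (fun x s => (S s)%:E * (f x * heatm (t * s)%R mu x))%E) => //; exact: sigma_finite_leb.
congr (_ * _)%E.
rewrite (@tonelli _ _ (Rn R n) (measurableTypeR R) R m leb
    (fun x s => (S s)%:E * (f x * heatm (t * s)%R mu x))%E)//; first last.
- exact: sigma_finite_leb.
- exact: sigma_finite_ref hm.
apply: eq_integral => s _; rewrite ge0_integralTZl//; first last.
- by have := S0 s; rewrite lee_fin.
- by move=> x; rewrite mule_ge0// heatm_ge0.
- by apply: emeasurable_funM => //; apply: measurable_heatm.
by rewrite (integral_heatf_heatm hm _ mf f0 smu).
Qed.

Section setting.
Variables (mu : bmeasure R n) (v : Rn R n -> \bar R) (e rho : R).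
Hypothesis mufin : (mu setT < +oo)%E.
Hypothesis rho0 : 0 < rho.
Hypothesis muB : mu (~` ball (0%R : 'rV[R]_n) rho) = 0%E.
Hypothesis Efin : (energy (2 * a) mu < +oo)%E.
Hypothesis ev : excessive v.
Hypothesis uv : {ae mu, forall x, (pot mu x <= v x)%E}.
Hypothesis e0 : 0 < e.

Let smu : sigma_finite setT mu := finite_sigma_finite mufin.
Let u : Rn R n -> \bar R := pot mu.
(** The potential of a measure of bounded support vanishes at infinity, so the shift by e > 0 makes
    [f] vanish outside a ball and hence integrable. [W] is excessive as a minimum, and u = f + W. *)
Let V (x : Rn R n) := (v x + e%:E)%E.
Let W (x : Rn R n) := mine (u x) (V x).
Let f (x : Rn R n) := maxe (u x - V x)%E 0%E.
(** Since [f] is only known to be integrable, it is truncated at 1, which makes <g, g> finite. *)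
Let g (x : Rn R n) := mine (f x) 1%E.

Let eu : excessive u. Proof. exact (pot_excessive H smu). Qed.
Let eV : excessive V. Proof. exact (addcst_excessive H (ltW e0) ev). Qed.
Let eW : excessive W. Proof. exact (mine_excessive H eu eV). Qed.
Let mu_ : measurable_fun setT u. Proof. exact (exc_meas eu). Qed.
Let mV : measurable_fun setT V. Proof. exact (exc_meas eV). Qed.
Let mW : measurable_fun setT W. Proof. exact (exc_meas eW). Qed.
Let u0 x : (0 <= u x)%E. Proof. exact (exc_ge0 eu x). Qed.
Let V0 x : (0 <= V x)%E. Proof. exact (exc_ge0 eV x). Qed.
Let W0 x : (0 <= W x)%E. Proof. exact (exc_ge0 eW x). Qed.
Let mf : measurable_fun setT f.
Proof.
apply: measurable_maxe; last exact: measurable_cst.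
by apply: emeasurable_funB.
Qed.
Let f0 x : (0 <= f x)%E. Proof. by rewrite /f le_max lexx orbT. Qed.
Let mg : measurable_fun setT g.
Proof. by apply: measurable_mine => //; exact: measurable_cst. Qed.
Let g0 x : (0 <= g x)%E. Proof. by rewrite /g le_min f0 lee01. Qed.
Let g1 x : (g x <= 1)%E. Proof. by rewrite /g ge_min lexx orbT. Qed.
Let gf x : (g x <= f x)%E. Proof. by rewrite /g ge_min lexx. Qed.

Let uE x : u x = (f x + W x)%E. Proof. exact: maxe_mine_split. Qed.

Let uF : pot mu = (fun y => f y + W y)%E.
Proof. by apply/funext => y; exact: maxe_mine_split. Qed.

Let supp : exists2 r, 0 < r & forall x, ~ ball (0 : 'rV[R]_n) r x -> (u x < e%:E)%E.
Proof. exact (pot_vanish H e0 rho0 muB mufin). Qed.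

Let ufin : exists x, (u x < +oo)%E.
Proof.
have [r r0 ur] := supp; exists (const_mx r); apply: lt_trans (ltry e); apply: ur.
have n0 : (0 < n)%N by rewrite (leq_trans _ (rs_n H)).
case=> _ /(_ ord0 (Ordinal n0)); rewrite /ball/= !mxE sub0r normrN gtr0_norm//.
by rewrite ltxx.
Qed.

Let intf : (\int[m]_x f x < +oo)%E.
Proof.
have [r r0 ur] := supp; have [x ux] := ufin.
apply: le_lt_trans (excessive_locint H r eu ux).
rewrite [leRHS]integral_mkcond; apply: ge0_le_integral.
- exact: measurableT.
- by move=> y _; exact: f0.
- exact: mf.
- apply/(measurable_restrictT _ _).1.
    by apply: measurable_open; exact: ball_open.
  exact: measurable_funTS.
move=> y _; rewrite patchE; case: ifPn => yr.
  by rewrite uE leeDl.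
have {}yr : ~ ball (0 : 'rV[R]_n) r y by move=> ry; rewrite mem_set in yr.
rewrite /f ge_max lexx andbT sube_le0_of_le// (le_trans (ltW (ur y yr)))// leeDr//.
exact: exc_ge0 ev y.
Qed.


Let theta r := (\int[mu]_x heatf m r f x)%E.

Let theta0 r : (0 <= theta r)%E.
Proof. by apply: integral_ge0 => x _; apply: heatf_ge0 => y; exact: f0. Qed.

Let mheatf (h : Rn R n -> \bar R) r : measurable_fun setT h -> (forall x, 0 <= h x)%E ->
  measurable_fun setT (fun x : Rn R n => heatf m r h x).
Proof. by move=> mh h0; apply: (measurable_heatf hm). Qed.

Let thetaD r : 0 < r ->
  (theta r + \int[mu]_x heatf m r W x <= energy (2 * a) mu)%E.
Proof.
move=> r0; apply: le_trans (energy_heat_le H r0 smu).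
rewrite -ge0_integralD; first last.
- exact: mheatf.
- by move=> x _; apply: heatf_ge0 => y; exact: W0.
- exact: mheatf.
- by move=> x _; apply: heatf_ge0 => y; exact: f0.
- exact: measurableT.
rewrite le_eqVlt; apply/orP; left; apply/eqP; apply: eq_integral => x _.
rewrite -(@heatfD _ _ m r f W x mf mW f0 W0); congr heatf.
by apply/funext => y; exact: (esym (uE y)).
Qed.

Let theta_le r : 0 < r -> (theta r <= energy (2 * a) mu)%E.
Proof.
move=> r0; apply: le_trans (thetaD r0); rewrite leeDl//.
by apply: integral_ge0 => x _; apply: heatf_ge0 => y; exact: W0.
Qed.

(** The hypothesis on mu enters here: u <= v almost everywhere gives W = u there, so W integrates to
    the full energy. Lower semicontinuity keeps this in the lower limit of H_r W, while H_r u never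
    exceeds the energy; nothing is left for H_r f. *)
Let theta_cvg (r : nat -> R) : (forall k, 0 < r k) -> r @ \oo --> (0:R) ->
  theta (r k) @[k --> \oo] --> 0%E.
Proof.
move=> r0 rc; apply: (@cvg0_complement R (fun k => theta (r k))
  (fun k => \int[mu]_x heatf m (r k) W x)%E (energy (2 * a) mu) Efin).
- by move=> k; exact: (theta0 (r k)).
- by move=> k; apply: integral_ge0 => x _; apply: heatf_ge0 => y; exact: W0.
- by move=> k; exact: (thetaD (r0 k)).
have -> : energy (2 * a) mu = (\int[mu]_x W x)%E.
  apply: ae_eq_integral => //; apply: ae_imp uv => x uvx _.
  by rewrite /W min_l// (le_trans uvx)// leeDl// lee_fin ltW.
apply: le_integral_limn_einf => //.
- by move=> k; exact: mheatf.
- by move=> k x; apply: heatf_ge0 => y; exact: W0.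
by move=> x; apply: (heatf_lsc H) => //; exact: exc_lsc eW.
Qed.

Let rest t := (\int[leb]_s ((S s)%:E * theta (t * s)%R))%E.

Let ct0 t : 0 <= c * t `^ a.
Proof. by rewrite mulr_ge0 ?powR_ge0// ltW// (rs_c_gt0 H). Qed.

Let rest_cvg (t : nat -> R) : (forall k, 0 < t k) -> t @ \oo --> (0:R) ->
  rest (t k) @[k --> \oo] --> 0%E.
Proof.
move=> t0 tc.
have Ef : (energy (2 * a) mu)%E \is a fin_num.
  by rewrite ge0_fin_numE//; apply: integral_ge0 => x _; exact: u0.
(* [theta] is bounded by the energy at positive times only; cutting to s > 0 changes nothing because
   S vanishes elsewhere. *)
pose h (k : nat) (s : measurableTypeR R) :=
  ((S s)%:E * (if (0 < s)%R then theta (t k * s)%R else 0))%E.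
have restE k : rest (t k) = (\int[leb]_s h k s)%E.
  apply: eq_integral => s _; rewrite /h; case: ltP => // s0.
  by rewrite S_le0// mul0e mul0e.
have mtheta k : measurable_fun setT (fun s : measurableTypeR R => theta (t k * s)%R).
  apply: (@measurable_tonelli _ _ (measurableTypeR R) (Rn R n) R mu
    (fun s x => heatf m (t k * s)%R f x)) => //; last first.
    by move=> s x; apply: heatf_ge0 => y; exact: f0.
  apply: (measurable_heatf hm) => //.
  by apply: measurable_funM => //; exact: measurable_fst.
have mh k : measurable_fun setT (h k).
  apply: emeasurable_funM => //; apply: measurable_fun_ifT => //.
  exact: measurable_fun_ltr.
have h0 k s : (0 <= h k s)%E by rewrite /h mule_ge0//; case: ifP.
have hE k s : (h k s <= (S s)%:E * energy (2 * a) mu)%E.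
  rewrite /h; apply: lee_wpmul2l => //; case: ltP => s0.
    by apply: theta_le; rewrite mulr_gt0.
  by apply: integral_ge0 => x _; exact: u0.
have hcvg : {ae leb, forall s : measurableTypeR R, setT s -> h k s @[k --> \oo] --> cst 0%E s}.
  apply: aeW => s _; rewrite /h; case: ltP => s0; last first.
    by under eq_fun do rewrite mule0; exact: cvg_cst.
  rewrite /cst -(mule0 (S s)%:E); apply: cvgeMl => //; apply: theta_cvg.
    by move=> k; rewrite mulr_gt0.
  by rewrite -(mul0r s); apply: cvgMl.
have mSE : measurable_fun setT (fun s : measurableTypeR R => (S s)%:E * energy (2 * a) mu)%E.
  by apply: emeasurable_funM => //; exact: measurable_cst.
have iSE : leb.-integrable setT (fun s : measurableTypeR R => (S s)%:E * energy (2 * a) mu)%E.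
  apply/integrableP; split => //.
  under eq_integral => s _.
    rewrite gee0_abs; last by rewrite mule_ge0//; apply: integral_ge0 => x _; exact: u0.
    over.
  rewrite ge0_integralZr//; last by apply: integral_ge0 => x _; exact: u0.
  rewrite lte_mul_pinfty ?(tw_S_fin tw)//.
  - exact: integral_ge0.
  - by rewrite ge0_fin_numE ?(tw_S_fin tw)//; exact: integral_ge0.
have hb : {ae leb, forall s : measurableTypeR R, forall k, setT s ->
    (`|h k s| <= (S s)%:E * energy (2 * a) mu)%E}.
  by apply: aeW => s k _; rewrite gee0_abs.
have [_ _ hl] := @dominated_convergence _ (measurableTypeR R) R leb setT measurableT h
  (cst 0%E) (fun s => (S s)%:E * energy (2 * a) mu)%E mh (measurable_cst _) hcvg iSE hb.
rewrite (_ : (fun k => rest (t k)) = fun k => (\int[leb]_s h k s)%E); last first.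
  by apply/funext => k; exact: restE.
by move: hl; rewrite /= integral0.
Qed.

(** Subtracts P_t W <= W from the splitting of u = f + W; the subtraction needs W finite, which
    holds almost everywhere for [m]. *)
Let f_smear t : 0 < t ->
  {ae m, forall x, (f x <= smear t f x + smear_rest t mu x)%E}.
Proof.
move=> t0; have [z uz] := ufin; apply: ae_imp (excessive_ae_fin H eu uz) => x ux.
have Wx : W x \is a fin_num.
  by rewrite ge0_fin_numE//; apply: le_lt_trans ux; rewrite /W ge_min lexx.
have h1 : (f x + W x = smear t (pot mu) x + smear_rest t mu x)%E.
  by rewrite -uE; exact (pot_split H x t0 smu).
apply: (lee_cancel_split Wx h1).
rewrite uF (smearD H t x mf mW f0 W0); apply: leeD; first exact: lexx.
exact: exc_smear eW _ _ t0.
Qed.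

Let N := (\int[m]_x (g x * g x))%E.

Let mrest t : measurable_fun setT (fun x : Rn R n => smear_rest t mu x).
Proof.
apply: measurable_funeM.
apply: (@measurable_tonelli _ _ (Rn R n) (measurableTypeR R) R leb
  (fun x s => (S s)%:E * heatm (t * s)%R mu x)%E).
- exact: sigma_finite_leb.
- apply: emeasurable_funM; first exact: measurable_on_snd mS.
  apply: measurable_heatm => //.
  by apply: measurable_funM => //; exact: measurable_snd.
- by move=> x s; rewrite mule_ge0// heatm_ge0.
Qed.

Let rest0 t x : (0 <= smear_rest t mu x)%E.
Proof.
apply: mule_ge0; first by rewrite lee_fin ct0.
by apply: integral_ge0 => s _; rewrite mule_ge0// heatm_ge0.
Qed.

Let integral_rest t : (\int[m]_x (g x * smear_rest t mu x) <= (c * t `^ a)%:E * rest t)%E.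
Proof.
apply: (@le_trans _ _ (\int[m]_x (f x * smear_rest t mu x))%E).
  apply: ge0_le_integral.
  - exact: measurableT.
  - by move=> x _; rewrite mule_ge0.
  - exact: emeasurable_funM.
  - exact: emeasurable_funM.
  - by move=> x _; rewrite lee_wpmul2r.
by rewrite (integral_smear_rest t mf f0 smu).
Qed.

(* Truncation decreases the Dirichlet form: [(f - g) * (1 - P g) >= 0] since
   [P g <= 1] and [g = 1] wherever [f > g]. *)
Let trunc (q : \bar R) x : (0 <= q <= 1)%E ->
  (g x * g x + f x * q <= g x * q + f x * g x)%E.
Proof.
move=> /andP[q0 q1]; rewrite /g; have [f1|f1] := leP (f x) 1%E.
  by rewrite addeC.
case: q q0 q1 => [q| |]//; rewrite !lee_fin => q0 q1; rewrite !mul1e mule1.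
case: (f x) f1 (f0 x) => [r| |]//; last first.
  by move=> _ _; rewrite (_ : (q%:E + +oo)%E = +oo%E) ?leey// addey.
rewrite lte_fin -EFinM -!EFinD lee_fin => r1 _.
exact: trunc_real.
Qed.

Let smear_g t x : 0 < t -> (0 <= smear t g x <= 1)%E.
Proof.
move=> t0; apply/andP; split; first by apply: smear_ge0 H _ _ _ _.
by rewrite -[leRHS](smear_cst H x t0 lee01); apply: (le_smear H).
Qed.

(** Testing [f_smear] against g gives <f, g> <= <f, P_t g> + c t^a rest(t) by symmetry of P_t.
    [trunc] transfers this from f to g once the finite number X = <f, P_t g> is added to both
    sides. *)
Let Nsmear t : 0 < t ->
  (N <= \int[m]_x (g x * smear t g x) + (c * t `^ a)%:E * rest t)%E.
Proof.
move=> t0; have msg : measurable_fun setT (fun x : Rn R n => smear t g x).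
  exact: (measurable_smear H).
have msf : measurable_fun setT (fun x : Rn R n => smear t f x).
  exact: (measurable_smear H).
have sg0 x : (0 <= smear t g x)%E by have /andP[] := smear_g x t0.
have sf0 x : (0 <= smear t f x)%E by apply: smear_ge0 H _ _ _ _.
have mfs : measurable_fun setT (fun x : Rn R n => f x * smear t g x)%E.
  exact: emeasurable_funM mf msg.
have mgs : measurable_fun setT (fun x : Rn R n => g x * smear t g x)%E.
  exact: emeasurable_funM mg msg.
have mgsf : measurable_fun setT (fun x : Rn R n => g x * smear t f x)%E.
  exact: emeasurable_funM mg msf.
have mgg : measurable_fun setT (fun x : Rn R n => g x * g x)%E.
  exact: emeasurable_funM mg mg.
have mfg : measurable_fun setT (fun x : Rn R n => f x * g x)%E.
  exact: emeasurable_funM mf mg.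
have mgr : measurable_fun setT (fun x : Rn R n => g x * smear_rest t mu x)%E.
  exact: emeasurable_funM mg (mrest t).
have pos (h k : Rn R n -> \bar R) : (forall x, 0 <= h x)%E -> (forall x, 0 <= k x)%E ->
    forall x, setT x -> (0 <= h x * k x)%E by move=> h0 k0 x _; rewrite mule_ge0.
have intD (h k : Rn R n -> \bar R) : measurable_fun setT h -> measurable_fun setT k ->
    (forall x, setT x -> 0 <= h x)%E -> (forall x, setT x -> 0 <= k x)%E ->
    (\int[m]_x (h x + k x) = \int[m]_x h x + \int[m]_x k x)%E.
  by move=> mh mk h0 k0; rewrite (ge0_integralD m measurableT h0 mh k0 mk).
set X := (\int[m]_x (f x * smear t g x))%E.
have Xfin : X \is a fin_num.
  rewrite ge0_fin_numE; last by apply: integral_ge0; exact: (pos _ _ f0 sg0).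
  apply: le_lt_trans intf; apply: ge0_le_integral.
  - exact: measurableT.
  - exact: (pos _ _ f0 sg0).
  - exact: mfs.
  - exact: mf.
  - move=> x _; rewrite -[leRHS]mule1; apply: lee_wpmul2l; first exact: f0.
    by have /andP[] := smear_g x t0.
rewrite -(leeD2rE _ _ Xfin) /N -(intD _ _ mgg mfs (pos _ _ g0 g0) (pos _ _ f0 sg0)).
apply: (@le_trans _ _ (\int[m]_x (g x * smear t g x + f x * g x))%E).
  apply: ge0_le_integral.
  - exact: measurableT.
  - by move=> x _; rewrite adde_ge0// mule_ge0.
  - exact: emeasurable_funD mgg mfs.
  - exact: emeasurable_funD mgs mfg.
  - by move=> x _; apply: trunc; exact: smear_g.
rewrite (intD _ _ mgs mfg (pos _ _ g0 sg0) (pos _ _ f0 g0)) -[leRHS]addeA.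
apply: leeD; first exact: lexx.
apply: (@le_trans _ _ (\int[m]_x (g x * smear t f x + g x * smear_rest t mu x))%E).
  apply: ae_le_integral.
  - exact: mfg.
  - exact: emeasurable_funD mgsf mgr.
  - by move=> x; rewrite mule_ge0.
  - by move=> x; rewrite adde_ge0// mule_ge0.
  - apply: ae_imp (f_smear t0) => x fx.
    by rewrite -ge0_muleDr// muleC lee_wpmul2l.
rewrite (intD _ _ mgsf mgr (pos _ _ g0 sf0) (pos _ _ g0 (rest0 t))).
rewrite (integral_smearC t mg mf g0 f0) -/X addeC; apply: leeD; last exact: lexx.
exact: integral_rest.
Qed.


Let phi r := (\int[m]_x (g x * heatf m r g x))%E.
Let phi0 r : (0 <= phi r)%E.
Proof. by apply: integral_ge0 => x _; rewrite mule_ge0// heatf_ge0. Qed.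

Let phi_le r : 0 < r -> (phi r <= N)%E.
Proof. by move=> r0; exact (integral_heatf_sqr_le hm r0 mg g0). Qed.

Let Nfin : N \is a fin_num.
Proof.
rewrite ge0_fin_numE; last by apply: integral_ge0 => x _; rewrite mule_ge0.
apply: le_lt_trans intf; apply: ge0_le_integral.
- exact: measurableT.
- by move=> x _; rewrite mule_ge0.
- exact: (emeasurable_funM mg mg).
- exact: mf.
- move=> x _; apply: (@le_trans _ _ (g x)); last exact: gf.
  by rewrite -[leRHS]mule1; apply: lee_wpmul2l; [exact: g0|exact: g1].
Qed.

Let phi_fin r : 0 < r -> phi r \is a fin_num.
Proof.
move=> r0; rewrite ge0_fin_numE; last exact: phi0.
by apply: (le_lt_trans (phi_le r0)); rewrite -ge0_fin_numE//; apply: integral_ge0 => x _; rewrite mule_ge0.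
Qed.

(** The semigroup law gives phi(2r) = <H_r g, H_r g>, so this is 2ab <= a^2 + b^2; it makes psi(2r)
    <= 2 psi(r). *)
Let phi_doubling r : 0 < r -> (2%:E * phi r <= N + phi (2 * r)%R)%E.
Proof.
move=> r0; have mh : measurable_fun setT (fun x : Rn R n => heatf m r g x).
  exact (mheatf r mg g0).
have h0 x : (0 <= heatf m r g x)%E by exact: heatf_ge0.
have -> : phi (2 * r) = (\int[m]_x (heatf m r g x * heatf m r g x))%E.
  rewrite -(integral_heatfC hm r mg mh g0 h0); apply: eq_integral => x _.
  by rewrite (heatf_heatf hm x r0 r0 mg g0) mulr_natl mulr2n.
have mgh : measurable_fun setT (fun x : Rn R n => g x * heatf m r g x)%E.
  exact (emeasurable_funM mg mh).
have mgg : measurable_fun setT (fun x : Rn R n => g x * g x)%E.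
  exact (emeasurable_funM mg mg).
have mhh : measurable_fun setT (fun x : Rn R n => heatf m r g x * heatf m r g x)%E.
  exact (emeasurable_funM mh mh).
have p1 x : (0 <= g x * heatf m r g x)%E by rewrite mule_ge0.
rewrite -(ge0_integralTZl m mgh p1)// -ge0_integralD; first last.
- exact: mhh.
- by move=> x _; rewrite mule_ge0.
- exact: mgg.
- by move=> x _; rewrite mule_ge0.
- exact: measurableT.
apply: ge0_le_integral.
- exact: measurableT.
- by move=> x _; rewrite mule_ge0.
- exact: (measurable_funeM _ mgh).
- exact: (emeasurable_funD mgg mhh).
- by move=> x _; apply: mule_amgm.
Qed.

Let psi r : \bar R := if (0 < r)%R then (N - phi r)%E else 0%E.

Let psi0 r : (0 <= psi r)%E.
Proof. by rewrite /psi; case: ifPn => // r0; rewrite sube_ge0 ?Nfin ?orbT// phi_le. Qed.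

Let mphi t : measurable_fun setT (fun r : measurableTypeR R => phi (t * r)%R).
Proof. exact: measurable_form_heatf. Qed.

Let mpsi : measurable_fun setT (psi : measurableTypeR R -> \bar R).
Proof.
apply: measurable_fun_ifT; first exact: measurable_fun_ltr.
  apply: emeasurable_funB; first exact: measurable_cst.
  by apply: (eq_measurable_fun _ _ (mphi 1)) => r _; rewrite /= mul1r.
exact: measurable_cst.
Qed.

Let psi_doubling r : 0 < r -> (psi (2 * r)%R <= 2%:E * psi r)%E.
Proof.
move=> r0; rewrite /psi mulr_gt0// r0.
have r2 : 0 < 2 * r by rewrite mulr_gt0.
by apply: lee_double_gap; [exact: Nfin|exact: phi_fin|exact: phi_fin|exact: phi_doubling].
Qed.

(** This is <g, g> - <g, P_t g> by [I_split]; in terms of psi the doubling property of the weight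
    applies. *)
Let I t := (\int[leb]_r ((w r)%:E * psi (t * r)%R))%E.

Let I0 t : (0 <= I t)%E.
Proof. by apply: integral_ge0 => r _; rewrite mule_ge0. Qed.

Let mwpsi t : measurable_fun setT (fun r : measurableTypeR R => (w r)%:E * psi (t * r)%R)%E.
Proof.
apply: (emeasurable_funM mw); apply: (@measurableT_comp _ _ _ _ _ _ psi) => //.
Qed.

Let I_split t : 0 < t ->
  (I t + \int[m]_x (g x * smear t g x) = N)%E.
Proof.
move=> t0; rewrite (integral_smear t mg mg g0 g0) -ge0_integralD; first last.
- by apply: (emeasurable_funM mw); exact: mphi.
- by move=> r _; rewrite mule_ge0//; exact: phi0.
- exact: mwpsi.
- by move=> r _; rewrite mule_ge0.
- exact: measurableT.
transitivity (\int[leb]_r ((w r)%:E * N))%E.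
  apply: eq_integral => r _; have [r1|r1] := leP r 1.
    by rewrite (tw_w_le1 tw r1) !mul0e adde0.
  have tr : 0 < t * r by rewrite mulr_gt0// (lt_trans _ r1).
  rewrite -ge0_muleDr; [|exact: psi0|exact: phi0].
  by rewrite /psi tr -/(phi (t * r)) subeK// phi_fin.
rewrite ge0_integralZr//; last by apply: integral_ge0 => x _; rewrite mule_ge0.
by rewrite (tw_w_mass tw) mul1e.
Qed.

Let smear_fin t : 0 < t -> (\int[m]_x (g x * smear t g x))%E \is a fin_num.
Proof.
move=> t0; have sg0 x : (0 <= smear t g x)%E by have /andP[] := smear_g x t0.
have i0 : (0 <= \int[m]_x (g x * smear t g x))%E.
  by apply: integral_ge0 => x _; rewrite mule_ge0.
rewrite ge0_fin_numE//; apply: (@le_lt_trans _ _ N).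
  by rewrite -(I_split t0) leeDr.
by rewrite -ge0_fin_numE//; apply: integral_ge0 => x _; rewrite mule_ge0.
Qed.

Let I_le t : 0 < t -> (I t <= (c * t `^ a)%:E * rest t)%E.
Proof.
move=> t0; rewrite -(leeD2rE _ _ (smear_fin t0)) (I_split t0) addeC.
exact: Nsmear.
Qed.

Let I_iter k t : 0 < t -> (I t <= ((2 `^ a) ^+ k)%:E * I (t / 2 ^+ k)%R)%E.
Proof.
elim: k t => [|k IH] t t0; first by rewrite expr0 mul1e divr1.
have t2 : 0 < t / 2 by rewrite divr_gt0.
have := tw_doubling tw mpsi psi0 psi_doubling t2.
rewrite (_ : 2 * (t / 2) = t); last by rewrite mulrC divfK.
move=> /le_trans; apply; rewrite exprS EFinM -muleA.
apply: lee_wpmul2l; first by rewrite lee_fin powR_ge0.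
have -> : t / 2 ^+ k.+1 = t / 2 / 2 ^+ k by rewrite exprS invfM mulrA.
exact: IH.
Qed.

(** The factor 2^(ak) from k doublings cancels against (t / 2^k)^a in [I_le], leaving c t^a rest(t /
    2^k), which tends to 0. *)
Let I_eq0 t : 0 < t -> I t = 0%E.
Proof.
move=> t0; apply/eqP; rewrite eq_le I0 andbT.
have tk k : 0 < t / 2 ^+ k by rewrite divr_gt0// exprn_gt0.
have tc : (t / 2 ^+ k) @[k --> \oo] --> (0:R).
  rewrite -(mulr0 t); apply: cvgMr.
  under eq_fun do rewrite -exprVn.
  by apply: cvg_expr; rewrite ger0_norm// invf_lt1// ltr1n.
have h : ((c * t `^ a)%:E * rest (t / 2 ^+ k)%R)%E @[k --> \oo] --> 0%E.
  rewrite -(mule0 (c * t `^ a)%:E); apply: cvgeMl => //.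
  exact: rest_cvg.
rewrite -(cvg_lim _ h)//; apply: lime_ge; first exact: cvgP h.
apply: nearW => k; apply: (le_trans (I_iter k t0)).
apply: (le_trans (lee_wpmul2l _ (I_le (tk k)))); first by rewrite lee_fin exprn_ge0// powR_ge0.
rewrite muleA -EFinM le_eqVlt; apply/orP; left; apply/eqP; congr (_%:E * _)%E.
rewrite mulrCA; congr (_ * _).
exact: powR_dyadic.
Qed.

Let G := (\int[m]_x g x)%E.

Let Gfin : G \is a fin_num.
Proof.
rewrite ge0_fin_numE; last by apply: integral_ge0.
apply: le_lt_trans intf; apply: ge0_le_integral => //.
Qed.

Let phi_inv s : 1 <= s -> (phi s <= (s^-1)%:E * (G * G))%E.
Proof.
move=> s1; have s0 : 0 < s by rewrite (lt_le_trans _ s1).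
have hG x : (heatf m s g x <= (s^-1)%:E * G)%E.
  rewrite -(ge0_integralTZl m mg g0); last by rewrite invr_ge0 ltW.
  apply: ge0_le_integral.
  - exact: measurableT.
  - by move=> y _; rewrite mule_ge0// lee_fin heat_ge0.
  - by apply: emeasurable_funM => //; apply: measurable_heatE.
  - exact: measurable_funeM.
  - move=> y _; apply: lee_wpmul2r; first exact: g0.
    by rewrite lee_fin; exact (heat_le_inv _ _ (rs_n H) s1).
rewrite muleCA.
apply: (@le_trans _ _ (\int[m]_x (g x * ((s^-1)%:E * G)))%E).
  apply: ge0_le_integral.
  - exact: measurableT.
  - by move=> x _; rewrite mule_ge0// heatf_ge0.
  - by apply: (emeasurable_funM mg); exact (mheatf s mg g0).
  - by apply: (emeasurable_funM mg); exact: measurable_cst.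
  - by move=> x _; apply: lee_wpmul2l.
rewrite ge0_integralZr//.
by rewrite mule_ge0 ?lee_fin ?invr_ge0 ?(ltW s0)//; apply: integral_ge0.
Qed.

(** I t = 0 means <g, g> = <g, P_t g> for every t > 0, and the right side decays like 1/t because
    the heat kernel at time s >= 1 is at most 1/s and g is integrable. *)
Let N_inv t : 1 <= t -> (N <= (t^-1)%:E * (G * G))%E.
Proof.
move=> t1; have t0 : 0 < t by rewrite (lt_le_trans _ t1).
have G0 : (0 <= G)%E by apply: integral_ge0.
have GG0 : (0 <= (t^-1)%:E * (G * G))%E by rewrite !mule_ge0// lee_fin invr_ge0 ltW.
rewrite -(I_split t0) (I_eq0 t0) add0e (integral_smear t mg mg g0 g0).
apply: (@le_trans _ _ (\int[leb]_r ((w r)%:E * ((t^-1)%:E * (G * G))))%E).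
  apply: ge0_le_integral.
  - exact: measurableT.
  - by move=> r _; rewrite mule_ge0//; exact: phi0.
  - by apply: (emeasurable_funM mw); exact: mphi.
  - by apply: (emeasurable_funM mw); exact: measurable_cst.
  move=> r _; have [r1|r1] := leP r 1.
    by rewrite (tw_w_le1 tw r1) !mul0e.
  apply: lee_wpmul2l => //; have tr : 1 <= t * r by rewrite mulr_ege1// ltW.
  apply: (le_trans (phi_inv tr)); apply: lee_wpmul2r; first by rewrite mule_ge0.
  rewrite lee_fin lef_pV2 ?posrE ?(lt_le_trans _ tr)//.
  by rewrite ler_peMr// ltW.
by rewrite ge0_integralZr// (tw_w_mass tw) mul1e.
Qed.

Let N_eq0 : N = 0%E.
Proof.
apply/eqP; rewrite eq_le; apply/andP; split; last first.
  by apply: integral_ge0 => x _; rewrite mule_ge0.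
have h : (((k.+1)%:R^-1)%:E * (G * G))%E @[k --> \oo] --> 0%E.
  rewrite -(mul0e (G * G)%E); apply: cvgeMr; first by rewrite fin_numM.
  by apply: cvg_EFin; [exact: nearW|exact: cvg_harmonic].
rewrite -(cvg_lim _ h)//; apply: lime_ge; first exact: cvgP h.
by apply: nearW => k; apply: N_inv; rewrite ler1n.
Qed.

Lemma domination_shift x : (pot mu x <= v x + e%:E)%E.
Proof.
apply: (excessive_ae_le H eu eV) => {x}.
have := @integral0_ae _ _ _ m (fun x => g x * g x)%E (emeasurable_funM mg mg) _ N_eq0.
have gg0 x : (0 <= g x * g x)%E by rewrite mule_ge0.
move=> /(_ gg0); apply: ae_imp => x /eqP; rewrite mule_eq0 orbb => /eqP gx.
have fx : f x = 0%E.
  by move: gx; rewrite /g /mine; case: ifP => // _ /eqP; rewrite onee_eq0.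
by rewrite uE fx add0e /W ge_min lexx orbT.
Qed.

End setting.

Lemma domination mu v (rho : R) : (mu setT < +oo)%E -> 0 < rho ->
  mu (~` ball (0%R : 'rV[R]_n) rho) = 0%E -> (energy (2 * a) mu < +oo)%E ->
  excessive v -> {ae mu, forall x, (pot mu x <= v x)%E} ->
  forall x, (pot mu x <= v x)%E.
Proof.
move=> mufin rho0 muB Efin ev uv x; apply/lee_addgt0Pr => e e0.
exact (domination_shift mufin rho0 muB Efin ev uv e0 x).
Qed.

End domination.

(** * Vague limits along an ultrafilter *)

Lemma midpoint_gt (R : realType) (q r : R) : q < r -> q < r - (r - q) / 2.
Proof. lra. Qed.

Section ultralimit.
Context (R : realType) (n : nat) (F : set_system nat).
Hypothesis FU : UltraFilter F.
Variable mu : nat -> bmeasure R n.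
Hypothesis bnd : forall r : R, exists M : R, forall k,
  (mu k (ball (0%R : 'rV[R]_n) r) <= M%:E)%E.
Implicit Types (X Y V W O : set 'rV[R]_n) (K : set 'rV[R]_n).

Let FF : ProperFilter F := ultra_proper.

(** A closed bounded interval is compact, so an ultrafilter has a cluster point there and converges
    to it. *)
Lemma ultra_bounded_cvg (u : nat -> R) (M : R) : (forall k, `|u k| <= M) ->
  exists l : R, u @ F --> l.
Proof.
move=> uM; have cM : compact `[- M, M]%classic by exact: segment_compact.
have FM : F (u @^-1` `[- M, M]%classic).
  by apply: filterE => k; rewrite /= in_itv/= -ler_norml; exact: uM.
have [p [_ clp]] := cM _ (fmap_proper_filter u FF) FM.
exists p => V Vp; have [//|nV] := in_ultra_setVsetC (u @^-1` V) FU.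
by have [q [nVq Vq]] := clp (~` V) V nV Vp.
Qed.

Definition bounded_borel X :=
  measurable (X : set (Rn R n)) /\ exists r : R, X `<=` ball (0%R : 'rV[R]_n) r.

(* The limit measure is the Caratheodory extension of the set function [ultramass]
   on bounded open sets; [ultramass] itself is only finitely additive. *)
Definition ultramass X : R := lim ((fun k => fine (mu k X)) @ F).

Let mball (r : R) : measurable (ball (0%R : 'rV[R]_n) r : set (Rn R n)).
Proof. by apply: measurable_open; exact: ball_open. Qed.

Lemma bounded_borel_fin X k : bounded_borel X -> mu k X \is a fin_num.
Proof.
move=> [mX [r Xr]]; have [M muM] := bnd r.
rewrite ge0_fin_numE//; apply: le_lt_trans (ltry M); apply: le_trans (muM k).
exact: le_measure (mem_set mX) (mem_set (mball r)) Xr.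
Qed.

Lemma ultramass_cvg X : bounded_borel X -> fine (mu k X) @[k --> F] --> ultramass X.
Proof.
move=> bX; have [mX [r Xr]] := bX; have [M muM] := bnd r.
have [|l ul] := @ultra_bounded_cvg (fun k => fine (mu k X)) M.
  move=> k; rewrite ger0_norm ?fine_ge0// -lee_fin fineK ?bounded_borel_fin//.
  by apply: le_trans (muM k); exact: le_measure (mem_set mX) (mem_set (mball r)) Xr.
by rewrite /ultramass (cvg_lim _ ul).
Qed.

Lemma ultramass_ge0 X : bounded_borel X -> 0 <= ultramass X.
Proof.
move=> bX; apply: limr_ge; first exact: cvgP (ultramass_cvg bX).
by apply: nearW => k; rewrite fine_ge0.
Qed.

Lemma sub_bounded_borel X Y : measurable (X : set (Rn R n)) -> X `<=` Y ->
  bounded_borel Y -> bounded_borel X.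
Proof. by move=> mX XY [_ [r Yr]]; split => //; exists r; exact: subset_trans Yr. Qed.

Lemma le_ultramass X Y : measurable (X : set (Rn R n)) -> bounded_borel Y -> X `<=` Y ->
  ultramass X <= ultramass Y.
Proof.
move=> mX bY XY; have bX := sub_bounded_borel mX XY bY.
apply: ler_lim; [exact: cvgP (ultramass_cvg bX)|exact: cvgP (ultramass_cvg bY)|].
apply: nearW => k; apply: fine_le; try exact: bounded_borel_fin.
exact: le_measure (mem_set mX) (mem_set bY.1) XY.
Qed.

Lemma ultramass_le_add X Y Z : bounded_borel X -> bounded_borel Y ->
  measurable (Z : set (Rn R n)) -> Z `<=` X `|` Y ->
  ultramass Z <= ultramass X + ultramass Y.
Proof.
move=> bX bY mZ ZXY; have [mX [r Xr]] := bX; have [mY [q Yq]] := bY.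
have bZ : bounded_borel Z.
  split => //; exists (Num.max r q) => x /ZXY[/Xr|/Yq]; apply: le_ball.
    by rewrite le_max lexx.
  by rewrite le_max lexx orbT.
apply: (ler_cvg_to (ultramass_cvg bZ) (cvgD (ultramass_cvg bX) (ultramass_cvg bY))).
apply: nearW => k; rewrite -lee_fin EFinD !fineK; try exact: bounded_borel_fin.
apply: (@le_trans _ _ (mu k (X `|` Y))).
  by apply: le_measure => //; rewrite inE//; exact: measurableU.
exact: measureU2.
Qed.

Lemma add_ultramass_le X Y Z : measurable (X : set (Rn R n)) ->
  measurable (Y : set (Rn R n)) -> bounded_borel Z -> X `&` Y = set0 ->
  X `|` Y `<=` Z -> ultramass X + ultramass Y <= ultramass Z.
Proof.
move=> mX mY bZ XY0 XYZ.
have bX : bounded_borel X by apply: sub_bounded_borel bZ => // x Xx; apply: XYZ; left.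
have bY : bounded_borel Y by apply: sub_bounded_borel bZ => // x Yx; apply: XYZ; right.
apply: (ler_cvg_to (cvgD (ultramass_cvg bX) (ultramass_cvg bY)) (ultramass_cvg bZ)).
apply: nearW => k; rewrite -lee_fin EFinD !fineK; try exact: bounded_borel_fin.
rewrite -measureU//; apply: le_measure => //; rewrite inE; [exact: measurableU|exact: bZ.1].
Qed.

Lemma ultramass0 : ultramass set0 = 0.
Proof.
have b0 : bounded_borel set0 by split => //; exists 0.
apply/eqP; rewrite eq_le ultramass_ge0// andbT.
have := @add_ultramass_le set0 set0 set0 measurable0 measurable0 b0 (set0I _).
rewrite setU0 => /(_ (@subset_refl _ _)); lra.
Qed.

Let bo X := open X /\ exists r : R, X `<=` ball (0%R : 'rV[R]_n) r.

Let bob X : bo X -> bounded_borel X.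
Proof. by move=> [oX rX]; split => //; exact: measurable_open. Qed.

(** The value +oo elsewhere leaves only covers by bounded open sets in the infimum defining
    [mu_ext]. *)
Let tau (X : set (Rn R n)) : \bar R := if `[< bo X >] then (ultramass X)%:E else +oo%E.

Let tauE X : bo X -> tau X = (ultramass X)%:E.
Proof. by move=> bX; rewrite /tau asboolT. Qed.

Let bo0 : bo set0. Proof. by split; [exact: open0|exists 0]. Qed.

Let tau0 : tau set0 = 0%E.
Proof. by rewrite tauE// ultramass0. Qed.

Let tau_ge0 X : (0 <= tau X)%E.
Proof.
rewrite /tau; case: ifPn => [/asboolP bX|_]; last exact: leey.
by rewrite lee_fin ultramass_ge0//; exact: bob.
Qed.

Let f1 : (mu_ext tau) set0 = 0%E. Proof. exact: (@mu_ext0 _ _ _ tau tau0 tau_ge0). Qed.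
Let f2 X : (0 <= (mu_ext tau) X)%E. Proof. exact: (@mu_ext_ge0 _ _ _ tau tau_ge0). Qed.
Let f3 : {homo (mu_ext tau) : A B / A `<=` B >-> (A <= B)%E}. Proof. exact: (@le_mu_ext _ _ _ tau). Qed.
Let f4 : sigma_subadditive (mu_ext tau). Proof. exact: (@mu_ext_sigma_subadditive _ _ _ tau tau_ge0). Qed.
Let om : {outer_measure set (Rn R n) -> \bar R} := HB.pack (mu_ext tau)
  (isOuterMeasure.Build R (Rn R n) (mu_ext tau) f1 f2 f3 f4).

Let om_open V : bo V -> (om V <= (ultramass V)%:E)%E.
Proof.
move=> bV; rewrite -tauE//; apply: ereal_inf_lbound.
exists (fun k : nat => if k is 0%N then (V : set (Rn R n)) else set0).
  split; first by case=> [|k]; [apply: measurable_open; case: bV|exact: measurable0].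
  by move=> x Vx; exists 0%N.
rewrite nneseries_recl//.
rewrite eseries_cond/= eseries0 ?adde0// => -[|k]//= _ _; exact: tau0.
Qed.

(** Compactness makes a countable open cover finite, so the finite subadditivity of [ultramass] is
    enough. *)
Let om_compact K : compact K -> ((ultramass K)%:E <= om K)%E.
Proof.
move=> cK; apply: le_ereal_inf_tmp => _ [A [mA KA] <-].
have [bA|/existsNP[k nbA]] := pselect (forall k, bo (A k)); last first.
  rewrite (@eseries_pinfty _ _ _ k) ?leey// => [j _|].
    by rewrite -ltNye (lt_le_trans _ (tau_ge0 _)).
  by rewrite /tau asboolF.
have [D _ KD] : finite_subset_cover setT A K.
  have := cK; rewrite compact_cover => /(_ nat setT A); apply => //.
  by move=> k _; exact: (bA k).1.
pose N := (\max_(i <- finmap.enum_fset D) i).+1.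
have KN : K `<=` \big[setU/set0]_(i < N) A i.
  move=> x /KD[i /= iD Ai]; rewrite -bigcup_mkord; exists i => //=.
  by rewrite ltnS; exact: leq_bigmax_seq.
apply: (@le_trans _ _ (\sum_(0 <= i < N) tau (A i))%E); last first.
  by apply: nneseries_lim_ge => i _ _; exact: tau_ge0.
have mK : measurable (K : set (Rn R n)) by exact: measurable_compact.
rewrite big_mkord; elim: N K mK KN {cK KA KD} => [|N IH] K mK KN.
  rewrite big_ord0; rewrite big_ord0 in KN.
  have -> : K = set0 by apply/seteqP; split.
  by rewrite ultramass0.
rewrite big_ord_recr/= (tauE (bA N)).
have bU p : bounded_borel (\big[setU/set0]_(i < p) A i).
  elim: p => [|p [mU [r Ur]]]; first by rewrite big_ord0; exact: bob bo0.
  rewrite big_ord_recr/=; split; first exact: measurableU.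
  have [q Aq] := (bA p).2; exists (Num.max r q) => x [/Ur|/Aq]; apply: le_ball.
    by rewrite le_max lexx.
  by rewrite le_max lexx orbT.
rewrite big_ord_recr/= in KN.
apply: (@le_trans _ _ ((ultramass (\big[setU/set0]_(i < N) A i))%:E + (ultramass (A N))%:E)%E).
  by rewrite -EFinD lee_fin; apply: ultramass_le_add => //; exact: bob.
by rewrite leeD2r//; apply: IH => //; exact: (bU N).1.
Qed.

Section shells.
Variables (V O : set 'rV[R]_n).
Hypotheses (bV : bo V) (oO : open O).
Let W := V `&` O.
(** Points of W further than 1/(j+1) from its complement; [C j] allows equality. The open [I j] and
    closed [C j] interlace, so that removing a [C j] leaves disjoint open pieces, on which
    [ultramass] is superadditive. *)
Let I j := [set x : 'rV[R]_n | exists r : R, j.+1%:R^-1 < r /\ ball x r `<=` W].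
Let C j := [set x : 'rV[R]_n | ball x (j.+1%:R^-1 : R) `<=` W].

Let j0 j : 0 < j.+1%:R^-1 :> R. Proof. by rewrite invr_gt0. Qed.

Let oI j : open (I j).
Proof.
rewrite openE => x [r [jr xr]]; rewrite /interior.
have d0 : 0 < (r - j.+1%:R^-1) / 2 by rewrite divr_gt0// subr_gt0.
apply: filterS (nbhsx_ballx x _ d0) => y xy.
exists (r - (r - j.+1%:R^-1) / 2); split; first exact: midpoint_gt.
move=> z yz; apply: xr; have := ball_triangle xy yz.
by apply: le_ball; rewrite addrC subrK.
Qed.

Let cC j : closed (C j).
Proof.
rewrite (_ : C j = \bigcap_(z in ~` W) ~` ball z (j.+1%:R^-1 : R)).
  by apply: closed_bigI => z _; apply: open_closedC; exact: ball_open.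
apply/seteqP; split => [x xW z nz zx|x xz y xy].
  by apply: nz; apply: xW; exact: ball_sym.
by apply: contrapT => ny; apply: (xz y ny); exact: ball_sym.
Qed.

Let IC j : I j `<=` C j.
Proof. by move=> x [r [jr xr]] y xy; apply: xr; exact: le_ball (ltW jr) _ xy. Qed.

Let CI j : C j `<=` I j.+1.
Proof.
move=> x xC; exists j.+1%:R^-1; split => //.
by rewrite ltf_pV2 ?posrE// ltr_nat.
Qed.

Let CW j : C j `<=` W.
Proof. by move=> x; apply; exact: ballxx. Qed.

Let IW j : I j `<=` V.
Proof. by move=> x /IC/CW[]. Qed.

Let I_cover x : W x -> exists j, I j x.
Proof.
have oW : open W by apply: openI => //; exact: bV.1.
move=> Wx; have /nbhs_ballP[r /= r0 xr] := open_nbhs_nbhs (conj oW Wx).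
have [j jr] := @ltr_add_invr R 0 r r0; exists j; exists r; split => //.
by rewrite add0r in jr.
Qed.

Let A j := I j.+2 `\` C j.

Let oA j : open (A j).
Proof. by apply: openI; [exact: oI|exact: closed_openC]. Qed.

Let boI j : bo (I j).
Proof. by split => //; have [_ [r Vr]] := bV; exists r => x Ix; exact: Vr (IW Ix). Qed.

Let boA j : bo (A j).
Proof. by split => //; have [_ [r Ir]] := boI j.+2; exists r => x [/Ir]. Qed.

Let A_le j : ultramass (A j) <= ultramass (I j.+2) - ultramass (I j).
Proof.
rewrite lerBrDr; apply: add_ultramass_le.
- by apply: measurable_open; exact: oA.
- by apply: measurable_open; exact: oI.
- exact: bob (boI _).
- by apply/seteqP; split => // x [[_ nC] /IC].
- by move=> x [[]//|/IC/CI/IC/CI].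
Qed.

(** The bounds [A_le] telescope with step two: shells two apart are disjoint, so the mass of V is
    counted at most twice. *)
Let A_sum N : \sum_(j < N) ultramass (A j) <= ultramass (I N) + ultramass (I N.+1).
Proof.
elim: N => [|N IH]; last by rewrite big_ord_recr/=; have := A_le N; lra.
by rewrite big_ord0; apply: addr_ge0; apply: ultramass_ge0; apply: bob; exact: boI.
Qed.

Let A_series : (\sum_(0 <= j <oo) om (A j) < +oo)%E.
Proof.
apply: (@le_lt_trans _ _ (2 * ultramass V)%:E); last exact: ltry.
apply: lime_le; first by apply: is_cvg_nneseries => j _ _; exact: outer_measure_ge0.
apply: nearW => N; rewrite big_mkord.
apply: (@le_trans _ _ (\sum_(j < N) (ultramass (A j))%:E)%E).
  by apply: lee_sum => j _; exact: om_open.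
rewrite sumEFin lee_fin (le_trans (A_sum N))//.
have IV j : ultramass (I j) <= ultramass V.
  exact (le_ultramass (measurable_open (@oI j)) (bob bV) (@IW j)).
by have := IV N; have := IV N.+1; lra.
Qed.

Let W_cover j : W `<=` I j.+1 `|` \bigcup_(i in ~` `I_j) A i.
Proof.
move=> x Wx; have [p Ip] := I_cover Wx.
(* For the least l with x in [I l], minimality keeps x out of [I l.-1] and so out of [C l.-2]; if l
   >= 2 then x lies in the shell of index l - 2. *)
have [l [Il lmin]] : exists l, I l x /\ forall i, (i < l)%N -> ~ I i x.
  have ex : exists p, `[< I p x >] by exists p; exact/asboolP.
  exists (ex_minn ex); case: ex_minnP => l /asboolP Il lm; split => // i il Ii.
  by have := lm i; rewrite leqNgt il => /(_ (asboolT Ii)).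
have [lj|jl] := leqP l j.+1.
  left; have mI : forall i k, I i `<=` I (i + k)%N.
    move=> i; elim=> [|k IH] y; first by rewrite addn0.
    by rewrite addnS => /IH/IC/CI.
  by rewrite -(subnKC lj); exact: mI.
right; case: l => [//|[//|l]] in Il lmin jl *.
exists l => /=; first by move=> /= lj; move: jl; rewrite !ltnS leqNgt lj.
by split => // /CI; apply: lmin.
Qed.

(** The argument by which metric outer measures make open sets measurable: [I j.+1] and V minus
    [C j.+1] are disjoint open subsets of V, and the shells missing from W form the tail of a
    convergent series. *)
Lemma ultra_outer_split : (om (V `&` O) + om (V `&` ~` O) <= (ultramass V)%:E)%E.
Proof.
have tail : (\sum_(j <= i <oo) om (A i))%E @[j --> \oo] --> 0%E.
  by apply: nneseries_tail_cvg; [exact: A_series|move=> i _; exact: outer_measure_ge0].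
have h : ((ultramass V)%:E + \sum_(j <= i <oo) om (A i))%E @[j --> \oo] --> (ultramass V)%:E.
  rewrite -[X in _ --> X]adde0; apply: cvgeD => //; exact: cvg_cst.
rewrite -(cvg_lim _ h)//; apply: lime_ge; first exact: cvgP h.
apply: nearW => j.
have h1 : (om W <= om (I j.+1) + \sum_(j <= i <oo) om (A i))%E.
  apply: (le_trans (le_outer_measure om _ _ (@W_cover j))).
  apply: (le_trans (outer_measureU2 om _ _)).
  by rewrite leeD2l//; exact: outer_measure_sigma_subadditive_tail.
have h2 : (om (I j.+1) + om (V `&` ~` O) <= (ultramass V)%:E)%E.
  have bVC : bo (V `&` ~` C j.+1).
    split; first by apply: openI; [exact: bV.1|exact: closed_openC].
    by have [_ [r Vr]] := bV; exists r => x [/Vr].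
  apply: (@le_trans _ _ ((ultramass (I j.+1))%:E + (ultramass (V `&` ~` C j.+1))%:E)%E).
    apply: leeD; first exact: om_open.
    apply: le_trans (om_open bVC); apply: le_outer_measure => x [Vx nO]; split => //.
    by move=> /CW[].
  rewrite -EFinD lee_fin; apply: add_ultramass_le.
  - exact: measurable_open.
  - by apply: measurable_open; case: bVC.
  - exact: bob.
  - by apply/seteqP; split => // x [/IC Cx [_]].
  - by move=> x [/IW|[]].
apply: (le_trans (leeD2r _ h1)); rewrite addeAC; exact: leeD2r.
Qed.

End shells.

Let om_caratheodory O : open O -> om.-caratheodory O.
Proof.
move=> oO; apply: le_caratheodory_measurable => X.
apply: le_ereal_inf_tmp => _ [B [mB XB] <-].
apply: (@le_trans _ _ (\sum_(k <oo) (om (B k `&` O) + om (B k `&` ~` O)))%E).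
  rewrite nneseriesD; try by move=> k _ _; exact: outer_measure_ge0.
  apply: leeD.
    apply: le_trans (outer_measure_sigma_subadditive om _).
    apply: le_outer_measure => x [/XB[k _ Bk] Ox]; by exists k.
  apply: le_trans (outer_measure_sigma_subadditive om _).
  apply: le_outer_measure => x [/XB[k _ Bk] Ox]; by exists k.
apply: lee_nneseries => [k _ _|k _].
  by rewrite adde_ge0//; exact: outer_measure_ge0.
rewrite /tau; case: ifPn => [/asboolP bB|_]; last exact: leey.
exact: ultra_outer_split.
Qed.

(** The two one-sided bounds of the portmanteau theorem. Equality may fail on sets whose boundary
    carries mass; the integral estimates below use only these bounds. *)
Lemma exists_ultralimit : exists g : bmeasure R n,
  (forall V, open V -> (exists r : R, V `<=` ball (0%R : 'rV[R]_n) r) ->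
     (g V <= (ultramass V)%:E)%E) /\
  (forall K, compact K -> ((ultramass K)%:E <= g K)%E).
Proof.
have mid : measurable_fun setT (fun x : caratheodory_type om => x : Rn R n).
  move=> _ Y mY; rewrite setTI; move: Y mY.
  apply: smallest_sub => [|U oU]; last exact: om_caratheodory.
  exact: (sigma_algebra_measurable (caratheodory_type om)).
exists (measure_function_pushforward__canonical__measure_function_Measure
  (om : {measure set (caratheodory_type om) -> \bar R}) mid).
by split => [V oV rV|K cK]; rewrite /=/pushforward preimage_id; [exact: om_open|exact: om_compact].
Qed.

End ultralimit.

(** Discretized layer cake formula: e times the number of levels (j+1) e below b falls short of b by
    at most e. *)
Lemma step_count_lower (R : realType) (e b : R) (J : nat) (P : nat -> bool) : 0 < e ->
  b <= J%:R * e -> (forall j, j.+1%:R * e <= b -> P j) ->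
  b - e <= \sum_(j < J) e * (P j)%:R.
Proof.
(* The minimum is the invariant of the induction on J: the sum grows by e with each level up to b
   and need not grow afterwards. *)
move=> e0 bJ Pj; apply: (@le_trans _ _ (Num.min (b - e) (J%:R * e))).
  by rewrite le_min lexx/= (le_trans _ bJ)// gerBl ltW.
elim: J {bJ} => [|J IH]; first by rewrite big_ord0 mul0r ge_min lexx orbT.
rewrite big_ord_recr/=; have [Jb|bJ] := leP (J.+1%:R * e) b.
  rewrite (Pj _ Jb) mulr1; apply: (@le_trans _ _ (Num.min (b - e) (J%:R * e) + e)).
    rewrite addr_minl subrK -natr1 mulrDl mul1r.
    by rewrite le_min !ge_min lexx orbT andbT gerBl (ltW e0).
  by rewrite lerD2r.
apply: (@le_trans _ _ (Num.min (b - e) (J%:R * e))).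
  rewrite le_min !ge_min lexx/= lerBlDr; move: bJ; rewrite -natr1 mulrDl mul1r => bJ.
  by rewrite (ltW bJ).
by rewrite (le_trans IH)// lerDl mulr_ge0// ltW.
Qed.

Lemma step_count_upper (R : realType) (e b : R) (J : nat) (P : nat -> bool) : 0 < e ->
  0 <= b -> (forall j, P j -> j.+1%:R * e <= b) ->
  \sum_(j < J) e * (P j)%:R <= b.
Proof.
move=> e0 b0 Pj; apply: (@le_trans _ _ (Num.min b (J%:R * e))); last by rewrite ge_min lexx.
elim: J => [|J IH]; first by rewrite big_ord0 mul0r le_min b0 lexx.
rewrite big_ord_recr/=; have [PJ|nPJ] := boolP (P J).
  rewrite mulr1 le_min; have := Pj _ PJ; rewrite -natr1 mulrDl mul1r => Jb.
  move: IH; rewrite le_min => /andP[_ IH].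
  by rewrite (le_trans _ Jb) ?lerD2r.
rewrite mulr0 addr0 (le_trans IH)// le_min !ge_min lexx/= orbC -natr1 mulrDl mul1r.
by rewrite lerDl (ltW e0).
Qed.

Lemma integral_step d (T : measurableType d) (R : realType) (mu : {measure set T -> \bar R})
    (U : nat -> set T) (e : R) J : 0 <= e -> (forall j, measurable (U j)) ->
  (\int[mu]_x (\sum_(j < J) e * \1_(U j) x)%:E = \sum_(j < J) e%:E * mu (U j))%E.
Proof.
move=> e0 mU; under eq_integral do rewrite -sumEFin.
rewrite ge0_integral_sum//.
- apply: eq_bigr => j _; under eq_integral do rewrite EFinM.
  rewrite ge0_integralTZl//.
  + by rewrite integral_indic// setIT.
  + by apply/measurable_EFinP; exact: measurable_indic.
- move=> j; apply/measurable_EFinP; apply: measurable_funM => //; exact: measurable_indic.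
- by move=> j x _; rewrite lee_fin mulr_ge0.
Qed.

Lemma measurable_step d (T : measurableType d) (R : realType)
    (U : nat -> set T) (e : R) J : (forall j, measurable (U j)) ->
  measurable_fun setT (fun x => (\sum_(j < J) e * \1_(U j) x)%:E).
Proof.
move=> mU; apply/measurable_EFinP; apply: measurable_sum => j.
by apply: measurable_funM => //; exact: measurable_indic.
Qed.

Lemma compact_sub_ball (R : realType) n (K : set 'rV[R]_n) : compact K ->
  exists2 r : R, 0 < r & K `<=` ball (0 : 'rV[R]_n) r.
Proof.
move=> /compact_bounded[M [_ KM]]; exists (`|M| + 2); first by rewrite ltr_wpDl.
move=> x Kx; rewrite -ball_normE /ball_/= sub0r normrN.
apply: (@le_lt_trans _ _ (`|M| + 1)); last by rewrite ltrD2l ltr1n.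
by apply: KM => //; rewrite (le_lt_trans (ler_norm M))// ltrDl.
Qed.

Lemma open_superlevel (R : realType) n (phi : 'rV[R]_n -> R) (b : R) : continuous phi ->
  open [set y | b < phi y].
Proof.
move=> cphi; apply: (@open_comp _ _ phi [set y | b < y]); last exact: open_gt.
by move=> z _; exact: cphi.
Qed.

Lemma compact_support_bounded (R : realType) n (phi : 'rV[R]_n -> R) : continuous phi ->
  (forall x, 0 <= phi x) -> compact (closure [set x | phi x != 0]) ->
  exists2 B : R, 0 < B & forall x, phi x <= B.
Proof.
move=> cphi phi0 supp; set K := closure _ in supp.
have phi_out x : ~ K x -> phi x = 0.
  by move=> nK; apply: contrapT => /eqP px; apply: nK; exact: subset_closure.
have : compact (phi @` K) by apply: continuous_compact => //; exact: continuous_subspaceT.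
move=> /compact_bounded[M [_ KM]]; exists (`|M| + 1); first by rewrite ltr_wpDl.
move=> x; have [Kx|nK] := pselect (K x); last by rewrite phi_out// addr_ge0.
apply: le_trans (ler_norm _) _; apply: (KM (`|M| + 1)); last by exists x.
by rewrite (le_lt_trans (ler_norm M))// ltrDl.
Qed.

(** * Integrals against the limit measure *)

Section ultralimit_integrals.
Context (R : realType) (n : nat) (F : set_system nat).
Hypothesis FU : UltraFilter F.
Variable mu : nat -> bmeasure R n.
Hypothesis bnd : forall r : R, exists M : R, forall k,
  (mu k (ball (0%R : 'rV[R]_n) r) <= M%:E)%E.
Variable g : bmeasure R n.
Hypothesis g_open : forall V : set 'rV[R]_n, open V ->
  (exists r : R, V `<=` ball (0%R : 'rV[R]_n) r) ->
  (g V <= (ultramass F mu V)%:E)%E.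
Hypothesis g_compact : forall K : set 'rV[R]_n, compact K ->
  ((ultramass F mu K)%:E <= g K)%E.

Let FF : ProperFilter F := ultra_proper.

Lemma ultralimit_radon : radon g.
Proof.
move=> K cK; have [r r0 Kr] := compact_sub_ball cK.
apply: (@le_lt_trans _ _ (g (ball (0%R : 'rV[R]_n) r))).
  apply: le_measure => //; rewrite inE; first exact: measurable_compact.
  by apply: measurable_open; exact: ball_open.
apply: le_lt_trans (ltry (ultramass F mu (ball (0%R : 'rV[R]_n) r))).
by apply: g_open; [exact: ball_open|exists r].
Qed.

Let sum_cvg (U : nat -> set 'rV[R]_n) (e : R) J : (forall j, bounded_borel (U j)) ->
  (\sum_(j < J) e * fine (mu k (U j))) @[k --> F] --> \sum_(j < J) e * ultramass F mu (U j).
Proof.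
move=> bU; elim: J => [|J IH].
  by under eq_fun do rewrite big_ord0; rewrite big_ord0; exact: cvg_cst.
under eq_fun do rewrite big_ord_recr/=; rewrite big_ord_recr/=.
by apply: cvgD => //; apply: cvgMr; exact: ultramass_cvg.
Qed.

Let sum_fine (U : nat -> set 'rV[R]_n) (e : R) J k : (forall j, bounded_borel (U j)) ->
  (\sum_(j < J) e%:E * mu k (U j) = (\sum_(j < J) e * fine (mu k (U j)))%:E)%E.
Proof.
move=> bU; rewrite -sumEFin; apply: eq_bigr => j _.
by rewrite EFinM fineK// (bounded_borel_fin bnd).
Qed.

(** Step functions on the open superlevel sets of h, cut to balls, stay below h and approach it; on
    each of their sets the bound for open sets applies, and Fatou's lemma concludes. *)
Lemma ultralimit_lsc (h : 'rV[R]_n -> \bar R) (C : R) : lower_semicontinuous h ->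
  (forall x, 0 <= h x)%E -> (\forall k \near F, (\int[mu k]_x h x <= C%:E)%E) ->
  (\int[g]_x h x <= C%:E)%E.
Proof.
move=> lh h0 hC; have mh := lsc_measurable lh.
pose e N : R := N.+1%:R^-1.
have e0 N : 0 < e N by rewrite invr_gt0.
(* (N+1)^2 levels of spacing 1/(N+1) reach the height N+1, so both the spacing and the cap on h
   disappear in the limit. *)
pose J N := (N.+1 * N.+1)%N.
pose U N j := ball (0%R : 'rV[R]_n) N%:R `&` [set x | ((j.+1%:R * e N)%:E < h x)%E].
have oU N j : open (U N j).
  apply: openI; first exact: ball_open.
  rewrite openE => x; rewrite /interior/= => hx; have [V xV hV] := lh x _ hx.
  by apply: filterS xV => y /hV.
have mU N j : measurable (U N j : set (Rn R n)) by exact: measurable_open.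
have bU N j : bounded_borel (U N j) by split => //; exists N%:R => x [].
pose s N x := (\sum_(j < J N) e N * \1_(U N j) x)%:E.
have s0 N x : (0 <= s N x)%E.
  by rewrite lee_fin sumr_ge0// => j _; rewrite mulr_ge0// ltW.
have sh N x : (s N x <= h x)%E.
  have := h0 x; case hx : (h x) => [b| |]//; last by move=> _; exact: leey.
  rewrite !lee_fin => b0; apply: (@step_count_upper R (e N) b (J N) (fun j => x \in U N j)) => // j.
  by rewrite inE => -[_] /=; rewrite hx lte_fin => /ltW.
apply: (@le_trans _ _ (limn_einf (fun N => \int[g]_x s N x)%E)).
  apply: le_integral_limn_einf => //; first by move=> N; exact: measurable_step.
  move=> x; apply: lee_real_below.
    by apply: limn_einf_ge; apply: nearW.
  move=> b b0 bh; apply/lee_subgt0Pr => d d0; apply: limn_einf_ge.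
  have [N1 N1d] := @ltr_add_invr R 0 d d0; rewrite add0r in N1d.
  have N2b : b <= (Num.truncn b).+1%:R by rewrite ltW// truncnS_gt.
  have N3x : `|x| < (Num.truncn `|x|).+1%:R by exact: truncnS_gt.
  exists (maxn N1 (maxn (Num.truncn b).+1 (Num.truncn `|x|).+1)) => // N /=.
  rewrite !geq_max => /and3P[N1N N2N N3N].
  apply: (@le_trans _ _ (b - e N)%:E).
    rewrite -EFinB lee_fin lerB// (le_trans _ (ltW N1d))// lef_pV2 ?posrE// ler_nat.
    by rewrite ltnS.
  rewrite lee_fin; apply: (@step_count_lower R (e N) b (J N) (fun j => x \in U N j)) => //.
    rewrite /J /e natrM -mulrA divff// mulr1 (le_trans N2b)// ler_nat.
    exact: leq_trans N2N _.
  move=> j jb; rewrite inE; split; last by rewrite /= (le_lt_trans _ bh)// lee_fin.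
  rewrite -ball_normE /ball_/= sub0r normrN (lt_le_trans N3x)// ler_nat//.
apply: limn_einf_le => N; rewrite integral_step ?(ltW (e0 N))//.
apply: (@le_trans _ _ (\sum_(j < J N) e N * ultramass F mu (U N j))%:E).
  rewrite -sumEFin; apply: lee_sum => j _; rewrite EFinM.
  rewrite lee_wpmul2l ?lee_fin ?(ltW (e0 N))//.
  by apply: g_open => //; exists N%:R => x [].
have sc := @sum_cvg (U N) (e N) (J N) (bU N).
rewrite lee_fin -(cvg_lim _ sc)//; apply: limr_le; first exact: cvgP sc.
move: hC; apply: filterS => k hk; rewrite -lee_fin -sum_fine//.
rewrite -integral_step ?(ltW (e0 N))//; apply: le_trans hk.
apply: ge0_le_integral => //.
- by move=> x _; exact: s0.
- exact: measurable_step.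
- by move=> x _; exact: sh.
Qed.

Section compact_support.
Variable phi : 'rV[R]_n -> R.
Hypothesis cphi : continuous phi.
Hypothesis phi0 : forall x, 0 <= phi x.
Hypothesis supp : compact (closure [set x | phi x != 0]).

Let K := closure [set x | phi x != 0].

Let mphi : measurable_fun setT (fun x : Rn R n => (phi x)%:E).
Proof. by apply/measurable_EFinP; exact: continuous_measurable_rV. Qed.

Let phi_out x : ~ K x -> phi x = 0.
Proof. by move=> nK; apply: contrapT => /eqP px; apply: nK; exact: subset_closure. Qed.

Let phi_bound := compact_support_bounded cphi phi0 supp.

Let bK : bounded_borel K.
Proof.
have [r _ Kr] := compact_sub_ball supp; split; last by exists r.
exact: measurable_compact.
Qed.

Let int_le (nu : bmeasure R n) (B : R) : 0 <= B -> (forall x, phi x <= B) ->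
  (\int[nu]_x (phi x)%:E <= B%:E * nu K)%E.
Proof.
move=> B0 pB; have mK : measurable (K : set (Rn R n)) := bK.1.
have -> : (B%:E * nu K = \int[nu]_x (B * \1_K x)%:E)%E.
  under eq_integral do rewrite EFinM.
  rewrite ge0_integralTZl//; first by rewrite integral_indic// setIT.
  by apply/measurable_EFinP; exact: measurable_indic.
apply: ge0_le_integral => //.
- by move=> x _; rewrite lee_fin.
- by apply/measurable_EFinP; apply: measurable_funM => //; exact: measurable_indic.
move=> x _; rewrite lee_fin indicE; case: (boolP (x \in _)) => [_|xK].
  by rewrite mulr1.
by rewrite phi_out ?mulr0// => Kx; rewrite mem_set in xK.
Qed.

(** Boundedness gives a limit along F. It is not below the integral because phi is lower
    semicontinuous, and not above it because the superlevel sets of phi within its support are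
    compact, where the opposite bound holds. *)
Lemma ultralimit_continuous :
  fine (\int[mu k]_x (phi x)%:E) @[k --> F] --> fine (\int[g]_x (phi x)%:E).
Proof.
have [B B0 pB] := phi_bound; have [mK [r Kr]] := bK; have [M muM] := bnd r.
have mBall : measurable (ball (0%R : 'rV[R]_n) r : set (Rn R n)).
  by apply: measurable_open; exact: ball_open.
have muK k : (mu k K <= M%:E)%E.
  by apply: le_trans (muM k); apply: le_measure => //; rewrite inE.
have I0 (nu : bmeasure R n) : (0 <= \int[nu]_x (phi x)%:E)%E.
  by apply: integral_ge0 => x _; rewrite lee_fin.
have IM k : (\int[mu k]_x (phi x)%:E <= (B * M)%:E)%E.
  apply: (le_trans (int_le _ (ltW B0) pB)); rewrite EFinM lee_wpmul2l//.
  by rewrite lee_fin ltW.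
have If k : (\int[mu k]_x (phi x)%:E)%E \is a fin_num.
  by rewrite ge0_fin_numE// (le_lt_trans (IM k))// ltry.
have gK : g K \is a fin_num by rewrite ge0_fin_numE//; apply: ultralimit_radon.
have Ig : (\int[g]_x (phi x)%:E)%E \is a fin_num.
  rewrite ge0_fin_numE// (le_lt_trans (int_le _ (ltW B0) pB))//.
  by rewrite -(fineK gK) -EFinM ltry.
have [l ul] : exists l : R, fine (\int[mu k]_x (phi x)%:E) @[k --> F] --> l.
  apply: (@ultra_bounded_cvg _ F FU (fun k => fine (\int[mu k]_x (phi x)%:E)) (B * M)) => k.
  by rewrite ger0_norm ?fine_ge0// -lee_fin fineK.
suff -> : fine (\int[g]_x (phi x)%:E) = l by [].
apply/eqP; rewrite eq_le; apply/andP; split.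
  rewrite -lee_fin fineK//; apply/lee_addgt0Pr => e e0; rewrite -EFinD.
  apply: ultralimit_lsc => [x b|x|]; last 2 first.
  - by rewrite lee_fin.
  - move/cvgrPdist_le : ul => /(_ _ e0); apply: filterS => k.
    rewrite ler_distlC => /andP[_]; by rewrite -lee_fin fineK.
  rewrite lte_fin => bx; exists [set y | b < phi y].
    by apply: open_nbhs_nbhs; split => //; exact: open_superlevel.
  by move=> y /=; rewrite lte_fin.
have gKM : 0 <= fine (g K) by rewrite fine_ge0.
apply/ler_addgt0Pr => d d0.
(* The step functions miss phi by at most e on K, so the error is e times the mass of K; the added 1
   avoids a zero denominator. *)
have [N Nd] := @ltr_add_invr R 0 (d / (fine (g K) + 1)) (divr_gt0 d0 (ltr_wpDl gKM ltr01)).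
rewrite add0r in Nd; pose e : R := N.+1%:R^-1; have e0 : 0 < e by rewrite invr_gt0.
pose J := (Num.truncn B).+1 * N.+1.
have BJ : B <= J%:R * e.
  by rewrite natrM -mulrA divff// mulr1 ltW// truncnS_gt.
pose U j := K `&` [set x | j.+1%:R * e <= phi x].
have cU j : compact (U j).
  apply: subclosed_compact supp _ => [|x []//].
  apply: closedI; first exact: closed_closure.
  by apply: (@closed_comp _ _ phi [set y | j.+1%:R * e <= y]) => //; exact: closed_ge.
have bU j : bounded_borel (U j).
  by apply: sub_bounded_borel bK => //; [exact: measurable_compact|move=> x []].
have step_le x : phi x <= e * \1_K x + \sum_(j < J) e * \1_(U j) x.
  have [Kx|nK] := pselect (K x); last first.
    rewrite phi_out// addr_ge0 ?mulr_ge0 ?(ltW e0)// sumr_ge0// => j _.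
    by rewrite mulr_ge0// ltW.
  rewrite {1}indicE mem_set// mulr1 -lerBlDl.
  apply: (@step_count_lower R e (phi x) J (fun j => x \in U j)) => //.
    exact: le_trans BJ.
  by move=> j jx; rewrite inE.
have mub k : fine (\int[mu k]_x (phi x)%:E) <= e * fine (mu k K) + \sum_(j < J) e * fine (mu k (U j)).
  rewrite -lee_fin fineK// EFinD -(sum_fine _ _ _ bU) EFinM fineK ?(bounded_borel_fin bnd)//.
  rewrite -integral_step ?(ltW e0)//; last by move=> j; case: (bU j).
  have -> : (e%:E * mu k K = \int[mu k]_x (e * \1_K x)%:E)%E.
    under eq_integral do rewrite EFinM.
    rewrite ge0_integralTZl ?(ltW e0)//; first by rewrite integral_indic// setIT.
    by apply/measurable_EFinP; exact: measurable_indic.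
  have mE : measurable_fun setT (fun x : Rn R n => (e * \1_K x)%:E).
    by apply/measurable_EFinP; apply: measurable_funM => //; exact: measurable_indic.
  have mS : measurable_fun setT (fun x : Rn R n => (\sum_(j < J) e * \1_(U j) x)%:E).
    by apply: measurable_step => j; case: (bU j).
  have pE (x : Rn R n) : setT x -> (0 <= (e * \1_K x)%:E)%E.
    by move=> _; rewrite lee_fin mulr_ge0// ltW.
  have pS (x : Rn R n) : setT x -> (0 <= (\sum_(j < J) e * \1_(U j) x)%:E)%E.
    by move=> _; rewrite lee_fin sumr_ge0// => j _; rewrite mulr_ge0// ltW.
  rewrite -(ge0_integralD (mu k) measurableT pE mE pS mS).
  apply: ge0_le_integral => //.
  - by move=> x _; rewrite lee_fin.
  - exact: emeasurable_funD.
  - by move=> x _; rewrite -EFinD lee_fin.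
have hl : l <= e * ultramass F mu K + \sum_(j < J) e * ultramass F mu (U j).
  have hK : e * fine (mu k K) @[k --> F] --> e * ultramass F mu K.
    by apply: cvgMr; exact: ultramass_cvg.
  have hU := @sum_cvg U e J bU.
  apply: (ler_cvg_to ul (cvgD hK hU)).
  exact: nearW.
apply: (le_trans hl); rewrite addrC; apply: lerD.
  rewrite -lee_fin fineK//.
  apply: (@le_trans _ _ (\int[g]_x (\sum_(j < J) e * \1_(U j) x)%:E)%E).
    rewrite integral_step ?(ltW e0)//; last by move=> j; case: (bU j).
    rewrite -sumEFin; apply: lee_sum => j _; rewrite EFinM lee_wpmul2l ?lee_fin ?(ltW e0)//.
    exact: g_compact.
  apply: ge0_le_integral => //.
  - by move=> x _; rewrite lee_fin sumr_ge0// => j _; rewrite mulr_ge0// ltW.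
  - by apply: measurable_step => j; case: (bU j).
  move=> x _; rewrite lee_fin; apply: (@step_count_upper R e (phi x) J (fun j => x \in U j)) => // j.
  by rewrite inE => -[].
apply: (@le_trans _ _ (e * fine (g K))).
  by rewrite ler_wpM2l ?(ltW e0)// -lee_fin fineK//; exact: g_compact.
move: Nd; rewrite ltr_pdivlMr ?ltr_wpDl// => /ltW; apply: le_trans.
by rewrite ler_wpM2l ?(ltW e0)// lerDl.
Qed.

End compact_support.

End ultralimit_integrals.

(** * Inner regularity of finite Borel measures *)

Section regularity.
Context (R : realType) (n : nat) (mu : bmeasure R n).
Hypothesis mufin : (mu setT < +oo)%E.
Implicit Types (U B C : set 'rV[R]_n).

Let mu_fin (X : set (Rn R n)) : measurable X -> mu X \is a fin_num.
Proof.
move=> mX; rewrite ge0_fin_numE//; apply: le_lt_trans mufin.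
by apply: le_measure => //; rewrite inE.
Qed.

Let muD_cvg0 U (C : nat -> set 'rV[R]_n) (r : R) : 0 < r ->
  measurable (U : set (Rn R n)) -> (forall j, measurable (C j : set (Rn R n))) ->
  (forall i j, (i <= j)%N -> C i `<=` C j) ->
  (mu (U `\` \bigcup_j C j) < r%:E)%E -> exists j, (mu (U `\` C j) < r%:E)%E.
Proof.
move=> r0 mU mC Cinc lt_r; pose D j := (U `\` C j : set (Rn R n)).
have mD j : measurable (D j) by exact: measurableD.
have DE : \bigcap_j D j = U `\` \bigcup_j C j.
  apply/seteqP; split => [x xD|x [Ux nC] j _].
    by split; [have [] := xD 0%N Logic.I|move=> [j _ Cj]; have [] := xD j Logic.I].
  by split => // Cj; apply: nC; exists j.
have h : mu (D j) @[j --> \oo] --> mu (\bigcap_j D j).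
  apply: nonincreasing_cvg_mu => //.
  - by rewrite -ge0_fin_numE// mu_fin.
  - exact: bigcap_measurable.
  - by move=> i j ij; apply/subsetPset => x [Ux nC]; split => // /(Cinc _ _ ij).
apply: contrapT => nE.
have : (r%:E <= mu (\bigcap_j D j))%E.
  rewrite -(cvg_lim _ h)//; apply: lime_ge; first exact: cvgP h.
  by apply: nearW => j; rewrite leNgt; apply/negP => jr; apply: nE; exists j.
by rewrite DE leNgt lt_r.
Qed.

(** Approximation from both sides at once makes the class stable under complements, which inner
    approximation alone would not be. *)
Let approximable := [set B : set (Rn R n) | forall r : R, 0 < r -> exists C O,
  [/\ closed (C : set 'rV[R]_n), open (O : set 'rV[R]_n), C `<=` B, B `<=` O &
      (mu (O `\` C) < r%:E)%E]].

Let approximable_open U : open U -> approximable U.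
Proof.
move=> oU r r0; pose C j := \bigcap_(z in ~` U) ~` ball z (j.+1%:R^-1 : R).
have cC j : closed (C j).
  by apply: closed_bigI => z _; apply: open_closedC; exact: ball_open.
have CU j : C j `<=` U.
  by move=> x xC; apply: contrapT => nU; apply: (xC x nU); exact: ballxx.
have UE : U `\` \bigcup_j C j = set0.
  apply/seteqP; split => // x [Ux nC]; apply: nC.
  have /nbhs_ballP[q /= q0 xq] := open_nbhs_nbhs (conj oU Ux).
  have [j jq] := @ltr_add_invr R 0 q q0; rewrite add0r in jq.
  exists j => // z nz zx; apply: nz; apply: xq; apply: ball_sym.
  exact: le_ball (ltW jq) _ zx.
have [|||j jr] := @muD_cvg0 U C r r0 (measurable_open oU).
- by move=> j; exact: measurable_closed.
- move=> i j ij x xC z nz zx; apply: (xC z nz); apply: le_ball zx.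
  by rewrite lef_pV2 ?posrE// ler_nat ltnS.
- by rewrite UE measure0 lte_fin.
by exists (C j), U; split.
Qed.

Let approximableC B : approximable B -> approximable (~` B).
Proof.
move=> aB r r0; have [C [U [cC oU CB BU lt_r]]] := aB r r0.
exists (~` U), (~` C); split.
- exact: open_closedC.
- exact: closed_openC.
- exact: subsetC.
- exact: subsetC.
by rewrite setDE setCK setIC -setDE.
Qed.

(** The union of the closed kernels need not be closed, but finitely many of them suffice since mu
    is finite. The gaps are taken summable to at most r/2. *)
Let approximable_bigcup (B : nat -> set (Rn R n)) :
  (forall k, approximable (B k)) -> approximable (\bigcup_k B k).
Proof.
move=> aB r r0; have r2 : 0 < r / 2 by rewrite divr_gt0.
have /choice[C CP] k : exists CO : set 'rV[R]_n * set 'rV[R]_n,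
    [/\ closed CO.1, open CO.2, CO.1 `<=` B k, B k `<=` CO.2 &
      (mu (CO.2 `\` CO.1) < (r / 2 / (2 ^ k.+1)%:R)%:E)%E].
  have q0 : 0 < r / 2 / (2 ^ k.+1)%:R by rewrite divr_gt0// ltr0n expn_gt0.
  by have [C [U h]] := aB k _ q0; exists (C, U).
pose U := \bigcup_k (C k).2; pose D N := \bigcup_(k in `I_N) (C k).1.
have oU : open U by apply: bigcup_open => k _; have [] := CP k.
have cD N : closed (D N).
  by apply: closed_bigcup => [|k _]; [exact: finite_II|have [] := CP k].
have mD k : measurable ((C k).2 `\` (C k).1 : set (Rn R n)).
  by apply: measurableD; [apply: measurable_open|apply: measurable_closed]; have [] := CP k.
have mU : measurable (U : set (Rn R n)) by exact: measurable_open.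
have mDN N : measurable (D N : set (Rn R n)) by exact: measurable_closed.
have [||N lt_r] := @muD_cvg0 U D r r0 mU mDN.
- by move=> i j ij x [k ki Ck]; exists k => //=; exact: leq_trans ki ij.
- apply: (@le_lt_trans _ _ (r / 2)%:E); last by rewrite lte_fin ltr_pdivrMr// ltr_pMr// ltr1n.
  apply: (@le_trans _ _ (\sum_(0 <= k <oo) mu ((C k).2 `\` (C k).1))%E).
    apply: measure_sigma_subadditive => //.
      by apply: measurableD => //; exact: bigcup_measurable.
    move=> x [[k _ Uk] nD]; exists k => //; split => // Ck; apply: nD.
    by exists k.+1 => //; exists k => /=.
  apply: (@le_trans _ _ (\sum_(0 <= k <oo) (0 + (r / 2 / (2 ^ k.+1)%:R)%:E))%E).
    apply: lee_nneseries => [k _ _|k _]; first exact: measure_ge0.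
    by rewrite add0e; have [_ _ _ _ /ltW] := CP k.
  apply: (le_trans (epsilon_trick xpredT _ (ltW r2))) => //.
  by rewrite eseries0 ?add0e.
exists (D N), U; split => //.
- by move=> x [k _ Ck]; exists k => //; have [_ _ + _ _] := CP k; apply.
- by move=> x [k _ Bk]; exists k => //; have [_ _ _ + _] := CP k; apply.
Qed.

Lemma measurable_approximable B (r : R) : measurable (B : set (Rn R n)) -> 0 < r ->
  exists C O, [/\ closed (C : set 'rV[R]_n), open (O : set 'rV[R]_n), C `<=` B, B `<=` O &
      (mu (O `\` C) < r%:E)%E].
Proof.
move=> mB; move: r; suff : approximable B by [].
move: B mB; apply: smallest_sub => [|U oU]; last exact: approximable_open.
split.
- exact: approximable_open open0.
- by move=> B aB; rewrite setTD; exact: approximableC.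
- by move=> B aB; exact: approximable_bigcup.
Qed.

Lemma exists_compact_pos B : measurable (B : set (Rn R n)) -> (0 < mu B)%E ->
  exists K : set 'rV[R]_n, [/\ compact K, K `<=` B & (0 < mu K)%E].
Proof.
move=> mB B0; have r0 : 0 < fine (mu B) by rewrite fine_gt0// B0 -ge0_fin_numE// mu_fin.
have [C [U [cC oU CB BU lt_r]]] := measurable_approximable mB r0.
rewrite fineK ?mu_fin// in lt_r.
have mC : measurable (C : set (Rn R n)) by exact: measurable_closed.
have C0 : (0 < mu C)%E.
  rewrite lt0e measure_ge0 andbT; apply/eqP => C0; move: lt_r; rewrite ltNge => /negP; apply.
  apply: (@le_trans _ _ (mu ((U `\` C) `|` C))).
    apply: le_measure; rewrite ?inE//; last by move=> x /BU Ux; have [|] := pselect (C x); [right|left].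
    by apply: measurableU => //; apply: measurableD => //; exact: measurable_open.
  rewrite measureU0//; apply: measurableD => //; exact: measurable_open.
pose K j := C `&` [set x : 'rV[R]_n | `|x| <= j%:R].
have cN j : closed [set x : 'rV[R]_n | `|x| <= j%:R].
  apply: (@closed_comp _ _ (fun x : 'rV[R]_n => `|x|) [set y | y <= j%:R]); last exact: closed_le.
  by move=> x _; exact: norm_continuous.
have cK j : compact (K j).
  apply: bounded_closed_compact; last exact: closedI.
  exists j%:R; split; first exact: num_real.
  by move=> M jM x [_ /= xj]; exact: le_trans xj (ltW jM).
apply: contrapT => nK; move: C0; rewrite lt0e => /andP[/negP + _]; apply; apply/eqP.
have K0 j : mu (K j) = 0%E.
  apply/eqP; rewrite eq_le measure_ge0 andbT leNgt; apply/negP => Kj.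
  by apply: nK; exists (K j); split => // x [/CB].
apply/eqP; rewrite eq_le measure_ge0 andbT.
apply: (@le_trans _ _ (\sum_(0 <= j <oo) mu (K j))%E); last by rewrite eseries0.
apply: measure_sigma_subadditive => //.
  by move=> j; exact: measurable_compact.
move=> x Cx; exists (Num.truncn `|x|).+1 => //; split => //=.
by rewrite ltW// truncnS_gt.
Qed.

End regularity.

Section restriction.
Context (R : realType) (n : nat).
Implicit Types (mu : bmeasure R n) (f : Rn R n -> \bar R).

Lemma ge0_integral_mrestr_le mu (D : set (Rn R n)) (mD : measurable D) f :
  measurable_fun setT f -> (forall x, 0 <= f x)%E ->
  (\int[mrestr mu mD]_x f x <= \int[mu]_x f x)%E.
Proof.
move=> mf f0; have mDC := measurableC mD.
have -> : (\int[mu]_x f x = \int[measure_add (mrestr mu mD) (mrestr mu mDC)]_x f x)%E.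
  apply: eq_measure_integral => A mA _.
  apply: (eq_trans _ (esym (measure_addE (mrestr mu mD) (mrestr mu mDC) A))).
  change (mu A = (mu (A `&` D) + mu (A `&` ~` D))%E); rewrite -measureU//.
  - by rewrite -setIUr setUv setIT.
  - exact: measurableI.
  - exact: measurableI.
  - by rewrite setIACA setICr setI0.
by rewrite ge0_integral_measure_add// leeDl//; exact: integral_ge0.
Qed.

End restriction.

(** * Sets of inner capacity zero *)

Section null_sets.
Context (R : realType) (n : nat) (m : bmeasure R n) (a c : R) (w S : R -> R).
Hypothesis H : riesz_setting m a c w S.
Notation kap := (@riesz R n (2 * a)).
Notation pot := (@potential R n (2 * a)).
Notation energy := (@energy R n (2 * a)).
Notation cap := (@cap R n (2 * a)).
Notation cap_inf := (@cap_inf R n (2 * a)).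
Notation ne := (@nearly_everywhere R n (2 * a)).
Implicit Types (mu nu : bmeasure R n) (A N K : set 'rV[R]_n) (x y z : 'rV[R]_n).

Definition admissible A mu := [/\ radon mu, concentrated mu A, mu setT = 1%E &
  (energy mu < +oo)%E].

Lemma finite_radon mu : (mu setT < +oo)%E -> radon mu.
Proof.
move=> mufin K cK; apply: le_lt_trans mufin.
by apply: le_measure => //; rewrite inE//; exact: measurable_compact.
Qed.

Lemma pot_mscale (k : {nonneg R}) mu x :
  pot (mscale k mu) x = (k%:num%:E * pot mu x)%E.
Proof.
apply: ge0_integral_mscale => //; first exact: (measurable_riesz H).
by move=> z _; exact: (riesz_ge0 H).
Qed.

Lemma mutual_mscaler (k : {nonneg R}) mu nu : sigma_finite setT nu ->
  mutual (2 * a) mu (mscale k nu) = (k%:num%:E * mutual (2 * a) mu nu)%E.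
Proof.
move=> snu; rewrite /mutual -ge0_integralTZl//; first last.
- by move=> x; exact: (pot_ge0 H).
- exact: (measurable_pot H).
by apply: eq_integral => x _; rewrite pot_mscale.
Qed.

Lemma mutual_mscalel (k : {nonneg R}) mu nu : sigma_finite setT nu ->
  mutual (2 * a) (mscale k mu) nu = (k%:num%:E * mutual (2 * a) mu nu)%E.
Proof.
move=> snu; apply: ge0_integral_mscale => //; first exact: (measurable_pot H).
by move=> x _; exact: (pot_ge0 H).
Qed.

Lemma energy_ge0 mu : (0 <= energy mu)%E.
Proof. by apply: integral_ge0 => x _; exact: (pot_ge0 H). Qed.

Lemma mutual_ge0 mu nu : (0 <= mutual (2 * a) mu nu)%E.
Proof. by apply: integral_ge0 => x _; exact: (pot_ge0 H). Qed.

Lemma cap_inf_ge0 A : (0 <= cap_inf A)%E.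
Proof. by apply: le_ereal_inf_tmp => _ [mu _ <-]; exact: energy_ge0. Qed.

Lemma cap_inf_le A mu : admissible A mu -> (cap_inf A <= energy mu)%E.
Proof. by move=> Amu; apply: ereal_inf_lbound; exists mu. Qed.

(** [cap] is 0 only when the infimum is +oo, whereas an admissible measure has finite energy. *)
Lemma cap_eq0P A : cap A = 0%E <-> forall mu, ~ admissible A mu.
Proof.
split=> [capA mu Amu|nA]; last first.
  have -> : cap A = (if cap_inf A == +oo%E then 0%E else if cap_inf A == 0%E then +oo%E
    else ((fine (cap_inf A))^-1)%:E) by [].
  rewrite (_ : cap_inf A = +oo%E) ?eqxx//.
  apply/eqP; rewrite -leye_eq; apply: le_ereal_inf_tmp => _ [mu Amu <-].
  by case: (nA mu).
move: capA; rewrite /Defs.cap -/(cap_inf A); case: ifPn => [/eqP Ioo _|Ioo].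
  have := cap_inf_le Amu; rewrite Ioo leye_eq => /eqP Eoo.
  by case: Amu => _ _ _; rewrite Eoo ltxx.
case: ifPn => // I0 -[] /eqP; rewrite invr_eq0 => /eqP fI0.
have Ifin : cap_inf A \is a fin_num by rewrite ge0_fin_numE ?cap_inf_ge0// ltey.
by move: I0; rewrite -(fineK Ifin) fI0 eqxx.
Qed.

Lemma sub_admissible A N mu : A `<=` N -> admissible A mu -> admissible N mu.
Proof.
by move=> AN [? [B [mB BA B0]] ? ?]; split => //; exists B; split => //; exact: subset_trans AN.
Qed.

Lemma sub_cap0 A N : A `<=` N -> cap N = 0%E -> cap A = 0%E.
Proof.
by move=> AN /cap_eq0P nN; apply/cap_eq0P => mu /(sub_admissible AN); exact: nN.
Qed.

Lemma energy_restrict mu (D : set (Rn R n)) (mD : measurable D) : radon mu ->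
  (energy (mrestr mu mD) <= energy mu)%E.
Proof.
move=> rmu; have smu := radon_sigma_finite rmu.
have rD : radon (mrestr mu mD).
  move=> K cK; apply: le_lt_trans (rmu K cK); apply: le_measure; rewrite ?inE//.
    by apply: measurableI => //; exact: measurable_compact.
  exact: measurable_compact.
have sD := radon_sigma_finite rD.
have pD x : (pot (mrestr mu mD) x <= pot mu x)%E.
  apply: ge0_integral_mrestr_le; first exact: (measurable_riesz H).
  by move=> z; exact: (riesz_ge0 H).
apply: (@le_trans _ _ (\int[mu]_x pot (mrestr mu mD) x)%E).
  apply: ge0_integral_mrestr_le; first exact: (measurable_pot H).
  by move=> z; exact: (pot_ge0 H).
apply: ge0_le_integral.
- exact: measurableT.
- by move=> x _; exact: (pot_ge0 H).
- exact: (measurable_pot H).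
- exact: (measurable_pot H).
- by move=> x _; exact: pD.
Qed.

Lemma exists_admissible mu (D : set (Rn R n)) : measurable D -> radon mu ->
  (energy mu < +oo)%E -> (0 < mu D < +oo)%E -> exists nu, admissible D nu.
Proof.
move=> mD rmu Efin /andP[D0 Dfin].
have p0 : 0 < fine (mu D) by rewrite fine_gt0// D0 Dfin.
have k0 : 0 <= (fine (mu D))^-1 by rewrite invr_ge0 ltW.
pose k : {nonneg R} := NngNum k0.
pose lam : bmeasure R n := mscale k (mrestr mu mD).
have lamE X : lam X = (((fine (mu D))^-1)%:E * mu (X `&` D))%E by [].
have lamT : lam setT = 1%E.
  rewrite lamE setTI -[X in (_ * X)%E]fineK ?ge0_fin_numE//.
  by rewrite -EFinM mulVf// gt_eqF.
have rlam : radon lam by apply: finite_radon; rewrite lamT ltry.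
have sD : sigma_finite setT (mrestr mu mD).
  by apply: finite_sigma_finite; change (mu (setT `&` D) < +oo)%E; rewrite setTI.
exists lam; split => //.
  by exists D; split => //; rewrite lamE setICl measure0 mule0.
have := energy_restrict mD rmu; rewrite /energy.
rewrite (mutual_mscalel _ _ (radon_sigma_finite rlam)) (mutual_mscaler _ _ sD) => Ele.
have Ef : (mutual (2 * a) (mrestr mu mD) (mrestr mu mD) < +oo)%E := le_lt_trans Ele Efin.
by rewrite !lte_mul_pinfty ?lee_fin ?mule_ge0 ?mutual_ge0 ?lee_fin.
Qed.

Lemma exists_bounded_pos mu (B : set (Rn R n)) : measurable B -> (0 < mu B)%E ->
  exists r : R, (0 < mu (B `&` ball (0%R : 'rV[R]_n) r))%E.
Proof.
move=> mB B0; apply: contrapT => nr.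
have mball (r : R) : measurable (ball (0%R : 'rV[R]_n) r : set (Rn R n)).
  by apply: measurable_open; exact: ball_open.
have Z j : mu (B `&` ball (0%R : 'rV[R]_n) j%:R) = 0%E.
  apply/eqP; rewrite eq_le measure_ge0 andbT leNgt; apply/negP => h.
  by apply: nr; exists j%:R.
move: B0; rewrite ltNge => /negP; apply.
apply: (@le_trans _ _ (\sum_(0 <= j <oo) mu (B `&` ball (0%R : 'rV[R]_n) j%:R))%E).
  apply: measure_sigma_subadditive => //; first by move=> j; exact: measurableI.
  move=> x Bx; exists (Num.truncn `|x : 'rV[R]_n|).+1 => //; split => //.
  by rewrite -ball_normE /ball_/= sub0r normrN truncnS_gt.
by rewrite eseries0.
Qed.

Lemma radon_ball mu (r : R) : radon mu -> (mu (ball (0%R : 'rV[R]_n) r) < +oo)%E.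
Proof.
move=> rmu; have cK : compact [set x : 'rV[R]_n | `|x| <= r].
  apply: bounded_closed_compact.
    exists r; split; first exact: num_real.
    by move=> M rM x /= xr; exact: le_trans xr (ltW rM).
  apply: (@closed_comp _ _ (fun x : 'rV[R]_n => `|x|) [set y | y <= r]); last exact: closed_le.
  by move=> x _; exact: norm_continuous.
apply: le_lt_trans (rmu _ cK); apply: le_measure; rewrite ?inE.
- by apply: measurable_open; exact: ball_open.
- exact: measurable_compact.
- by move=> x; rewrite -ball_normE /ball_/= sub0r normrN => /ltW.
Qed.

(** Were B charged, so would be its part in some ball, of finite mass; the normalized restriction to
    it would be admissible for N. *)
Lemma cap0_null mu N (B : set (Rn R n)) : cap N = 0%E -> radon mu ->
  (energy mu < +oo)%E -> measurable B -> B `<=` N -> mu B = 0%E.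
Proof.
move=> /cap_eq0P nN rmu Ef mB BN; apply/eqP; rewrite eq_le measure_ge0 andbT leNgt.
apply/negP => B0; have [r r0] := exists_bounded_pos mB B0.
have mball : measurable (ball (0%R : 'rV[R]_n) r : set (Rn R n)).
  by apply: measurable_open; exact: ball_open.
have mD := measurableI _ _ mB mball.
have [|nu Anu] := exists_admissible mD rmu Ef.
  rewrite r0/=; apply: le_lt_trans (radon_ball r rmu).
  by apply: le_measure; rewrite ?inE.
by apply: (nN nu); apply: sub_admissible Anu => x [/BN].
Qed.

Lemma nearly_everywhere_ae mu nu A (B : set (Rn R n)) (k : R) : sigma_finite setT nu ->
  ne (fun y => (k%:E <= pot nu y)%E) A -> radon mu -> (energy mu < +oo)%E ->
  measurable B -> B `<=` A -> mu (~` B) = 0%E ->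
  {ae mu, forall x, (k%:E <= pot nu x)%E}.
Proof.
move=> snu neA rmu Ef mB BA B0; have mp := measurable_pot H snu.
pose L : set (Rn R n) := [set x | (pot nu x < k%:E)%E].
have mL : measurable L.
  have := mp measurableT _ (emeasurable_itv `]-oo, k%:E[%O); congr (measurable _).
  by apply/seteqP; split => x /=; rewrite /L/= in_itv/=; [case|split].
exists (~` B `|` (B `&` L)); split.
- by apply: measurableU; [exact: measurableC|exact: measurableI].
- rewrite measureU0//; first exact: measurableC.
    exact: measurableI.
  apply: (cap0_null neA rmu Ef); first exact: measurableI.
  by move=> x [/BA Ax] /= Lx; split => //; rewrite leNgt Lx.
move=> x /= nx; have [Bx|] := pselect (B x); [right; split => //|by left].
by rewrite /L/= ltNge; apply/negP.
Qed.

End null_sets.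

(** * Equilibrium measures of compact sets *)

(** The right side is the energy on the segment from the minimizer (energy E) to a competitor
    (energy q), with mutual energy b; its derivative at t = 0 is 2 (b - E). *)
Lemma variational_real (R : realType) (E b q : R) :
  (forall t, 0 < t < 1 -> E <= (1 - t) * ((1 - t) * E + t * b) + t * ((1 - t) * b + t * q)) ->
  E <= b.
Proof.
move=> h; rewrite leNgt; apply/negP => bE; pose d := `|q| + `|b| + `|E| + 1.
have d0 : 0 < d by rewrite /d; have := normr_ge0 q; have := normr_ge0 b; have := normr_ge0 E; lra.
(* Small enough that the second-order term t (E - 2b + q) stays below E - b. *)
pose t := (E - b) / (2 * (d + (E - b))).
have Eb : 0 < E - b by rewrite subr_gt0.
have den : 0 < 2 * (d + (E - b)) by rewrite mulr_gt0// addr_gt0.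
have tE : t * (2 * (d + (E - b))) = E - b by rewrite /t divfK// gt_eqF.
have t0 : 0 < t by rewrite divr_gt0.
have t1 : t < 1 by rewrite /t ltr_pdivrMr//; lra.
have := h t; rewrite t0 t1 => /(_ isT) ht.
have qd : E - 2 * b + q <= 2 * d.
  rewrite /d; have := ler_norm q; have := ler_norm E; have := lerNnormlW (lexx `|b|).
  by have := normr_ge0 q; have := normr_ge0 E; lra.
have h1 : 0 <= t * (2 * (b - E) + t * (E - 2 * b + q)) by nra.
have h2 : 0 <= 2 * (b - E) + t * (E - 2 * b + q) by rewrite -(pmulr_rge0 _ t0).
have h3 : t * (E - 2 * b + q) <= t * (2 * d) by rewrite ler_pM2l.
have h4 : 0 < t * (E - b) by rewrite mulr_gt0.
by lra.
Qed.

Section compact_equilibrium.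
Context (R : realType) (n : nat) (m : bmeasure R n) (a c : R) (w S : R -> R).
Hypothesis H : riesz_setting m a c w S.
Notation kap := (@riesz R n (2 * a)).
Notation pot := (@potential R n (2 * a)).
Notation energy := (@energy R n (2 * a)).
Notation mutual := (@mutual R n (2 * a)).
Notation cap := (@cap R n (2 * a)).
Notation cap_inf := (@cap_inf R n (2 * a)).
Notation ne := (@nearly_everywhere R n (2 * a)).
Notation Mplus := (@Mplus R n (2 * a)).
Notation admissible := (@admissible R n a).
Implicit Types (mu nu lam : bmeasure R n) (A N K : set 'rV[R]_n) (x y z : 'rV[R]_n).

Lemma riesz_lower x (r : R) : exists2 d : R, 0 < d &
  forall z, ball (0 : 'rV[R]_n) r z -> (d%:E <= kap x z)%E.
Proof.
have [D xD] := sqdist_le_ball x r.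
pose e := Num.sqrt (Num.max D 0) + 1.
have e1 : 0 < e by rewrite ltr_wpDl// sqrtr_ge0.
exists (e `^ (2 * a - n%:R)); first exact: powR_gt0.
move=> z /xD xz; rewrite /riesz; case: eqP => [//|/eqP xnz]; first by rewrite leey.
have d0 : 0 < Defs.edist x z.
  by rewrite sqrtr_gt0 lt_neqAle sqdist_ge0 andbT eq_sym sqdist_eq0.
rewrite lee_fin -[2 * a - n%:R]opprK opprB !powRN lef_pV2 ?posrE ?powR_gt0//.
rewrite ge0_ler_powR ?nnegrE ?(ltW d0) ?(ltW e1)//.
  have n3 : 3%:R <= n%:R :> R by rewrite ler_nat; exact: rs_n H.
  by have := rs_a_le1 H; lra.
rewrite ler_wpDr// ler_wsqrtr// (le_trans xz)// le_max lexx//.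
Qed.

(** The constant d depends on x and r only, so a bound on potentials at one point bounds the masses
    of a ball uniformly in the measure. *)
Lemma pot_lower x (r : R) : exists2 d : R, 0 < d &
  forall mu, (d%:E * mu (ball (0%R : 'rV[R]_n) r) <= pot mu x)%E.
Proof.
have [d d0 dk] := riesz_lower x r; exists d => // mu.
have mB : measurable (ball (0%R : 'rV[R]_n) r : set (Rn R n)).
  by apply: measurable_open; exact: ball_open.
rewrite -(@integral_cst _ (Rn R n) R mu _ mB d%:E).
apply: (@le_trans _ _ (\int[mu]_(z in ball (0%R : 'rV[R]_n) r) kap x z)%E).
  apply: ge0_le_integral.
  - exact: mB.
  - by move=> z _; rewrite lee_fin ltW.
  - exact: measurable_cst.
  - by apply: measurable_funTS; exact: (measurable_riesz H).
  - by move=> z /dk.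
apply: ge0_subset_integral.
- exact: mB.
- exact: measurableT.
- by apply: (measurable_riesz H).
- by move=> z _; exact: (riesz_ge0 H).
- by [].
Qed.

Lemma pot_gt0 mu x : (0 < mu setT)%E -> (0 < pot mu x)%E.
Proof.
move=> mu0; have [r r0] := exists_bounded_pos measurableT mu0; rewrite setTI in r0.
have [d d0 dp] := pot_lower x r; apply: lt_le_trans (dp mu).
by rewrite mule_gt0.
Qed.

Lemma energy_gt0 mu : sigma_finite setT mu -> (0 < mu setT)%E -> (0 < energy mu)%E.
Proof.
move=> smu mu0; rewrite lt0e (energy_ge0 H) andbT; apply/eqP => E0.
have := @integral0_ae _ _ _ mu (pot mu) (measurable_pot H smu) (fun x => pot_ge0 H mu x) E0.
case=> N [mN N0 sN]; move: (mu0); rewrite ltNge => /negP; apply; rewrite -N0.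
apply: le_measure; rewrite ?inE// => x _; apply: sN => /= px.
by have := pot_gt0 x mu0; rewrite px ltxx.
Qed.

Lemma admissible_outside K mu : compact K -> admissible K mu -> mu (~` K) = 0%E.
Proof.
move=> cK [_ [B [mB BK B0]] _ _]; apply/eqP; rewrite eq_le measure_ge0 andbT -B0.
apply: le_measure; rewrite ?inE; [|exact: measurableC|exact: subsetC].
by apply: measurableC; exact: measurable_compact.
Qed.

(** All measures live on the compact K, so the limit along the ultrafilter loses no mass. Its energy
    is controlled by two successive one-variable limits and positive definiteness, without
    convergence of product measures. *)
Lemma exists_minimizer K : compact K -> (exists nu, admissible K nu) ->
  exists2 lam, admissible K lam & energy lam = cap_inf K.
Proof.
move=> cK [nu0 A0].
have Ifin : cap_inf K \is a fin_num.
  rewrite ge0_fin_numE ?(cap_inf_ge0 H)//.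
  by apply: (le_lt_trans (cap_inf_le A0)); case: A0.
have /choice[l lP] (k : nat) : exists lam, admissible K lam /\
    (energy lam <= cap_inf K + (k.+1%:R^-1)%:E)%E.
  have k0 : 0 < k.+1%:R^-1 :> R by rewrite invr_gt0.
  have [_ [lam Alam <-] /ltW lt_l] := lb_ereal_inf_adherent k0 Ifin.
  by exists lam.
have lT k : l k setT = 1%E by have [[]] := lP k.
have [F [FU Foo]] := @ultraFilterLemma nat \oo _.
have mball (r : R) : measurable (ball (0%R : 'rV[R]_n) r : set (Rn R n)).
  by apply: measurable_open; exact: ball_open.
have bnd (r : R) : exists M : R, forall k, (l k (ball (0%R : 'rV[R]_n) r) <= M%:E)%E.
  by exists 1 => k; rewrite -(lT k); apply: le_measure; rewrite ?inE.
have [lam [lo lc]] := exists_ultralimit FU bnd.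
have FF : ProperFilter F by exact: ultra_proper.
have umE X r : bounded_borel X -> (forall k, l k X = r%:E) -> ultramass F l X = r.
  move=> bX lX; apply: (@cvg_unique _ _ (fine (l k X) @[k --> F])) => //.
  - exact (ultramass_cvg FU bnd bX).
  - by rewrite (_ : (fun k => _) = cst r); [exact: cvg_cst|apply/funext => k; rewrite lX].
have [r r0 Kr] := compact_sub_ball cK.
have mK : measurable (K : set (Rn R n)) by exact: measurable_compact.
have lK k : l k K = 1%E.
  rewrite -(lT k) -(setUv K) measureU0//; first exact: measurableC.
  by apply: (admissible_outside cK); have [] := lP k.
have lamout : lam (~` K) = 0%E.
  apply/eqP; rewrite eq_le measure_ge0 andbT.
  have Z j : lam (~` K `&` ball (0%R : 'rV[R]_n) j%:R) = 0%E.
    have bX : bounded_borel (~` K `&` ball (0%R : 'rV[R]_n) j%:R).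
      by split; [apply: measurableI => //; exact: measurableC|exists j%:R => x []].
    have U0 : ultramass F l (~` K `&` ball (0%R : 'rV[R]_n) j%:R) = 0.
      apply: umE => // k; apply/eqP; rewrite eq_le measure_ge0 andbT.
      apply: (@le_trans _ _ (l k (~` K))); last by rewrite (admissible_outside cK (lP k).1).
      by apply: le_measure; rewrite ?inE//; [case: bX|exact: measurableC].
    apply/eqP; rewrite eq_le measure_ge0 andbT.
    apply: (@le_trans _ _ (ultramass F l (~` K `&` ball (0%R : 'rV[R]_n) j%:R))%:E).
      apply: lo; last by exists j%:R => x [].
      apply: openI; last exact: ball_open.
      by apply: closed_openC; apply: compact_closed => //; exact: norm_hausdorff.
    by rewrite U0.
  apply: (@le_trans _ _ (\sum_(0 <= j <oo) lam (~` K `&` ball (0%R : 'rV[R]_n) j%:R))%E).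
    apply: measure_sigma_subadditive.
    - by move=> j; apply: measurableI => //; exact: measurableC.
    - exact: measurableC.
    move=> x Kx; exists (Num.truncn `|x|).+1 => //; split => //.
    by rewrite -ball_normE /ball_/= sub0r normrN truncnS_gt.
  by rewrite eseries0.
have lamT : lam setT = 1%E.
  rewrite -(setUv K) measureU0//; last exact: measurableC.
  apply/eqP; rewrite eq_le; apply/andP; split.
    apply: (@le_trans _ _ (lam (ball (0%R : 'rV[R]_n) r))).
      by apply: le_measure; rewrite ?inE.
    have bB : bounded_borel (ball (0%R : 'rV[R]_n) r) by split => //; exists r.
    rewrite -(umE _ 1 bB); first by apply: lo; [exact: ball_open|exists r].
    move=> k; apply/eqP; rewrite eq_le; apply/andP; split.
      by rewrite -(lT k); apply: le_measure; rewrite ?inE.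
    by rewrite -(lK k); apply: le_measure; rewrite ?inE.
  by rewrite -(umE K 1) //; [exact: lc|split => //; exists r].
have slam : sigma_finite setT lam by apply: finite_sigma_finite; rewrite lamT ltry.
have sl k : sigma_finite setT (l k) by apply: finite_sigma_finite; rewrite lT ltry.
have near_l (e : R) : 0 < e -> \forall k \near F, (energy (l k) <= cap_inf K + e%:E)%E.
  move=> e0; apply: Foo; have [j je] := @ltr_add_invr R 0 e e0; rewrite add0r in je.
  exists j => // k /= jk; apply: (le_trans (lP k).2); rewrite leeD2l// lee_fin.
  by rewrite (le_trans _ (ltW je))// lef_pV2 ?posrE// ler_nat ltnS.
have Ele (e : R) : 0 < e -> (energy lam <= cap_inf K + e%:E)%E.
  move=> e0; rewrite -(fineK Ifin) -EFinD.
  (* The limit in j, against the fixed potential of [l k]; [mutual_amgm] bounds the mutual energies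
     by the average of the two energies. The limit in k follows, against the potential of [lam]. *)
  have h k : (energy (l k) <= cap_inf K + e%:E)%E -> (mutual lam (l k) <= (fine (cap_inf K) + e)%:E)%E.
    move=> hk; apply: (ultralimit_lsc FU bnd lo).
    - exact: (pot_lsc H).
    - by move=> x; exact: (pot_ge0 H).
    move: (near_l e e0); apply: filterS => j hj.
    have h2 := mutual_amgm H (sl k) (sl j).
    rewrite -(@lee_pmul2l _ 2%:E)//; apply: (le_trans h2).
    have IE : cap_inf K = (fine (cap_inf K))%:E by rewrite fineK.
    rewrite {}IE in hk hj; move: hk hj; set i := fine _ => hk hj.
    apply: (le_trans (leeD hk hj)); rewrite -!EFinD -EFinM lee_fin; lra.
  apply: (ultralimit_lsc FU bnd lo).
  - exact: (pot_lsc H).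
  - by move=> x; exact: (pot_ge0 H).
  move: (near_l e e0); apply: filterS => k hk.
  have := mutualC H (sl k) slam; rewrite /mutual => ->.
  exact: h.
have Alam : admissible K lam.
  split => //.
  - by apply: finite_radon; rewrite lamT ltry.
  - by exists K; split.
  - by apply: (le_lt_trans (Ele 1 ltr01)); rewrite -(fineK Ifin) -EFinD ltry.
exists lam => //; apply/eqP; rewrite eq_le cap_inf_le// andbT.
by apply/lee_addgt0Pr => e e0; exact: Ele.
Qed.

Lemma energy_mixture (k l : {nonneg R}) lam nu : sigma_finite setT lam -> sigma_finite setT nu ->
  let mu : bmeasure R n := measure_add (mscale k lam) (mscale l nu) in
  energy mu = (k%:num%:E * (k%:num%:E * energy lam + l%:num%:E * mutual lam nu) +
               l%:num%:E * (k%:num%:E * mutual nu lam + l%:num%:E * energy nu))%E.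
Proof.
move=> slam snu mu.
have mpl : measurable_fun setT (pot lam : Rn R n -> \bar R) by exact: (measurable_pot H).
have mpn : measurable_fun setT (pot nu : Rn R n -> \bar R) by exact: (measurable_pot H).
have pE : pot mu = (fun x => k%:num%:E * pot lam x + l%:num%:E * pot nu x)%E.
  apply/funext => x; rewrite -!(pot_mscale H).
  apply: ge0_integral_measure_add => //; last exact: (measurable_riesz H).
  by move=> z _; exact: (riesz_ge0 H).
have kp0 (q : {nonneg R}) nu0 x : (0 <= q%:num%:E * pot nu0 x)%E.
  by rewrite mule_ge0 ?(pot_ge0 H)// lee_fin.
have mk : measurable_fun setT (fun x : Rn R n => k%:num%:E * pot lam x)%E.
  exact: measurable_funeM.
have ml : measurable_fun setT (fun x : Rn R n => l%:num%:E * pot nu x)%E.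
  exact: measurable_funeM.
have mp : measurable_fun setT (pot mu : Rn R n -> \bar R).
  by rewrite pE; exact: emeasurable_funD.
have int nu0 : (\int[nu0]_x pot mu x = k%:num%:E * mutual nu0 lam + l%:num%:E * mutual nu0 nu)%E.
  rewrite pE (ge0_integralD _ measurableT (fun (x : Rn R n) _ => kp0 k lam x) mk
    (fun (x : Rn R n) _ => kp0 l nu x) ml).
  by rewrite !ge0_integralTZl// => x; exact: (pot_ge0 H).
have p0 (x : Rn R n) : setT x -> (0 <= pot mu x)%E by move=> _; exact: (pot_ge0 H).
rewrite /Defs.energy {1}/Defs.mutual.
rewrite (ge0_integral_measure_add (mscale k lam) (mscale l nu) measurableT p0 mp).
rewrite (ge0_integral_mscale lam measurableT k mp p0) (ge0_integral_mscale nu measurableT l mp p0).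
by rewrite !int.
Qed.

Lemma minimizer_variational K lam nu : admissible K lam -> energy lam = cap_inf K ->
  admissible K nu -> (cap_inf K <= mutual nu lam)%E.
Proof.
move=> Al El An; have [rl [B [mB BK B0]] lT Elf] := Al.
have [rn [D [mD DK D0]] nT Enf] := An.
have sl := radon_sigma_finite rl; have sn := radon_sigma_finite rn.
have fE mu : (energy mu < +oo)%E -> energy mu \is a fin_num.
  by move=> h; rewrite ge0_fin_numE// (energy_ge0 H).
have fl := fE _ Elf; have fn := fE _ Enf.
have fb : mutual nu lam \is a fin_num.
  rewrite ge0_fin_numE ?(mutual_ge0 H)//.
  apply: (@lte_pmul_fin _ 2); rewrite ?(mutual_ge0 H)//.
  apply: (le_lt_trans (mutual_amgm H sl sn)).
  by rewrite -(fineK fl) -(fineK fn) -EFinD ltry.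
have lE : energy lam = (fine (energy lam))%:E by rewrite fineK.
have nE : energy nu = (fine (energy nu))%:E by rewrite fineK.
have bE : mutual nu lam = (fine (mutual nu lam))%:E by rewrite fineK.
move: lE nE bE; set E := fine _; set q := fine _; set b := fine _ => lE nE bE.
rewrite -El lE bE lee_fin.
apply: (@variational_real _ _ _ q) => t /andP[t0 t1].
have t1' : 0 <= 1 - t by rewrite subr_ge0 ltW.
pose k : {nonneg R} := NngNum t1'; pose l : {nonneg R} := NngNum (ltW t0).
pose mu : bmeasure R n := measure_add (mscale k lam) (mscale l nu).
have muE X : mu X = ((1 - t)%:E * lam X + t%:E * nu X)%E.
  exact: (measure_addE (mscale k lam) (mscale l nu) X).
have muT : mu setT = 1%E by rewrite muE lT nT !mule1 -EFinD subrK.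
have emix : energy mu = ((1 - t)%:E * ((1 - t)%:E * energy lam + t%:E * mutual lam nu) +
    t%:E * ((1 - t)%:E * mutual nu lam + t%:E * energy nu))%E.
  exact (energy_mixture k l sl sn).
have {}emix : energy mu =
    ((1 - t) * ((1 - t) * E + t * b) + t * ((1 - t) * b + t * q))%:E.
  rewrite emix (mutualC H sl sn) lE nE bE; move: (1 - t) => s.
  by rewrite !(EFinD, EFinM).
rewrite -lee_fin -emix -lE El; apply: cap_inf_le; split => //.
- by apply: finite_radon; rewrite muT ltry.
- exists (B `|` D); split; first exact: measurableU.
    by move=> x [/BK|/DK].
  have Z (nu0 : bmeasure R n) (C : set (Rn R n)) : measurable C -> C `<=` B `|` D ->
      nu0 (~` C) = 0%E -> nu0 (~` (B `|` D)) = 0%E.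
    move=> mC CBD C0; apply/eqP; rewrite eq_le measure_ge0 andbT -C0.
    apply: le_measure; rewrite ?inE; [|exact: measurableC|exact: subsetC].
    by apply: measurableC; exact: measurableU.
  rewrite muE (Z lam B) ?(Z nu D)// ?mule0 ?adde0//.
- by rewrite emix ltry.
Qed.

Lemma ae_eq_integral_le (nu : bmeasure R n) (f g : Rn R n -> \bar R) :
  measurable_fun setT f -> measurable_fun setT g ->
  (forall x, 0 <= f x)%E -> (forall x, 0 <= g x)%E ->
  {ae nu, forall x, (f x <= g x)%E} -> (\int[nu]_x f x < +oo)%E ->
  (\int[nu]_x g x <= \int[nu]_x f x)%E -> {ae nu, forall x, g x = f x}.
Proof.
move=> mf mg f0 g0 fg ffin gf; pose h (x : Rn R n) := maxe (g x - f x)%E 0%E.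
have mh : measurable_fun setT h.
  by apply: measurable_maxe; [exact: emeasurable_funB|exact: measurable_cst].
have h0 x : (0 <= h x)%E by rewrite /h le_max lexx orbT.
have gE x : (f x <= g x)%E -> g x = (f x + h x)%E.
  move=> fgx; rewrite addeC {1}(maxe_mine_split (g0 x) (f0 x)); congr (_ + _)%E.
  by rewrite minC min_l.
have ffn : (\int[nu]_x f x)%E \is a fin_num by rewrite ge0_fin_numE// integral_ge0.
have Ih : (\int[nu]_x h x = 0)%E.
  apply/eqP; rewrite eq_le; apply/andP; split; last exact: integral_ge0.
  rewrite -(leeD2lE _ _ ffn) adde0.
  rewrite -(ge0_integralD nu measurableT (fun x _ => f0 x) mf (fun x _ => h0 x) mh).
  apply: le_trans gf; apply: ae_le_integral => //.
  - exact: emeasurable_funD.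
  - by move=> x; rewrite adde_ge0.
  - by apply: ae_imp fg => x fgx; rewrite -gE.
apply: ae_imp2 fg (integral0_ae mh h0 Ih) => x fgx hx.
by rewrite (gE x fgx) hx adde0.
Qed.

(** The energy minimizer divided by its energy I, or the zero measure when K carries no admissible
    measure. The variational inequality gives potential at least I nearly everywhere. *)
Lemma compact_equilibrium K : compact K -> exists g : bmeasure R n,
  [/\ (g setT < +oo)%E, g (~` K) = 0%E, (energy g < +oo)%E,
      {ae g, forall x, pot g x = 1%E} &
      ne (fun y => 1 <= pot g y)%E K /\ g setT = cap K].
Proof.
move=> cK; have mK : measurable (K : set (Rn R n)) by exact: measurable_compact.
have [eA|nA] := pselect (exists nu, admissible K nu); last first.
  have cap0 : cap K = 0%E by apply/(cap_eq0P H) => nu Anu; apply: nA; exists nu.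
  exists (mzero : bmeasure R n); split => //.
  - by rewrite /= /mzero ltry.
  - by rewrite /energy/Defs.mutual integral_measure_zero ltry.
  - by exists setT; split => //; exact: measurableT.
  - split; last by rewrite cap0.
    by apply: (sub_cap0 H) cap0 => x [].
have [lam Al El] := exists_minimizer cK eA.
have lamout := admissible_outside cK Al.
have [rl cl lT Elf] := Al; have sl := radon_sigma_finite rl.
have El0 : (0 < energy lam)%E by apply: energy_gt0 => //; rewrite lT lte01.
have lE : energy lam = (fine (energy lam))%:E by rewrite fineK// ge0_fin_numE// ltW.
move: lE; set I := fine _ => lE; have I0 : 0 < I by rewrite -lte_fin -lE.
have mp : measurable_fun setT (pot lam : Rn R n -> \bar R) by exact: (measurable_pot H).
have cI (nu : bmeasure R n) : nu setT = 1%E -> (\int[nu]_x (cst I%:E x) = I%:E)%E.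
  by move=> nT; rewrite integral_cst// nT mule1.
(* A unit measure nu carried by the set where pot lam < I has mutual energy at most I with [lam],
   and at least I by the variational inequality; equality would force pot lam = I almost everywhere
   for nu. *)
have neI : ne (fun y => I%:E <= pot lam y)%E K.
  apply/(cap_eq0P H) => nu An; have AnK : admissible K nu.
    by apply: sub_admissible An => x [].
  have [_ [B [mB BN B0]] nT Enf] := An.
  have var := minimizer_variational Al El AnK; rewrite -El lE in var.
  have aelt : {ae nu, forall x, (pot lam x < I%:E)%E}.
    exists (~` B); split => //; first exact: measurableC.
    by move=> x /= nx Bx; apply: nx; have [_ /negP] := BN _ Bx; rewrite -ltNge.
  have aele : {ae nu, forall x, (pot lam x <= cst I%:E x)%E}.
    by apply: ae_imp aelt => x /ltW.
  have fin : (mutual nu lam < +oo)%E.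
    apply: le_lt_trans (ltry I); rewrite -(cI nu nT).
    apply: ae_le_integral => // x; first exact: (pot_ge0 H).
    by rewrite lee_fin ltW.
  have := @ae_eq_integral_le nu (pot lam) (cst I%:E) mp (measurable_cst _)
    (fun x => pot_ge0 H lam x) (fun=> ltW (_ : 0 < I%:E)%E) aele fin.
  rewrite lte_fin => /(_ I0); rewrite (cI nu nT) => /(_ var) aeeq.
  have [N [mN N0 sN]] : {ae nu, forall x : Rn R n, False}.
    by apply: ae_imp2 aelt aeeq => x /[swap] <-; rewrite ltxx.
  move: nT => /eqP; rewrite (_ : setT = N) ?N0 ?eqe ?(eq_sym 0) ?oner_eq0//.
  by apply/seteqP; split => // x _; apply: sN => /=; case.
(* The potential integrates to exactly I against the unit measure [lam], so the lower bound is an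
   equality almost everywhere. *)
have aeI : {ae lam, forall x, pot lam x = I%:E}.
  have aege := nearly_everywhere_ae H sl neI rl Elf mK (@subset_refl _ K) lamout.
  apply: (@ae_eq_integral_le lam (cst I%:E) (pot lam)) => //.
  - by move=> x; rewrite lee_fin ltW.
  - by move=> x; exact: (pot_ge0 H).
  - by rewrite (cI lam lT) ltry.
  - by rewrite (cI lam lT) -lE.
have k0 : 0 <= I^-1 by rewrite invr_ge0 ltW.
pose k : {nonneg R} := NngNum k0; pose g : bmeasure R n := mscale k lam.
have gX X : g X = (I^-1%:E * lam X)%E by [].
have pg x : pot g x = (I^-1%:E * pot lam x)%E by exact: (pot_mscale H k).
have gT : g setT = I^-1%:E by rewrite gX lT mule1.
exists g; split.
- by rewrite gT ltry.
- by rewrite gX lamout mule0.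
- rewrite /energy (mutual_mscalel H _ _ (finite_sigma_finite _)); last by rewrite gT ltry.
  by rewrite (mutual_mscaler H _ _ sl) -/(energy lam) lE -!EFinM ltry.
- case: aeI => N [mN N0 sN]; exists N; split => //; first by rewrite gX N0 mule0.
  by move=> x /= nx; apply: sN => /= px; apply: nx; rewrite pg px -EFinM mulVf// gt_eqF.
split.
  apply: (sub_cap0 H) neI => x [Kx nx]; split => // px; apply: nx.
  by rewrite pg -(@lee_pmul2l _ I%:E)// mule1 muleA -EFinM divff ?gt_eqF// mul1e.
by rewrite gT /Defs.cap -/(cap_inf K) -El lE /= eqe gt_eqF.
Qed.

End compact_equilibrium.

(** * Increasing sequences of potentials *)

Lemma powR_split (R : realType) (a v : R) : 0 < v -> v `^ a = v `^ (a - 1) * v.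
Proof.
move=> v0; rewrite -[X in _ * X]powRr1 ?(ltW v0)// -powRD ?subrK//.
by apply/implyP => _; rewrite gt_eqF.
Qed.

Section smoothed_potentials.
Context (R : realType) (n : nat) (m : bmeasure R n) (a c : R) (w S : R -> R).
Hypothesis H : riesz_setting m a c w S.
Notation leb := (@lebesgue_measure R).
Notation kap := (@riesz R n (2 * a)).
Notation pot := (@potential R n (2 * a)).
Notation smear := (smear m w).
Implicit Types (mu nu : bmeasure R n) (x y z : 'rV[R]_n).

Let hm := rs_ref H.
Let tw := rs_weights H.

(** Of the time integral of kappa only the times in [v, 2v] are kept: there s^(a-1) >= (2v)^(a-1) as
    a <= 1, and the kernel is at least 2^(-n/2) times the one at v. The length v of the interval
    completes v^a, which is at least r^a. *)
Lemma heat_le_riesz (r : R) : 0 < r -> exists2 C : R, 0 < C &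
  forall v x z, r <= v -> ((heat v x z)%:E <= C%:E * kap x z)%E.
Proof.
move=> r0; pose q : R := c * (2 `^ (a - 1) * (r `^ a * 2 `^ (- (n%:R / 2)))).
have q0 : 0 < q by rewrite !mulr_gt0 ?powR_gt0// (rs_c_gt0 H).
exists q^-1; first by rewrite invr_gt0.
move=> v x z rv; have v0 : 0 < v by rewrite (lt_le_trans r0).
suff qk : (q%:E * (heat v x z)%:E <= kap x z)%E.
  rewrite -[leLHS]mul1e -[1%E](_ : (q^-1)%:E * q%:E = 1)%E; last first.
    by rewrite -EFinM mulVf// gt_eqF.
  by rewrite -muleA lee_wpmul2l// lee_fin invr_ge0 ltW.
pose K := c * ((2 * v) `^ (a - 1) * (2 `^ (- (n%:R / 2)) * heat v x z)).
have K0 : 0 <= K.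
  by rewrite !mulr_ge0 ?powR_ge0 ?heat_ge0// ltW// (rs_c_gt0 H).
rewrite (rs_riesz H).
have mF : measurable_fun setT (fun s : measurableTypeR R => (c * tpow a s * heat s x z)%:E).
  apply/measurable_EFinP; apply: measurable_funM.
    by apply: measurable_funM => //; exact: measurable_tpow.
  exact: measurable_heat.
have F0 s : (0 <= (c * tpow a s * heat s x z)%:E)%E.
  by rewrite lee_fin !mulr_ge0 ?tpow_ge0 ?heat_ge0// ltW// (rs_c_gt0 H).
apply: (@le_trans _ _ (\int[leb]_(s in `[v, (2 * v)%R]) (c * tpow a s * heat s x z)%:E)%E); last first.
  by apply: ge0_subset_integral.
apply: (@le_trans _ _ (\int[leb]_(s in `[v, (2 * v)%R]) cst K%:E s)%E).
  have Lm := @lebesgue_measure_itv R `[v, 2 * v]%O.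
  rewrite /= lte_fin ltr_pMl// ltr1n -EFinB in Lm.
  rewrite integral_cst// [X in (_ <= _ * X)%E](_ : _ = (2 * v - v)%:E); last exact: Lm.
  rewrite -!EFinM lee_fin.
  have -> : 2 * v - v = v by ring.
  have -> : K * v = c * (2 `^ (a - 1) * (v `^ a * 2 `^ (- (n%:R / 2)))) * heat v x z.
    rewrite /K powRM ?(ltW v0)//.
    rewrite (powR_split a v0); ring.
  rewrite ler_wpM2r ?heat_ge0// /q ler_pM2l ?(rs_c_gt0 H)// ler_pM2l ?powR_gt0//.
  rewrite ler_pM2r ?powR_gt0// ge0_ler_powR ?nnegrE ?(ltW r0) ?(ltW v0)//.
  by rewrite ltW// (rs_a_gt0 H).
apply: ge0_le_integral => //; first exact: measurable_funTS.
move=> s /=; rewrite in_itv/= => /andP[vs s2v]; have s0 : 0 < s by rewrite (lt_le_trans v0).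
have v20 : 0 < 2 * v by rewrite mulr_gt0.
rewrite lee_fin /K mulrA ler_pM//.
- by rewrite mulr_ge0 ?powR_ge0// ltW// (rs_c_gt0 H).
- by rewrite mulr_ge0 ?powR_ge0 ?heat_ge0.
- rewrite ler_pM2l ?(rs_c_gt0 H)// /tpow s0.
  rewrite -[a - 1]opprK opprB !powRN lef_pV2 ?posrE ?powR_gt0//.
  by rewrite ge0_ler_powR ?nnegrE ?(ltW s0) ?(ltW v20)// subr_ge0 (rs_a_le1 H).
rewrite !heatE// mulrA -powRM ?mulr_ge0 ?pi_ge0 ?(ltW v0)//.
rewrite ler_pM ?powR_ge0 ?expR_ge0//.
  rewrite !powRN lef_pV2 ?posrE ?powR_gt0 ?mulr_gt0 ?pi_gt0//.
  rewrite ge0_ler_powR ?nnegrE ?divr_ge0 ?mulr_ge0 ?pi_ge0 ?(ltW s0) ?(ltW v0)//.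
  by rewrite mulrCA ler_pM2l ?pi_gt0.
by rewrite ler_expR lerN2 ler_wpM2l ?sqdist_ge0// lef_pV2 ?posrE.
Qed.

Lemma S_eq_tpow s : s <= 1 -> S s = tpow a s.
Proof.
move=> s1; have := tw_conv tw s; rewrite integral0_eq ?add0e => [[]//|r _].
have [r1|r1] := leP r 1; first by rewrite (tw_w_le1 tw r1) mul0r.
by rewrite /tpow ltNge subr_le0 (le_trans s1 (ltW r1))/= mulr0.
Qed.

Lemma heatm_le_pot (r : R) : 0 < r -> exists2 C : R, 0 < C &
  forall mu v x, r <= v -> (heatm v mu x <= C%:E * pot mu x)%E.
Proof.
move=> /heat_le_riesz[C C0 hC]; exists C => // mu v x rv.
have mk : measurable_fun setT (fun z : Rn R n => kap x z) by exact: (measurable_riesz H).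
have k0 z : (0 <= kap x z)%E by exact: (riesz_ge0 H).
rewrite -(ge0_integralTZl mu mk k0 (ltW C0)); apply: ge0_le_integral.
- exact: measurableT.
- by move=> z _; rewrite lee_fin heat_ge0.
- exact: measurable_heatE.
- exact: measurable_funeM.
- by move=> z _; exact: hC.
Qed.

(** The image of [smear_rest] under H_r, by [heatf_smear_rest]. The delay r removes the singularity
    of the kernel at time 0. *)
Definition heat_rest r t mu x : \bar R :=
  ((c * t `^ a)%:E * \int[leb]_s ((S s)%:E * heatm (r + t * s)%R mu x))%E.

Let ct0 t : 0 <= c * t `^ a.
Proof. by rewrite mulr_ge0 ?powR_ge0// ltW// (rs_c_gt0 H). Qed.
Let S0 s : (0 <= (S s)%:E)%E. Proof. by rewrite lee_fin (tw_S_ge0 tw). Qed.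
Let mS : measurable_fun setT (fun r : measurableTypeR R => (S r)%:E).
Proof. by apply/measurable_EFinP; exact: tw_mS tw. Qed.

Lemma measurable_heatm_affine r t mu x : sigma_finite setT mu ->
  measurable_fun setT (fun s : measurableTypeR R => heatm (r + t * s)%R mu x).
Proof.
by move=> smu; apply: measurable_heatm => //; apply: measurable_funD => //; exact: measurable_funM.
Qed.

Let mSh r t mu x : sigma_finite setT mu ->
  measurable_fun setT (fun s : measurableTypeR R => (S s)%:E * heatm (r + t * s)%R mu x)%E.
Proof. by move=> smu; apply: emeasurable_funM => //; exact: measurable_heatm_affine. Qed.

Let Sh0 r t mu x s : (0 <= (S s)%:E * heatm (r + t * s)%R mu x)%E.
Proof. by rewrite mule_ge0// heatm_ge0. Qed.

Lemma heat_rest_ge0 r t mu x : (0 <= heat_rest r t mu x)%E.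
Proof. by rewrite mule_ge0 ?lee_fin ?ct0// integral_ge0. Qed.

Lemma heatf_smear_rest r t mu x : 0 < r -> 0 < t -> sigma_finite setT mu ->
  heatf m r (smear_rest a c S t mu) x = heat_rest r t mu x.
Proof.
move=> r0 t0 smu; rewrite /heat_rest /heatf /smear_rest.
have mp : measurable_fun setT (fun p : Rn R n * measurableTypeR R =>
    (heat r x p.1)%:E * ((S p.2)%:E * heatm (t * p.2)%R mu p.1))%E.
  apply: emeasurable_funM; first by apply: measurable_heatE.
  apply: emeasurable_funM; first exact: measurable_on_snd mS.
  apply: measurable_heatm => //; apply: measurable_funM => //; exact: measurable_snd.
have p0 y s : (0 <= (heat r x y)%:E * ((S s)%:E * heatm (t * s)%R mu y))%E.
  by rewrite !mule_ge0// ?heatm_ge0// lee_fin heat_ge0.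
transitivity (\int[m]_y ((c * t `^ a)%:E *
    \int[leb]_s ((heat r x y)%:E * ((S s)%:E * heatm (t * s)%R mu y))))%E.
  apply: eq_integral => y _; rewrite muleCA; congr (_ * _)%E.
  rewrite ge0_integralTZl//; last by rewrite heat_ge0.
    by apply: emeasurable_funM => //; exact: measurable_heatm_scale.
  by move=> s; rewrite mule_ge0// heatm_ge0.
rewrite (ge0_integralTZl m _ _ (ct0 t)); first last.
- by move=> y; apply: integral_ge0.
- apply: (@measurable_tonelli _ _ (Rn R n) (measurableTypeR R) R leb
    (fun y s => (heat r x y)%:E * ((S s)%:E * heatm (t * s)%R mu y))%E) => //.
  exact: sigma_finite_leb.
congr (_ * _)%E.
rewrite (@tonelli _ _ (Rn R n) (measurableTypeR R) R m leb
    (fun y s => (heat r x y)%:E * ((S s)%:E * heatm (t * s)%R mu y))%E (sigma_finite_ref hm)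
    (@sigma_finite_leb R) mp p0).
apply: eq_integral => s _; have [s0|s0] := leP s 0.
  rewrite (S_le0 H s0) mul0e; under eq_integral do rewrite mul0e mule0.
  by rewrite integral0.
under eq_integral do rewrite muleCA.
rewrite ge0_integralTZl//; first last.
- by have := S0 s; rewrite lee_fin.
- by move=> y; rewrite mule_ge0 ?heatm_ge0// lee_fin heat_ge0.
- by apply: emeasurable_funM; [apply: measurable_heatE|apply: measurable_heatm].
by congr (_ * _)%E; apply: (heatf_heatm hm) => //; rewrite mulr_gt0.
Qed.

Lemma heatf_pot_split r t mu x : 0 < r -> 0 < t -> sigma_finite setT mu ->
  heatf m r (pot mu) x = (heatf m r (smear t (pot mu)) x + heat_rest r t mu x)%E.
Proof.
move=> r0 t0 smu; rewrite -heatf_smear_rest//.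
have ms : measurable_fun setT (smear t (pot mu) : Rn R n -> \bar R).
  by apply: (measurable_smear H); [exact: (measurable_pot H)|move=> y; exact: (pot_ge0 H)].
have mr : measurable_fun setT (smear_rest a c S t mu : Rn R n -> \bar R).
  apply: measurable_funeM.
  apply: (@measurable_tonelli _ _ (Rn R n) (measurableTypeR R) R leb
    (fun x s => (S s)%:E * heatm (t * s)%R mu x)%E).
  - exact: sigma_finite_leb.
  - apply: emeasurable_funM; first exact: measurable_on_snd mS.
    apply: measurable_heatm => //.
    by apply: measurable_funM => //; exact: measurable_snd.
  - by move=> y s; rewrite mule_ge0// heatm_ge0.
rewrite -(@heatfD _ _ m r _ _ x ms mr).
- congr heatf; apply/funext => y; exact: (pot_split H).
- by move=> y; apply: (smear_ge0 H) => z; exact: (pot_ge0 H).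
- move=> y; apply: mule_ge0; first by rewrite lee_fin ct0.
  by apply: integral_ge0 => s _; rewrite mule_ge0// heatm_ge0.
Qed.

(** Since S(s) = s^(a-1) on (0, 1], the rest at scale t contains all of the times up to t; by
    Fatou's lemma it exhausts H_r (pot mu) as t grows, which leaves nothing for the part H_r P_t. *)
Lemma heatf_smear_pot_vanish r mu x : 0 < r -> sigma_finite setT mu ->
  (heatf m r (pot mu) x < +oo)%E ->
  heatf m r (smear k.+1%:R (pot mu)) x @[k --> \oo] --> 0%E.
Proof.
move=> r0 smu fin; apply: (@cvg0_complement R (fun k => heatf m r (smear k.+1%:R (pot mu)) x)
  (fun k => heat_rest r k.+1%:R mu x) _ fin).
- move=> k; apply: heatf_ge0 => y; apply: (smear_ge0 H) => z; exact: (pot_ge0 H).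
- by move=> k; exact: heat_rest_ge0.
- by move=> k; rewrite -heatf_pot_split.
rewrite (heatf_pot_time H _ r0 smu).
have ctp0 s : 0 <= c * tpow a s by rewrite mulr_ge0 ?tpow_ge0// ltW// (rs_c_gt0 H).
have mhr : measurable_fun setT (fun s : measurableTypeR R => heatm (r + s)%R mu x).
  by apply: measurable_heatm => //; exact: measurable_funD.
have mctp : measurable_fun setT (fun s : measurableTypeR R => (c * tpow a s)%:E).
  by apply/measurable_EFinP; apply: measurable_funM => //; exact: measurable_tpow.
(* Cut at s <= k+1: after scaling by k+1 this is the range s <= 1, where S is known. *)
pose h (k : nat) (s : measurableTypeR R) :=
  ((c * tpow a s)%:E * (if (s <= k.+1%:R)%R then heatm (r + s)%R mu x else 0))%E.
have mh k : measurable_fun setT (h k).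
  apply: emeasurable_funM => //; apply: measurable_fun_ifT => //; exact: measurable_fun_ler.
have h0 k s : (0 <= h k s)%E.
  by rewrite /h mule_ge0 ?lee_fin//; case: ifP => // _; exact: heatm_ge0.
apply: (@le_trans _ _ (limn_einf (fun k => \int[leb]_s h k s)%E)).
  apply: le_integral_limn_einf => //.
  - exact: emeasurable_funM.
  - by move=> s; rewrite mule_ge0 ?lee_fin// heatm_ge0.
  move=> s; apply: limn_einf_ge; exists (Num.truncn s).+1 => // k /= sk.
  rewrite /h ifT// (le_trans (ltW (truncnS_gt s)))// ler_nat.
  exact: leq_trans sk _.
apply: le_limn_einf => k; have k0 : 0 < k.+1%:R :> R by [].
have mhc : measurable_fun setT (fun s : measurableTypeR R => h k (k.+1%:R * s)%R).
  by apply: (measurableT_comp (mh k)); exact: measurable_funM.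
have hc0 s : (0 <= h k (k.+1%:R * s)%R)%E by exact: h0.
rewrite -(ge0_integral_scaling k0 (mh k) (h0 k)).
rewrite -(ge0_integralTZl _ mhc hc0 (ltW k0)).
rewrite /heat_rest -(ge0_integralTZl _ (mSh r k.+1%:R x smu) (Sh0 r k.+1%:R mu x) (ct0 _)).
apply: ge0_le_integral.
- exact: measurableT.
- by move=> s _; rewrite mule_ge0// lee_fin.
- exact: measurable_funeM.
- by apply: measurable_funeM; exact: mSh.
move=> s _; rewrite /h; case: ifPn => [sk|_]; last by rewrite !mule0 mule_ge0 ?lee_fin ?ct0.
have s1 : s <= 1 by rewrite -(ler_pM2l k0) mulr1.
rewrite (S_eq_tpow s1) !muleA -!EFinM lee_wpmul2r ?heatm_ge0// lee_fin.
rewrite /tpow pmulr_rgt0//; case: ltP => s0; last by rewrite !mulr0.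
rewrite powRM ?(ltW s0)// le_eqVlt; apply/orP; left; apply/eqP.
rewrite (powR_split a k0); ring.
Qed.

End smoothed_potentials.

Lemma adde_eq_fin (R : realType) (x y : \bar R) (r : R) : (0 <= x)%E -> (0 <= y)%E ->
  (x + y = r%:E)%E -> [/\ x = (fine x)%:E, y = (fine y)%:E & fine x + fine y = r].
Proof. by case: x => [x| |]//; case: y => [y| |]// _ _ [<-]. Qed.

Lemma split_upper (R : realType) (p q k k' e C : R) : p + q = k -> C <= q + e ->
  k <= k' + e -> p <= k' + 2 * e - C.
Proof. lra. Qed.

Lemma split_lower (R : realType) (p q k e e0 C : R) : p + q = k -> p <= k + 2 * e - C ->
  e0 = 2 * e -> C <= q + e0.
Proof. lra. Qed.

(** * Cutoffs and tightness of the rest kernels *)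

Section cutoff.
Context (R : realType) (n : nat) (x : 'rV[R]_n) (D : R).

(** min(1, (D + 1 - sqdist x z)^+), with minimum and positive part written through absolute values
    so that continuity is immediate. *)
Definition cutoff (z : 'rV[R]_n) : R :=
  let u := D + 1 - sqdist x z in let v := (u + `|u|) / 2 in (1 + v - `|1 - v|) / 2.

Lemma cutoff_ge0 z : 0 <= cutoff z.
Proof.
rewrite /cutoff/=; set u := D + 1 - _; set v := (u + `|u|) / 2.
have v0 : 0 <= v by rewrite /v; have := ler_norm (- u); rewrite normrN; lra.
by have := ler_normB 1 v; rewrite normr1 (ger0_norm v0); lra.
Qed.

Lemma cutoff_le1 z : cutoff z <= 1.
Proof.
rewrite /cutoff/=; set u := D + 1 - _; set v := (u + `|u|) / 2.
by have := ler_norm (- (1 - v)); rewrite normrN; lra.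
Qed.

Lemma cutoff_eq1 z : sqdist x z <= D -> cutoff z = 1.
Proof.
rewrite /cutoff/= => xz; have u1 : 1 <= D + 1 - sqdist x z by lra.
rewrite (ger0_norm (le_trans ler01 u1)).
have -> : (D + 1 - sqdist x z + (D + 1 - sqdist x z)) / 2 = D + 1 - sqdist x z by field.
by rewrite ler0_norm; [field|lra].
Qed.

Lemma cutoff_eq0 z : D + 1 <= sqdist x z -> cutoff z = 0.
Proof.
rewrite /cutoff/= => xz; have u0 : D + 1 - sqdist x z <= 0 by lra.
by rewrite (ler0_norm u0) subrr mul0r subr0 addr0 normr1 subrr mul0r.
Qed.

End cutoff.

Section ultra_rest.
Context (R : realType) (n : nat) (m : bmeasure R n) (a c : R) (w S : R -> R).
Hypothesis H : riesz_setting m a c w S.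
Notation leb := (@lebesgue_measure R).
Notation kap := (@riesz R n (2 * a)).
Notation pot := (@potential R n (2 * a)).
Notation smear := (smear m w).
Notation heat_rest := (heat_rest a c S).
Implicit Types (mu nu : bmeasure R n) (x y z : 'rV[R]_n).

Let hm := rs_ref H.
Let tw := rs_weights H.

Lemma cvg_sqdistr (T : Type) (F : set_system T) {FF : Filter F} (u : T -> 'rV[R]_n) x z :
  u @ F --> z -> sqdist x (u t) @[t --> F] --> sqdist x z.
Proof.
move=> uz; rewrite sqdistC; under eq_fun do rewrite sqdistC.
exact: cvg_sqdist.
Qed.

Lemma cvg_cutoff (T : Type) (F : set_system T) {FF : Filter F} (u : T -> 'rV[R]_n) x (D : R) z :
  u @ F --> z -> cutoff x D (u t) @[t --> F] --> cutoff x D z.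
Proof.
move=> uz; rewrite /cutoff/=.
have h1 : (D + 1 - sqdist x (u t)) @[t --> F] --> D + 1 - sqdist x z.
  by apply: cvgB; [exact: cvg_cst|exact: cvg_sqdistr].
have h2 : ((D + 1 - sqdist x (u t) + `|D + 1 - sqdist x (u t)|) / 2) @[t --> F] -->
    (D + 1 - sqdist x z + `|D + 1 - sqdist x z|) / 2.
  by apply: cvgMl; apply: cvgD => //; exact: cvg_norm.
apply: cvgMl; apply: cvgB; first by apply: cvgD => //; exact: cvg_cst.
by apply: cvg_norm; apply: cvgB => //; exact: cvg_cst.
Qed.

Lemma continuous_cutoff x (D : R) : continuous (cutoff x D).
Proof. by move=> z; exact: (@cvg_cutoff _ (nbhs z) _ id). Qed.

Lemma sqdist_bounded x (D : R) : exists r : R, [set z | sqdist x z <= D] `<=` ball (0 : 'rV[R]_n) r.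
Proof.
exists (`|x| + Num.sqrt `|D| + 1) => z /= xz; rewrite -ball_normE /ball_/= sub0r normrN.
apply: contrapT => /negP; rewrite -leNgt => rz.
have r0 : 0 < Num.sqrt `|D| + 1 by rewrite ltr_wpDl// sqrtr_ge0.
have nb : ~ ball x (Num.sqrt `|D| + 1) z.
  rewrite -ball_normE /ball_/= => xz1.
  by have := ler_normB x (x - z); rewrite subKr; lra.
have := sqdist_ball r0 nb; rewrite leNgt => /negP; apply.
apply: (le_lt_trans xz); apply: (le_lt_trans (ler_norm D)).
rewrite -{1}(sqr_sqrtr (normr_ge0 D)) ltrXn2r// ?nnegrE ?sqrtr_ge0 ?(ltW r0)//.
by rewrite ltrDl.
Qed.

Lemma compact_cutoff x (D : R) : compact (closure [set z | cutoff x D z != 0]).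
Proof.
have cl : closed [set z : 'rV[R]_n | sqdist x z <= D + 1].
  apply: (@closed_comp _ _ (fun z : 'rV[R]_n => sqdist x z) [set y | y <= D + 1]); last exact: closed_le.
  by move=> z _; exact: (@cvg_sqdistr _ (nbhs z) _ id).
have cp : compact [set z : 'rV[R]_n | sqdist x z <= D + 1].
  apply: bounded_closed_compact => //; have [r Dr] := sqdist_bounded x (D + 1).
  exists r; split; first exact: num_real.
  move=> M rM z /Dr; rewrite -ball_normE /ball_/= sub0r normrN => /ltW zr.
  exact: le_trans zr (ltW rM).
apply: (subclosed_compact (@closed_closure _ _) cp).
rewrite [X in _ `<=` X]((closure_id _).1 cl); apply: closure_subset => z /=.
by apply: contraNT; rewrite -ltNge => /ltW /cutoff_eq0 ->.
Qed.

Section limit.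
Variables (F : set_system nat) (gam : nat -> bmeasure R n) (sig g : bmeasure R n).
Hypothesis FU : UltraFilter F.
Hypothesis bnd : forall r : R, exists M : R, forall k,
  (gam k (ball (0%R : 'rV[R]_n) r) <= M%:E)%E.
Hypothesis g_open : forall V : set 'rV[R]_n, open V ->
  (exists r : R, V `<=` ball (0%R : 'rV[R]_n) r) ->
  (g V <= (ultramass F gam V)%:E)%E.
Hypothesis g_compact : forall K : set 'rV[R]_n, compact K ->
  ((ultramass F gam K)%:E <= g K)%E.
Hypothesis rgam : forall k, radon (gam k).
Hypothesis gam_sig : forall k x, (pot (gam k) x <= pot sig x)%E.

Let FF : ProperFilter F := ultra_proper.
Let rg : radon g := ultralimit_radon g_open.
Let sg : sigma_finite setT g := radon_sigma_finite rg.
Let sgam k : sigma_finite setT (gam k) := radon_sigma_finite (rgam k).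

Variables (r t : R) (x : 'rV[R]_n).
Hypotheses (r0 : 0 < r) (t0 : 0 < t) (sigx : (pot sig x < +oo)%E).

Let b s := c * t `^ a * S s.
Let b0 s : 0 <= b s.
Proof. by rewrite /b !mulr_ge0 ?powR_ge0 ?(tw_S_ge0 tw)// ltW// (rs_c_gt0 H). Qed.
Let mb : measurable_fun setT (b : measurableTypeR R -> R).
Proof. by apply: measurable_funM => //; exact: tw_mS tw. Qed.
Let b_le0 s : s <= 0 -> b s = 0.
Proof. by move=> s0; rewrite /b (S_le0 H s0) mulr0. Qed.
Let bfin : (\int[leb]_s (b s)%:E < +oo)%E.
Proof.
rewrite /b; under eq_integral do rewrite EFinM.
rewrite ge0_integralTZl//.
- rewrite lte_mul_pinfty ?lee_fin ?mulr_ge0 ?powR_ge0 ?(tw_S_fin tw)//.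
  by rewrite ltW// (rs_c_gt0 H).
- by apply/measurable_EFinP; exact: tw_mS tw.
- by move=> s; rewrite lee_fin (tw_S_ge0 tw).
- by rewrite mulr_ge0 ?powR_ge0// ltW// (rs_c_gt0 H).
Qed.

(** The diagonal value of the heat kernel at time r, an upper bound at all later times. *)
Let G0 : R := (pi * r) `^ (- (n%:R / 2)).
Let heat_le_G0 s z : 0 < s -> heat (r + t * s) x z <= G0.
Proof.
move=> s0; have v0 : 0 < r + t * s by rewrite addr_gt0// mulr_gt0.
rewrite heatE//; apply: (@le_trans _ _ ((pi * (r + t * s)) `^ (- (n%:R / 2)))).
  rewrite ler_piMr ?powR_ge0// -expR0 ler_expR oppr_le0 divr_ge0 ?sqdist_ge0 ?(ltW v0)//.
rewrite /G0 !powRN lef_pV2 ?posrE ?powR_gt0 ?mulr_gt0 ?pi_gt0//.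
rewrite ge0_ler_powR ?nnegrE ?divr_ge0 ?mulr_ge0 ?pi_ge0 ?(ltW r0) ?(ltW v0)//.
by rewrite ler_pM2l ?pi_gt0// lerDl mulr_ge0 ?ltW.
Qed.

(** [Q], the time integral of [q], is the kernel of [heat_rest]; [P] is the complementary kernel M -
    Q, nonnegative by [heat_le_G0]. Lower semicontinuity bounds integrals from one side only, and
    for [P] this is the side that bounds [Q] from below. *)
Let q s z := b s * heat (r + t * s) x z.
Let p s z := b s * (G0 - heat (r + t * s) x z).
Let q0 s z : 0 <= q s z. Proof. by rewrite mulr_ge0 ?heat_ge0. Qed.
Let p0 s z : 0 <= p s z.
Proof.
rewrite /p; have [s0|s0] := leP s 0; first by rewrite b_le0// mul0r.
by rewrite mulr_ge0// subr_ge0 heat_le_G0.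
Qed.
Let qpE s z : q s z + p s z = b s * G0.
Proof. by rewrite /q /p; ring. Qed.

Let mq z : measurable_fun setT (fun s : measurableTypeR R => (q s z)%:E).
Proof.
apply/measurable_EFinP; apply: measurable_funM => //; apply: measurable_heat => //.
by apply: measurable_funD => //; exact: measurable_funM.
Qed.
Let mp z : measurable_fun setT (fun s : measurableTypeR R => (p s z)%:E).
Proof.
apply/measurable_EFinP; apply: measurable_funM => //; apply: measurable_funB => //.
by apply: measurable_heat => //; apply: measurable_funD => //; exact: measurable_funM.
Qed.
Let mq2 : measurable_fun setT (fun sz : Rn R n * measurableTypeR R => (q sz.2 sz.1)%:E).
Proof.
apply/measurable_EFinP; apply: measurable_funM; first exact: measurable_on_snd mb.
apply: measurable_heat => //; apply: measurable_funD => //.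
by apply: measurable_funM => //; exact: measurable_snd.
Qed.

Let Q z := (\int[leb]_s (q s z)%:E)%E.
Let P z := (\int[leb]_s (p s z)%:E)%E.
Let Q0 z : (0 <= Q z)%E. Proof. by apply: integral_ge0 => s _; rewrite lee_fin. Qed.
Let P0 z : (0 <= P z)%E. Proof. by apply: integral_ge0 => s _; rewrite lee_fin. Qed.

Let M := fine (\int[leb]_s (b s * G0)%:E)%E.
Let G00 : 0 <= G0. Proof. exact: powR_ge0. Qed.
Let Ifin : (\int[leb]_s (b s * G0)%:E)%E = M%:E.
Proof.
rewrite fineK// ge0_fin_numE; last by apply: integral_ge0 => s _; rewrite lee_fin mulr_ge0.
under eq_integral do rewrite mulrC EFinM.
rewrite ge0_integralTZl//.
  by rewrite lte_mul_pinfty ?lee_fin.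
by apply/measurable_EFinP.
Qed.
Let M0 : 0 <= M. Proof. by rewrite fine_ge0// integral_ge0// => s _; rewrite lee_fin mulr_ge0. Qed.

Let QPE z : (Q z + P z = M%:E)%E.
Proof.
rewrite -Ifin -ge0_integralD//; try by move=> s _; rewrite lee_fin.
by apply: eq_integral => s _; rewrite -EFinD qpE.
Qed.

Let mQ : measurable_fun setT (Q : Rn R n -> \bar R).
Proof.
apply: (@measurable_tonelli _ _ (Rn R n) (measurableTypeR R) R leb (fun z s => (q s z)%:E)) => //.
- exact: sigma_finite_leb.
- by move=> z s; rewrite lee_fin.
Qed.

Let rest_Q mu : sigma_finite setT mu -> heat_rest r t mu x = (\int[mu]_z Q z)%E.
Proof.
move=> smu.
rewrite (@tonelli _ _ (Rn R n) (measurableTypeR R) R mu leb (fun z s => (q s z)%:E) smu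
  (@sigma_finite_leb R) mq2); last by move=> z s; rewrite lee_fin.
transitivity ((c * t `^ a)%:E * \int[leb]_s ((S s)%:E * heatm (r + t * s)%R mu x))%E; first by [].
rewrite -ge0_integralTZl.
- apply: eq_integral => s _; rewrite muleA -EFinM.
  have mh : measurable_fun setT (fun z : Rn R n => (heat (r + t * s) x z)%:E).
    exact: measurable_heatE.
  have h0 z : (0 <= (heat (r + t * s) x z)%:E)%E by rewrite lee_fin heat_ge0.
  by rewrite -(ge0_integralTZl mu mh h0 (b0 s)).
- apply: emeasurable_funM; first by apply/measurable_EFinP; exact: tw_mS tw.
  exact: measurable_heatm_affine.
- by move=> s; rewrite mule_ge0 ?heatm_ge0// lee_fin (tw_S_ge0 tw).
- by rewrite mulr_ge0 ?powR_ge0// ltW// (rs_c_gt0 H).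
Qed.

Section tail.
Variables (C : R).
Hypothesis C0 : 0 < C.
Hypothesis heat_bound : forall k v, r <= v -> (heatm v (gam k) x <= C%:E)%E.
Let Kn : R := 2 `^ (n%:R / 2) * 2.
Let Kn0 : 0 < Kn. Proof. by rewrite mulr_gt0 ?powR_gt0. Qed.
(** By [heat_tail_le], beyond squared distance D the kernel is at most this fraction of itself plus
    the kernel at twice the time. It is bounded by 1 and tends to 0 as D grows. *)
Let ee (D s : R) := Num.min 1 (Kn * (r + t * s) / D).

Let tail_kernel (D s : R) z : 0 < D -> 0 < s ->
  (1 - cutoff x D z) * heat (r + t * s) x z <=
  ee D s * (heat (r + t * s) x z + heat (2 * (r + t * s)) x z).
Proof.
move=> D0 s0; set v := r + t * s; have v0 : 0 < v by rewrite addr_gt0// mulr_gt0.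
have e0 : 0 <= ee D s.
  by rewrite /ee le_min ler01/= divr_ge0 ?mulr_ge0 ?(ltW v0) ?(ltW Kn0) ?(ltW D0).
have [xz|xz] := leP (sqdist x z) D.
  by rewrite cutoff_eq1// subrr mul0r mulr_ge0// addr_ge0 ?heat_ge0.
have h1 : (1 - cutoff x D z) * heat v x z <= heat v x z.
  by rewrite ler_piMl ?heat_ge0// lerBlDr lerDl cutoff_ge0.
apply: (le_trans h1); rewrite /ee -/v; have [_|lt1] := leP 1 (Kn * v / D).
  by rewrite mul1r lerDl heat_ge0.
have h2 := heat_tail_le v0 D0 (ltW xz); apply: (le_trans h2).
rewrite (_ : _ * _ * v = Kn * v / D); last by rewrite /Kn; ring.
by rewrite ler_wpM2l ?lerDr ?heat_ge0// divr_ge0 ?mulr_ge0 ?(ltW v0) ?(ltW Kn0) ?(ltW D0).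
Qed.

Let ee_cvg : (\int[leb]_s (b s * ee j.+1%:R s)%:E)%E @[j --> \oo] --> 0%E.
Proof.
have e01 j s : 0 < s -> 0 <= ee j.+1%:R s <= 1.
  move=> s0; rewrite /ee le_min ler01 ge_min lexx/= andbT divr_ge0// mulr_ge0 ?(ltW Kn0)//.
  by rewrite addr_ge0 ?mulr_ge0 ?ltW.
have h0 j s : 0 <= b s * ee j.+1%:R s <= b s.
  have [s0|s0] := leP s 0; first by rewrite b_le0// mul0r lexx.
  have /andP[e0 e1] := e01 j s s0.
  by rewrite mulr_ge0//= ler_piMr.
have mh j : measurable_fun setT (fun s : measurableTypeR R => (b s * ee j.+1%:R s)%:E).
  apply/measurable_EFinP; apply: measurable_funM => //; apply: measurable_minr => //.
  apply: measurable_funM => //; apply: measurable_funM => //.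
  by apply: measurable_funD => //; exact: measurable_funM.
have hc : {ae leb, forall s : measurableTypeR R, setT s ->
    (b s * ee j.+1%:R s)%:E @[j --> \oo] --> cst 0%E s}.
  apply: aeW => s _; apply: cvg_EFin; first exact: nearW.
  have [s0|s0] := leP s 0.
    by rewrite b_le0//; under eq_fun do rewrite mul0r; exact: cvg_cst.
  have hz : b s * (Kn * (r + t * s)) * j.+1%:R^-1 @[j --> \oo] --> (0:R).
    by rewrite -[X in _ --> X](mulr0 (b s * (Kn * (r + t * s)))); apply: cvgMr; exact: cvg_harmonic.
  apply: (squeeze_cvgr _ (cvg_cst 0) hz); apply: nearW => j.
  have /andP[-> _] := h0 j s; rewrite -mulrA ler_wpM2l//.
  by rewrite /ee ge_min lexx orbT.
have ib : leb.-integrable setT (fun s : measurableTypeR R => (b s)%:E).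
  apply/integrableP; split; first exact/measurable_EFinP.
  by under eq_integral do rewrite gee0_abs ?lee_fin//.
have hb : {ae leb, forall s : measurableTypeR R, forall j, setT s ->
    (`|(b s * ee j.+1%:R s)%:E| <= (b s)%:E)%E}.
  by apply: aeW => s j _; have /andP[h1 h2] := h0 j s; rewrite gee0_abs ?lee_fin.
have [_ _] := @dominated_convergence _ (measurableTypeR R) R leb setT measurableT
  (fun j s => (b s * ee j.+1%:R s)%:E) (cst 0%E) (fun s => (b s)%:E) mh (measurable_cst _) hc ib hb.
by rewrite /= integral0.
Qed.

(** Tightness, uniform in k: the heat extensions of all [gam k] at x are bounded by C from time r
    on, and the integral of b times [ee] tends to 0 by dominated convergence. Two kernels occur in
    the tail bound, hence the factor 2 C. *)
Lemma rest_tail (e : R) : 0 < e -> exists D : R, forall k,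
  (\int[gam k]_z ((1 - cutoff x D z)%:E * Q z) <= e%:E)%E.
Proof.
move=> e0; have e1 : 0 < e / (2 * C) by rewrite divr_gt0// mulr_gt0.
have := ee_cvg => /fine_cvgP[fe] /cvgrPdist_lt /(_ _ e1) ne.
have [j [/= fj ej]] := filter_ex (filterI fe ne).
have D0 : 0 < j.+1%:R :> R by [].
have e0s s : 0 < s -> 0 <= ee j.+1%:R s.
  move=> s0; rewrite /ee le_min ler01/= divr_ge0// mulr_ge0 ?(ltW Kn0)//.
  by rewrite addr_ge0 ?mulr_ge0 ?ltW.
have bee0 s : 0 <= b s * ee j.+1%:R s.
  have [s0|s0] := leP s 0; first by rewrite b_le0// mul0r.
  by rewrite mulr_ge0// e0s.
have mbe : measurable_fun setT (fun s : measurableTypeR R => (b s * ee j.+1%:R s)%:E).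
  apply/measurable_EFinP; apply: measurable_funM => //; apply: measurable_minr => //.
  apply: measurable_funM => //; apply: measurable_funM => //.
  by apply: measurable_funD => //; exact: measurable_funM.
have mcut : measurable_fun setT (fun z : Rn R n => (1 - cutoff x j.+1%:R z)%:E).
  apply/measurable_EFinP; apply: measurable_funB => //.
  exact: continuous_measurable_rV (@continuous_cutoff x j.+1%:R).
have cut0 z : 0 <= 1 - cutoff x j.+1%:R z by rewrite subr_ge0 cutoff_le1.
exists j.+1%:R => k.
have m2 : measurable_fun setT (fun sz : Rn R n * measurableTypeR R =>
    (1 - cutoff x j.+1%:R sz.1)%:E * (q sz.2 sz.1)%:E)%E.
  by apply: emeasurable_funM mq2; exact: measurable_on_fst mcut.
have p2 z s : (0 <= (1 - cutoff x j.+1%:R z)%:E * (q s z)%:E)%E.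
  by rewrite mule_ge0 ?lee_fin.
apply: (@le_trans _ _ (\int[gam k]_z \int[leb]_s ((1 - cutoff x j.+1%:R z)%:E * (q s z)%:E))%E).
  rewrite le_eqVlt; apply/orP; left; apply/eqP; apply: eq_integral => z _.
  by rewrite (ge0_integralTZl leb (mq z) _ (cut0 z))// => s; rewrite lee_fin.
rewrite (@tonelli _ _ (Rn R n) (measurableTypeR R) R (gam k) leb
  (fun z s => (1 - cutoff x j.+1%:R z)%:E * (q s z)%:E)%E (sgam k)
  (@sigma_finite_leb R) m2 p2).
apply: (@le_trans _ _ (\int[leb]_s ((2 * C)%:E * (b s * ee j.+1%:R s)%:E))%E); last first.
  rewrite (ge0_integralTZl leb mbe); last 2 first.
  - by move=> s; rewrite lee_fin.
  - by rewrite mulr_ge0// ltW.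
  rewrite -(fineK fj) -EFinM lee_fin; move: ej; rewrite sub0r normrN ltr_pdivlMr ?mulr_gt0//.
  rewrite ger0_norm; last by rewrite fine_ge0// integral_ge0// => s _; rewrite lee_fin.
  by rewrite mulrC => /ltW.
apply: ge0_le_integral.
- exact: measurableT.
- by move=> s _; apply: integral_ge0.
- apply: (@measurable_tonelli _ _ (measurableTypeR R) (Rn R n) R (gam k)
    (fun s z => (1 - cutoff x j.+1%:R z)%:E * (q s z)%:E)%E (sgam k)) => //.
  apply: emeasurable_funM; first exact: measurable_on_snd mcut.
  apply/measurable_EFinP; apply: measurable_funM; first exact: measurable_on_fst mb.
  apply: measurable_heat => //; apply: measurable_funD => //.
  by apply: measurable_funM => //; exact: measurable_fst.
- exact: measurable_funeM.
move=> s _; have [s0|s0] := leP s 0.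
  rewrite integral0_eq; first by rewrite mule_ge0// lee_fin ?bee0// mulr_ge0// ltW.
  by move=> z _; rewrite /q b_le0// mul0r mule0.
have v0 : 0 < r + t * s by rewrite addr_gt0// mulr_gt0.
have rv : r <= r + t * s by rewrite lerDl mulr_ge0// ltW.
have rv2 : r <= 2 * (r + t * s) by rewrite (le_trans rv)// ler_peMl ?ltW// ltr1n.
apply: (@le_trans _ _ (\int[gam k]_z ((b s * ee j.+1%:R s)%:E *
    ((heat (r + t * s) x z)%:E + (heat (2 * (r + t * s)) x z)%:E)))%E).
  apply: ge0_le_integral.
  - exact: measurableT.
  - by [].
  - apply: emeasurable_funM => //; apply/measurable_EFinP; apply: measurable_funM => //.
    exact: measurable_heat.
  - apply: measurable_funeM; apply: emeasurable_funD; exact: measurable_heatE.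
  move=> z _; rewrite -EFinD -!EFinM lee_fin /q mulrCA -[leRHS]mulrA.
  by apply: ler_wpM2l; [exact: b0|exact: tail_kernel].
rewrite (ge0_integralTZl (gam k)).
- rewrite [leRHS]muleC; apply: lee_wpmul2l; first by rewrite lee_fin.
  rewrite ge0_integralD//; first last.
  + exact: measurable_heatE.
  + by move=> z _; rewrite lee_fin heat_ge0.
  + exact: measurable_heatE.
  + by move=> z _; rewrite lee_fin heat_ge0.
  rewrite (_ : 2 * C = C + C); last by ring.
  by rewrite EFinD; apply: leeD; exact: heat_bound.
- apply: emeasurable_funD; exact: measurable_heatE.
- by move=> z; rewrite adde_ge0// lee_fin heat_ge0.
- exact: bee0.
Qed.


End tail.


Let heat_const : exists2 C : R, 0 < C &
  forall k v, r <= v -> (heatm v (gam k) x <= C%:E)%E.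
Proof.
have [C C0 hC] := heatm_le_pot H r0.
have sx0 : (0 <= pot sig x)%E by exact: (pot_ge0 H).
exists (C * fine (pot sig x) + 1); first by rewrite ltr_wpDl// mulr_ge0 ?fine_ge0// ltW.
move=> k v rv; apply: (le_trans (hC (gam k) v x rv)).
apply: (@le_trans _ _ (C%:E * pot sig x)%E); first by rewrite lee_wpmul2l// lee_fin ltW.
by rewrite -(fineK (_ : pot sig x \is a fin_num)) ?ge0_fin_numE// -EFinM lee_fin lerDl.
Qed.

Let cutP D z := ((cutoff x D z)%:E * P z)%E.

Let cutP_time D z : cutP D z = (\int[leb]_s (cutoff x D z * p s z)%:E)%E.
Proof.
under eq_integral do rewrite EFinM.
by rewrite (ge0_integralTZl leb (mp z))// ?cutoff_ge0// => s; rewrite lee_fin.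
Qed.

Let cutP_lsc D : lower_semicontinuous (cutP D).
Proof.
apply: lsc_seq => z u uz; rewrite cutP_time.
rewrite (_ : (fun k => cutP D (u k)) = fun k => (\int[leb]_s (cutoff x D (u k) * p s (u k))%:E)%E); last first.
  by apply/funext => k; rewrite cutP_time.
have mcp y : measurable_fun setT (fun s : measurableTypeR R => (cutoff x D y * p s y)%:E).
  by apply/measurable_EFinP; apply: measurable_funM => //; have /measurable_EFinP := mp y.
have cp0 s y : (0 <= (cutoff x D y * p s y)%:E)%E by rewrite lee_fin mulr_ge0// cutoff_ge0.
apply: le_integral_limn_einf => // s.
have [s0|s0] := leP s 0.
  by apply: limn_einf_ge; apply: nearW => k; rewrite /p b_le0// !mul0r !mulr0.
have v0 : 0 < r + t * s by rewrite addr_gt0// mulr_gt0.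
have h : (cutoff x D (u k) * p s (u k))%:E @[k --> \oo] --> (cutoff x D z * p s z)%:E.
  apply: cvg_EFin; first exact: nearW.
  apply: cvgM; first exact: cvg_cutoff.
  apply: cvgMr; apply: cvgB; first exact: cvg_cst.
  rewrite heatC; under eq_fun do rewrite heatC.
  exact: cvg_heat.
by rewrite (cvg_limn_einf_sup h).1.
Qed.

(** Beyond the cutoff the rest is small uniformly in k. Inside, it is M times the integral of the
    cutoff, which converges, minus the integral of the lower semicontinuous [cutP], whose limit is
    bounded on the right side. *)
Lemma ultra_heat_rest C : (\forall k \near F, (C%:E <= heat_rest r t (gam k) x)%E) ->
  (C%:E <= heat_rest r t g x)%E.
Proof.
move=> nC; apply/lee_addgt0Pr => e0 e00.
(* One e for the part beyond the cutoff, one for the convergence of the cutoff integrals. *)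
pose e := e0 / 2; have ep : 0 < e by rewrite divr_gt0.
have [B B0 hB] := heat_const; have [D tD] := rest_tail B0 hB ep.
have mcut : measurable_fun setT (fun z : Rn R n => (cutoff x D z)%:E).
  by apply/measurable_EFinP; exact: continuous_measurable_rV (@continuous_cutoff x D).
have mP : measurable_fun setT (P : Rn R n -> \bar R).
  apply: (@measurable_tonelli _ _ (Rn R n) (measurableTypeR R) R leb (fun z s => (p s z)%:E)) => //.
  - exact: sigma_finite_leb.
  - apply/measurable_EFinP; apply: measurable_funM; first exact: measurable_on_snd mb.
    apply: measurable_funB => //; apply: measurable_heat => //; apply: measurable_funD => //.
    by apply: measurable_funM => //; exact: measurable_snd.
  - by move=> z s; rewrite lee_fin.
have mcP : measurable_fun setT (cutP D : Rn R n -> \bar R) by exact: emeasurable_funM.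
have mcQ : measurable_fun setT (fun z : Rn R n => (cutoff x D z)%:E * Q z)%E.
  exact: emeasurable_funM.
have cut0 z : (0 <= (cutoff x D z)%:E)%E by rewrite lee_fin cutoff_ge0.
have cP0 z : (0 <= cutP D z)%E by rewrite mule_ge0.
have cQ0 z : (0 <= (cutoff x D z)%:E * Q z)%E by rewrite mule_ge0.
have split mu : (\int[mu]_z cutP D z + \int[mu]_z ((cutoff x D z)%:E * Q z) =
    M%:E * \int[mu]_z (cutoff x D z)%:E)%E.
  rewrite -(ge0_integralD mu measurableT (fun z _ => cP0 z) mcP (fun z _ => cQ0 z) mcQ).
  rewrite -(ge0_integralTZl mu mcut cut0 M0); apply: eq_integral => z _.
  by rewrite -ge0_muleDr// addeC QPE muleC.
have cutfin mu : radon mu -> (\int[mu]_z (cutoff x D z)%:E)%E \is a fin_num.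
  move=> rmu; rewrite ge0_fin_numE; last exact: integral_ge0.
  have cK := @compact_cutoff x D.
  apply: le_lt_trans (rmu _ cK); rewrite -[leRHS]mul1e -integral_cst; last exact: measurable_compact.
  rewrite [leRHS]integral_mkcond; apply: ge0_le_integral => //.
    apply/(measurable_restrictT _ _).1; first exact: measurable_compact.
    exact: measurable_cst.
  move=> z _; rewrite patchE; case: ifPn => zK; first by rewrite lee_fin cutoff_le1.
  have [->//|nz] := eqVneq (cutoff x D z) 0.
  by move: zK; rewrite mem_set//; exact: subset_closure.
set L := fine (\int[g]_z (cutoff x D z)%:E)%E.
have LE : (\int[g]_z (cutoff x D z)%:E)%E = L%:E by rewrite fineK// cutfin.
have rest_cut mu : sigma_finite setT mu -> heat_rest r t mu x =
    (\int[mu]_z ((cutoff x D z)%:E * Q z) + \int[mu]_z ((1 - cutoff x D z)%:E * Q z))%E.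
  move=> smu; rewrite rest_Q//.
  have c10 z : (0 <= (1 - cutoff x D z)%:E)%E by rewrite lee_fin subr_ge0 cutoff_le1.
  have c1Q0 z : (0 <= (1 - cutoff x D z)%:E * Q z)%E by rewrite mule_ge0.
  have mc1Q : measurable_fun setT (fun z : Rn R n => (1 - cutoff x D z)%:E * Q z)%E.
    apply: emeasurable_funM mQ; apply/measurable_EFinP; apply: measurable_funB => //.
    by apply/measurable_EFinP.
  rewrite -(ge0_integralD mu measurableT (fun z _ => cQ0 z) mcQ (fun z _ => c1Q0 z) mc1Q).
  by apply: eq_integral => z _; rewrite -ge0_muleDl// -EFinD addrC subrK mul1e.
have eM : 0 < e / (M + 1) by rewrite divr_gt0// ltr_wpDl.
have cutcvg := ultralimit_continuous FU bnd g_open g_compact (@continuous_cutoff x D)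
  (cutoff_ge0 x D) (@compact_cutoff x D).
have P_bound : (\int[g]_z cutP D z <= (M * L + 2 * e - C)%:E)%E.
  apply: (ultralimit_lsc FU bnd g_open (@cutP_lsc D) cP0).
  move/cvgrPdist_le : cutcvg => /(_ _ eM) => ncut.
  apply: filterS2 nC ncut => k hC; rewrite ler_distlC -/L => /andP[_ hL].
  move: hC (tD k) (split (gam k)); rewrite (rest_cut _ (sgam k)).
  rewrite -(fineK (cutfin _ (rgam k))) -EFinM => hC tDk /adde_eq_fin[||PE QE PQ].
  - exact: integral_ge0.
  - exact: integral_ge0.
  rewrite PE lee_fin; rewrite QE in hC.
  have : (C%:E <= (fine (\int[gam k]_z ((cutoff x D z)%:E * Q z))%E + e)%:E)%E.
    by apply: (le_trans hC); rewrite EFinD leeD2l.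
  rewrite lee_fin => hC2.
  have : M * fine (\int[gam k]_z (cutoff x D z)%:E)%E <= M * L + e.
    apply: (@le_trans _ _ (M * (L + e / (M + 1)))); first by rewrite ler_wpM2l.
    rewrite mulrDr lerD2l mulrA ler_pdivrMr ?ltr_wpDl//.
    by rewrite mulrC ler_wpM2l ?(ltW ep)// lerDl.
  exact: split_upper PQ hC2.
move: (split g); rewrite LE -EFinM => /adde_eq_fin[||PE QE PQ].
- exact: integral_ge0.
- exact: integral_ge0.
rewrite PE lee_fin in P_bound.
apply: (@le_trans _ _ (\int[g]_z ((cutoff x D z)%:E * Q z) + e0%:E)%E).
  by rewrite QE -EFinD lee_fin; apply: (split_lower PQ P_bound); rewrite /e mulrC divfK.
apply: leeD => //; rewrite (rest_cut _ sg) leeDl//.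
by apply: integral_ge0 => z _; rewrite mule_ge0// lee_fin subr_ge0 cutoff_le1.
Qed.

End limit.
End ultra_rest.

Section ultra_potential.
Context (R : realType) (n : nat) (m : bmeasure R n) (a c : R) (w S : R -> R).
Hypothesis H : riesz_setting m a c w S.
Notation leb := (@lebesgue_measure R).
Notation kap := (@riesz R n (2 * a)).
Notation pot := (@potential R n (2 * a)).
Notation smear := (smear m w).
Notation heat_rest := (heat_rest a c S).
Notation excessive := (excessive m w).
Implicit Types (mu nu : bmeasure R n) (x y z : 'rV[R]_n).

Let hm := rs_ref H.
Let tw := rs_weights H.

Lemma locally_bounded_of_pot_le (gam : nat -> bmeasure R n) (sig : bmeasure R n) x :
  (pot sig x < +oo)%E -> (forall k, (pot (gam k) x <= pot sig x)%E) ->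
  forall r : R, exists M : R, forall k, (gam k (ball (0%R : 'rV[R]_n) r) <= M%:E)%E.
Proof.
move=> sx gs r; have [d d0 dk] := pot_lower H x r.
exists (d^-1 * fine (pot sig x)) => k.
rewrite EFinM fineK; last by rewrite ge0_fin_numE//; exact: (pot_ge0 H).
rewrite lee_pdivlMl//.
exact: (le_trans (dk _)).
Qed.

Section limit.
Variables (F : set_system nat) (gam : nat -> bmeasure R n) (sig g : bmeasure R n).
Variable h : Rn R n -> \bar R.
Hypothesis FU : UltraFilter F.
Hypothesis Foo : \oo `<=` F.
Hypothesis bnd : forall r : R, exists M : R, forall k,
  (gam k (ball (0%R : 'rV[R]_n) r) <= M%:E)%E.
Hypothesis g_open : forall V : set 'rV[R]_n, open V ->
  (exists r : R, V `<=` ball (0 : 'rV[R]_n) r) ->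
  (g V <= (ultramass F gam V)%:E)%E.
Hypothesis g_compact : forall K : set 'rV[R]_n, compact K ->
  ((ultramass F gam K)%:E <= g K)%E.
Hypothesis rgam : forall k, radon (gam k).
Hypothesis rsig : radon sig.
Hypothesis gam_sig : forall k x, (pot (gam k) x <= pot sig x)%E.
Hypothesis hcvg : forall x, (fun k => pot (gam k) x) @ \oo --> h x.
Hypothesis hub : forall k x, (pot (gam k) x <= h x)%E.

Let FF : ProperFilter F := ultra_proper.
Let rg : radon g := ultralimit_radon g_open.
Let sg : sigma_finite setT g := radon_sigma_finite rg.
Let sgam k : sigma_finite setT (gam k) := radon_sigma_finite (rgam k).
Let ssig : sigma_finite setT sig := radon_sigma_finite rsig.

Let eh : excessive h.
Proof.
apply: (excessive_limn_einf H (f := fun k => pot (gam k))) => // k.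
exact: (pot_excessive H).
Qed.

Let mpot mu : sigma_finite setT mu -> measurable_fun setT (pot mu : Rn R n -> \bar R) :=
  measurable_pot H (mu := mu).

(** The principle of descent: kappa(x, .) is nonnegative and lower semicontinuous. *)
Lemma ultra_pot_le x : (pot g x <= h x)%E.
Proof.
have := exc_ge0 eh x.
case: (h x) (hub^~ x) => [C| |] hubx hx; rewrite ?leey//.
apply: (ultralimit_lsc FU bnd g_open).
- apply: lsc_seq => z u uz.
  under [X in limn_einf X]funext => k do rewrite (rieszC H).
  by rewrite (rieszC H); exact: (riesz_le_limn_einf H).
- by move=> z; exact: (riesz_ge0 H).
- by apply: nearW => k; exact: hubx.
Qed.

(** The scale t is fixed from [sig] alone, before k, so that the part H_r P_t of every potential of
    the sequence is below e. What remains passes to the limit by [ultra_heat_rest]. *)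
Let heatf_limit_le r x : 0 < r -> (pot sig x < +oo)%E ->
  (heatf m r (pot sig) x < +oo)%E -> (heatf m r h x <= heatf m r (pot g) x)%E.
Proof.
move=> r0 sx hx.
have mhp (f : Rn R n -> \bar R) : measurable_fun setT f ->
    measurable_fun setT (fun y : Rn R n => ((heat r x y)%:E * f y)%E).
  by move=> mf; apply: emeasurable_funM => //; exact: measurable_heatE.
have hp0 (f : Rn R n -> \bar R) : (forall y, 0 <= f y)%E ->
    forall y, (0 <= (heat r x y)%:E * f y)%E.
  by move=> f0 y; rewrite mule_ge0 ?lee_fin ?heat_ge0.
apply: lee_real_below.
  by apply: heatf_ge0 => y; exact: (pot_ge0 H).
move=> b b0 bh; apply/lee_addgt0Pr => e e0.
have fatou : (heatf m r h x <= limn_einf (fun k => heatf m r (pot (gam k)) x))%E.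
  apply: le_integral_limn_einf.
  - by apply: mhp; exact: exc_meas eh.
  - by move=> k; apply: mhp; exact: mpot.
  - by apply: hp0; exact: exc_ge0 eh.
  - by move=> k; apply: hp0 => y; exact: (pot_ge0 H).
  move=> y; apply: (le_trans _ (@limn_einf_pMl R (fun k => pot (gam k) y) (heat r x y) (heat_ge0 _ _ _))).
  by rewrite lee_wpmul2l ?lee_fin ?heat_ge0// (cvg_limn_einf_sup (@hcvg y)).1.
have bnear := limn_einf_gt_near (lt_le_trans bh fatou).
have vanish := heatf_smear_pot_vanish H r0 ssig hx.
have [N _ /(_ N (leqnn N))/= hN] : \forall k \near \oo, (heatf m r (smear k.+1%:R (pot sig)) x < e%:E)%E.
  apply: (vanish [set y | (y < e%:E)%E]).
  by apply: open_nbhs_nbhs; split; [exact: open_ereal_lt_ereal|rewrite /= lte_fin].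
pose t : R := N.+1%:R.
have t0 : 0 < t by [].
have rest_near : \forall k \near F, ((b - e)%:E <= heat_rest r t (gam k) x)%E.
  apply: Foo; apply: filterS bnear => k bk.
  have := heatf_pot_split H x r0 t0 (sgam k).
  have : (heatf m r (smear t (pot (gam k))) x <= e%:E)%E.
    apply: (le_trans _ (ltW hN)); apply: le_heatf.
    - by apply: (measurable_smear H); [exact: mpot|move=> y; exact: (pot_ge0 H)].
    - by apply: (measurable_smear H); [exact: mpot|move=> y; exact: (pot_ge0 H)].
    - by move=> y; apply: (smear_ge0 H) => z; exact: (pot_ge0 H).
    - move=> y; apply: (le_smear H); [exact: mpot|exact: mpot| |exact: gam_sig].
      by move=> z; exact: (pot_ge0 H).
  move=> se hE; rewrite hE in bk.
  rewrite EFinB leeBlDl//; apply: (le_trans (ltW bk)).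
  by rewrite leeD2r.
have := ultra_heat_rest H FU bnd g_open g_compact rgam gam_sig r0 t0 sx rest_near.
move=> hr; rewrite -leeBlDr// -EFinB; apply: (le_trans hr).
rewrite (heatf_pot_split H x r0 t0 sg) leeDr//.
by apply: heatf_ge0 => y; apply: (smear_ge0 H) => z; exact: (pot_ge0 H).
Qed.

(** [heatf_limit_le] needs H_(tr) (pot sig) finite at x. This holds for almost every r with w r > 0,
    because P_t (pot sig) is finite there. *)
Let smear_limit_le t x : 0 < t -> (pot sig x < +oo)%E -> (smear t h x <= pot g x)%E.
Proof.
move=> t0 sx.
apply: (@le_trans _ _ (smear t (pot g) x)); last exact: exc_smear (pot_excessive H sg) _ x t0.
have msm (f : Rn R n -> \bar R) := @measurable_smear_integrand _ _ _ _ _ _ _ H t f x.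
have w0 r : 0 <= w r := tw_w_ge0 tw r.
have wh0 (f : Rn R n -> \bar R) r : (forall y, 0 <= f y)%E ->
    (0 <= (w r)%:E * heatf m (t * r)%R f x)%E.
  by move=> f0; rewrite mule_ge0 ?lee_fin ?w0//; exact: heatf_ge0.
have p0 mu y : (0 <= pot mu y)%E by exact: (pot_ge0 H).
have iS : leb.-integrable setT (fun r : measurableTypeR R =>
    (w r)%:E * heatf m (t * r)%R (pot sig) x)%E.
  apply/integrableP; split; first by apply: msm; [exact: mpot|exact: p0].
  rewrite (eq_integral (fun r : measurableTypeR R =>
    (w r)%:E * heatf m (t * r)%R (pot sig) x)%E); last first.
    by move=> r _; rewrite gee0_abs//; apply: wh0; exact: p0.
  apply: le_lt_trans sx; exact: exc_smear (pot_excessive H ssig) t x t0.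
apply: ae_le_integral.
- by apply: msm; [exact: exc_meas eh|exact: exc_ge0 eh].
- by apply: msm; [exact: mpot|exact: p0].
- by move=> r; apply: wh0; exact: exc_ge0 eh.
- by move=> r; apply: wh0; exact: p0.
apply: ae_imp (integrable_ae measurableT iS) => r /(_ Logic.I).
have [wr|wr] := eqVneq (w r) 0; first by rewrite wr !mul0e.
have wr0 : 0 < w r by rewrite lt_neqAle eq_sym wr w0.
have r0 : 0 < r.
  rewrite ltNge; apply/negP => r0; move/eqP: wr; apply.
  by rewrite (tw_w_le1 tw)// (le_trans r0).
rewrite ge0_fin_numE; last by apply: wh0; exact: p0.
move=> /(lte_pmul_fin wr0) hs; rewrite lee_wpmul2l ?lee_fin//.
apply: heatf_limit_le => //; first exact: mulr_gt0.
by apply: hs; apply: heatf_ge0; exact: p0.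
Qed.

Lemma ultra_pot_ge x0 : (pot sig x0 < +oo)%E -> forall x, (h x <= pot g x)%E.
Proof.
move=> sx0; apply: (excessive_ae_le H eh (pot_excessive H sg)).
apply: ae_imp (excessive_ae_fin H (pot_excessive H ssig) sx0) => x sx.
apply: (@le_trans _ _ (limn_einf (fun k => smear (k.+1%:R^-1) h x))).
  apply: (smear_lsc H) => //.
  - exact: cvg_harmonic.
  - exact: exc_meas eh.
  - exact: exc_ge0 eh.
  - exact: exc_lsc eh.
by apply: limn_einf_le => k; exact: smear_limit_le.
Qed.

End limit.
End ultra_potential.

(** * Measures are determined by their potentials *)

(** A lower bound on y and the limit of the sum x + y bound the lower limit of x from above; this
    supplies the upper estimate that Fatou's lemma cannot give. *)
Lemma limn_einf_add_le (R : realType) (x y z : nat -> \bar R) (X Y : \bar R) :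
  (forall k, x k + y k = z k)%E -> X \is a fin_num -> Y \is a fin_num ->
  (forall k, 0 <= x k)%E -> (forall k, 0 <= y k)%E ->
  z @ \oo --> (X + Y)%E -> (Y <= limn_einf y)%E -> (limn_einf x <= X)%E.
Proof.
case: X => [X| |]// xyz; case: Y => [Y| |]// _ _ x0 y0 zXY Yy.
apply/lee_addgt0Pr => e e0; rewrite leNgt; apply/negP => /limn_einf_gt_near xnear.
have e20 : 0 < e / 2 by rewrite divr_gt0.
have ynear : \forall k \near \oo, ((Y - e / 2)%:E < y k)%E.
  by apply: limn_einf_gt_near; apply: lt_le_trans Yy; rewrite lte_fin ltrBlDr ltrDl.
have znear : \forall k \near \oo, (z k < (X + Y + e / 2)%:E)%E.
  apply: (zXY [set u | (u < (X + Y + e / 2)%:E)%E]).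
  apply: open_nbhs_nbhs; split; first exact: open_ereal_lt_ereal.
  by rewrite /= -EFinD lte_fin ltrDl.
have [k [[xk yk] zk]] : exists k, (((X + e)%:E < x k)%E /\ ((Y - e / 2)%:E < y k)%E) /\ (z k < (X + Y + e / 2)%:E)%E.
  have [N _ hN] := filterI (filterI xnear ynear) znear.
  by exists N; apply: hN => /=.
move: xk yk zk (x0 k) (y0 k); rewrite -xyz.
case: (x k) => [xk| |]//; case: (y k) => [yk| |]//.
rewrite -EFinD !lte_fin => + + + _ _.
lra.
Qed.

Lemma pmule_cancel (R : realType) (k : R) (x y : \bar R) : 0 < k ->
  (k%:E * x = k%:E * y)%E -> x = y.
Proof.
by move=> k0 e; rewrite -(@muleVK _ k x) ?gt_eqF// e muleVK// gt_eqF.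
Qed.

Lemma ge0_dominated_cvg d (T : measurableType d) (R : realType)
    (mu : {measure set T -> \bar R}) (f : nat -> T -> \bar R) (g B : T -> \bar R) :
  (forall k, measurable_fun setT (f k)) -> measurable_fun setT g ->
  measurable_fun setT B -> (forall k x, 0 <= f k x)%E ->
  (forall x, f^~ x @ \oo --> g x) -> (forall k x, f k x <= B x)%E ->
  (\int[mu]_x B x < +oo)%E ->
  (\int[mu]_x f k x)%E @[k --> \oo] --> (\int[mu]_x g x)%E.
Proof.
move=> mf mg mB f0 fg fB iB.
have B0 x : (0 <= B x)%E := le_trans (f0 0%N x) (fB 0%N x).
have iB' : mu.-integrable setT B.
  apply/integrableP; split => //.
  by rewrite (eq_integral B)// => x _; rewrite gee0_abs.
have hc : {ae mu, forall x, setT x -> f k x @[k --> \oo] --> g x}.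
  by apply: aeW => x _; exact: fg.
have hb : {ae mu, forall x, forall k, setT x -> (`|f k x| <= B x)%E}.
  by apply: aeW => x k _; rewrite gee0_abs.
by have [_ _] := dominated_convergence measurableT mf mg hc iB' hb.
Qed.

Lemma cvg_heat_time (R : realType) n (v : nat -> R) (v0 : R) (x z : 'rV[R]_n) :
  0 < v0 -> (forall k, 0 < v k) -> v @ \oo --> v0 ->
  heat (v k) x z @[k --> \oo] --> heat v0 x z.
Proof.
move=> v00 vk0 vc; rewrite heatE//; under eq_fun do rewrite heatE//.
apply: cvgM; last first.
  apply: (cvg_comp _ expR); last exact: continuous_expR.
  by apply: cvgN; apply: cvgMr; apply: cvgV => //; rewrite gt_eqF.
have pwE u : 0 < u -> (pi * u) `^ (- (n%:R / 2)) = expR (- (n%:R / 2) * ln (pi * u)).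
  by move=> u0; rewrite /powR gt_eqF// mulr_gt0// pi_gt0.
rewrite pwE//; under eq_fun do rewrite pwE//.
apply: (cvg_comp _ expR); last exact: continuous_expR.
apply: cvgMr; apply: (cvg_comp _ (@ln R)); first by apply: cvgMr; exact: vc.
by apply: continuous_ln; rewrite mulr_gt0// pi_gt0.
Qed.

Section unique.
Context (R : realType) (n : nat) (m : bmeasure R n) (a c : R) (w S : R -> R).
Hypothesis H : riesz_setting m a c w S.
Notation leb := (@lebesgue_measure R).
Notation kap := (@riesz R n (2 * a)).
Notation pot := (@potential R n (2 * a)).
Notation smear := (smear m w).
Notation smear_rest := (smear_rest a c S).
Implicit Types (mu nu : bmeasure R n) (x y z : 'rV[R]_n) (f g : Rn R n -> \bar R).

Let hm := rs_ref H.
Let tw := rs_weights H.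

Let S0 r : (0 <= (S r)%:E)%E.
Proof. by rewrite lee_fin (tw_S_ge0 tw). Qed.

Let mS : measurable_fun setT (fun r : measurableTypeR R => (S r)%:E).
Proof. by apply/measurable_EFinP; exact: tw_mS tw. Qed.

(** Up to the factor c t^a, the pairing of f with [smear_rest t mu], as [integral_smear_rest] shows.
    It depends on mu through the potential only, while for small t it approximates the integral of f
    against mu times that of S. *)
Definition time_form t f mu : \bar R :=
  (\int[leb]_s ((S s)%:E * \int[mu]_y heatf m (t * s)%R f y))%E.

Lemma measurable_time_form t f mu : sigma_finite setT mu -> measurable_fun setT f ->
  (forall y, 0 <= f y)%E -> measurable_fun setT
    (fun s : measurableTypeR R => (S s)%:E * \int[mu]_y heatf m (t * s)%R f y)%E.
Proof.
move=> smu mf f0; apply: emeasurable_funM => //.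
apply: (@measurable_tonelli _ _ (measurableTypeR R) (Rn R n) R mu
  (fun s x => heatf m (t * s)%R f x)) => //; last first.
  by move=> s x; apply: heatf_ge0 => y; exact: f0.
apply: (measurable_heatf hm) => //.
by apply: measurable_funM => //; exact: measurable_fst.
Qed.

Let form0 t f mu s : (forall y, 0 <= f y)%E ->
  (0 <= (S s)%:E * \int[mu]_y heatf m (t * s)%R f y)%E.
Proof. by move=> f0; rewrite mule_ge0//; apply: integral_ge0 => y _; exact: heatf_ge0. Qed.

(** Where the potential is finite, hence almost everywhere for [m], the rest is pot mu - P_t (pot
    mu), a function of the potential alone. *)
Lemma time_form_unique mu nu x0 t f : sigma_finite setT mu -> sigma_finite setT nu ->
  (forall x, pot mu x = pot nu x) -> (pot mu x0 < +oo)%E -> 0 < t ->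
  measurable_fun setT f -> (forall y, 0 <= f y)%E ->
  time_form t f mu = time_form t f nu.
Proof.
move=> smu snu pE px0 t0 mf f0.
have ct0 : 0 < c * t `^ a by rewrite mulr_gt0 ?powR_gt0// (rs_c_gt0 H).
have restE : {ae m, forall x, smear_rest t mu x = smear_rest t nu x}.
  apply: ae_imp (excessive_ae_fin H (pot_excessive H smu) px0) => x px.
  have sle := exc_smear (pot_excessive H smu) x t0.
  have sfin : smear t (pot mu) x \is a fin_num.
    rewrite ge0_fin_numE ?(le_lt_trans sle)//.
    by apply: (smear_ge0 H) => y; exact: (pot_ge0 H).
  have e1 := pot_split H x t0 smu; have e2 := pot_split H x t0 snu.
  have pE' : pot nu = pot mu by apply/funext => y; rewrite pE.
  rewrite pE' in e2; rewrite e1 in e2; move: e2.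
  rewrite addeC (addeC (smear t (pot mu) x)) => /(congr1 (fun u => u - smear t (pot mu) x)%E).
  by rewrite !addeK.
have rest0 (r : bmeasure R n) x : (0 <= smear_rest t r x)%E.
  rewrite mule_ge0 ?lee_fin ?(ltW ct0)//; apply: integral_ge0 => s _.
  by rewrite mule_ge0// heatm_ge0.
have mrest (r : bmeasure R n) : sigma_finite setT r -> measurable_fun setT (fun x : Rn R n => smear_rest t r x).
  move=> sr; apply: measurable_funeM.
  apply: (@measurable_tonelli _ _ (Rn R n) (measurableTypeR R) R leb
    (fun x s => (S s)%:E * heatm (t * s)%R r x)%E).
  - exact: sigma_finite_leb.
  - apply: emeasurable_funM; first exact: measurable_on_snd mS.
    apply: measurable_heatm => //.
    by apply: measurable_funM => //; exact: measurable_snd.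
  - by move=> x s; rewrite mule_ge0// heatm_ge0.
have : (\int[m]_x (f x * smear_rest t mu x) = \int[m]_x (f x * smear_rest t nu x))%E.
  apply/eqP; rewrite eq_le; apply/andP; split; apply: ae_le_integral.
  - by apply: emeasurable_funM => //; exact: mrest.
  - by apply: emeasurable_funM => //; exact: mrest.
  - by move=> x; rewrite mule_ge0.
  - by move=> x; rewrite mule_ge0.
  - by apply: ae_imp restE => x ->.
  - by apply: emeasurable_funM => //; exact: mrest.
  - by apply: emeasurable_funM => //; exact: mrest.
  - by move=> x; rewrite mule_ge0.
  - by move=> x; rewrite mule_ge0.
  - by apply: ae_imp restE => x ->.
rewrite (integral_smear_rest H t mf f0 smu) (integral_smear_rest H t mf f0 snu).
exact: pmule_cancel.
Qed.

Let M := (\int[leb]_s (S s)%:E)%E.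

Let Mfin : M \is a fin_num.
Proof. by rewrite ge0_fin_numE ?(tw_S_fin tw)//; exact: integral_ge0. Qed.

Let M_gt0 : (0 < M)%E.
Proof.
(* On [1/2, 1] the rest weight is S(s) = s^(a-1) >= 1. *)
pose I : set (measurableTypeR R) := `[2^-1 : R, 1]%classic.
have mI : measurable I by exact: measurable_itv.
apply: (@lt_le_trans _ _ (\int[leb]_(s in I) (4^-1 : R)%:E)%E 0%E).
  have Lm := @lebesgue_measure_itv R `[2^-1, 1]%O.
  rewrite /= lte_fin invf_lt1// ltr1n -EFinB in Lm.
  rewrite integral_cst// [X in (_ < _ * X)%E](_ : _ = (1 - 2^-1)%:E); last exact: Lm.
  by rewrite -EFinM lte_fin mulr_gt0// subr_gt0 invf_lt1// ltr1n.
apply: (@le_trans _ _ (\int[leb]_(s in I) (S s)%:E)%E); last first.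
  by apply: ge0_subset_integral.
apply: ge0_le_integral.
- exact: mI.
- by move=> s _; rewrite lee_fin invr_ge0.
- exact: measurable_cst.
- exact: measurable_funTS mS.
move=> s; rewrite /I /= in_itv/= => /andP[s1 s2].
have s0 : 0 < s by lra.
rewrite lee_fin (S_eq_tpow H s2) /tpow s0.
have := powR_split a s0.
have : s `^ 1 <= s `^ a.
  have := rs_a_le1 H; have := rs_a_gt0 H => a0 a1.
  rewrite /powR gt_eqF// ler_expR ler_wnM2r//.
  by rewrite ln_le0.
rewrite powRr1 ?(ltW s0)// => sa e; rewrite e in sa.
have p0 : 0 <= s `^ (a - 1) by exact: powR_ge0.
have : 1 <= s `^ (a - 1) by rewrite -(ler_pM2r s0) mul1r.
by lra.
Qed.

Lemma time_form_lower f mu : sigma_finite setT mu -> measurable_fun setT f ->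
  (forall y, 0 <= f y)%E -> lower_semicontinuous (f : 'rV[R]_n -> \bar R) ->
  (M * \int[mu]_y f y <= limn_einf (fun k => time_form k.+1%:R^-1 f mu))%E.
Proof.
move=> smu mf f0 lf.
have I0 : (0 <= \int[mu]_y f y)%E by apply: integral_ge0.
rewrite /M -ge0_integralZr//.
apply: le_integral_limn_einf.
- by apply: emeasurable_funM => //; exact: measurable_cst.
- by move=> k; exact: measurable_time_form.
- by move=> s; rewrite mule_ge0.
- by move=> k s; exact: form0.
move=> s; have [s0|s0] := leP s 0.
  rewrite (S_le0 H s0) mul0e; apply: limn_einf_ge; apply: nearW => k.
  by rewrite mul0e.
apply: (le_trans _ (@limn_einf_pMl R (fun k => \int[mu]_y heatf m (k.+1%:R^-1 * s)%R f y)%E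
  (S s) (tw_S_ge0 tw s))).
rewrite lee_wpmul2l//; apply: le_integral_limn_einf => //.
- move=> k; apply: (measurable_heatf hm) => //.
- by move=> k x; exact: heatf_ge0.
move=> x; apply: (heatf_lsc H x _ _ mf f0 lf).
- by move=> k; rewrite mulr_gt0.
- by rewrite -(mul0r s); apply: cvgMl; exact: cvg_harmonic.
Qed.

Lemma time_formD t f g mu : sigma_finite setT mu -> measurable_fun setT f ->
  measurable_fun setT g -> (forall y, 0 <= f y)%E -> (forall y, 0 <= g y)%E ->
  time_form t (fun y => f y + g y)%E mu = (time_form t f mu + time_form t g mu)%E.
Proof.
move=> smu mf mg f0 g0.
rewrite /time_form -(ge0_integralD leb measurableT (fun s _ => form0 t mu s f0)
  (measurable_time_form t smu mf f0) (fun s _ => form0 t mu s g0)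
  (measurable_time_form t smu mg g0)).
apply: eq_integral => s _; rewrite -ge0_muleDr; first last.
- by apply: integral_ge0 => y _; exact: heatf_ge0.
- by apply: integral_ge0 => y _; exact: heatf_ge0.
congr (_ * _)%E.
have mh (h : Rn R n -> \bar R) : measurable_fun setT h -> (forall y, 0 <= h y)%E ->
    measurable_fun setT (fun x : Rn R n => heatf m (t * s)%R h x).
  by move=> mh h0; apply: (measurable_heatf hm) => //.
have h0 (h : Rn R n -> \bar R) : (forall y, 0 <= h y)%E -> forall x, (0 <= heatf m (t * s)%R h x)%E.
  by move=> h0 x; exact: heatf_ge0.
rewrite -(ge0_integralD mu measurableT (fun x _ => h0 f f0 x) (mh f mf f0)
  (fun x _ => h0 g g0 x) (mh g mg g0)).
by apply: eq_integral => x _; rewrite (@heatfD _ _ m _ f g x mf mg f0 g0).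
Qed.

(** For a heat kernel the limit is exact: from time 1 on, the kernels are dominated by a multiple of
    kappa(x0, .), which is integrable for mu because pot mu x0 is finite. *)
Lemma time_form_heat (C : R) x0 mu : 0 <= C -> sigma_finite setT mu ->
  (pot mu x0 < +oo)%E ->
  time_form k.+1%:R^-1 (fun z => (C * heat 1 x0 z)%:E) mu @[k --> \oo] -->
    (M * \int[mu]_z (C * heat 1 x0 z)%:E)%E.
Proof.
move=> C0 smu px0.
have [K K0 hK] := heat_le_riesz H ltr01.
pose psi (v : R) z := (C * heat v x0 z)%:E.
have psi0 v z : (0 <= psi v z)%E by rewrite lee_fin mulr_ge0// heat_ge0.
have mpsi v : measurable_fun setT (psi v : Rn R n -> \bar R).
  apply/measurable_EFinP; apply: measurable_funM => //.
  have : measurable_fun setT (fun z : Rn R n => (heat v x0 z)%:E) by exact: measurable_heatE.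
  by move=> /measurable_EFinP.
pose B z := ((C * K)%:E * kap x0 z)%E.
have mB : measurable_fun setT (B : Rn R n -> \bar R).
  by apply: measurable_funeM; exact: (measurable_riesz H).
have CK0 : 0 <= C * K by rewrite mulr_ge0// ltW.
have iBE : (\int[mu]_z B z = (C * K)%:E * pot mu x0)%E.
  rewrite (ge0_integralTZl mu _ _ CK0)//; first by exact: (measurable_riesz H).
  by move=> z; exact: (riesz_ge0 H).
have iB : (\int[mu]_z B z < +oo)%E.
  by rewrite iBE lte_mul_pinfty ?lee_fin.
have psiB v z : 1 <= v -> (psi v z <= B z)%E.
  by move=> v1; rewrite /psi /B !EFinM -muleA lee_wpmul2l ?lee_fin//; exact: hK.
have formE k s : 0 < s -> (\int[mu]_y heatf m (k.+1%:R^-1 * s)%R (psi 1%R) y =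
    \int[mu]_y psi (1%R + k.+1%:R^-1 * s)%R y)%E.
  move=> s0; apply: eq_integral => y _; rewrite /heatf /psi.
  have ks : 0 < k.+1%:R^-1 * s :> R by rewrite mulr_gt0.
  transitivity (\int[m]_z (C%:E * ((heat (k.+1%:R^-1 * s) y z)%:E * (heat 1 z x0)%:E)))%E.
    by apply: eq_integral => z _; rewrite -!EFinM (heatC 1 z x0) mulrCA.
  rewrite (ge0_integralTZl m _ _ C0).
  - by rewrite (heat_semigroup hm)// -EFinM heatC addrC.
  - by apply: emeasurable_funM; exact: measurable_heatE.
  - by move=> z; rewrite mule_ge0// lee_fin heat_ge0.
have I0 v : (0 <= \int[mu]_z psi v z)%E by apply: integral_ge0.
rewrite /M -ge0_integralZr//; last exact: (I0 1%R).
apply: (@ge0_dominated_cvg _ (measurableTypeR R) R leb _ _ (fun s => (S s)%:E * \int[mu]_z B z)%E).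
- by move=> k; exact: (measurable_time_form k.+1%:R^-1 smu (mpsi 1%R) (psi0 1%R)).
- by apply: emeasurable_funM => //; exact: measurable_cst.
- by apply: emeasurable_funM => //; exact: measurable_cst.
- by move=> k s; apply: form0; exact: (psi0 1%R).
- move=> s; have [s0|s0] := leP s 0.
    rewrite (S_le0 H s0) mul0e; under eq_fun do rewrite mul0e.
    exact: cvg_cst.
  apply: cvgeMl => //.
  rewrite [X in X @ _ --> _](_ : _ = fun k => \int[mu]_y psi (1%R + k.+1%:R^-1 * s)%R y)%E; last first.
    by apply/funext => k; exact: formE.
  apply: (@ge0_dominated_cvg _ (Rn R n) R mu (fun k => psi (1 + k.+1%:R^-1 * s)) (psi 1) B) => //.
    move=> z; apply: cvg_EFin; first exact: nearW.
    apply: cvgMr; apply: cvg_heat_time => //; first by move=> k; rewrite addr_gt0// mulr_gt0.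
    rewrite -[X in _ --> X]addr0; apply: cvgD; first exact: cvg_cst.
    by rewrite -(mul0r s); apply: cvgMl; exact: cvg_harmonic.
  by move=> k z; apply: psiB; rewrite lerDl mulr_ge0// ltW.
- move=> k s; have [s0|s0] := leP s 0; first by rewrite (S_le0 H s0) !mul0e.
  rewrite lee_wpmul2l// (formE k s s0); apply: ge0_le_integral => //.
  by move=> z _; apply: psiB; rewrite lerDl mulr_ge0// ltW.
rewrite ge0_integralZr//; last by apply: integral_ge0 => z _; apply: le_trans (psiB 1 z _).
by rewrite lte_mul_pinfty// ?(tw_S_fin tw)//; exact: integral_ge0.
Qed.

(** A multiple psi of the heat kernel at time 1 dominates phi. Both phi and psi - phi are lower
    semicontinuous, so [time_form_lower] applies to each; with the exact limit for psi, the lower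
    bound for psi - phi becomes an upper bound for phi. *)
Lemma integral_unique_le mu nu x0 (phi : 'rV[R]_n -> R) :
  sigma_finite setT mu -> sigma_finite setT nu ->
  (forall x, pot mu x = pot nu x) -> (pot mu x0 < +oo)%E ->
  continuous phi -> (forall x, 0 <= phi x) -> compact (closure [set x | phi x != 0]) ->
  (\int[mu]_x (phi x)%:E <= \int[nu]_x (phi x)%:E)%E.
Proof.
move=> smu snu pE px0 cphi phi0 supp.
have [B B0 pB] := compact_support_bounded cphi phi0 supp.
have [r r0 Kr] := compact_sub_ball supp.
have [D hD] := sqdist_le_ball x0 r.
pose eta : R := (pi * 1) `^ (- (n%:R / 2)) * expR (- (D / 1)).
have eta0 : 0 < eta.
  by rewrite mulr_gt0 ?expR_gt0// powR_gt0// mulr1 pi_gt0.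
pose C := B / eta.
have C0 : 0 <= C by rewrite divr_ge0// ltW.
pose psi z := C * heat 1 x0 z.
have phipsi z : phi z <= psi z.
  have [Bz|nBz] := pselect (ball (0 : 'rV[R]_n) r z); last first.
    have -> : phi z = 0.
      by apply: contrapT => /eqP pz; apply: nBz; apply: Kr; exact: subset_closure.
    by rewrite mulr_ge0// heat_ge0.
  apply: (le_trans (pB z)); rewrite /psi /C -mulrA ler_peMr ?(ltW B0)//.
  rewrite mulrC ler_pdivlMr// mul1r /eta heatE// ler_wpM2l ?powR_ge0//.
  by rewrite ler_expR lerN2 ler_pM2r ?invr_gt0//; exact: hD.
pose q z := psi z - phi z.
have q0 z : 0 <= q z by rewrite subr_ge0.
have cpsi (u : nat -> 'rV[R]_n) z : u @ \oo --> z -> psi (u t) @[t --> \oo] --> psi z.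
  move=> uz; apply: cvgMr; rewrite heatC; under eq_fun do rewrite heatC.
  exact: cvg_heat.
have lsc_of (f : 'rV[R]_n -> R) :
    (forall z (u : nat -> 'rV[R]_n), u @ \oo --> z -> f (u k) @[k --> \oo] --> f z) ->
    lower_semicontinuous (fun z => (f z)%:E).
  move=> cf; apply: lsc_seq => z u uz.
  have h : (f (u k))%:E @[k --> \oo] --> (f z)%:E.
    by apply: cvg_EFin; [exact: nearW|exact: cf].
  by rewrite (cvg_limn_einf_sup h).1.
have lphi : lower_semicontinuous (fun z => (phi z)%:E).
  by apply: lsc_of => z u uz; apply: (cvg_comp _ phi uz); exact: cphi.
have lq : lower_semicontinuous (fun z => (q z)%:E).
  apply: lsc_of => z u uz; apply: cvgB; first exact: cpsi.
  by apply: (cvg_comp _ phi uz); exact: cphi.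
have mphi := lsc_measurable lphi; have mq := lsc_measurable lq.
have phi0E z : (0 <= (phi z)%:E)%E by rewrite lee_fin.
have q0E z : (0 <= (q z)%:E)%E by rewrite lee_fin.
pose I mu' (f : 'rV[R]_n -> R) := (\int[mu']_z (f z)%:E)%E.
have I0 (mu' : bmeasure R n) (f : 'rV[R]_n -> R) : (forall z, 0 <= f z) -> (0 <= I mu' f)%E.
  by move=> f0; apply: integral_ge0 => z _; rewrite lee_fin.
have psiE : (fun z => ((phi z)%:E + (q z)%:E)%E) = (fun z => (C * heat 1 x0 z)%:E).
  by apply/funext => z; rewrite -EFinD /q addrC subrK.
have ID : I nu psi = (I nu phi + I nu q)%E.
  rewrite /I -(ge0_integralD nu measurableT (fun x _ => phi0E x) mphi (fun x _ => q0E x) mq).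
  by apply: eq_integral => z _; rewrite -EFinD /q addrC subrK.
have pnu : (pot nu x0 < +oo)%E by rewrite -pE.
have Ifin : I nu psi \is a fin_num.
  have [K K0 hK] := heatm_le_pot H ltr01.
  rewrite ge0_fin_numE; last by apply: I0 => z; rewrite mulr_ge0// heat_ge0.
  rewrite /I /psi; under eq_integral do rewrite EFinM.
  rewrite (ge0_integralTZl nu _ _ C0); first last.
  - by move=> z; rewrite lee_fin heat_ge0.
  - exact: measurable_heatE.
  rewrite lte_mul_pinfty ?lee_fin//.
  apply: (le_lt_trans (hK nu 1 x0 (lexx _))).
  by rewrite lte_mul_pinfty ?lee_fin// ltW.
have [If Iq] : I nu phi \is a fin_num /\ I nu q \is a fin_num.
  by move: Ifin; rewrite ID fin_numD => /andP[].
have tk (k : nat) : 0 < k.+1%:R^-1 :> R by [].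
have form_ge0 t f (mu' : bmeasure R n) : (forall y, 0 <= f y)%E -> (0 <= time_form t f mu')%E.
  by move=> f0; apply: integral_ge0 => s _; exact: form0.
suff h : (M * I mu phi <= M * I nu phi)%E.
  by move: h; rewrite lee_pmul2l.
apply: (le_trans (time_form_lower smu mphi phi0E lphi)).
rewrite (_ : (fun k => time_form k.+1%:R^-1 _ mu) =
  (fun k => time_form k.+1%:R^-1 (fun z => (phi z)%:E) nu)); last first.
  by apply/funext => k; exact: (time_form_unique smu snu pE px0).
apply: (@limn_einf_add_le R _ (fun k => time_form k.+1%:R^-1 (fun z => (q z)%:E) nu)
  (fun k => time_form k.+1%:R^-1 (fun z => (C * heat 1 x0 z)%:E) nu) _ (M * I nu q)%E).
- by move=> k; rewrite -psiE; rewrite (time_formD _ snu mphi mq phi0E q0E).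
- exact: fin_numM.
- exact: fin_numM.
- by move=> k; exact: form_ge0.
- by move=> k; exact: form_ge0.
- by rewrite -(ge0_muleDr _ (I0 nu phi phi0) (I0 nu q q0)) -ID; exact: time_form_heat.
- exact: time_form_lower.
Qed.

Lemma integral_unique mu nu x0 (phi : 'rV[R]_n -> R) :
  sigma_finite setT mu -> sigma_finite setT nu ->
  (forall x, pot mu x = pot nu x) -> (pot mu x0 < +oo)%E ->
  continuous phi -> (forall x, 0 <= phi x) -> compact (closure [set x | phi x != 0]) ->
  (\int[mu]_x (phi x)%:E = \int[nu]_x (phi x)%:E)%E.
Proof.
move=> smu snu pE px0 cphi phi0 supp; apply/eqP; rewrite eq_le; apply/andP; split.
  exact: (integral_unique_le smu snu pE px0).
by apply: (integral_unique_le snu smu (fun x => esym (pE x)) (x0 := x0)) => //; rewrite -pE.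
Qed.

End unique.

Section pot_limit.
Context (R : realType) (n : nat) (m : bmeasure R n) (a c : R) (w S : R -> R).
Hypothesis H : riesz_setting m a c w S.
Notation pot := (@potential R n (2 * a)).
Variables (gam : nat -> bmeasure R n) (sig : bmeasure R n) (h : Rn R n -> \bar R).
Variable x0 : 'rV[R]_n.
Hypothesis rgam : forall k, radon (gam k).
Hypothesis rsig : radon sig.
Hypothesis gam_sig : forall k x, (pot (gam k) x <= pot sig x)%E.
Hypothesis sigx0 : (pot sig x0 < +oo)%E.
Hypothesis hcvg : forall x, (fun k => pot (gam k) x) @ \oo --> h x.
Hypothesis hub : forall k x, (pot (gam k) x <= h x)%E.

Let bnd : forall r : R, exists M : R, forall k,
  (gam k (ball (0%R : 'rV[R]_n) r) <= M%:E)%E.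
Proof. exact: (locally_bounded_of_pot_le H sigx0). Qed.

Let ultra_pot (F : set_system nat) : UltraFilter F -> \oo `<=` F ->
  exists g : bmeasure R n, [/\ radon g, forall x, pot g x = h x &
    forall phi : 'rV[R]_n -> R, continuous phi -> (forall x, 0 <= phi x) ->
      compact (closure [set x | phi x != 0]) ->
      fine (\int[gam k]_x (phi x)%:E) @[k --> F] --> fine (\int[g]_x (phi x)%:E)].
Proof.
move=> FU Foo; have [g [go gc]] := exists_ultralimit FU bnd.
exists g; split; first exact: ultralimit_radon go.
  move=> x; apply/eqP; rewrite eq_le; apply/andP; split.
    exact: (ultra_pot_le H FU bnd go rgam hcvg hub).
  exact: (ultra_pot_ge H FU Foo bnd go gc rgam rsig gam_sig hcvg hub sigx0).
by move=> phi cphi phi0 supp; exact: (ultralimit_continuous FU bnd go gc cphi phi0 supp).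
Qed.

Lemma exists_pot_limit : exists g : bmeasure R n, radon g /\ forall x, pot g x = h x.
Proof.
have [F [FU Foo]] := @ultraFilterLemma nat \oo _.
by have [g [rg gE _]] := ultra_pot FU Foo; exists g.
Qed.

Lemma pot_limit_vague g (phi : 'rV[R]_n -> R) : radon g -> (forall x, pot g x = h x) ->
  continuous phi -> (forall x, 0 <= phi x) -> compact (closure [set x | phi x != 0]) ->
  fine (\int[gam k]_x (phi x)%:E) @[k --> \oo] --> fine (\int[g]_x (phi x)%:E).
Proof.
move=> rg gE cphi phi0 supp; apply/cvgrPdist_lt => e e0.
set u := fun k => fine (\int[gam k]_x (phi x)%:E); set l := fine _.
apply: contrapT => nnear.
(* If convergence fails, some ultrafilter finer than the one at infinity contains the bad indices.
   Along it the integrals converge to those of a measure with the same potential as g, which by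
   uniqueness have the value l. *)
pose bad := [set k | ~ `|l - u k| < e].
have WP : ProperFilter (within bad (\oo : set_system nat)).
  split; last exact: within_filter.
  move=> W; apply: nnear; have W' : \oo [set k | bad k -> False] := W.
  by apply: filterS W' => k /= hk; apply: contrapT => /hk.
have [F [FU Fw]] := ultraFilterLemma WP.
have Foo : \oo `<=` F.
  by move=> X Xoo; apply: Fw; apply: filterS Xoo => k Xk _.
have Fbad : F bad by apply: Fw; exact: nearW.
have [g' [rg' gE' cg']] := ultra_pot FU Foo.
have FF : ProperFilter F := ultra_proper.
have : fine (\int[gam k]_x (phi x)%:E) @[k --> F] --> l.
  have -> : l = fine (\int[g']_x (phi x)%:E).
    congr fine; apply: (integral_unique H (radon_sigma_finite rg) (radon_sigma_finite rg')
      (x0 := x0)) => //.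
    - by move=> x; rewrite gE gE'.
    - rewrite gE; apply: le_lt_trans sigx0.
      rewrite -(cvg_lim _ (@hcvg x0))//; apply: lime_le; first exact: cvgP (@hcvg x0).
      by apply: nearW => k.
  exact: cg'.
move=> /cvgrPdist_lt/(_ e e0) Fgood.
by have [k []] := filter_ex (filterI Fbad Fgood).
Qed.

End pot_limit.

(** * Inner equilibrium measures *)

Section equilibrium.
Context (R : realType) (n : nat) (m : bmeasure R n) (a c : R) (w S : R -> R).
Hypothesis H : riesz_setting m a c w S.
Notation leb := (@lebesgue_measure R).
Notation kap := (@riesz R n (2 * a)).
Notation pot := (@potential R n (2 * a)).
Notation energy := (@energy R n (2 * a)).
Notation mutual := (@mutual R n (2 * a)).
Notation cap := (@cap R n (2 * a)).
Notation cap_inf := (@cap_inf R n (2 * a)).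
Notation ne := (@nearly_everywhere R n (2 * a)).
Notation Mplus := (@Mplus R n (2 * a)).
Notation admissible := (@admissible R n a).
Notation equilibrium := (@equilibrium R n (2 * a)).
Notation excessive := (excessive m w).
Implicit Types (mu nu g : bmeasure R n) (x y z : 'rV[R]_n) (A K : set 'rV[R]_n).

Let hm := rs_ref H.
Let tw := rs_weights H.

Definition compact_eq K g := [/\ (g setT < +oo)%E, g (~` K) = 0%E, (energy g < +oo)%E,
  {ae g, forall x, pot g x = 1%E} & ne (fun y => 1 <= pot g y)%E K /\ g setT = cap K].

Lemma compact_eq_radon K g : compact_eq K g -> radon g.
Proof. by case=> gf *; exact: finite_radon. Qed.

(** Since pot g = 1 almost everywhere for g, the bound v >= 1 seen by g alone is the hypothesis of
    the domination principle. *)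
Lemma compact_eq_dominated K g (v : Rn R n -> \bar R) : compact K -> compact_eq K g ->
  excessive v -> {ae g, forall x, (1 <= v x)%E} -> forall x, (pot g x <= v x)%E.
Proof.
move=> cK [gf g0 Eg ae1 _] ev aev.
have [r r0 Kr] := compact_sub_ball cK.
apply: (domination H gf r0 _ Eg ev).
  apply: (subset_measure0 _ _ _ g0).
  - apply: measurableC; apply: measurable_open; exact: ball_open.
  - apply: measurableC; exact: measurable_compact.
  - exact: subsetC.
by apply: ae_imp2 ae1 aev => x ->.
Qed.

Lemma compact_eq_le1 K g x : compact K -> compact_eq K g -> (pot g x <= 1)%E.
Proof.
move=> cK eg; apply: (@compact_eq_dominated K g (cst 1%E) cK eg).
  exact: (cst_excessive H).
by apply: aeW => y.
Qed.

Lemma compact_eq_le_pot K g A nu x : compact K -> compact_eq K g -> K `<=` A ->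
  radon nu -> ne (fun y => 1 <= pot nu y)%E A -> (pot g x <= pot nu x)%E.
Proof.
move=> cK eg KA rnu neA; have snu := radon_sigma_finite rnu.
apply: (compact_eq_dominated cK eg (pot_excessive H snu)).
have [gf g0 Eg _ _] := eg.
apply: (nearly_everywhere_ae H snu neA (compact_eq_radon eg) Eg _ KA g0).
exact: measurable_compact.
Qed.

Lemma sub_ne A K (P : 'rV[R]_n -> Prop) : K `<=` A -> ne P A -> ne P K.
Proof. by move=> KA; apply: (sub_cap0 H) => x [/KA]. Qed.

Lemma le_ne A (P Q : 'rV[R]_n -> Prop) : (forall x, P x -> Q x) -> ne P A -> ne Q A.
Proof. by move=> PQ; apply: (sub_cap0 H) => x [Ax nQ]; split => // /PQ. Qed.

(* A compact subset of positive capacity of the exceptional set would carry an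
   equilibrium measure whose potential is at least 1 nearly everywhere on it. *)
Lemma ne_ge1_of_dominates A (v : 'rV[R]_n -> \bar R) :
  (forall K g, compact K -> K `<=` A -> compact_eq K g -> forall x, (pot g x <= v x)%E) ->
  ne (fun y => 1 <= v y)%E A.
Proof.
move=> dom; apply/(cap_eq0P H) => mu [rmu [B [mB BA B0]] mu1 Ef].
have mufin : (mu setT < +oo)%E by rewrite mu1 ltry.
have muB : (0 < mu B)%E.
  rewrite lt_neqAle eq_sym measure_ge0 andbT; apply/negP => /eqP muB.
  have : (mu setT <= 0)%E.
    rewrite -(setUv B); apply: (le_trans (measureU2 _ _ _)) => //; first exact: measurableC.
    have e : (mu B + mu (~` B) = 0)%E by rewrite muB B0 adde0.
    by rewrite le_eqVlt; apply/orP; left; apply/eqP; exact: e.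
  by rewrite mu1 lee_fin ler10.
have [K [cK KB muK]] := exists_compact_pos mufin mB muB.
have mK := measurable_compact cK.
have [nu Knu] : exists nu, admissible K nu.
  apply: (exists_admissible H mK rmu Ef); rewrite muK /=.
  by apply: le_lt_trans mufin; apply: le_measure => //; rewrite inE.
have [g eg] := compact_equilibrium H cK.
have KA : K `<=` A by move=> x /KB/BA[].
have gv := dom K g cK KA eg.
have [_ _ _ _ [neK _]] := eg.
have neK' : ne (fun y => 1 <= v y)%E K.
  by apply: le_ne neK => x h; exact: le_trans h (gv x).
move/(cap_eq0P H) : neK' => /(_ nu); apply.
by apply: sub_admissible Knu => x Kx; split => //; have [] := BA _ (KB _ Kx).
Qed.

Section set.
Variables (A : set 'rV[R]_n) (gA : bmeasure R n).
Hypothesis eqA : equilibrium A gA.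

Lemma equilibrium_radon : radon gA.
Proof. by case: eqA => [[]]. Qed.

Lemma equilibrium_fin : exists x, (pot gA x < +oo)%E.
Proof. by case: eqA => [[_ [x px]] _]; exists x; rewrite ltey. Qed.

Lemma equilibrium_le nu x : Mplus nu -> ne (fun y => 1 <= pot nu y)%E A ->
  (pot gA x <= pot nu x)%E.
Proof.
by case: eqA => _ -> Mnu nenu; apply: ereal_inf_lbound; exists nu.
Qed.

Lemma compact_eq_le_equilibrium K g x : compact K -> compact_eq K g -> K `<=` A ->
  (pot g x <= pot gA x)%E.
Proof.
move=> cK eg KA; case: eqA => _ ->; apply: le_ereal_inf_tmp => _ [nu [[rnu _] nenu] <-].
exact: (compact_eq_le_pot x cK eg KA rnu nenu).
Qed.

(** The infimum runs over uncountably many potentials, so their exceptional sets cannot be united.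
    The equilibrium potentials of compact subsets lie below each of them, hence below the
    infimum. *)
Lemma equilibrium_ge1 : ne (fun y => 1 <= pot gA y)%E A.
Proof.
apply: ne_ge1_of_dominates => K g cK KA eg x.
exact: compact_eq_le_equilibrium eg KA.
Qed.

(** The compact subsets of A form a directed family; a sequence maximizing V selects a countable
    part of it. Its limit h dominates the equilibrium potential of every compact subset, so h >= 1
    nearly everywhere on A; being the potential of a measure, h is at least pot gA by minimality. *)
Lemma exists_compact_exhaustion : exists K : nat -> set 'rV[R]_n,
  exists g : nat -> bmeasure R n,
  [/\ forall k, compact (K k) /\ K k `<=` A, forall k, compact_eq (K k) (g k) &
      forall x, (fun k => pot (g k) x) @ \oo --> pot gA x].
Proof.
have [eqm eqmP] : exists e : set 'rV[R]_n -> bmeasure R n,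
    forall K, compact K -> compact_eq K (e K).
  have h K : exists g, compact K -> compact_eq K g.
    have [cK|nK] := pselect (compact K).
      by have [g eg] := compact_equilibrium H cK; exists g.
    by exists gA.
  by have [e eP] := choice h; exists e.
(* One number measuring the size of the potential: monotone in K, at most 1, and sensitive to
   changes on sets of positive reference measure because the heat kernel is positive. *)
pose V K := heatf m 1 (pot (eqm K)) (0 : 'rV[R]_n).
have p0 mu y : (0 <= pot mu y)%E by exact: (pot_ge0 H).
have sK K : compact K -> sigma_finite setT (eqm K).
  by move=> /eqmP/compact_eq_radon; exact: radon_sigma_finite.
have mp K : compact K -> measurable_fun setT (pot (eqm K) : Rn R n -> \bar R).
  by move=> cK; apply: (measurable_pot H); exact: sK.
have mono K L : compact K -> compact L -> K `<=` L ->
    forall x, (pot (eqm K) x <= pot (eqm L) x)%E.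
  move=> cK cL KL x; have [_ _ _ _ [neL _]] := eqmP L cL.
  exact: (compact_eq_le_pot x cK (eqmP K cK) KL (compact_eq_radon (eqmP L cL)) neL).
have V0 K : (0 <= V K)%E by apply: heatf_ge0 => y; exact: p0.
have V1 K : compact K -> (V K <= 1)%E.
  move=> cK; rewrite -[X in (_ <= X)%E](heatf_cst hm (0 : 'rV[R]_n) ltr01 (@lee01 R)).
  apply: le_heatf => //; first exact: mp.
  by move=> y; exact: compact_eq_le1 (eqmP K cK).
pose F := [set K | compact K /\ K `<=` A].
pose s := ereal_sup (V @` F).
have F0 : F set0 by split; [exact: compact0|].
have s_ge0 : (0 <= s)%E.
  by apply: (le_trans (V0 set0)); apply: ereal_sup_ubound; exists set0.
have s_le1 : (s <= 1)%E by apply: ge_ereal_sup => _ [K [cK _] <-]; exact: V1.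
have sfin : s \is a fin_num by rewrite ge0_fin_numE// (le_lt_trans s_le1)// ltry.
have hj (j : nat) : exists K : set 'rV[R]_n, F K /\ (s - j.+1%:R^-1%:E < V K)%E.
  have j0 : 0 < j.+1%:R^-1 :> R by [].
  by have [_ [K FK <-] hK] := ub_ereal_sup_adherent j0 sfin; exists K.
have [K' K'P] := choice hj.
pose K := fix kk j := if j is i.+1 then kk i `|` K' i.+1 else K' 0%N.
have FK j : F (K j).
  elim: j => [|j [cK KA]]/=; first by have [] := K'P 0%N.
  have [[cK' K'A] _] := K'P j.+1; split; first exact: compactU.
  by move=> x [/KA|/K'A].
have K'K j : K' j `<=` K j by case: j => //= j x ?; right.
have KK j : K j `<=` K j.+1 by move=> x ?; left.
have KKle i j : (i <= j)%N -> K i `<=` K j.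
  elim: j => [|j IH]; first by rewrite leqn0 => /eqP->.
  rewrite leq_eqVlt => /orP[/eqP->//|/IH h].
  exact: subset_trans h (KK j).
pose g j := eqm (K j).
have ag j := eqmP _ (FK j).1.
pose h x := ereal_sup (range (fun j => pot (g j) x)).
have hcvg x : (fun j => pot (g j) x) @ \oo --> h x.
  apply: ereal_nondecreasing_cvgn => i j ij; apply: mono; [exact: (FK i).1|exact: (FK j).1|].
  exact: KKle.
have hub j x : (pot (g j) x <= h x)%E by apply: ereal_sup_ubound; exists j.
have rg j : radon (g j) := compact_eq_radon (ag j).
have eh : excessive h.
  apply: (excessive_limn_einf H (f := fun k => pot (g k))) => // k.
  by apply: (pot_excessive H); exact: radon_sigma_finite.
have h_le1 x : (h x <= 1)%E.
  by apply: ge_ereal_sup => _ [j _ <-]; exact: compact_eq_le1 (FK j).1 (ag j).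
have g_gA j x : (pot (g j) x <= pot gA x)%E.
  exact: compact_eq_le_equilibrium (FK j).1 (ag j) (FK j).2.
have h_gA x : (h x <= pot gA x)%E by apply: ge_ereal_sup => _ [j _ <-]; exact: g_gA.
have sle : (s <= heatf m 1 h (0 : 'rV[R]_n))%E.
  apply/lee_addgt0Pr => e e0; have [j je] := @ltr_add_invr R 0 e e0; rewrite add0r in je.
  have Vle : (V (K' j) <= heatf m 1 h (0 : 'rV[R]_n))%E.
    apply: le_heatf => //.
    - by apply: mp; have [[]] := K'P j.
    - exact: exc_meas eh.
    move=> y; apply: le_trans (hub j y); apply: mono => //.
    - by have [[]] := K'P j.
    - exact: (FK j).1.
  have [_ sj] := K'P j.
  apply: (@le_trans _ _ (V (K' j) + j.+1%:R^-1%:E)%E).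
    by rewrite -leeBlDr// ltW.
  by apply: leeD => //; rewrite lee_fin ltW.
have dom L gL : compact L -> L `<=` A -> compact_eq L gL -> forall x, (pot gL x <= h x)%E.
  move=> cL LA eL.
  have rL := compact_eq_radon eL; have sL := radon_sigma_finite rL.
  have eL' := pot_excessive H sL.
  apply: (excessive_ae_le H eL' eh).
  (* Adding L to the sets [K k] cannot push V above the supremum s, which h already attains; so
     max(pot gL, h) has the same finite heat average as h and agrees with it almost everywhere. *)
  pose f x := maxe (pot gL x) (h x).
  have mf : measurable_fun setT (f : Rn R n -> \bar R).
    by apply: measurable_maxe; [exact: exc_meas eL'|exact: exc_meas eh].
  have f0 y : (0 <= f y)%E by rewrite /f le_max p0.
  have hf y : (h y <= f y)%E by rewrite /f le_max lexx orbT.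
  have mheat (u : Rn R n -> \bar R) : measurable_fun setT u ->
      measurable_fun setT (fun y : Rn R n => ((heat 1 0 y)%:E * u y)%E).
    by move=> mu_; apply: emeasurable_funM => //; exact: measurable_heatE.
  have heat0 (u : Rn R n -> \bar R) y : (0 <= u y)%E -> (0 <= (heat 1 0 y)%:E * u y)%E.
    by move=> u0; rewrite mule_ge0// lee_fin heat_ge0.
  have fs : (heatf m 1 f (0 : 'rV[R]_n) <= s)%E.
    pose fk k x := maxe (pot gL x) (pot (g k) x).
    have mfk k : measurable_fun setT (fk k : Rn R n -> \bar R).
      by apply: measurable_maxe; [exact: exc_meas eL'|apply: mp; exact: (FK k).1].
    have fk0 k y : (0 <= fk k y)%E by rewrite /fk le_max p0.
    apply: (@le_trans _ _ (limn_einf (fun k => heatf m 1 (fk k) (0 : 'rV[R]_n)))).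
      apply: le_integral_limn_einf.
      - exact: mheat.
      - by move=> k; exact: mheat.
      - by move=> y; exact: heat0.
      - by move=> k y; exact: heat0.
      move=> y; apply: (le_trans _ (@limn_einf_pMl R (fun k => fk k y) (heat 1 0 y) (heat_ge0 _ _ _))).
      rewrite lee_wpmul2l ?lee_fin ?heat_ge0// ge_max; apply/andP; split.
        by apply: limn_einf_ge; apply: nearW => k; rewrite /fk le_max lexx.
      rewrite -(cvg_limn_einf_sup (@hcvg y)).1; apply: le_limn_einf => k.
      by rewrite /fk le_max lexx orbT.
    apply: limn_einf_le => k.
    have cU : compact (K k `|` L) by apply: compactU => //; exact: (FK k).1.
    have FU : F (K k `|` L) by split => // x [/(FK k).2|/LA].
    apply: (@le_trans _ _ (V (K k `|` L))); last first.
      by apply: ereal_sup_ubound; exists (K k `|` L).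
    apply: le_heatf => //; first exact: mp.
    move=> y; rewrite /fk ge_max; apply/andP; split.
      have [_ _ _ _ [neU _]] := eqmP _ cU.
      by apply: (compact_eq_le_pot y cL eL _ (compact_eq_radon (eqmP _ cU)) neU) => x; right.
    apply: mono; [exact: (FK k).1|exact: cU|by move=> x; left].
  have h0 y : (0 <= h y)%E := exc_ge0 eh y.
  have : {ae m, forall y, ((heat 1 0 y)%:E * f y = (heat 1 0 y)%:E * h y)%E}.
    apply: ae_eq_integral_le.
    - by apply: mheat; exact: exc_meas eh.
    - exact: mheat.
    - by move=> y; exact: heat0.
    - by move=> y; exact: heat0.
    - by apply: aeW => y; rewrite lee_wpmul2l ?lee_fin ?heat_ge0.
    - apply: le_lt_trans (ltry 1).
      apply: (@le_trans _ _ (heatf m 1 f (0 : 'rV[R]_n))); last exact: le_trans fs s_le1.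
      apply: le_heatf => //; exact: exc_meas eh.
    - exact: le_trans fs sle.
  apply: ae_imp => y /pmule_cancel fh.
  by rewrite -fh ?heat_gt0// /f le_max lexx.
exists K, g; split; [exact: FK|exact: ag|].
have [x0 gA0] := equilibrium_fin.
have [gam [rgam gamE]] := exists_pot_limit H rg equilibrium_radon g_gA gA0 hcvg hub.
have h_ge1 : ne (fun y => 1 <= h y)%E A by exact: ne_ge1_of_dominates.
have gA_h x : (pot gA x <= h x)%E.
  rewrite -gamE; apply: equilibrium_le.
    split => //; exists x; rewrite gamE.
    by apply/negP => /eqP hoo; have := h_le1 x; rewrite hoo.
  by apply: le_ne h_ge1 => y; rewrite gamE.
move=> x; have -> : pot gA x = h x by apply/eqP; rewrite eq_le gA_h h_gA.
exact: hcvg.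
Qed.

Lemma equilibrium_le1 x : (pot gA x <= 1)%E.
Proof.
have [K [g [FK eg gcv]]] := exists_compact_exhaustion.
rewrite -(cvg_lim _ (@gcv x))//; apply: lime_le; first exact: cvgP (@gcv x).
by apply: nearW => k; exact: compact_eq_le1 (FK k).1 (eg k).
Qed.

Lemma le_cap K : K `<=` A -> (cap K <= cap A)%E.
Proof.
move=> KA.
have IAK : (cap_inf A <= cap_inf K)%E.
  apply: le_ereal_inf_tmp => _ [mu Kmu <-]; apply: ereal_inf_lbound; exists mu => //.
  exact: sub_admissible Kmu.
have IA0 := cap_inf_ge0 H A; have IK0 := cap_inf_ge0 H K.
move: IAK IA0 IK0; rewrite /cap.
case: (cap_inf A) => [i| |]//; case: (cap_inf K) => [k| |]//=; rewrite ?eqxx//.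
- rewrite !lee_fin !eqe => ik i0 k0.
  have [i0'|iN] := eqVneq i 0; first by rewrite leey.
  have ip : 0 < i by rewrite lt_neqAle eq_sym iN.
  have kp : 0 < k by exact: lt_le_trans ip ik.
  by rewrite (gt_eqF kp) lee_fin lef_pV2.
- move=> _ i0 _; case: ifP => // _.
  by rewrite lee_fin invr_ge0 -lee_fin.
Qed.

(** Upper bound: pot gA <= 1, so the mutual energy with the equilibrium measure of a compact subset
    is at most its mass, a capacity. Lower bound: pot gA >= 1 nearly everywhere, so every admissible
    measure has mutual energy at least 1 with gA. *)
Lemma equilibrium_cap : energy gA = cap A.
Proof.
have rgA := equilibrium_radon; have sgA := radon_sigma_finite rgA.
have E0 : (0 <= energy gA)%E := energy_ge0 H gA.
apply/eqP; rewrite eq_le; apply/andP; split.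
  have [K [g [FK eg gcv]]] := exists_compact_exhaustion.
  have sg k : sigma_finite setT (g k) := radon_sigma_finite (compact_eq_radon (eg k)).
  apply: (@le_trans _ _ (limn_einf (fun k => mutual gA (g k)))).
    apply: le_integral_limn_einf.
    - exact: (measurable_pot H).
    - by move=> k; exact: (measurable_pot H).
    - by move=> x; exact: (pot_ge0 H).
    - by move=> k x; exact: (pot_ge0 H).
    - by move=> x; rewrite (cvg_limn_einf_sup (@gcv x)).1.
  apply: limn_einf_le => k; rewrite (mutualC H sgA (sg k)).
  have [_ _ _ _ [_ gT]] := eg k.
  apply: (le_trans _ (le_cap (FK k).2)); rewrite -gT.
  rewrite -[X in (_ <= X)%E]mul1e -(@integral_cst _ (Rn R n) R (g k) _ measurableT 1%E).
  apply: ge0_le_integral.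
  - exact: measurableT.
  - by move=> x _; exact: (pot_ge0 H).
  - exact: (measurable_pot H).
  - exact: measurable_cst.
  - by move=> x _; exact: equilibrium_le1.
have [e_oo|e_fin] := eqVneq (energy gA) +oo%E; first by rewrite e_oo leey.
pose e := fine (energy gA).
have eE : energy gA = e%:E by rewrite fineK// ge0_fin_numE// ltey.
have e0 : 0 <= e by rewrite fine_ge0.
have key mu : admissible A mu -> exists2 q : R, energy mu = q%:E & 0 < q /\ q^-1 <= e.
  move=> [rmu [B [mB BA B0]] mu1 Ef].
  have smu := radon_sigma_finite rmu.
  have q0 : (0 < energy mu)%E by apply: (energy_gt0 H smu); rewrite mu1 lte_fin.
  have qfin : energy mu \is a fin_num by rewrite ge0_fin_numE// ltW.
  exists (fine (energy mu)); first by rewrite fineK.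
  set q := fine _; have qE : energy mu = q%:E by rewrite fineK.
  have qp : 0 < q by rewrite -lte_fin -qE.
  split => //.
  have mut : (1 <= mutual mu gA)%E.
    have ae1 := nearly_everywhere_ae H sgA equilibrium_ge1 rmu Ef mB BA B0.
    have T1 : (\int[mu]_x cst 1%E x = 1)%E by rewrite integral_cst// mul1e.
    rewrite -[X in (X <= _)%E]T1.
    apply: ae_le_integral => //.
    - exact: (measurable_pot H).
    - by move=> x; exact: (pot_ge0 H).
  have qi0 : 0 <= q^-1 by rewrite invr_ge0 ltW.
  (* The multiple 1/q is optimal in the inequality between mutual energy and energies: 2/q <= e +
     1/q, hence 1/q <= e. *)
  pose lam : bmeasure R n := mscale (NngNum qi0) mu.
  have slam : sigma_finite setT lam.
    apply: finite_sigma_finite; change ((q^-1)%:E * mu setT < +oo)%E.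
    by rewrite mu1 mule1 ltry.
  have := mutual_amgm H sgA slam.
  have -> : energy lam = (q^-1)%:E.
    rewrite /energy (mutual_mscaler H) // (mutual_mscalel H)//.
    change ((q^-1)%:E * ((q^-1)%:E * energy mu) = (q^-1)%:E)%E.
    by rewrite qE -!EFinM mulVf ?gt_eqF// mulr1.
  have -> : mutual lam gA = ((q^-1)%:E * mutual mu gA)%E by rewrite (mutual_mscalel H).
  rewrite eE => h.
  have : (2%:E * ((q^-1)%:E * 1) <= e%:E + (q^-1)%:E)%E.
    apply: le_trans h; rewrite lee_wpmul2l// lee_wpmul2l//.
  rewrite mule1 -EFinM -EFinD lee_fin; lra.
rewrite eE /cap.
case: ifPn => [_|Ioo]; first by rewrite lee_fin.
have [mu Amu] : exists mu, admissible A mu.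
  apply: contrapT => nA; move/negP: Ioo; apply; rewrite -leye_eq.
  by apply: le_ereal_inf_tmp => _ [mu Amu <-]; exfalso; apply: nA; exists mu.
have [q qE [qp qe]] := key mu Amu.
have ep : 0 < e by apply: lt_le_trans qe; rewrite invr_gt0.
have Ige : ((e^-1)%:E <= cap_inf A)%E.
  apply: le_ereal_inf_tmp => _ [nu Anu <-]; have [q' -> [q'p q'e]] := key nu Anu.
  by rewrite lee_fin -[q']invrK lef_pV2// posrE invr_gt0.
have Ifin : cap_inf A \is a fin_num by rewrite ge0_fin_numE ?ltey// (cap_inf_ge0 H).
rewrite -(fineK Ifin) in Ige *; rewrite lee_fin in Ige.
have ip : 0 < fine (cap_inf A) by apply: lt_le_trans Ige; rewrite invr_gt0.
rewrite eqe gt_eqF// lee_fin -[e]invrK lef_pV2// posrE invr_gt0//.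
Qed.

End set.
End equilibrium.

(** * Exhaustions by universally measurable sets *)

Lemma sqrt_riesz_exponent (R : realType) (n : nat) (alpha : R) :
  0 < alpha -> alpha <= 2 -> (3 <= n)%N ->
  exists m : bmeasure R n, exists a c : R, exists w S : R -> R,
    riesz_setting m a c w S /\ alpha = 2 * a.
Proof.
move=> a0 a2 n3; have [m hm] := exists_heat_reference R n.
have h0 : 0 < alpha / 2 by rewrite divr_gt0.
have h1 : alpha / 2 <= 1 by rewrite ler_pdivrMr// mul1r.
have [w [S tw]] := exists_time_weights h0 h1.
have aE : alpha = 2 * (alpha / 2) by field.
have [c c0 cE] := riesz_time_integral h0 h1 n3.
exists m, (alpha / 2), c, w, S; split => //; split => //.
Qed.

Section exhaustion.
Context (R : realType) (n : nat) (m : bmeasure R n) (a c : R) (w S : R -> R).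
Hypothesis H : riesz_setting m a c w S.
Notation pot := (@potential R n (2 * a)).
Notation energy := (@energy R n (2 * a)).
Notation mutual := (@mutual R n (2 * a)).
Notation cap := (@cap R n (2 * a)).
Notation ne := (@nearly_everywhere R n (2 * a)).
Notation Mplus := (@Mplus R n (2 * a)).
Notation admissible := (@admissible R n a).
Notation equilibrium := (@equilibrium R n (2 * a)).
Implicit Types (mu nu : bmeasure R n) (x y z : 'rV[R]_n).
Variables (A : set 'rV[R]_n) (U : nat -> set 'rV[R]_n).
Variables (gA : bmeasure R n) (g : nat -> bmeasure R n).
Hypothesis Umeas : forall k, universally_measurable (U k).
Hypothesis Umono : forall k l, (k <= l)%N -> U k `<=` U l.
Hypothesis Ucover : \bigcup_k U k = setT.
Hypothesis eqA : equilibrium A gA.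
Hypothesis eqg : forall k, equilibrium (A `&` U k) (g k).

Let rA : radon gA := equilibrium_radon eqA.
Let sA : sigma_finite setT gA := radon_sigma_finite rA.
Let rg k : radon (g k) := equilibrium_radon (eqg k).
Let sg k : sigma_finite setT (g k) := radon_sigma_finite (rg k).
Let MA : Mplus gA := eqA.1.
Let Mg k : Mplus (g k) := (eqg k).1.

Let g_gA k x : (pot (g k) x <= pot gA x)%E.
Proof.
apply: (equilibrium_le (eqg k)) => //.
by apply: (sub_ne H _ (equilibrium_ge1 H eqA)) => y [].
Qed.

Lemma exhaustion_pot_mono k l x : (k <= l)%N -> (pot (g k) x <= pot (g l) x)%E.
Proof.
move=> kl; apply: (equilibrium_le (eqg k)) => //.
by apply: (sub_ne H _ (equilibrium_ge1 H (eqg l))) => y [Ay /(Umono kl)].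
Qed.

Let h x := ereal_sup (range (fun k => pot (g k) x)).

Let hcvg x : (fun k => pot (g k) x) @ \oo --> h x.
Proof. by apply: ereal_nondecreasing_cvgn => k l; exact: exhaustion_pot_mono. Qed.

Let hub k x : (pot (g k) x <= h x)%E.
Proof. by apply: ereal_sup_ubound; exists k. Qed.

Let h_le1 x : (h x <= 1)%E.
Proof. by apply: ge_ereal_sup => _ [k _ <-]; exact: (equilibrium_le1 H (eqg k)). Qed.

(* A measure charging the exceptional set charges its intersection with a Borel
   kernel of some [U k], on which already [pot (g k) < 1]. *)
Let h_ge1 : ne (fun y => 1 <= h y)%E A.
Proof.
apply/(cap_eq0P H) => mu [rmu [B [mB BA B0]] mu1 Ef].
have mufin : (mu setT < +oo)%E by rewrite mu1 ltry.
have bor k : exists B12 : set (Rn R n) * set (Rn R n),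
    [/\ measurable B12.1, measurable B12.2, B12.1 `<=` U k, U k `<=` B12.2 &
      mu (B12.2 `\` B12.1) = 0%E].
  by have [B1 [B2 h12]] := Umeas k rmu; exists (B1, B2).
have [B12 B12P] := choice bor.
have m1 k : measurable (B12 k).1 by case: (B12P k).
have m2 k : measurable (B12 k).2 by case: (B12P k).
have [k muk] : exists k, (0 < mu (B `&` (B12 k).1))%E.
  (* Otherwise every outer Borel set would meet B in a null set, its gap to the kernel being null;
     the outer sets cover the space, so mu would vanish. *)
  apply: contrapT => npos.
  have null k : mu (B `&` (B12 k).2) = 0%E.
    apply: (@subset_measure0 _ _ _ mu _ ((B `&` (B12 k).1) `|` ((B12 k).2 `\` (B12 k).1))).
    - exact: measurableI.
    - by apply: measurableU; [exact: measurableI|exact: measurableD].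
    - move=> x [Bx x2]; have [x1|nx1] := pselect ((B12 k).1 x); first by left.
      by right.
    have [_ _ _ _ gap] := B12P k.
    apply: (eq_trans (measureU0 (measurableI _ _ mB (m1 k)) (measurableD (m2 k) (m1 k)) gap)).
    apply/eqP; rewrite eq_le measure_ge0 andbT leNgt; apply/negP => pos.
    by apply: npos; exists k.
  have : (mu setT <= 0)%E.
    have -> : 0%E = (mu (~` B) + \sum_(0 <= k <oo) mu (B `&` (B12 k).2))%E.
      by rewrite B0 add0e eseries0// => k _ _; exact: null.
    have -> : [set: Rn R n] = ~` B `|` \bigcup_k (B `&` (B12 k).2).
      apply/seteqP; split => // x _; have [Bx|] := pselect (B x); last by left.
      have : (\bigcup_k U k) x by rewrite Ucover.
      move=> [k _ Ukx]; right; exists k => //; split => //.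
      by have [_ _ _ sub _] := B12P k; exact: sub.
    have mUn : measurable (\bigcup_k (B `&` (B12 k).2) : set (Rn R n)).
      by apply: bigcupT_measurable => k; exact: measurableI.
    apply: (le_trans (measureU2 _ (measurableC mB) mUn)); apply: leeD => //.
    by apply: measure_sigma_subadditive => // k; exact: measurableI.
  by rewrite mu1 lee_fin ler10.
have mD : measurable (B `&` (B12 k).1) by exact: measurableI.
have [nu Dnu] : exists nu, admissible (B `&` (B12 k).1) nu.
  apply: (exists_admissible H mD rmu Ef); rewrite muk/=.
  by apply: le_lt_trans mufin; apply: le_measure => //; rewrite inE.
move/(cap_eq0P H) : (equilibrium_ge1 H (eqg k)) => /(_ nu); apply.
apply: sub_admissible Dnu => x [Bx x1].
have [Ax nh] := BA _ Bx; split.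
  by split => //; have [_ _ sub _ _] := B12P k; exact: sub.
by move=> gx; apply: nh; exact: le_trans gx (hub k x).
Qed.

(** Minimality of gA compares only potentials of measures, so the supremum h must first be realized
    as one; h <= 1 keeps that measure in [Mplus]. *)
Let h_gA x : h x = pot gA x.
Proof.
have [x0 gA0] := equilibrium_fin eqA.
have [gam [rgam gamE]] := exists_pot_limit H rg rA g_gA gA0 hcvg hub.
apply/eqP; rewrite eq_le; apply/andP; split.
  by apply: ge_ereal_sup => _ [k _ <-]; exact: g_gA.
rewrite -gamE; apply: (equilibrium_le eqA).
  split => //; exists x; rewrite gamE.
  by apply/negP => /eqP hoo; have := h_le1 x; rewrite hoo.
by apply: (le_ne H _ h_ge1) => y; rewrite gamE.
Qed.

Lemma exhaustion_pot_cvg x : (fun k => pot (g k) x) @ \oo --> pot gA x.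
Proof. by rewrite -h_gA; exact: hcvg. Qed.

Lemma integral_compact_support_fin mu (phi : 'rV[R]_n -> R) : radon mu -> continuous phi ->
  (forall x, 0 <= phi x) -> compact (closure [set x | phi x != 0]) ->
  (\int[mu]_x (phi x)%:E)%E \is a fin_num.
Proof.
move=> rmu cphi phi0 supp; have [b b0 pb] := compact_support_bounded cphi phi0 supp.
set K := closure _ in supp; have mK := measurable_compact supp.
have phi_out x : ~ K x -> phi x = 0.
  by move=> nK; apply: contrapT => /eqP px; apply: nK; exact: subset_closure.
rewrite ge0_fin_numE; last by apply: integral_ge0 => x _; rewrite lee_fin.
apply: (@le_lt_trans _ _ (\int[mu]_(x in K) cst b%:E x)%E).
  rewrite [X in (_ <= X)%E]integral_mkcond; apply: ge0_le_integral.
  - exact: measurableT.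
  - by move=> x _; rewrite lee_fin.
  - by apply/measurable_EFinP; exact: continuous_measurable_rV.
  - by apply/(measurable_restrictT _ mK); exact: measurable_cst.
  move=> x _; rewrite patchE; case: ifPn => xK; first by rewrite lee_fin.
  by rewrite phi_out// => Kx; move/negP: xK; apply; rewrite inE.
rewrite integral_cst// lte_mul_pinfty ?lee_fin ?(ltW b0)//.
exact: rmu.
Qed.

Lemma exhaustion_vague : vague_cvg g gA.
Proof.
move=> f cf supp.
have [x0 gA0] := equilibrium_fin eqA.
pose p (x : 'rV[R]_n) : R := (`|f x| + f x) / 2; pose q (x : 'rV[R]_n) : R := (`|f x| - f x) / 2.
have cp : continuous p.
  have gen (F : set_system 'rV[R]_n) (FF : Filter F) (l : R) : f @ F --> l ->
      (`|f y| + f y) / 2 @[y --> F] --> (`|l| + l) / 2.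
    by move=> fl; apply: cvgMl; apply: cvgD; [apply: cvg_norm|].
  by move=> x; exact: (gen _ _ _ (@cf x)).
have cq : continuous q.
  have gen (F : set_system 'rV[R]_n) (FF : Filter F) (l : R) : f @ F --> l ->
      (`|f y| - f y) / 2 @[y --> F] --> (`|l| - l) / 2.
    by move=> fl; apply: cvgMl; apply: cvgB; [apply: cvg_norm|].
  by move=> x; exact: (gen _ _ _ (@cf x)).
have p0 x : 0 <= p x by rewrite divr_ge0// addrC -lerBlDl sub0r -normrN ler_norm.
have q0 x : 0 <= q x by rewrite divr_ge0// subr_ge0 ler_norm.
have sub (r : 'rV[R]_n -> R) : (forall x, f x = 0 -> r x = 0) ->
    compact (closure [set x | r x != 0]).
  move=> fr; apply: (subclosed_compact _ supp); first exact: closed_closure.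
  apply: closure_subset => x /=; apply: contra_neq; exact: fr.
have sp : compact (closure [set x | p x != 0]).
  by apply: sub => x fx; rewrite /p fx normr0 addr0 mul0r.
have sq : compact (closure [set x | q x != 0]).
  by apply: sub => x fx; rewrite /q fx normr0 subr0 mul0r.
have mE (r : 'rV[R]_n -> R) : continuous r -> measurable_fun setT (fun x : Rn R n => (r x)%:E).
  by move=> cr; apply/measurable_EFinP; exact: continuous_measurable_rV.
have int (nu : bmeasure R n) (r : 'rV[R]_n -> R) : radon nu -> continuous r ->
    (forall x, 0 <= r x) -> compact (closure [set x | r x != 0]) ->
    nu.-integrable setT (fun x : Rn R n => (r x)%:E).
  move=> rnu cr r0 sr; apply/integrableP; split; first exact: mE.
  under eq_integral do rewrite gee0_abs ?lee_fin//.
  by rewrite -ge0_fin_numE ?integral_compact_support_fin//; apply: integral_ge0 => x _; rewrite lee_fin.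
have parts (nu : bmeasure R n) : radon nu -> (\int[nu]_x (f x)%:E =
    (fine (\int[nu]_x (p x)%:E) - fine (\int[nu]_x (q x)%:E))%:E)%E.
  move=> rnu; rewrite EFinB !fineK ?integral_compact_support_fin//.
  rewrite -(integralB measurableT (int nu p rnu cp p0 sp) (int nu q rnu cq q0 sq)).
  apply: eq_integral => x _; rewrite -EFinB; congr EFin; by rewrite /p /q; field.
rewrite (parts gA rA) (funext (fun k => parts (g k) (rg k))).
apply: cvg_EFin; first exact: nearW.
by apply: cvgB; apply: (pot_limit_vague H rg rA g_gA gA0 hcvg hub rA (fun x => esym (h_gA x))).
Qed.

Section finite_capacity.
Hypothesis capA : (cap A < +oo)%E.

Let EA : energy gA = cap A := equilibrium_cap H eqA.

Let e0 : (0 <= energy gA)%E := energy_ge0 H gA.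
Let ek0 k : (0 <= energy (g k))%E := energy_ge0 H (g k).
Let mk0 k : (0 <= mutual gA (g k))%E := mutual_ge0 H gA (g k).

Let efin : energy gA \is a fin_num.
Proof. by rewrite ge0_fin_numE// EA. Qed.

Let mk_le k : (mutual gA (g k) <= energy gA)%E.
Proof.
apply: ge0_le_integral.
- exact: measurableT.
- by move=> x _; exact: (pot_ge0 H).
- exact: (measurable_pot H).
- exact: (measurable_pot H).
- by move=> x _; exact: g_gA.
Qed.

Let ek_le k : (energy (g k) <= mutual gA (g k))%E.
Proof.
rewrite (mutualC H sA (sg k)); apply: ge0_le_integral.
- exact: measurableT.
- by move=> x _; exact: (pot_ge0 H).
- exact: (measurable_pot H).
- exact: (measurable_pot H).
- by move=> x _; exact: g_gA.
Qed.

Let e := fine (energy gA).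
Let mk k := fine (mutual gA (g k)).
Let ek k := fine (energy (g k)).

Let mkfin k : mutual gA (g k) \is a fin_num.
Proof. by rewrite ge0_fin_numE// (le_lt_trans (mk_le k))// EA. Qed.

Let ekfin k : energy (g k) \is a fin_num.
Proof. by rewrite ge0_fin_numE// (le_lt_trans (ek_le k))// (le_lt_trans (mk_le k))// EA. Qed.

Let mk_cvg : mk @ \oo --> e.
Proof.
have mc := @cvg_monotone_convergence _ (Rn R n) R gA setT measurableT (fun k => pot (g k))
  (fun k => measurable_pot H (sg k)) (fun k x _ => pot_ge0 H (g k) x)
  (fun x _ k l => @exhaustion_pot_mono k l x).
have limE : (fun x : Rn R n => limn (fun k => pot (g k) x)) = pot gA.
  by apply/funext => x; exact: (cvg_lim _ (@exhaustion_pot_cvg x)).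
rewrite limE in mc.
have : (fun k => mutual gA (g k)) @ \oo --> energy gA by exact: mc.
by rewrite /e -[X in _ --> X](fineK efin) => /fine_cvg.
Qed.

Let ek_cvg : ek @ \oo --> e.
Proof.
apply: (@squeeze_cvgr _ _ _ _ (fun k => 2 * mk k - e) mk).
- apply: nearW => k; apply/andP; split; last first.
    by rewrite -lee_fin !fineK.
  have := mutual_amgm H (sg k) sA.
  rewrite -(fineK (mkfin k)) -(fineK (ekfin k)) -(fineK efin) -EFinM -EFinD lee_fin.
  by rewrite lerBlDr.
- rewrite [X in _ --> X](_ : e = 2 * e - e); last by ring.
  by apply: cvgB; [apply: cvgMr; exact: mk_cvg|exact: cvg_cst].
- exact: mk_cvg.
Qed.

Lemma exhaustion_energy_cvg : (fun k => dist_energy (2 * a) (g k) gA) @ \oo --> 0%E.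
Proof.
have dE k : dist_energy (2 * a) (g k) gA = (ek k + e - 2 * mk k)%:E.
  rewrite /dist_energy (mutualC H (sg k) sA).
  by rewrite EFinB EFinM (EFinD (ek k)) !fineK.
rewrite (funext dE).
apply: cvg_EFin; first exact: nearW.
have -> : 0 = e + e - 2 * e :> R by ring.
apply: cvgB; last by apply: cvgMr; exact: mk_cvg.
by apply: cvgD; [exact: ek_cvg|exact: cvg_cst].
Qed.

Lemma exhaustion_cap_cvg : (fun k => cap (A `&` U k)) @ \oo --> cap A.
Proof.
have cE k : cap (A `&` U k) = (ek k)%:E by rewrite -(equilibrium_cap H (eqg k)) fineK.
rewrite (funext cE).
rewrite -EA -(fineK efin); apply: cvg_EFin; first exact: nearW.
exact: ek_cvg.
Qed.

End finite_capacity.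
End exhaustion.

Theorem mainTheorem20 (R : realType) (n : nat) (alpha : R)
  (hn : (3 <= n)%N) (ha0 : 0 < alpha) (ha2 : alpha <= 2)
  (A : set 'rV[R]_n) (U : nat -> set 'rV[R]_n)
  (gA : bmeasure R n) (g : nat -> bmeasure R n) :
  inner_thin alpha A ->
  (forall k, universally_measurable (U k)) ->
  (forall k l, (k <= l)%N -> U k `<=` U l) ->
  \bigcup_k U k = setT ->
  equilibrium alpha A gA ->
  (forall k, equilibrium alpha (A `&` U k) (g k)) ->
  [/\ vague_cvg g gA,
      (forall x,
        (forall k l, (k <= l)%N ->
           (potential alpha (g k) x <= potential alpha (g l) x)%E) /\
        ((fun k => potential alpha (g k) x) @ \oo --> potential alpha gA x))
    & ((cap alpha A < +oo)%E ->
        ((fun k => dist_energy alpha (g k) gA) @ \oo --> 0%E) /\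
        ((fun k => cap alpha (A `&` U k)) @ \oo --> cap alpha A))].
Proof.
move=> _ mU Umono Ucover.
have [m [a [c [w [S [H ->]]]]]] := sqrt_riesz_exponent ha0 ha2 hn.
move=> eqA eqg; split.
- exact: (exhaustion_vague H mU Umono Ucover eqA eqg).
- move=> x; split; first by move=> k l; exact: (exhaustion_pot_mono H Umono eqg).
  exact: (exhaustion_pot_cvg H mU Umono Ucover eqA eqg).
- move=> capA; split.
    exact: (exhaustion_energy_cvg H mU Umono Ucover eqA eqg capA).
  exact: (exhaustion_cap_cvg H mU Umono Ucover eqA eqg capA).
Qed.
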